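(* Let $T:X\to X$ be a mixing probability preserving Gibbs-Markov map, with associated metric $d$, probability measure $m$ and partition $\alpha$, and let $f:X\to\mathbb{R}$ be a measurable function satisfying $\sum_{a\in\alpha} m(a)Df(a)^\eta<\infty$ for some $\eta\in(0,1]$. Write $S_nf=\sum_{k=0}^{n-1}f\circ T^k$. (A) Assume $f\in L^2$. Then: - Either $f$ is the sum of a measurable coboundary and a constant, i.e., there exist a measurable function $u:X\to\mathbb{R}$ and $c\in\mathbb{R}$ such that $f=u-u\circ T+c$ almost everywhere. In this case $u$ is bounded, and $S_nf-nc$ converges in distribution to $Z-Z'$, where $Z$ and $Z'$ are independent random variables with the same distribution as $u$. - Otherwise, let $\tilde f=f-\int f\,dm$ and define $\sigma^2=\int\tilde f^2\,dm+2\sum_{k=1}^\infty\int\tilde f\cdot\tilde f\circ T^k\,dm$. Then this series converges, $\sigma^2>0$, and $(S_nf-n\int f\,dm)/\sqrt n$ converges in distribution to $\mathcal{N}(0,\sigma^2)$. (B) Assume $f\notin L^2$. Let $Z_0,Z_1,\dots$ be i.i.d. random variables with the same distribution as $f$. Consider sequences $A_n\in\mathbb{R}$ and $B_n>0$, and a nondegenerate (i.e. nonconstant) random variable $W$. Then $(S_nf-A_n)/B_n$ converges in distribution to $W$ if and only if $(\sum_{k=0}^{n-1}Z_k-A_n)/B_n$ converges in distribution to $W$.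
   Context: Let $(X,d)$ be a bounded metric space endowed with a probability measure $m$. A map $T:X\to X$ preserving $m$ is Gibbs-Markov if there exists a partition $\alpha$ of $X$ (modulo $0$) by sets of positive measure such that: (1) Markov: for all $a\in\alpha$, $T(a)$ is a union (modulo $0$) of elements of $\alpha$ and $T:a\to T(a)$ is invertible. (2) Big image and preimage property: there is a finite subset $\{a_1,\dots,a_n\}$ of $\alpha$ such that for any $a\in\alpha$ there exist $i,j\in\{1,\dots,n\}$ with $a\subset T(a_i)$ and $a_j\subset T(a)$ (modulo $0$). (3) Expansion: there exists $\gamma<1$ such that for all $a\in\alpha$, for almost all $x,y\in a$, $d(Tx,Ty)\ge\gamma^{-1}d(x,y)$. (4) Distortion: for $a\in\alpha$ let $g(x)=\frac{dm_{|a}}{d(m\circ T_{|a})}(x)$, $x\in a$, be the inverse of the jacobian of $T$ on $a$. There exists $C$ such that for all $a\in\alpha$, for almost all $x,y\in a$, $\left|1-\frac{g(x)}{g(y)}\right|\le C\,d(Tx,Ty)$. The Gibbs-Markov map $T$ is mixing if for all $a,b\in\alpha$ there exists $N$ such that $b\subset T^n(a)$ modulo $0$ for any $n>N$. For $f:X\to\mathbb{R}$ and $A\subset X$, $Df(A)$ denotes the best Lipschitz constant of $f$ on $A$. $L^2=L^2(m)$. *)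

(* Defs.v *)
From HB Require Import structures.
From mathcomp Require Import all_boot all_order all_algebra.
From mathcomp Require Import all_classical all_reals all_analysis.

Set Implicit Arguments.
Unset Strict Implicit.
Unset Printing Implicit Defensive.

Import Order.TTheory GRing.Theory Num.Theory.
Import numFieldNormedType.Exports.

Local Open Scope classical_set_scope.
Local Open Scope ring_scope.
Local Open Scope charge_scope.

#[short(type="metricMeasurableType")]
HB.structure Definition MetricMeasurable (R : numDomainType)
  (disp : measure_display) := {T of Metric R T & Measurable disp T}.

Section modulo0.
Context {disp} {X : measurableType disp} {R : realType} (m : probability X R).

Definition subset_mod0 (A B : set X) := m.-negligible (A `\` B).

Definition eq_mod0 (A B : set X) := m.-negligible (A `+` B).

(* Sets of positive measure that are pairwise disjoint modulo 0 are distinct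
   modulo 0, so [alpha] has no repeated classes, and it is countable. *)
Definition partition_mod0 (alpha : set (set X)) :=
  [/\ forall a, alpha a -> measurable a /\ (0 < m a)%E,
      forall a b, alpha a -> alpha b -> a <> b -> m.-negligible (a `&` b) &
      m.-negligible (~` \bigcup_(a in alpha) a)].

Definition measure_preserving (T : X -> X) :=
  measurable_fun setT T /\
  forall A, measurable A -> m (T @^-1` A) = m A.

End modulo0.

(* [m] is a Borel probability measure or an extension of one by null sets
   (for instance its completion). *)
Definition borel_mod0 {R : realType} {disp} {X : metricMeasurableType R disp}
    (m : probability X R) :=
  (forall U : set X, open U -> measurable U) /\
  (forall A : set X, measurable A ->
     exists2 B, <<s [set U : set X | open U] >> B & eq_mod0 m A B).

Definition bounded_metric {R : realType} (X : metricType R) :=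
  exists M : R, forall x y : X, mdist x y <= M.

Section inverse_jacobian.
Context {disp} {X : measurableType disp} {R : realType} (m : probability X R).
Variables (T : X -> X) (a : set X).

(* [T : a -> T a] is an isomorphism of measurable spaces and it is nonsingular:
   it preserves null sets, as is implicit in the existence of its jacobian. *)
Definition invertible_on :=
  [/\ measurable a,
      {in a &, injective T},
      forall A, measurable A -> A `<=` a -> measurable (T @` A) &
      forall A, A `<=` a -> m.-negligible A -> m.-negligible (T @` A)].

Lemma invertible_on_measurable : invertible_on -> measurable a.
Proof. by case. Qed.

Lemma invertible_on_lty : invertible_on -> (m a < +oo)%E.
Proof. by move=> Ta; rewrite ltey_eq fin_num_measure//; case: Ta. Qed.

Hypothesis Ta : invertible_on.

(* The measure m \o T_|a, that is A |-> m (T (A `&` a)); the proof argument makes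
   it canonically a finite measure. *)
Definition image_measure of invertible_on : set X -> \bar R :=
  fun A => m (T @` (A `&` a)).

Let image_measurable A : measurable A -> measurable (T @` (A `&` a)).
Proof.
by case: Ta => ma _ mT _ mA; apply: mT => //; exact: measurableI.
Qed.

Let image0 : image_measure Ta set0 = 0%E.
Proof. by rewrite /image_measure set0I image_set0 measure0. Qed.

Let image_ge0 A : (0 <= image_measure Ta A)%E.
Proof. exact: measure_ge0. Qed.

Let image_sigma_additive : semi_sigma_additive (image_measure Ta).
Proof.
move=> F mF tF mUF; rewrite /image_measure setI_bigcupl image_bigcup.
apply: measure_semi_sigma_additive => [i||].
- exact: image_measurable.
- apply/trivIsetP => i j _ _ ij; apply/seteqP; split => // y.
  move=> [[x [Fx ax] <-] [z [Fz az]]] Tzx.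
  have [_ injT _ _] := Ta.
  have zx : z = x by apply: injT => //; rewrite inE.
  have : (F i `&` F j) x by split => //; rewrite -zx.
  by move/trivIsetP: tF => /(_ i j I I ij) ->.
- rewrite -image_bigcup -setI_bigcupl; exact: image_measurable.
Qed.

HB.instance Definition _ := isMeasure.Build _ _ _ (image_measure Ta)
  image0 image_ge0 image_sigma_additive.

Let image_fin : fin_num_fun (image_measure Ta).
Proof.
by move=> A mA; rewrite /image_measure fin_num_measure//; exact: image_measurable.
Qed.

HB.instance Definition _ := Measure_isFinite.Build _ _ _ (image_measure Ta)
  image_fin.

Definition inv_jacobian : X -> \bar R :=
  'd (charge_of_finite_measure
        (mfrestr (invertible_on_measurable Ta) (invertible_on_lty Ta)))
  '/d (image_measure Ta).

End inverse_jacobian.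

Section gibbs_markov.
Context {R : realType} {disp} {X : metricMeasurableType R disp}.
Variables (m : probability X R) (T : X -> X) (alpha : set (set X)).

Definition markov_property := forall a, alpha a ->
  invertible_on m T a /\
  exists2 beta, beta `<=` alpha & eq_mod0 m (T @` a) (\bigcup_(b in beta) b).

Definition big_image_preimage := exists F : set (set X),
  [/\ finite_set F, F `<=` alpha &
      forall a, alpha a ->
        (exists2 b, F b & subset_mod0 m a (T @` b)) /\
        (exists2 b, F b & subset_mod0 m b (T @` a))].

(* In the next two definitions "for almost all x, y in a" refers to the
   product measure; the nested quantifiers express it without requiring the
   exceptional set to be measurable for the product sigma-algebra. *)
Definition expansion := exists gamma : R, 0 < gamma < 1 /\
  forall a, alpha a -> \forall x \ae m, \forall y \ae m, a x -> a y ->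
    gamma^-1 * mdist x y <= mdist (T x) (T y).

Definition distortion := exists C : R,
  forall a, alpha a -> exists Ta : invertible_on m T a,
    let g := fine \o inv_jacobian Ta in
    \forall x \ae m, \forall y \ae m, a x -> a y ->
      `|1 - g x / g y| <= C * mdist (T x) (T y).

Record gibbs_markov : Prop := GibbsMarkov {
  gm_bounded : bounded_metric X ;
  gm_borel : borel_mod0 m ;
  gm_preserving : measure_preserving m T ;
  gm_partition : partition_mod0 m alpha ;
  gm_markov : markov_property ;
  gm_big_image_preimage : big_image_preimage ;
  gm_expansion : expansion ;
  gm_distortion : distortion }.

(* [a] is only given modulo 0, and [T] is not constrained on the null set left
   uncovered by [alpha], which [T] might map onto a set of positive measure.
   Hence the inclusion is required of every version of [a]. *)
Definition gm_mixing := forall a b, alpha a -> alpha b ->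
  exists N : nat, forall n, (N < n)%N ->
    forall Z, m.-negligible Z -> subset_mod0 m b (iter n T @` (a `\` Z)).

End gibbs_markov.

(* The best Lipschitz constant of f on A, which is +oo if f is not Lipschitz. *)
Definition lipschitz_const {R : realType} {X : metricType R}
    (f : X -> R) (A : set X) : \bar R :=
  ereal_inf [set K%:E | K in [set K : R | 0 <= K /\
    forall x y, A x -> A y -> `|f x - f y| <= K * mdist x y]].

Definition birkhoff_sum {X : Type} {R : realType} (T : X -> X) (f : X -> R)
  (n : nat) (x : X) : R := \sum_(0 <= k < n) f (iter k T x).

Section coboundary.
Context {disp} {X : measurableType disp} {R : realType} (m : probability X R).
Variables (T : X -> X) (f : X -> R).

Definition coboundary_up_to_constant (u : X -> R) (c : R) :=
  \forall x \ae m, f x = u x - u (T x) + c.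

Definition correlation (k : nat) : R :=
  let ft x := f x - (\int[m]_y f y)%R in
  (\int[m]_x (ft x * ft (iter k T x)))%R.

(* The term of index j of the series is the correlation at time j.+1. *)
Definition correlation_series : R^nat := series (fun j => correlation j.+1).

Definition asymptotic_variance : R :=
  correlation 0 + 2 * limn correlation_series.

End coboundary.

Definition ess_bounded {disp} {X : measurableType disp} {R : realType}
  (m : probability X R) (u : X -> R) :=
  exists M : R, \forall x \ae m, `|u x| <= M.

Definition same_law {d1 d2} {T1 : measurableType d1} {T2 : measurableType d2}
    {R : realType} (P1 : probability T1 R) (P2 : probability T2 R)
    (Y1 : {RV P1 >-> R}) (Y2 : {RV P2 >-> R}) :=
  forall A : set R, measurable A -> distribution P1 Y1 A = distribution P2 Y2 A.

Section independence.
Context {disp} {S : measurableType disp} {R : realType} (P : probability S R).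

Definition independent2 (Y Z : {RV P >-> R}) :=
  forall A B : set R, measurable A -> measurable B ->
    P (Y @^-1` A `&` Z @^-1` B) = (P (Y @^-1` A) * P (Z @^-1` B))%E.

Definition mutually_independent (Z : nat -> {RV P >-> R}) :=
  forall (s : seq nat) (A : nat -> set R), uniq s ->
    (forall i, measurable (A i)) ->
    P (\bigcap_(i in [set` s]) (Z i @^-1` A i)) =
    (\prod_(i <- s) P (Z i @^-1` A i))%E.

Definition nondegenerate_rv (W : {RV P >-> R}) :=
  ~ exists c : R, \forall w \ae P, W w = c.

End independence.

(* The Y_n live on the space (S, P) and the limit W on the space (S', Q). *)
Definition cvg_in_distribution {d d'} {S : measurableType d}
    {S' : measurableType d'} {R : realType} (P : probability S R)
    (Y : nat -> S -> R) (Q : probability S' R) (W : S' -> R) :=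
  forall h : R -> R, continuous h -> bounded_fun h ->
    (fun n => \int[P]_x (h (Y n x))%:E)%E @ \oo -->
    (\int[Q]_w (h (W w))%:E)%E.

(* Main.v *)
(** The cylinders of the Markov partition have bounded distortion, and with the
big image property and mixing this gives a Doeblin lower bound: the measures with
regular density that are pushed forward by [T] converge to [m] exponentially fast.
Approximating [e] by its averages on the cylinders, one gets
[|Cov(e, v \o T^k)| <= K r^k ||v||_2] for every square integrable [e] which is
Lipschitz on the partition elements, with constants having a moment of order [eta].

If [f] is in [L^2], then [W v = \sum_(k >= 1) Cov(f, v \o T^k)] is a bounded
functional on [L^2], say [W v = E(v h)]. The function [f - E f + h - h \o T] is
orthogonal to all the [v \o T] and its second moment is [sigma^2], so that
[sigma^2 = 0] only for coboundaries. With [V_n = expi (t S_n)], the sequence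
[E V_n + i t W(V_n)] is multiplied by [1 - sigma^2 t^2 / 2 + o(t^2)] at each step,
which is the central limit theorem.

If [f = u - u \o T + c], then [u] is almost constant on most of some small
cylinder; [T^n] maps it onto a union of partition elements with bounded
distortion, hence [u] is bounded on a partition element, and then everywhere.
Exactness makes [u] and [u \o T^n] asymptotically independent.

If [f] is not in [L^2], set [e = expi (t f) - 1]. Then [||e||_1] and [t] are
[o(||e||_2)], so [E V_n + \sum_k Cov(e, V_n \o T^k)] is multiplied by
[E expi (t f)] at each step up to an error [o(||e||_2^2)]. Tightness of
[(S_n - A_n) / B_n], or of its independent analogue, bounds [n ||e||_2^2] at
[t = s / B_n]; the two characteristic functions are then asymptotically equal. *)

Require Import Defs.
From HB Require Import structures.
From mathcomp Require Import all_boot all_order all_algebra.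
From mathcomp Require Import all_classical all_reals all_analysis.
From mathcomp Require Import measurable_realfun ring lra zify.

Set Implicit Arguments.
Unset Strict Implicit.
Unset Printing Implicit Defensive.

Import Order.TTheory GRing.Theory Num.Theory.
Import numFieldNormedType.Exports.

Local Open Scope classical_set_scope.
Local Open Scope ring_scope.

(** * Expectations, probabilities and L2 norms *)

(** The axioms hold only modulo null sets and the inverse jacobian is a mere Radon-Nikodym
    derivative, so the work takes place in a model that speaks only of masses of sets. Regularity of
    a measure [nu] is a cross inequality between [nu E * m F] and [m E * nu F], and preimages
    replace the transfer operator. Errors stay relative to the mass of the target set, which lets
    bounds on sets pass to functions in L1 and L2. Since [eta] may be below 1, the Lipschitz
    constants of [f] need not be integrable. For a lag k, cylinders of length about k/2 are used:
    symbols where [theta] to the k/2 times the constant exceeds 1 have exponentially small mass, and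
    elsewhere a number at most 1 is bounded by its power [eta]. Complex numbers are replaced by
    cosines with an arbitrary phase, the phase -pi/2 giving sines. Outside L2, the recursion for the
    characteristic function is accurate only for about 1/D(t) steps, D(t) being the squared L2 norm
    of expi (t f) - 1. Longer sums are stopped there, and the remaining terms are hidden in a phase
    at the end of the orbit. *)

Notation Ex m u := (Rintegral m setT u).

Definition pr {d} {S : measurableType d} {R : realType} (m : probability S R)
  (A : set S) : R := fine (m A).

Definition integ {d} {S : measurableType d} {R : realType} (m : probability S R)
  (u : S -> R) := m.-integrable setT (EFin \o u).

Definition sq_integ {d} {S : measurableType d} {R : realType}
    (m : probability S R) (u : S -> R) :=
  measurable_fun setT u /\ integ m (fun x => u x ^+ 2).

Definition norm2 {d} {S : measurableType d} {R : realType}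
  (m : probability S R) (u : S -> R) : R := Num.sqrt (Ex m (fun x => u x ^+ 2)).

Section probability_calculus.
Context d (S : measurableType d) (R : realType) (m : probability S R).
Implicit Types (A B : set S) (u v w : S -> R).

Lemma pr_fin A : measurable A -> m A = (pr m A)%:E.
Proof. by move=> mA; rewrite /pr fineK// fin_num_measure. Qed.

Lemma pr_ge0 A : 0 <= pr m A.
Proof. by rewrite /pr fine_ge0. Qed.

Lemma prT : pr m setT = 1.
Proof. by rewrite /pr probability_setT. Qed.

Lemma pr0 : pr m set0 = 0.
Proof. by rewrite /pr measure0. Qed.

Lemma le_pr A B : measurable A -> measurable B -> A `<=` B -> pr m A <= pr m B.
Proof.
move=> mA mB AB; rewrite -lee_fin -!pr_fin//.
by apply: le_measure; rewrite ?inE.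
Qed.

Lemma pr_le1 A : measurable A -> pr m A <= 1.
Proof. by move=> mA; rewrite -prT; exact: le_pr. Qed.

Lemma prDI A B : measurable A -> measurable B ->
  pr m A = pr m (A `\` B) + pr m (A `&` B).
Proof.
move=> mA mB; apply: EFin_inj; rewrite EFinD -!pr_fin//.
- exact: measureDI.
- exact: measurableI.
- exact: measurableD.
Qed.

Lemma prU_le A B : measurable A -> measurable B ->
  pr m (A `|` B) <= pr m A + pr m B.
Proof.
move=> mA mB; rewrite (prDI (measurableU _ _ mA mB) mB) lerD//.
- apply: le_pr => //; first by apply: measurableD => //; exact: measurableU.
  by move=> x [[]].
- by apply: le_pr => //; apply: measurableI => //; exact: measurableU.
Qed.

Lemma pr_negligible A : measurable A -> m.-negligible A -> pr m A = 0.
Proof. by move=> mA /(negligibleP m mA) A0; rewrite /pr A0. Qed.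

Lemma pr_eq0_negligible A : measurable A -> pr m A = 0 -> m.-negligible A.
Proof.
by move=> mA A0; apply/(negligibleP m mA); apply: (etrans (pr_fin mA)); rewrite A0.
Qed.

Lemma pr_sub0 A B : measurable A -> measurable B -> A `<=` B ->
  pr m B = 0 -> pr m A = 0.
Proof.
by move=> mA mB AB B0; apply/eqP; rewrite eq_le pr_ge0 andbT -B0 le_pr.
Qed.

Lemma pr_bigcup_series (F : nat -> set S) : (forall i, measurable (F i)) ->
  trivIset setT F ->
  series (fun i => pr m (F i)) @ \oo --> pr m (\bigcup_i F i).
Proof.
move=> mF tF; have mU : measurable (\bigcup_i F i) by exact: bigcup_measurable.
have : (\sum_(0 <= i < n) m (F i))%E @[n --> \oo] --> (pr m (\bigcup_i F i))%:E.
  by rewrite -(pr_fin mU); exact: (@measure_sigma_additive _ _ _ m F mF tF).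
move=> /fine_cvgP[_]; apply: cvg_trans; apply: near_eq_cvg.
apply: nearW => n; rewrite /series/=.
rewrite [X in fine X](_ : _ = (\sum_(0 <= i < n) pr m (F i))%:E)//.
by rewrite -sumEFin; apply: eq_bigr => i _; exact: pr_fin.
Qed.

Lemma integ_measurable u : integ m u -> measurable_fun setT u.
Proof. by move=> /integrableP[/measurable_EFinP]. Qed.

Lemma integ_le u v : measurable_fun setT u -> (forall x, `|u x| <= v x) ->
  integ m v -> integ m u.
Proof.
move=> mu uv iv; apply: le_integrable iv => //; first exact/measurable_EFinP.
by move=> x _ /=; rewrite lee_fin (le_trans (uv x)) ?ler_norm.
Qed.

Lemma integ_cst (c : R) : integ m (fun=> c).
Proof. exact: finite_measure_integrable_cst. Qed.

Lemma integ_bounded u (M : R) : measurable_fun setT u ->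
  (forall x, `|u x| <= M) -> integ m u.
Proof. by move=> mu uM; exact: (integ_le mu uM (integ_cst M)). Qed.

Lemma integD u v : integ m u -> integ m v -> integ m (fun x => u x + v x).
Proof. by move=> iu iv; exact: (integrableD measurableT iu iv). Qed.

Lemma integN u : integ m u -> integ m (fun x => - u x).
Proof. by move=> iu; exact: (integrableN iu). Qed.

Lemma integB u v : integ m u -> integ m v -> integ m (fun x => u x - v x).
Proof. by move=> iu iv; apply: integD => //; exact: integN. Qed.

Lemma integZ (c : R) u : integ m u -> integ m (fun x => c * u x).
Proof. by move=> iu; exact: (integrableZl measurableT c iu). Qed.

Lemma integ_norm u : integ m u -> integ m (fun x => `|u x|).
Proof.
by move=> iu; exact: (integrable_norm iu).
Qed.

Lemma integ_sum n (u : nat -> S -> R) : (forall i, integ m (u i)) ->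
  integ m (fun x => \sum_(0 <= i < n) u i x).
Proof.
move=> iu; elim: n => [|n IHn].
  by under eq_fun do rewrite big_geq//; exact: integ_cst.
by under eq_fun do rewrite big_nat_recr//=; apply: integD.
Qed.

Lemma ExD u v : integ m u -> integ m v ->
  Ex m (fun x => u x + v x) = Ex m u + Ex m v.
Proof. by move=> iu iv; rewrite RintegralD. Qed.

Lemma ExB u v : integ m u -> integ m v ->
  Ex m (fun x => u x - v x) = Ex m u - Ex m v.
Proof. by move=> iu iv; rewrite RintegralB. Qed.

Lemma ExZ (c : R) u : integ m u -> Ex m (fun x => c * u x) = c * Ex m u.
Proof. by move=> iu; rewrite RintegralZl. Qed.

Lemma ExN u : integ m u -> Ex m (fun x => - u x) = - Ex m u.
Proof.
by move=> iu; rewrite -mulN1r -ExZ//; congr (Ex m _); apply/funext => x; rewrite mulN1r.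
Qed.

Lemma Ex_cst (c : R) : Ex m (fun=> c) = c.
Proof. by rewrite Rintegral_cst// -[fine _]/(pr m setT) prT mulr1. Qed.

Lemma Ex_sum n (u : nat -> S -> R) : (forall i, integ m (u i)) ->
  Ex m (fun x => \sum_(0 <= i < n) u i x) = \sum_(0 <= i < n) Ex m (u i).
Proof.
move=> iu; elim: n => [|n IHn].
  by under eq_fun do rewrite big_geq//; rewrite Ex_cst big_geq.
under eq_fun do rewrite big_nat_recr//=.
by rewrite ExD// ?big_nat_recr//= ?IHn//; exact: integ_sum.
Qed.

Lemma le_Ex u v : integ m u -> integ m v -> (forall x, u x <= v x) ->
  Ex m u <= Ex m v.
Proof. by move=> iu iv uv; apply: le_Rintegral. Qed.

Lemma Ex_ge0 u : (forall x, 0 <= u x) -> 0 <= Ex m u.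
Proof. by move=> u0; apply: Rintegral_ge0. Qed.

Lemma Ex_norm u : integ m u -> `|Ex m u| <= Ex m (fun x => `|u x|).
Proof. by move=> iu; exact: le_normr_Rintegral. Qed.

Lemma Ex_le_norm u v : integ m v -> measurable_fun setT u ->
  (forall x, `|u x| <= v x) -> `|Ex m u| <= Ex m v.
Proof.
move=> iv mu uv; have iu := integ_le mu uv iv.
by apply: (le_trans (Ex_norm iu)); apply: le_Ex => //; exact: integ_norm.
Qed.

Lemma Ex_bounded u (M : R) : measurable_fun setT u ->
  (forall x, `|u x| <= M) -> `|Ex m u| <= M.
Proof.
by move=> mu uM; rewrite -[leRHS]Ex_cst; apply: Ex_le_norm => //; exact: integ_cst.
Qed.

Lemma ae_eq_Ex u v : measurable_fun setT u -> measurable_fun setT v ->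
  (\forall x \ae m, u x = v x) -> Ex m u = Ex m v.
Proof.
move=> mu mv uv; rewrite /Rintegral; congr fine.
apply: ae_eq_integral => //; [exact/measurable_EFinP|exact/measurable_EFinP|].
by apply: filterS uv => x /= -> _.
Qed.

(** [v] equals the maximum of [u] and [v] almost everywhere, and this maximum bounds [u] at every
    point. *)
Lemma ae_le_Ex u v : integ m u -> integ m v ->
  (\forall x \ae m, u x <= v x) -> Ex m u <= Ex m v.
Proof.
move=> iu iv uv.
have mm : measurable_fun setT (fun x => Num.max (u x) (v x)).
  by apply: measurable_maxr; exact: integ_measurable.
have -> : Ex m v = Ex m (fun x => Num.max (u x) (v x)).
  apply: ae_eq_Ex => //; first exact: integ_measurable.
  by apply: filterS uv => x /max_idPr.
apply: le_Ex => //.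
  apply: (integ_le mm _ (integD (integ_norm iu) (integ_norm iv))) => x.
  have := normr_ge0 (u x); have := normr_ge0 (v x).
  by case: (leP (u x) (v x)) => _; lra.
by move=> x; rewrite le_max lexx.
Qed.

Lemma Ex_eq0_ae u : integ m u -> (forall x, 0 <= u x) -> Ex m u = 0 ->
  \forall x \ae m, u x = 0.
Proof.
move=> iu u0 Eu.
have : (\int[m]_(x in setT) `|(EFin \o u) x| = 0)%E.
  transitivity (\int[m]_x (u x)%:E)%E.
    by apply: eq_integral => x _ /=; rewrite ger0_norm.
  have fu : (\int[m]_x (u x)%:E)%E \is a fin_num by exact: integrable_fin_num.
  by rewrite -(fineK fu); move: Eu; rewrite /Rintegral => ->.
move/(ae_eq_integral_abs m measurableT _).1 => H.
have /H : measurable_fun setT (EFin \o u).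
  by apply/measurable_EFinP; exact: integ_measurable.
by apply: filterS => x /(_ I) /= [].
Qed.

Lemma Ex_indic A : measurable A -> Ex m (\1_A) = pr m A.
Proof. by move=> mA; rewrite /Rintegral integral_indic// setIT. Qed.

Lemma integ_indic A : measurable A -> integ m \1_A.
Proof. by move=> mA; exact: integrable_indic. Qed.

Lemma integ_indicM A u : measurable A -> integ m u ->
  integ m (fun x => \1_A x * u x).
Proof.
move=> mA iu; apply: (integ_le _ _ (integ_norm iu)).
  by apply: measurable_funM; [exact: measurable_indic|exact: integ_measurable].
by move=> x; rewrite normrM indicE; case: (_ \in _); rewrite ?normr1 ?normr0 ?mul1r ?mul0r.
Qed.

Lemma cvg_Ex (u_ : nat -> S -> R) u v : (forall n, measurable_fun setT (u_ n)) ->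
  measurable_fun setT u -> integ m v ->
  (forall n x, `|u_ n x| <= v x) -> (forall x, u_ ^~ x @ \oo --> u x) ->
  (fun n => Ex m (u_ n)) @ \oo --> Ex m u.
Proof.
move=> mu_ mu iv uv cu.
have cE : {ae m, forall x, setT x -> (EFin \o u_ n) x @[n --> \oo] --> (EFin \o u) x}.
  by apply: aeW => x _; apply: cvg_EFin; [exact: nearW|exact: cu].
have bE : {ae m, forall x n, setT x -> (`|(EFin \o u_ n) x| <= (EFin \o v) x)%E}.
  by apply: aeW => x n _; exact: uv.
have [iu _] := @dominated_convergence _ _ _ m setT measurableT
  (fun n => EFin \o u_ n) (EFin \o u) (EFin \o v)
  (fun n => (measurable_EFinP _ _).2 (mu_ n)) ((measurable_EFinP _ _).2 mu)
  cE iv bE.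
by rewrite -(fineK (integrable_fin_num measurableT iu)) => /fine_cvgP[_].
Qed.

Lemma sq_integ_measurable u : sq_integ m u -> measurable_fun setT u.
Proof. by case. Qed.

Lemma sq_integM u v : sq_integ m u -> sq_integ m v ->
  integ m (fun x => u x * v x).
Proof.
move=> [mu iu] [mv iv]; apply: (integ_le _ _ (integD iu iv)).
  exact: measurable_funM.
move=> x; rewrite ler_norml; apply/andP; split; nra.
Qed.

Lemma sq_integ_integ u : sq_integ m u -> integ m u.
Proof.
move=> [mu iu]; apply: (integ_le _ _ (integD iu (integ_cst 1))) => // x.
by rewrite ler_norml; apply/andP; split; nra.
Qed.

Lemma sq_integ_le u v : measurable_fun setT u -> (forall x, `|u x| <= v x) ->
  sq_integ m v -> sq_integ m u.
Proof.
move=> mu uv [mv iv]; split => //; apply: (integ_le _ _ iv).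
  exact: measurable_funX.
by move=> x; rewrite normrX lerXn2r// ?nnegrE// (le_trans _ (uv x)).
Qed.

Lemma sq_integ_bounded u (M : R) : measurable_fun setT u ->
  (forall x, `|u x| <= M) -> sq_integ m u.
Proof.
move=> mu uM; apply: (@sq_integ_le _ (fun=> M)) => //; split => //.
exact: integ_cst.
Qed.

Lemma sq_integ_cst (c : R) : sq_integ m (fun=> c).
Proof. by apply: (@sq_integ_bounded _ `|c|). Qed.

Lemma sq_integZ (c : R) u : sq_integ m u -> sq_integ m (fun x => c * u x).
Proof.
move=> [mu iu]; split; first exact: measurable_funM.
by under eq_fun do rewrite exprMn; exact: integZ.
Qed.

Lemma sq_integN u : sq_integ m u -> sq_integ m (fun x => - u x).
Proof.
by move=> L2u; under eq_fun do rewrite -mulN1r; exact: sq_integZ.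
Qed.

Lemma sq_integD u v : sq_integ m u -> sq_integ m v ->
  sq_integ m (fun x => u x + v x).
Proof.
move=> L2u L2v; have [mu iu] := L2u; have [mv iv] := L2v.
split; first exact: measurable_funD.
under eq_fun do rewrite sqrrD -mulr_natl.
by apply: integD => //; apply: integD => //; apply: integZ; exact: sq_integM.
Qed.

Lemma sq_integB u v : sq_integ m u -> sq_integ m v ->
  sq_integ m (fun x => u x - v x).
Proof. by move=> L2u L2v; apply: sq_integD => //; exact: sq_integN. Qed.

Lemma sq_integ_norm u : sq_integ m u -> sq_integ m (fun x => `|u x|).
Proof.
move=> [mu iu]; split; first exact: measurableT_comp.
by under eq_fun do rewrite real_normK ?num_real//.
Qed.

Lemma sq_integM_bounded u v (M : R) : sq_integ m u -> measurable_fun setT v ->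
  (forall x, `|v x| <= M) -> sq_integ m (fun x => u x * v x).
Proof.
move=> L2u mv vM; apply: (@sq_integ_le _ (fun x => M * `|u x|)).
- by apply: measurable_funM => //; exact: sq_integ_measurable.
- by move=> x; rewrite normrM mulrC ler_wpM2r.
- by apply: sq_integZ; exact: sq_integ_norm.
Qed.

Lemma sq_integ_indic A : measurable A -> sq_integ m \1_A.
Proof.
move=> mA; apply: (@sq_integ_bounded _ 1); first exact: measurable_indic.
by move=> x; rewrite indicE; case: (_ \in _); rewrite ?normr1 ?normr0.
Qed.

Lemma sq_integ_indicM A u : measurable A -> sq_integ m u ->
  sq_integ m (fun x => \1_A x * u x).
Proof.
move=> mA L2u; under eq_fun do rewrite mulrC.
apply: (sq_integM_bounded (M := 1) L2u); first exact: measurable_indic.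
by move=> x; rewrite indicE; case: (_ \in _); rewrite ?normr1 ?normr0.
Qed.

Lemma norm2_ge0 u : 0 <= norm2 m u. Proof. exact: sqrtr_ge0. Qed.

Lemma norm2K u : norm2 m u ^+ 2 = Ex m (fun x => u x ^+ 2).
Proof. by rewrite sqr_sqrtr// Ex_ge0// => x; exact: sqr_ge0. Qed.

Lemma le_norm2 u v : sq_integ m u -> sq_integ m v ->
  (forall x, `|u x| <= `|v x|) -> norm2 m u <= norm2 m v.
Proof.
move=> [_ iu] [_ iv] uv; apply: ler_wsqrtr; apply: le_Ex => // x.
by rewrite -(real_normK (num_real (u x))) -(real_normK (num_real (v x))) lerXn2r// nnegrE.
Qed.

Lemma norm2_normr u : norm2 m (fun x => `|u x|) = norm2 m u.
Proof.
by rewrite /norm2; congr (Num.sqrt (Ex m _)); apply/funext => x; rewrite real_normK ?num_real.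
Qed.

Lemma norm2_bounded u (M : R) : measurable_fun setT u ->
  (forall x, `|u x| <= M) -> norm2 m u <= M.
Proof.
move=> mu uM.
have M0 : 0 <= M.
  apply: le_trans (Ex_bounded mu uM); exact: normr_ge0.
have -> : M = norm2 m (fun=> M) by rewrite /norm2 Ex_cst sqrtr_sqr ger0_norm.
apply: le_norm2; [exact: sq_integ_bounded|exact: sq_integ_cst|].
by move=> x; rewrite (ger0_norm M0).
Qed.

Lemma norm2_indic A : measurable A -> norm2 m \1_A = Num.sqrt (pr m A).
Proof.
move=> mA; rewrite /norm2 -Ex_indic//; congr (Num.sqrt (Ex m _)).
by apply/funext => x; rewrite indicE; case: (_ \in _); rewrite ?expr1n ?expr0n.
Qed.

Lemma Cauchy_Schwarz_Ex u v : sq_integ m u -> sq_integ m v ->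
  `|Ex m (fun x => u x * v x)| <= norm2 m u * norm2 m v.
Proof.
move=> L2u L2v; have [mu iu] := L2u; have [mv iv] := L2v.
have iuv := sq_integM L2u L2v.
set a := Ex m (fun x => u x ^+ 2); set b := Ex m (fun x => v x ^+ 2).
set c := Ex m _.
have a0 : 0 <= a by apply: Ex_ge0 => x; exact: sqr_ge0.
have b0 : 0 <= b by apply: Ex_ge0 => x; exact: sqr_ge0.
(* A nonnegative quadratic form in (s, t). The point (b, -c) gives c^2 <= a b if b > 0, the point
   (c, -a) gives c = 0 if b = 0 < a, and (1, -c) settles the case where both vanish. *)
have Q (s t : R) : 0 <= s ^+ 2 * a + 2 * s * t * c + t ^+ 2 * b.
  have : 0 <= Ex m (fun x => (s * u x + t * v x) ^+ 2).
    by apply: Ex_ge0 => x; exact: sqr_ge0.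
  rewrite (_ : (fun x => _) = fun x => s ^+ 2 * u x ^+ 2 +
    ((2 * s * t) * (u x * v x) + t ^+ 2 * v x ^+ 2)); last first.
    by apply/funext => x; ring.
  by rewrite !ExD ?ExZ ?addrA//; do ?apply: integD; exact: integZ.
rewrite -[norm2 m u * _]/(Num.sqrt a * Num.sqrt b) -sqrtrM//.
rewrite -sqrtr_sqr ler_wsqrtr//.
have [b_eq0|b_neq0] := eqVneq b 0; last first.
  have := Q b (- c); have : 0 < b by rewrite lt_neqAle eq_sym b_neq0 b0.
  by move=> ? ?; nra.
have [a_eq0|a_neq0] := eqVneq a 0; first by have := Q 1 (- c); rewrite a_eq0 b_eq0; nra.
have := Q c (- a); have : 0 < a by rewrite lt_neqAle eq_sym a_neq0 a0.
by move=> ? ?; nra.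
Qed.

Lemma Ex_norm_le_norm2 u : sq_integ m u -> Ex m (fun x => `|u x|) <= norm2 m u.
Proof.
move=> L2u; have := Cauchy_Schwarz_Ex (sq_integ_norm L2u) (sq_integ_cst 1).
under eq_fun do rewrite mulr1.
rewrite norm2_normr {2}/norm2 Ex_cst expr1n sqrtr1 mulr1.
exact/le_trans/ler_norm.
Qed.

Lemma norm_Ex_le_norm2 u : sq_integ m u -> `|Ex m u| <= norm2 m u.
Proof.
move=> L2u; apply: le_trans (Ex_norm_le_norm2 L2u).
exact/Ex_norm/sq_integ_integ.
Qed.

Lemma norm2D u v : sq_integ m u -> sq_integ m v ->
  norm2 m (fun x => u x + v x) <= norm2 m u + norm2 m v.
Proof.
move=> L2u L2v; have [mu iu] := L2u; have [mv iv] := L2v.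
rewrite -[leRHS]ger0_norm ?addr_ge0 ?norm2_ge0// -sqrtr_sqr ler_wsqrtr//.
rewrite sqrrD !norm2K.
under eq_fun do rewrite sqrrD -mulr_natl.
rewrite ExD//; last by apply: integD => //; apply: integZ; exact: sq_integM.
rewrite ExD//; last by apply: integZ; exact: sq_integM.
rewrite ExZ; last exact: sq_integM.
rewrite lerD2r lerD2l -[leRHS]mulr_natl ler_wpM2l//.
by apply: le_trans (Cauchy_Schwarz_Ex L2u L2v); exact: ler_norm.
Qed.

Lemma markov_Ex u (c : R) : integ m u -> (forall x, 0 <= u x) -> 0 < c ->
  pr m [set x | c < u x] <= Ex m u / c.
Proof.
move=> iu u0 c0.
have mA : measurable [set x | c < u x].
  rewrite [X in measurable X](_ : _ = u @^-1` `]c, +oo[); last first.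
    by apply/seteqP; split => x /=; rewrite in_itv/= andbT.
  by rewrite -[X in measurable X]setTI; apply: integ_measurable.
rewrite ler_pdivlMr// mulrC -Ex_indic// -ExZ; last exact: integ_indic.
apply: le_Ex => //; first by apply: integZ; exact: integ_indic.
move=> x; rewrite indicE; case: (boolP (x \in _)); rewrite ?inE/= ?mulr1 ?mulr0// => /ltW//.
Qed.

End probability_calculus.

(** * Expectations under a measure-preserving map *)

Section measure_preserving_calculus.
Context d (S : measurableType d) (R : realType) (m : probability S R).
Variable T : S -> S.
Hypothesis mpT : measure_preserving m T.

Lemma mp_measurable : measurable_fun setT T. Proof. by case: mpT. Qed.

Lemma mp_preimage A : measurable A -> measurable (T @^-1` A).
Proof. by move=> mA; rewrite -[X in measurable X]setTI; exact: mp_measurable. Qed.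

Lemma pr_preimage A : measurable A -> pr m (T @^-1` A) = pr m A.
Proof. by case: mpT => _ mT mA; rewrite /pr mT. Qed.

Lemma measure_preserving_iter k : measure_preserving m (iter k T).
Proof.
elim: k => [|k [mk pk]]; first by split => //; exact: measurable_id.
split; first by apply: (measurableT_comp mp_measurable mk).
move=> A mA; rewrite [X in m X](_ : _ = iter k T @^-1` (T @^-1` A))//.
rewrite pk; last exact: mp_preimage.
by case: mpT => _ ->.
Qed.

Lemma ae_preimage (P : S -> Prop) : (\forall x \ae m, P x) ->
  \forall x \ae m, P (T x).
Proof.
move=> [N [mN N0 PN]]; exists (T @^-1` N); split => //.
- exact: mp_preimage.
- by case: mpT => _ ->.
- by move=> x /=; exact: PN.
Qed.

Lemma Ex_comp u : measurable_fun setT u -> Ex m (fun x => u (T x)) = Ex m u.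
Proof.
move=> mu; rewrite /Rintegral; congr fine.
have E (f : S -> \bar R) : measurable_fun setT f -> (forall x, (0 <= f x)%E) ->
    (\int[m]_x f (T x) = \int[m]_x f x)%E.
  move=> mf f0.
  have := @ge0_integral_pushforward _ _ _ _ R T mp_measurable m setT f measurableT mf.
  rewrite preimage_setT => <-//.
  by apply: eq_measure_integral => [|? A mA _]; [exact: mp_measurable|case: mpT => _ /(_ _ mA)].
have mEu : measurable_fun setT (EFin \o u) by exact/measurable_EFinP.
rewrite integralE [RHS]integralE; congr (_ - _)%E.
- transitivity (\int[m]_x (EFin \o u)^\+ (T x))%E; last first.
    by apply: E => //; exact: measurable_funepos.
  by apply: eq_integral => x _; rewrite !funeposE.
- transitivity (\int[m]_x (EFin \o u)^\- (T x))%E; last first.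
    by apply: E => //; exact: measurable_funeneg.
  by apply: eq_integral => x _; rewrite !funenegE.
Qed.

Lemma integ_comp u : integ m u -> integ m (fun x => u (T x)).
Proof.
move=> iu; have mu := integ_measurable iu.
apply/integrableP; split.
  by apply/measurable_EFinP; exact: measurableT_comp mu mp_measurable.
move: iu => /integrableP[_]; apply: le_lt_trans.
have := @ge0_integral_pushforward _ _ _ _ R T mp_measurable m setT
  (fun x => `|(EFin \o u) x|%E) measurableT.
rewrite preimage_setT => <-//; last first.
  by apply: measurableT_comp => //; exact/measurable_EFinP.
rewrite le_eqVlt; apply/orP; left; apply/eqP.
by apply: eq_measure_integral => [|? A mA _]; [exact: mp_measurable|case: mpT => _ /(_ _ mA)].
Qed.

Lemma sq_integ_comp u : sq_integ m u -> sq_integ m (fun x => u (T x)).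
Proof.
by move=> [mu iu]; split; [exact: measurableT_comp mu mp_measurable|exact: (integ_comp iu)].
Qed.

Lemma norm2_comp u : measurable_fun setT u -> norm2 m (fun x => u (T x)) = norm2 m u.
Proof.
move=> mu; rewrite /norm2 (Ex_comp (u := fun x => u x ^+ 2))//.
exact: measurable_funX.
Qed.

End measure_preserving_calculus.

(** * Cylinders of Gibbs-Markov maps *)

Lemma ler_series_lim (R : realType) (u v : nat -> R) (l l' : R) :
  series u @ \oo --> l -> series v @ \oo --> l' -> (forall i, u i <= v i) ->
  l <= l'.
Proof.
move=> ul vl uv; apply: (ler_cvg_to ul vl); apply: nearW => n.
by rewrite /series/=; apply: ler_sum.
Qed.

Lemma cvg_seriesZ (R : realType) (c : R) (u : nat -> R) (l : R) :
  series u @ \oo --> l -> series (fun i => c * u i) @ \oo --> c * l.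
Proof.
move=> ul; rewrite [X in X @ _ --> _](_ : _ = fun n => c * series u n).
  exact: cvgMr.
by apply/funext => n; rewrite /series/= mulr_sumr.
Qed.

Lemma ler_series_term (R : realType) (u : nat -> R) (l : R) (i : nat) :
  series u @ \oo --> l -> (forall i, 0 <= u i) -> u i <= l.
Proof.
move=> ul u0; apply: (@le_trans _ _ (series u i.+1)).
  by rewrite /series/= big_nat_recr//= ler_wpDl// sumr_ge0.
have nd : nondecreasing_seq (series u).
  by apply/nondecreasing_seqP => n; rewrite /series/= big_nat_recr//= lerDl.
rewrite -(cvg_lim _ ul)//.
by apply: nondecreasing_cvgn_le => //; apply: cvgP ul.
Qed.

Section markov_model.
Context d (S : measurableType d) (R : realType) (m : probability S R).
Variable T : S -> S.

(* [b i] stands for the image of the branch domain [a i]. *)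
Fixpoint cylinder (a : nat -> set S) (w : seq nat) : set S :=
  if w is i :: w' then a i `&` T @^-1` cylinder a w' else setT.

(** The Gibbs-Markov axioms rewritten for masses of sets, with the [a i] truly disjoint and possibly
    null. [mm_distortion] says that the inverse jacobian of a branch varies by at most the factor
    [expR (C * theta ^+ n)] over the preimage of a cylinder of length n; the empty word gives
    bounded distortion over the whole branch. The symbols of [s] are those of the big image and
    preimage property. *)
Record markov_model (a b : nat -> set S) (s : seq nat) (theta C : R) : Prop :=
  MarkovModel {
  mm_mp : measure_preserving m T ;
  mm_theta : 0 < theta < 1 ;
  mm_C : 0 <= C ;
  mm_a : forall i, measurable (a i) ;
  mm_b : forall i, measurable (b i) ;
  mm_triv : trivIset setT a ;
  mm_cover : pr m (~` \bigcup_i a i) = 0 ;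
  mm_image : forall i, a i `<=` T @^-1` b i ;
  mm_markov : forall i j, pr m (a j `\` b i) = 0 \/ pr m (a j `&` b i) = 0 ;
  mm_distortion : forall i w E F, measurable E -> measurable F ->
    E `<=` cylinder a w -> F `<=` cylinder a w ->
    pr m (a i `&` T @^-1` E) * pr m (b i `&` F) <=
    expR (C * theta ^+ size w) *
      (pr m (b i `&` E) * pr m (a i `&` T @^-1` F)) ;
  mm_pos : forall i, i \in s -> 0 < pr m (a i) ;
  mm_big_image : forall i, 0 < pr m (a i) ->
    exists2 j, j \in s & pr m (a j `\` b i) = 0 ;
  mm_big_preimage : forall i, 0 < pr m (a i) ->
    exists2 j, j \in s & pr m (a i `\` b j) = 0 ;
  mm_mixing : forall i j, 0 < pr m (a i) -> 0 < pr m (a j) ->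
    exists N, forall n, (N < n)%N -> 0 < pr m (a i `&` iter n T @^-1` a j) }.

(** A finite measure whose density varies by at most the factor [expR (K * theta ^+ n)] on a
    cylinder of length n, written without the density. The empty word is excluded: densities on
    different partition elements are not compared. *)
Record regular (a : nat -> set S) (theta K : R) (nu : set S -> R) : Prop :=
  Regular {
  rg_ge0 : forall A, measurable A -> 0 <= nu A ;
  rg_ac : forall A, measurable A -> pr m A = 0 -> nu A = 0 ;
  rg_sigma : forall F : nat -> set S, (forall i, measurable (F i)) ->
    trivIset setT F -> series (fun i => nu (F i)) @ \oo --> nu (\bigcup_i F i) ;
  rg_dist : forall w E F, w <> [::] -> measurable E -> measurable F ->
    E `<=` cylinder a w -> F `<=` cylinder a w ->
    nu E * pr m F <= expR (K * theta ^+ size w) * (pr m E * nu F) }.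

Section model.
Variables (a b : nat -> set S) (s : seq nat) (theta C : R).
Hypothesis M : markov_model a b s theta C.

Let mpT := mm_mp M.
Let ma := mm_a M.
Let mb := mm_b M.

Let theta_gt0 : 0 < theta. Proof. by case/andP: (mm_theta M). Qed.
Let theta_lt1 : theta < 1. Proof. by case/andP: (mm_theta M). Qed.

Let mT A : measurable A -> measurable (T @^-1` A).
Proof. exact: (mp_preimage mpT). Qed.

Let mTn n A : measurable A -> measurable (iter n T @^-1` A).
Proof. exact: (mp_preimage (measure_preserving_iter mpT n)). Qed.

Lemma measurable_cylinder w : measurable (cylinder a w).
Proof.
by elim: w => [|i w IHw] //=; apply: measurableI => //; exact: mT.
Qed.

Lemma measurable_cylinder_bigcup (Q : set (seq nat)) :
  measurable (\bigcup_(w in Q) cylinder a w).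
Proof.
rewrite bigcup_mkcond; apply: countable_bigcupT_measurable => // w.
by case: ifP => // _; exact: measurable_cylinder.
Qed.

Lemma le_regular K theta' nu : regular a theta' K nu ->
  forall A B, measurable A -> measurable B -> A `<=` B -> nu A <= nu B.
Proof.
move=> rnu A B mA mB AB.
have mBA : measurable (B `\` A) by exact: measurableD.
have := @rg_sigma _ _ _ _ rnu (bigcup2 A (B `\` A)).
rewrite bigcup2E setDUK// => H.
have {}H : series (fun i => nu (bigcup2 A (B `\` A) i)) @ \oo --> nu B.
  apply: H.
    by move=> [|[|i]] /=.
  by rewrite -trivIset_bigcup2; apply/seteqP; split => x //= [? []].
have := ler_series_term 0 H; apply => -[|[|i]] /=; exact: (rg_ge0 rnu).
Qed.

Lemma regularU2 K theta' nu : regular a theta' K nu ->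
  forall A B, measurable A -> measurable B -> A `&` B = set0 ->
  nu (A `|` B) = nu A + nu B.
Proof.
move=> rnu A B mA mB AB.
have H : series (fun i => nu (bigcup2 A B i)) @ \oo --> nu (A `|` B).
  rewrite -bigcup2E; apply: (rg_sigma rnu) => [[|[|i]] //=|].
  by rewrite -trivIset_bigcup2.
have n0 : nu set0 = 0 by apply: (rg_ac rnu) => //; exact: pr0.
have H2 : series (fun i => nu (bigcup2 A B i)) @ \oo --> nu A + nu B.
  apply: cvg_near_cst; exists 2%N => // n /= n2.
  rewrite /series/= -(subnKC n2) addnC.
  rewrite (big_cat_nat (n := 2))//= ?leq_addl//.
  rewrite big_nat_recr//= big_nat1 big1_seq ?addr0// => i /andP[_].
  by rewrite mem_index_iota => /andP[]; case: i => [|[|i]].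
exact: (cvg_unique _ H H2).
Qed.

Lemma regular_split K theta' nu : regular a theta' K nu -> forall B, measurable B ->
  series (fun i => nu (a i `&` B)) @ \oo --> nu B.
Proof.
move=> rnu B mB.
have mU : measurable (\bigcup_i a i) by exact: bigcup_measurable.
have mUB : measurable ((\bigcup_i a i) `&` B) by exact: measurableI.
have -> : nu B = nu ((\bigcup_i a i) `&` B).
  rewrite -[in LHS](setUIDK B (\bigcup_i a i)) (regularU2 rnu).
  - rewrite (@rg_ac _ _ _ _ rnu (B `\` _)) ?addr0 1?setIC//.
      exact: measurableD.
    apply: pr_sub0 (mm_cover M) => //; first exact: measurableD.
      exact: measurableC.
  - by rewrite setIC.
  - exact: measurableD.
  - by apply/seteqP; split => x //= [[_ ?] []].
rewrite setI_bigcupl; apply: (rg_sigma rnu); first by move=> i; exact: measurableI.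
exact: trivIset_setIr (mm_triv M).
Qed.

Lemma regular_pr : regular a theta 0 (pr m).
Proof.
split=> [A _|A _ //|F mF tF|w E F _ mE mF _ _]; first exact: pr_ge0.
  exact: pr_bigcup_series.
by rewrite mul0r expR0 mul1r.
Qed.

Let preimage_bigcup_a i (F : nat -> set S) :
  a i `&` T @^-1` (\bigcup_n F n) = \bigcup_n (a i `&` T @^-1` F n).
Proof. by rewrite preimage_bigcup setI_bigcupr. Qed.

(** The pushed density on a cylinder [w] is the density of [nu] on [i :: w], which is one letter
    longer, times the inverse jacobian: the former contributes [theta * K], the latter [C]. *)
Lemma regular_branch K nu i : 0 <= K -> regular a theta K nu ->
  regular a theta (theta * K + C) (fun B => nu (a i `&` T @^-1` B)).
Proof.
move=> K0 rnu; have maT A : measurable A -> measurable (a i `&` T @^-1` A).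
  by move=> mA; apply: measurableI => //; exact: mT.
have ac A : measurable A -> pr m A = 0 -> pr m (a i `&` T @^-1` A) = 0.
  move=> mA A0; apply: (@pr_sub0 _ _ _ m _ (T @^-1` A)) => //; [exact: maT|exact: mT|].
  by rewrite pr_preimage.
split=> [A mA|A mA A0|F mF tF|w E F w0 mE mF Ew Fw].
- by apply: (rg_ge0 rnu); exact: maT.
- by apply: (rg_ac rnu); [exact: maT|exact: ac].
- rewrite preimage_bigcup_a; apply: (rg_sigma rnu); first by move=> n; exact: maT.
  by move=> k l _ _ [x [[_ Fk] [_ Fl]]]; apply: tF => //; exists (T x).
(* By the Markov property the image [b i] contains the cylinder or misses it; in the second case the
   left-hand side is 0. *)
have [iw|iw] : pr m (cylinder a w `\` b i) = 0 \/ pr m (cylinder a w `&` b i) = 0.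
  case: w w0 {Ew Fw} => //= j w _.
  have mw : measurable (a j `&` T @^-1` cylinder a w).
    by apply: measurableI => //; apply: mT; exact: measurable_cylinder.
  have [j0|j0] := mm_markov M i j; [left|right].
    by apply: (pr_sub0 _ _ _ j0); [exact: measurableD|exact: measurableD|move=> x [[]]].
  by apply: (pr_sub0 _ _ _ j0); [exact: measurableI|exact: measurableI|move=> x [[]]].
  have nuw : nu (a i `&` T @^-1` E) * pr m (a i `&` T @^-1` F) <=
      expR (K * theta ^+ (size w).+1) * (pr m (a i `&` T @^-1` E) * nu (a i `&` T @^-1` F)).
    apply: (@rg_dist _ _ _ _ rnu (i :: w)) => //; [exact: maT|exact: maT| |].
      by move=> x [? ?]; split => //; exact: Ew.
    by move=> x [? ?]; split => //; exact: Fw.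
  have bF : pr m (b i `&` F) = pr m F.
    rewrite [RHS](prDI m mF (mb i)) (@pr_sub0 _ _ _ m (F `\` b i) (cylinder a w `\` b i)) ?add0r 1?setIC//.
    - exact: measurableD.
    - by apply: measurableD => //; exact: measurable_cylinder.
    - by move=> x [? ?]; split => //; exact: Fw.
  have bE : pr m (b i `&` E) <= pr m E by apply: le_pr => //; exact: measurableI.
  have := mm_distortion M i mE mF Ew Fw; rewrite bF => dist.
  have [F0|F0] := eqVneq (pr m (a i `&` T @^-1` F)) 0.
    move: dist; rewrite F0 !mulr0 => dist.
    have : pr m (a i `&` T @^-1` E) = 0 \/ pr m F = 0.
      have : pr m (a i `&` T @^-1` E) * pr m F == 0.
        by rewrite eq_le dist mulr_ge0// pr_ge0.
      by rewrite mulf_eq0 => /orP[/eqP|/eqP]; [left|right].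
    have rhs0 : 0 <= expR ((theta * K + C) * theta ^+ size w) * (pr m E * nu (a i `&` T @^-1` F)).
      by rewrite !mulr_ge0 ?expR_ge0 ?pr_ge0//; apply: (rg_ge0 rnu); exact: maT.
    case=> z; last by rewrite z mulr0.
    by rewrite (rg_ac rnu (maT _ mE) z) mul0r.
  have {}F0 : 0 < pr m (a i `&` T @^-1` F) by rewrite lt_neqAle eq_sym F0 pr_ge0.
  rewrite -(ler_pM2r F0).
  rewrite (_ : (theta * K + C) * _ = K * theta ^+ (size w).+1 + C * theta ^+ size w); last by rewrite exprS; ring.
  rewrite expRD.
  set e1 := expR (K * _) in nuw *; set e2 := expR (C * _) in dist *.
  set nE := nu _ in nuw *; set nF := nu _ in nuw *.
  set pE' := pr m (a i `&` T @^-1` E) in nuw dist *.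
  set pF' := pr m (a i `&` T @^-1` F) in nuw dist F0 *.
  have e10 : 0 < e1 by exact: expR_gt0.
  have e20 : 0 < e2 by exact: expR_gt0.
  have nF0 : 0 <= nF by apply: (rg_ge0 rnu); exact: maT.
  have pF0 : 0 <= pr m F by exact: pr_ge0.
  apply: (@le_trans _ _ (e1 * (pE' * nF) * pr m F)).
    by rewrite mulrAC ler_wpM2r.
  apply: (@le_trans _ _ (e1 * nF * (e2 * (pr m E * pF')))).
    rewrite (_ : _ * pr m F = e1 * nF * (pE' * pr m F)); last by ring.
    rewrite ler_wpM2l ?mulr_ge0 ?(ltW e10)//; apply: (le_trans dist).
    by rewrite ler_wpM2l ?(ltW e20)// ler_wpM2r ?(ltW F0).
  by rewrite le_eqVlt; apply/orP; left; apply/eqP; ring.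
have E0 : pr m (a i `&` T @^-1` E) = 0.
  apply: (@pr_sub0 _ _ _ m _ (T @^-1` (E `&` b i))).
  - exact: maT.
  - by apply: mT; exact: measurableI.
  - by move=> x [ax Tx]; split => //; exact: (mm_image M).
  - rewrite pr_preimage//; last exact: measurableI.
    apply: (pr_sub0 _ _ _ iw); [exact: measurableI| |by move=> x [? ?]; split => //; exact: Ew].
    by apply: measurableI => //; exact: measurable_cylinder.
rewrite (rg_ac rnu (maT _ mE) E0) mul0r !mulr_ge0 ?expR_ge0 ?pr_ge0//.
by apply: (rg_ge0 rnu); exact: maT.
Qed.

(** For fixed [E] and [F] the inequality of regularity is linear in [nu], so it may be summed over
    the branches. *)
Lemma regular_preimage K nu : 0 <= K -> regular a theta K nu ->
  regular a theta (theta * K + C) (fun B => nu (T @^-1` B)).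
Proof.
move=> K0 rnu; split=> [A mA|A mA A0|F mF tF|w E F w0 mE mF Ew Fw].
- by apply: (rg_ge0 rnu); exact: mT.
- by apply: (rg_ac rnu); [exact: mT|rewrite pr_preimage].
- rewrite preimage_bigcup; apply: (rg_sigma rnu); first by move=> n; exact: mT.
  by move=> k l _ _ [x [Fk Fl]]; apply: tF => //; exists (T x).
have sE := regular_split rnu (mT mE); have sF := regular_split rnu (mT mF).
rewrite mulrC mulrA.
apply: (ler_series_lim (cvg_seriesZ (c := pr m F) sE) (cvg_seriesZ (c := _) sF)) => i.
rewrite mulrC -mulrA; exact: (rg_dist (regular_branch i K0 rnu)).
Qed.

Lemma le_regular_cst K K' nu : K <= K' -> regular a theta K nu ->
  regular a theta K' nu.
Proof.
move=> KK' [n0 nac ns nd]; split => // w E F w0 mE mF Ew Fw.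
apply: (le_trans (nd _ _ _ w0 mE mF Ew Fw)).
rewrite ler_wpM2r//; first by rewrite mulr_ge0 ?pr_ge0 ?n0.
by rewrite ler_expR ler_wpM2r// exprn_ge0// ltW.
Qed.

(** The fixed point of [K |-> theta * K + C], which bounds the regularity constant in the long
    run. *)
Let C1 := C / (1 - theta).

Let C1_ge0 : 0 <= C1.
Proof. by rewrite divr_ge0 ?(mm_C M)// subr_ge0 ltW. Qed.

Let C1E : theta * C1 + C = C1.
Proof. by rewrite /C1; field; rewrite subr_eq0 eq_sym lt_eqF. Qed.

Lemma regular_iter K nu n : 0 <= K -> regular a theta K nu ->
  regular a theta (theta ^+ n * K + C1) (fun B => nu (iter n T @^-1` B)).
Proof.
move=> K0 rnu; elim: n => [|n IHn].
  by apply: le_regular_cst rnu; rewrite expr0 mul1r lerDl.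
have := regular_preimage _ IHn; rewrite mulrDr mulrA -exprS -addrA C1E; apply.
by rewrite addr_ge0// mulr_ge0// exprn_ge0// ltW.
Qed.

Lemma seq_lower (u : nat -> R) (t : seq nat) : (forall i, i \in t -> 0 < u i) ->
  exists2 e, 0 < e & forall i, i \in t -> e <= u i.
Proof.
elim: t => [|i t IHt] ut; first by exists 1.
have [e e0 eu] : exists2 e, 0 < e & forall i, i \in t -> e <= u i.
  by apply: IHt => j jt; apply: ut; rewrite inE jt orbT.
exists (Num.min e (u i)); first by rewrite lt_min e0 ut ?inE ?eqxx.
move=> j; rewrite inE => /orP[/eqP ->|/eu]; rewrite ge_min ?lexx ?orbT//.
by move=> ->.
Qed.

Let pr_sub_mod0 A B : measurable A -> measurable B -> pr m (A `\` B) = 0 ->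
  pr m A <= pr m B.
Proof.
move=> mA mB AB; rewrite (prDI m mA mB) AB add0r.
by apply: le_pr => //; exact: measurableI.
Qed.

(** Distortion over a whole branch, with [F] the full space. The big image property bounds
    [pr m (b i)] from below by the smallest mass among the finitely many symbols of [s]. *)
Lemma branch_upper : exists2 c, 0 <= c & forall i B, measurable B ->
  pr m (a i `&` T @^-1` B) <= c * (pr m (a i) * pr m B).
Proof.
have [e e0 es] := seq_lower (fun i => @mm_pos _ _ _ _ _ M i).
exists (expR C / e); first by rewrite divr_ge0 ?expR_ge0// ltW.
move=> i B mB; have mTB := mT mB.
have maB : measurable (a i `&` T @^-1` B) by exact: measurableI.
have [ai0|ai0] := eqVneq (pr m (a i)) 0.
  by rewrite (pr_sub0 maB (ma i) _ ai0) ?ai0 ?mul0r ?mulr0.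
have {}ai0 : 0 < pr m (a i) by rewrite lt_neqAle eq_sym ai0 pr_ge0.
have [j js jb] := mm_big_image M ai0.
have eb : e <= pr m (b i) by apply: (le_trans (es _ js)); exact: pr_sub_mod0.
have := @mm_distortion _ _ _ _ _ M i [::] B setT mB measurableT (@subsetT _ _) (@subsetT _ _).
rewrite setIT preimage_setT setIT expr0 mulr1 => dist.
rewrite mulrAC ler_pdivlMr//.
apply: (@le_trans _ _ (pr m (a i `&` T @^-1` B) * pr m (b i))).
  by rewrite ler_wpM2l ?pr_ge0.
apply: (le_trans dist); rewrite ler_wpM2l ?expR_ge0// mulrC ler_wpM2l ?pr_ge0//.
by apply: le_pr => //; exact: measurableI.
Qed.

Lemma branch_lower i B : measurable B ->
  expR (- C) * (pr m (a i) * pr m (b i `&` B)) <= pr m (a i `&` T @^-1` B).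
Proof.
move=> mB.
have := @mm_distortion _ _ _ _ _ M i [::] setT B measurableT mB (@subsetT _ _) (@subsetT _ _).
rewrite preimage_setT !setIT expr0 mulr1 => dist.
rewrite expRN ler_pdivrMl ?expR_gt0//; apply: (le_trans dist).
rewrite ler_wpM2l ?expR_ge0// -[leRHS]mul1r ler_wpM2r ?pr_ge0//.
exact: pr_le1.
Qed.

(** Regularity on the one-letter cylinder [a i] exchanges [nu] for [m] at the cost of a factor
    [expR (K * theta)]. *)
Lemma regular_branch_upper K : exists2 c, 0 <= c & forall nu, regular a theta K nu ->
  forall i B, measurable B -> nu (a i `&` T @^-1` B) <= c * (nu (a i) * pr m B).
Proof.
have [c c0 cP] := branch_upper.
exists (expR (K * theta) * c); first by rewrite mulr_ge0 ?expR_ge0.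
move=> nu rnu i B mB; have mTB := mT mB.
have maB : measurable (a i `&` T @^-1` B) by exact: measurableI.
have [ai0|ai0] := eqVneq (pr m (a i)) 0.
  have aB0 : pr m (a i `&` T @^-1` B) = 0 by apply: (pr_sub0 maB (ma i) _ ai0).
  by rewrite (rg_ac rnu maB aB0) (rg_ac rnu _ ai0)// mul0r mulr0.
have {}ai0 : 0 < pr m (a i) by rewrite lt_neqAle eq_sym ai0 pr_ge0.
have d1 : nu (a i `&` T @^-1` B) * pr m (a i) <=
   expR (K * theta ^+ 1) * (pr m (a i `&` T @^-1` B) * nu (a i)).
  apply: (@rg_dist _ _ _ _ rnu [:: i]) => //=; rewrite preimage_setT setIT//.
rewrite -(ler_pM2r ai0); apply: (le_trans d1); rewrite expr1.
rewrite -!mulrA ler_wpM2l ?expR_ge0//.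
rewrite (_ : c * _ = c * (pr m (a i) * pr m B) * nu (a i)); last by ring.
rewrite ler_wpM2r//; [exact: (rg_ge0 rnu)|exact: cP].
Qed.

Lemma regular_branch_lower K : exists2 c, 0 < c & forall nu, regular a theta K nu ->
  forall i B, measurable B -> c * (nu (a i) * pr m (b i `&` B)) <= nu (a i `&` T @^-1` B).
Proof.
exists (expR (- (K * theta)) * expR (- C)); first by rewrite mulr_gt0 ?expR_gt0.
move=> nu rnu i B mB; have mTB := mT mB.
have maB : measurable (a i `&` T @^-1` B) by exact: measurableI.
have [ai0|ai0] := eqVneq (pr m (a i)) 0.
  by rewrite (rg_ac rnu _ ai0)// mul0r mulr0; exact: (rg_ge0 rnu).
have {}ai0 : 0 < pr m (a i) by rewrite lt_neqAle eq_sym ai0 pr_ge0.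
have d1 : nu (a i) * pr m (a i `&` T @^-1` B) <=
   expR (K * theta ^+ 1) * (pr m (a i) * nu (a i `&` T @^-1` B)).
  apply: (@rg_dist _ _ _ _ rnu [:: i]) => //=; rewrite preimage_setT setIT//.
move: d1; rewrite expr1 => d1.
rewrite -mulrA expRN ler_pdivrMl ?expR_gt0// -(ler_pM2l ai0).
apply: (@le_trans _ _ (nu (a i) * (expR (- C) * (pr m (a i) * pr m (b i `&` B))))).
  by rewrite le_eqVlt; apply/orP; left; apply/eqP; ring.
apply: (@le_trans _ _ (nu (a i) * pr m (a i `&` T @^-1` B))).
  by rewrite ler_wpM2l ?(rg_ge0 rnu)//; exact: branch_lower.
by apply: (le_trans d1); rewrite le_eqVlt; apply/orP; left; apply/eqP; ring.
Qed.

Let pr_le_sum (t : seq nat) B : measurable B ->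
  pr m B <= pr m (B `\` \big[setU/set0]_(i <- t) b i) + \sum_(i <- t) pr m (b i `&` B).
Proof.
elim: t B => [|i t IHt] B mB; first by rewrite !big_nil setD0 addr0.
have mBb : measurable (B `\` b i) by exact: measurableD.
have := IHt _ mBb; rewrite !big_cons (prDI m mB (mb i)) setDDl [B `&` _]setIC.
have : \sum_(j <- t) pr m (b j `&` (B `\` b i)) <= \sum_(j <- t) pr m (b j `&` B).
  apply: ler_sum => j _.
  by apply: le_pr; [exact: measurableI|exact: measurableI|move=> x [? []]].
by move=> h1 h2; lra.
Qed.

(** Big preimages: every symbol of positive mass lies, modulo 0, in some [b j] with [j] in [s]. *)
Lemma pr_image_cover : pr m (~` \big[setU/set0]_(i <- s) b i) = 0.
Proof.
set U := \big[_/_]_(i <- s) _.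
have mU : measurable U by exact: bigsetU_measurable.
have mC : measurable (~` U) by exact: measurableC.
suff H k : pr m (a k `&` ~` U) = 0.
  have := regular_split regular_pr mC.
  rewrite (_ : (fun i => _) = fun=> 0); last by apply/funext => k; rewrite H.
  rewrite (_ : series _ = fun=> 0); last by apply/funext => k; rewrite /series/= big1.
  by move=> H0; apply: (cvg_unique _ H0 (cvg_cst _)).
have mk : measurable (a k `&` ~` U) by exact: measurableI.
have [ak0|ak0] := eqVneq (pr m (a k)) 0; first by apply: (pr_sub0 mk (ma k) _ ak0).
have {}ak0 : 0 < pr m (a k) by rewrite lt_neqAle eq_sym ak0 pr_ge0.
have [j js jb] := mm_big_preimage M ak0.
apply: (pr_sub0 mk _ _ jb); first exact: measurableD.
move=> x [ax Ux]; split => // bx; apply: Ux.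
by rewrite /U -bigcup_seq; exists j.
Qed.

Lemma pr_image_sum B : measurable B -> pr m B <= \sum_(i <- s) pr m (b i `&` B).
Proof.
move=> mB; apply: (le_trans (pr_le_sum s mB)); rewrite gerDr.
set U := \big[_/_]_(i <- s) _.
have mU : measurable U by exact: bigsetU_measurable.
rewrite le_eqVlt; apply/orP; left; apply/eqP.
by apply: (pr_sub0 _ _ _ pr_image_cover) => //; [exact: measurableD|exact: measurableC].
Qed.

Let mixing_time : exists N0, forall i j, i \in s -> j \in s ->
  forall n, (N0 < n)%N -> 0 < pr m (a i `&` iter n T @^-1` a j).
Proof.
have ub (P : nat -> nat -> Prop) (t : seq nat) : (forall i, i \in t -> exists N, forall n, (N < n)%N -> P i n) ->
    exists N, forall i, i \in t -> forall n, (N < n)%N -> P i n.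
  elim: t => [|i t IHt] Pt; first by exists 0%N.
  have [N1 NP1] := Pt i (mem_head _ _).
  have [N2 NP2] : exists N, forall i, i \in t -> forall n, (N < n)%N -> P i n.
    by apply: IHt => j jt; apply: Pt; rewrite inE jt orbT.
  exists (maxn N1 N2) => j; rewrite inE => /orP[/eqP ->|jt] n; rewrite gtn_max => /andP[n1 n2].
    exact: NP1.
  exact: NP2.
have [|N NP] := ub (fun i n => forall j, j \in s -> 0 < pr m (a i `&` iter n T @^-1` a j)) s.
  move=> i si; have [|N NP] := ub (fun j n => 0 < pr m (a i `&` iter n T @^-1` a j)) s.
    by move=> j sj; apply: (mm_mixing M); exact: (mm_pos M).
  by exists N => n Nn j sj; exact: NP.
by exists N => i j si sj n Nn; exact: NP.
Qed.

(** After N steps, mixing puts a definite mass of each seed [a j] into every [a i] with [i] in [s],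
    and one more branch spreads it over the images [b i], which together cover the space. Finiteness
    of [s] makes the mixing time and the mass uniform. *)
Lemma seed_lower : exists N0, forall N, (N0 < N)%N -> exists2 c, 0 < c &
  forall j B, j \in s -> measurable B -> c * pr m B <= pr m (a j `&` iter N.+1 T @^-1` B).
Proof.
have [N0 NP] := mixing_time; exists N0 => N NN0.
have [e e0 eP] : exists2 e, 0 < e & forall j, j \in s -> forall i, i \in s ->
    e <= pr m (a j `&` iter N T @^-1` a i).
  have H j : exists2 e, 0 < e & j \in s -> forall i, i \in s -> e <= pr m (a j `&` iter N T @^-1` a i).
    have [js|js] := boolP (j \in s); last by exists 1.
    have [|e e0 eP] := @seq_lower (fun i => pr m (a j `&` iter N T @^-1` a i)) s.
      by move=> i si; exact: NP.
    by exists e.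
  have [g gP] : {g : nat -> R & forall j, 0 < g j /\ (j \in s -> forall i, i \in s -> g j <= pr m (a j `&` iter N T @^-1` a i))}.
    by apply: (choice (P := fun j e => 0 < e /\ (j \in s -> forall i, i \in s -> e <= pr m (a j `&` iter N T @^-1` a i)))) => j; have [e ? ?] := H j; exists e.
  have [|e e0 eP] := @seq_lower g s; first by move=> j _; case: (gP j).
  exists e => // j js i si; apply: (le_trans (eP _ js)).
  by case: (gP j) => _; apply.
have [c c0 cP] := regular_branch_lower (C + C1).
(* [(size s).+1] bounds the number of images in the sum and is never 0. *)
exists (c * e / (size s).+1%:R); first by rewrite !mulr_gt0 ?invr_gt0.
move=> j B js mB.
(* The constant does not depend on [N]: one branch gives [C], and the later steps at most [C1]
   more. *)
have rj : regular a theta (C + C1) (fun B => pr m (a j `&` iter N T @^-1` B)).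
  case: N NN0 {NP eP} => // N _.
  have := regular_iter N _ (regular_branch j (lexx 0) regular_pr).
  rewrite mulr0 add0r => /(_ (mm_C M)) H.
  rewrite (_ : (fun B => _) = (fun B => pr m (a j `&` T @^-1` (iter N T @^-1` B)))); last first.
    by apply/funext => A; congr (pr m (_ `&` _)); apply/seteqP; split => x /=; rewrite -iterS iterSr.
  apply: le_regular_cst H; rewrite lerD2r -[leRHS]mul1r ler_wpM2r ?(mm_C M)//.
  by rewrite exprn_ile1// ltW.
set nu := fun B => pr m (a j `&` iter N T @^-1` B) in rj.
have mTB := mT mB.
rewrite -[leRHS]/(nu (T @^-1` B)).
have nuB i : i \in s -> c * e * pr m (b i `&` B) <= nu (T @^-1` B).
  move=> si; have := cP _ rj i B mB.
  have : nu (a i `&` T @^-1` B) <= nu (T @^-1` B).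
    by apply: (le_regular rj) => //; exact: measurableI.
  move=> h1 h2; apply: le_trans h1; apply: le_trans h2.
  by rewrite -mulrA ler_wpM2l ?(ltW c0)// ler_wpM2r ?pr_ge0//; exact: eP.
have : c * e * pr m B <= \sum_(i <- s) nu (T @^-1` B).
  apply: (@le_trans _ _ (c * e * \sum_(i <- s) pr m (b i `&` B))).
    by rewrite ler_wpM2l ?mulr_ge0 ?(ltW c0) ?(ltW e0)//; exact: pr_image_sum.
  by rewrite mulr_sumr big_seq [leRHS]big_seq; apply: ler_sum => i; exact: nuB.
rewrite big_const_seq count_predT iter_addr_0 => H.
rewrite mulrAC ler_pdivrMr// (le_trans H)// -[leLHS]mulr_natr ler_wpM2l ?pr_ge0//.
by rewrite ler_nat.
Qed.

(** One branch carries [a i] over [b i], which contains a seed of [s], and the bound for seeds takes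
    over. The two units added to [N0] pay for this branch and for the last branch of the seed
    bound. *)
Lemma Doeblin K : exists N0, forall N, (N0 < N)%N -> exists2 c, 0 < c &
  forall nu, regular a theta K nu -> forall B, measurable B ->
    c * (nu setT * pr m B) <= nu (iter N T @^-1` B).
Proof.
have [N0 NP] := seed_lower; exists N0.+2 => -[//|[//|N]] NN.
have [c1 c10 cP1] := NP N NN.
have [c2 c20 cP2] := regular_branch_lower K.
exists (c2 * c1); first by rewrite mulr_gt0.
move=> nu rnu B mB.
have mB' : measurable (iter N.+1 T @^-1` B) by exact: mTn.
rewrite (_ : iter _ T @^-1` B = T @^-1` (iter N.+1 T @^-1` B)); last first.
  by apply/seteqP; split => x /=; rewrite -iterS -iterSr.
have s1 := regular_split rnu (mT mB').
have s2 := regular_split rnu measurableT.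
rewrite [nu setT * _]mulrC mulrA.
apply: (ler_series_lim (cvg_seriesZ (c := c2 * c1 * pr m B) s2) s1) => i.
rewrite setIT.
have [ai0|ai0] := eqVneq (pr m (a i)) 0.
  rewrite (rg_ac rnu _ ai0)// mulr0; apply: (rg_ge0 rnu).
  by apply: measurableI => //; exact: mT.
have {}ai0 : 0 < pr m (a i) by rewrite lt_neqAle eq_sym ai0 pr_ge0.
have [j js jb] := mm_big_image M ai0.
apply: le_trans (cP2 _ rnu i _ mB').
rewrite -!mulrA ler_wpM2l ?(ltW c20)// mulrA mulrC ler_wpM2l ?(rg_ge0 rnu)//.
apply: (le_trans (cP1 j B js mB)); apply: pr_sub_mod0.
- by apply: measurableI => //; exact: mTn.
- exact: measurableI.
- apply: (pr_sub0 _ _ _ jb); [|exact: measurableD|].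
    by apply: measurableD; apply: measurableI => //; exact: mTn.
  by move=> x [[ax Bx] bx]; split => // bx'; apply: bx.
Qed.

(** Chosen to be stable under one Doeblin step: if [theta ^+ q <= 4^-1], then [q] iterations bring
    the constant [4 * C1] down to at most [C1 + C1], and the subtraction of half of the lower bound
    doubles it back to [4 * C1]. *)
Let K0 := 4 * C1.

Let K0_ge0 : 0 <= K0. Proof. by rewrite mulr_ge0. Qed.

Let regular_cst : 0 <= C1 /\ theta * K0 + C <= K0.
Proof.
split => //; rewrite /K0 mulrCA (_ : theta * C1 = C1 - C); last by rewrite -[in RHS]C1E addrK.
by have := mm_C M; lra.
Qed.

(* Subtracting from [nu] half of its part guaranteed by the lower bound costs
   only a factor 2 on the distortion constant. *)
Let regularB K c nu : 0 <= K -> 0 <= c ->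
  regular a theta K nu -> (forall B, measurable B -> 2 * c * pr m B <= nu B) ->
  regular a theta (2 * K) (fun B => nu B - c * pr m B).
Proof.
move=> K_ge0 c0 rnu low; split=> [A mA|A mA A0|F mF tF|w E F w0 mE mF Ew Fw].
- by have := low A mA; have := pr_ge0 m A; nra.
- by rewrite (rg_ac rnu)// A0 mulr0 subr0.
- rewrite [X in X @ _ --> _](_ : _ = fun n => series (fun i => nu (F i)) n -
      series (fun i => c * pr m (F i)) n).
    apply: cvgB; first exact: (rg_sigma rnu).
    by apply: cvg_seriesZ; exact: pr_bigcup_series.
  by apply/funext => n; rewrite /series/= sumrB.
- have := rg_dist rnu w0 mE mF Ew Fw; have := low F mF.
  have := pr_ge0 m E; have := pr_ge0 m F.
  rewrite (_ : 2 * K * _ = K * theta ^+ size w + K * theta ^+ size w); last by ring.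
  rewrite expRD; set e := expR _.
  have e1 : 1 <= e by rewrite -expR0 ler_expR mulr_ge0// exprn_ge0// ltW.
  set pE := pr m E; set pF := pr m F; set nE := nu E; set nF := nu F => pF0 pE0 h1 h2.
  suff : 0 <= pE * ((e * e - e) * nF - (e * e - 1) * (c * pF)) by nra.
  apply: mulr_ge0 => //.
  have ee : 0 <= e * e - e by rewrite -{3}[e]mulr1 -mulrBr mulr_ge0 ?subr_ge0// (le_trans ler01).
  have cF : 0 <= c * pF by exact: mulr_ge0.
  have h3 : (e * e - e) * (2 * (c * pF)) <= (e * e - e) * nF.
    by rewrite ler_wpM2l// mulrA.
  have := mulr_ge0 (sqr_ge0 (e - 1)) cF; lra.
Qed.

(** Every [q] steps a fixed fraction of the mass is turned into a multiple of [m], and the remainder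
    stays in the same regular class, so the deviation contracts by [1 - c]. The upper bound on one
    branch is what makes the error relative to [pr m B]. *)
Lemma regular_mixing : exists rho C', [/\ 0 < rho, rho < 1, 0 <= C' &
  forall nu, regular a theta K0 nu -> forall l B, (0 < l)%N -> measurable B ->
  `|nu (iter l T @^-1` B) - nu setT * pr m B| <= C' * rho ^+ l * (nu setT * pr m B)].
Proof.
have [N0 NP] := Doeblin K0.
have [q [Nq q4]] : exists q, (N0 < q)%N /\ theta ^+ q <= 4^-1.
  have th0 : theta ^+ n @[n --> \oo] --> 0.
    by apply: cvg_expr; rewrite ger0_norm ?ltW.
  have /cvgrPdist_le/(_ 4^-1) := th0; case; first by rewrite invr_gt0.
  move=> N _ HN; exists (maxn N N0.+1); split; first by rewrite leq_max ltnSn orbT.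
  have /= := HN (maxn N N0.+1) (leq_maxl _ _); rewrite sub0r normrN ger0_norm//.
  by rewrite exprn_ge0// ltW.
have [c' c'0 cP'] := NP q Nq.
(* Half of the Doeblin constant, kept below 1 so that the contraction factor [1 - c] is positive. *)
pose c := Num.min (c' / 2) 2^-1.
have c0 : 0 < c by rewrite lt_min !divr_gt0//= invr_gt0.
have c1 : c < 1 by rewrite gt_min invf_lt1// ltr1n orbT.
have cP nu : regular a theta K0 nu -> forall B, measurable B ->
    2 * c * (nu setT * pr m B) <= nu (iter q T @^-1` B).
  move=> rnu B mB; apply: le_trans (cP' nu rnu B mB).
  rewrite ler_wpM2r//; first by rewrite mulr_ge0 ?pr_ge0// (rg_ge0 rnu).
  have : c <= c' / 2 by rewrite ge_min lexx.
  by lra.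
have [U U0 UP] := regular_branch_upper K0.
have step nu : regular a theta K0 nu -> forall r B, (0 < r)%N -> measurable B ->
    nu (iter r T @^-1` B) <= U * (nu setT * pr m B).
  move=> rnu [//|r] B _ mB.
  have mB' : measurable (iter r T @^-1` B) by exact: mTn.
  rewrite (_ : iter _ T @^-1` B = T @^-1` (iter r T @^-1` B)); last first.
    by apply/seteqP; split => x /=; rewrite -iterS -iterSr.
  have s1 := regular_split rnu (mT mB').
  have s2 := regular_split rnu measurableT.
  rewrite [nu setT * _]mulrC mulrA.
  apply: (ler_series_lim s1 (cvg_seriesZ (c := U * pr m B) s2)) => i.
  rewrite setIT; apply: (le_trans (UP nu rnu i _ mB')).
  by rewrite /pr (measure_preserving_iter mpT r).2// -!mulrA [nu _ * _]mulrC.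
have main n : forall nu, regular a theta K0 nu -> forall r B, (0 < r)%N -> measurable B ->
    `|nu (iter (n * q + r) T @^-1` B) - nu setT * pr m B| <=
    (1 - c) ^+ n * ((U + 1) * (nu setT * pr m B)).
  elim: n => [|n IHn] nu rnu r B r0 mB.
    rewrite mul0n add0n expr0 mul1r.
    have := step nu rnu r B r0 mB.
    have : 0 <= nu (iter r T @^-1` B) by apply: (rg_ge0 rnu); exact: mTn.
    have : 0 <= nu setT * pr m B by rewrite mulr_ge0 ?pr_ge0 ?(rg_ge0 rnu).
    by move=> ? ? ?; rewrite ler_norml; apply/andP; split; nra.
  pose nu' B := nu (iter q T @^-1` B) - c * nu setT * pr m B.
  have nuT0 : 0 <= nu setT by rewrite (rg_ge0 rnu).
  have rnu' : regular a theta K0 nu'.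
    rewrite (_ : K0 = 2 * (2 * C1)); last by rewrite /K0; ring.
    apply: regularB; first by rewrite mulr_ge0.
    - by rewrite mulr_ge0// ltW.
    - apply: le_regular_cst (regular_iter q K0_ge0 rnu).
      rewrite [leRHS]mulrDl mul1r lerD2r /K0 mulrA ler_piMl//.
      by move: q4; lra.
    - by move=> A mA; have := cP nu rnu A mA; rewrite !mulrA.
  have := IHn nu' rnu' r B r0 mB.
  rewrite /nu' preimage_setT prT mulr1 /pr (measure_preserving_iter mpT _).2// -/(pr m B).
  rewrite (_ : iter q T @^-1` _ = iter (n.+1 * q + r) T @^-1` B); last first.
    have -> : (n.+1 * q + r = n * q + r + q)%N by rewrite mulSn -addnA addnC.
    by apply/seteqP; split => x /=; rewrite (iterD (n * q + r) q).
  rewrite (_ : _ - c * nu setT * pr m B - _ =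
    nu (iter (n.+1 * q + r) T @^-1` B) - nu setT * pr m B); last by ring.
  move=> /le_trans; apply; rewrite le_eqVlt; apply/orP; left; apply/eqP.
  by rewrite exprS; ring.
have q0 : (0 < q)%N by apply: leq_ltn_trans Nq.
(* By Bernoulli's inequality [rho ^+ q >= 1 - c], which turns the contraction over blocks of [q]
   steps into a rate per step. *)
pose rho := 1 - c / q%:R.
have qR : (0 : R) < q%:R by rewrite ltr0n.
have cq : c / q%:R <= c by rewrite ler_pdivrMr// ler_peMr ?(ltW c0)// ler1n.
have rho0 : 0 < rho by rewrite subr_gt0 (le_lt_trans cq).
have rho1 : rho < 1 by rewrite ltrBlDr ltrDl divr_gt0.
have rhoq : 1 - c <= rho ^+ q.
  have bern n : 1 - n%:R * (c / q%:R) <= rho ^+ n.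
    elim: n => [|n IHn]; first by rewrite mul0r subr0 expr0.
    rewrite exprS; apply: (@le_trans _ _ (rho * (1 - n%:R * (c / q%:R)))); last first.
      by rewrite ler_wpM2l// ltW.
    have : 0 <= n%:R * (c / q%:R) * (c / q%:R).
      by rewrite !mulr_ge0 ?invr_ge0 ?ler0n ?ltW.
    rewrite -natr1 /rho; move: (c / q%:R) => z.
    by move: (n%:R : R) => k ?; nra.
  by have := bern q; rewrite mulrCA divff ?gt_eqF// mulr1.
exists rho, ((U + 1) / rho ^+ q); split => //.
  by rewrite mulr_ge0 ?invr_ge0 ?exprn_ge0 ?(ltW rho0) ?addr_ge0.
move=> nu rnu l B l0 mB.
(* The remainder is taken between 1 and [q], because the initial upper bound needs at least one
   step. *)
have [k [r [r0 rq lE]]] : exists k r, [/\ (0 < r)%N, (r <= q)%N & l = (k * q + r)%N].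
  exists (l.-1 %/ q)%N, (l.-1 %% q).+1; split => //; first by rewrite ltn_mod.
  by rewrite addnS -divn_eq prednK.
rewrite lE; apply: (le_trans (main k nu rnu r B r0 mB)).
have V0 : 0 <= nu setT * pr m B by rewrite mulr_ge0 ?pr_ge0 ?(rg_ge0 rnu).
rewrite mulrA ler_wpM2r// -mulrA mulrC ler_wpM2l ?addr_ge0//.
apply: (@le_trans _ _ ((rho ^+ q) ^+ k)).
  by rewrite lerXn2r// ?nnegrE ?subr_ge0 ?exprn_ge0 ?ltW.
rewrite -exprM ler_pdivlMl ?exprn_gt0// -exprD mulnC.
by apply: ler_wiXn2l; [exact: ltW|exact: ltW|rewrite addnC leq_add2r].
Qed.

Lemma regular_cylinder nu w : regular a theta K0 nu ->
  regular a theta K0 (fun B => nu (cylinder a w `&` iter (size w) T @^-1` B)).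
Proof.
elim: w nu => [|i w IHw] nu rnu /=.
  rewrite (_ : (fun B => _) = nu)//; apply/funext => B; congr nu.
  by rewrite setTI; apply/seteqP; split.
have := IHw _ (le_regular_cst regular_cst.2 (regular_branch i K0_ge0 rnu)).
rewrite [X in regular _ _ _ X](_ : _ =
  fun B => nu (a i `&` T @^-1` cylinder a w `&` iter (size w).+1 T @^-1` B))//.
apply/funext => B; congr nu; rewrite -setIA; congr (_ `&` _).
by apply/seteqP; split => x /=; rewrite -iterS iterSr.
Qed.

Let cylinderS i j w B : cylinder a (i :: j :: w) `&` iter (size w).+2 T @^-1` B =
  a i `&` T @^-1` (cylinder a (j :: w) `&` iter (size w).+1 T @^-1` B).
Proof.
rewrite [LHS]/= -setIA; congr (_ `&` _).
by apply/seteqP; split => x /=; rewrite -!iterS !iterSr.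
Qed.

Let regular_step i nu : regular a theta K0 nu ->
  regular a theta K0 (fun B => nu (a i `&` T @^-1` B)).
Proof. by move=> rnu; exact: le_regular_cst regular_cst.2 (regular_branch i K0_ge0 rnu). Qed.

Lemma cylinder_upper : exists2 c, 0 <= c & forall w i nu B,
  regular a theta K0 nu -> measurable B ->
  nu (cylinder a (i :: w) `&` iter (size w).+1 T @^-1` B) <=
  c * (nu (cylinder a (i :: w)) * pr m B).
Proof.
have [c c0 cP] := regular_branch_upper K0; exists c => //.
elim=> [|j w IHw] i nu B rnu mB.
  by rewrite /= preimage_setT setIT; exact: cP.
by rewrite cylinderS; exact: (IHw j _ B (regular_step i rnu) mB).
Qed.

Let cylinder_lower_regular : exists2 c, 0 < c & forall w i nu B,
  regular a theta K0 nu -> measurable B ->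
  c * (nu (cylinder a (i :: w)) * pr m (b (last i w) `&` B)) <=
  nu (cylinder a (i :: w) `&` iter (size w).+1 T @^-1` B).
Proof.
have [c c0 cP] := regular_branch_lower K0; exists c => //.
elim=> [|j w IHw] i nu B rnu mB.
  by rewrite /= preimage_setT setIT; exact: cP.
by rewrite cylinderS; exact: (IHw j _ B (regular_step i rnu) mB).
Qed.

Lemma cylinder_lower : exists2 c, 0 < c & forall w i B, measurable B ->
  c * (pr m (cylinder a (i :: w)) * pr m (b (last i w) `&` B)) <=
  pr m (cylinder a (i :: w) `&` iter (size w).+1 T @^-1` B).
Proof.
have [c c0 cP] := cylinder_lower_regular; exists c => // w i B mB.
exact: (cP w i _ B (le_regular_cst K0_ge0 regular_pr) mB).
Qed.

Lemma cylinder_mixing : exists rho C', [/\ 0 < rho, rho < 1, 0 <= C' &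
  forall w l B, w <> [::] -> measurable B ->
  `|pr m (cylinder a w `&` iter (l + size w) T @^-1` B) -
    pr m (cylinder a w) * pr m B| <=
  C' * rho ^+ l * (pr m (cylinder a w) * pr m B)].
Proof.
have [rho [C' [rho0 rho1 C'0 H]]] := regular_mixing.
have [c c0 cP] := cylinder_upper.
have rpr := le_regular_cst K0_ge0 regular_pr.
exists rho, (C' + c + 1); split => //; first by rewrite !addr_ge0.
move=> w l B w0 mB.
have cB0 : 0 <= pr m (cylinder a w) * pr m B by rewrite mulr_ge0 ?pr_ge0.
(* With no delay nothing has mixed yet; the upper bound on cylinders supplies the constant. *)
case: l => [|l].
  rewrite expr0 mulr1 add0n; case: w w0 cB0 => // i w _ cB0.
  have := cP w i _ B rpr mB.
  have : 0 <= pr m (cylinder a (i :: w) `&` iter (size w).+1 T @^-1` B) by exact: pr_ge0.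
  move: cB0; rewrite [size (i :: w)]/=; move: (pr m (_ `&` _)) (_ * _) => x y *.
  by rewrite ler_norml; apply/andP; split; nra.
have := H _ (regular_cylinder w rpr) l.+1 B isT mB.
rewrite preimage_setT setIT.
rewrite (_ : iter (size w) T @^-1` (iter l.+1 T @^-1` B) = iter (l.+1 + size w) T @^-1` B); last first.
  by apply/seteqP; split => x /=; rewrite -iterS -iterD.
move=> /le_trans; apply; rewrite ler_wpM2r// ler_wpM2r ?exprn_ge0 ?(ltW rho0)//.
by rewrite -addrA ler_wpDr// addr_ge0.
Qed.

End model.
End markov_model.

(** * From Gibbs-Markov maps to the countable model *)

Section partition_enumeration.
Context d (S : measurableType d) (R : realType) (m : probability S R).
Variable alpha : set (set S).
Hypothesis palpha : partition_mod0 m alpha.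

Let alpha_measurable A : alpha A -> measurable A.
Proof. by case: palpha => + _ _ => /(_ A) H /H[]. Qed.

Let alpha_pos A : alpha A -> 0 < pr m A.
Proof.
move=> aA; case: palpha => + _ _ => /(_ A aA)[mA].
by rewrite pr_fin// lte_fin.
Qed.

Let alpha_disjoint A B : alpha A -> alpha B -> A <> B -> m.-negligible (A `&` B).
Proof. by case: palpha => _ + _; exact. Qed.

Let negligible_other A (s : seq (set S)) : alpha A -> A \notin s ->
  (forall B, B \in s -> alpha B) ->
  m.-negligible (A `&` \big[setU/set0]_(B <- s) B).
Proof.
move=> aA; elim: s => [_ _|B s IHs]; first by rewrite big_nil setI0; exact: negligible_set0.
rewrite inE negb_or => /andP[/eqP AB As] sal; rewrite big_cons setIUr.
apply: negligibleU; first by apply: alpha_disjoint => //; apply: sal; rewrite mem_head.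
by apply: IHs => // B' B's; apply: sal; rewrite inE B's orbT.
Qed.

Let sum_pr (s : seq (set S)) : uniq s -> (forall A, A \in s -> alpha A) ->
  \sum_(A <- s) pr m A <= pr m (\big[setU/set0]_(A <- s) A).
Proof.
elim: s => [_ _|A s IHs /= /andP[As us] sal]; first by rewrite !big_nil pr0.
have aA : alpha A by apply: sal; rewrite mem_head.
have {}sal B : B \in s -> alpha B by move=> Bs; apply: sal; rewrite inE Bs orbT.
have mA := alpha_measurable aA.
have mU : measurable (\big[setU/set0]_(B <- s) B).
  by rewrite big_seq; apply: bigsetU_measurable => B /sal; exact: alpha_measurable.
rewrite !big_cons; set U := \big[_/_]_(B <- s) B in mU *.
have nAU : pr m (A `&` U) = 0.
  by apply: pr_negligible; [exact: measurableI|exact: negligible_other].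
have := IHs us sal; rewrite -/U (prDI m mU mA) [U `&` A]setIC nAU addr0.
rewrite (prDI m (measurableU _ _ mA mU) mA).
rewrite (_ : (A `|` U) `\` A = U `\` A); last first.
  by apply/seteqP; split => x /=; [move=> [[]//]|move=> [? ?]; split => //; right].
rewrite (_ : (A `|` U) `&` A = A); last first.
  by apply/seteqP; split => x /=; [move=> [_ ?]|move=> ?; split => //; left].
by rewrite addrC lerD2r.
Qed.

(** In a probability space at most n almost disjoint sets have mass above 1/(n+1). *)
Lemma partition_mod0_countable : countable alpha.
Proof.
have -> : alpha = \bigcup_(n in setT) [set A | alpha A /\ n.+1%:R^-1 < pr m A].
  apply/seteqP; split=> [A aA|A [n _ []]//].
  have [n] := ltr_add_invr (alpha_pos aA); rewrite add0r => nA.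
  by exists n.
apply: bigcup_countable => // n _; apply: finite_set_countable.
apply: contrapT => /infinite_set_fset -/(_ n.+2)[B BA Bn].
have BP A : A \in finmap.enum_fset B -> alpha A /\ n.+1%:R^-1 < pr m A by move=> /BA.
have := sum_pr (finmap.fset_uniq B) (fun A AB => (BP A AB).1).
apply/negP; rewrite -ltNge.
have mU : measurable (\big[setU/set0]_(A <- finmap.enum_fset B) A).
  by rewrite big_seq; apply: bigsetU_measurable => A /BP[/alpha_measurable].
apply: (le_lt_trans (pr_le1 m mU)).
apply: (@lt_le_trans _ _ (\sum_(A <- finmap.enum_fset B) n.+1%:R^-1)).
  rewrite big_const_seq count_predT iter_addr_0 -[ltRHS]mulr_natr ltr_pdivlMl// mulr1.
  by rewrite ltr_nat.
by rewrite big_seq [leRHS]big_seq; apply: ler_sum => A /BP[_ /ltW].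
Qed.

Lemma partition_mod0_enum : exists (e : nat -> set S) (idx : set S -> nat),
  [/\ forall i, e i = set0 \/ alpha (e i),
      forall A, alpha A -> e (idx A) = A &
      forall i j, i <> j -> m.-negligible (e i `&` e j)].
Proof.
have /countable_injP[idx idx_inj] := partition_mod0_countable.
(* Integers that index no element of the partition receive the empty set. *)
pose e i := if pselect (exists A, alpha A /\ idx A = i) is left h
  then projT1 (cid h) else set0.
have eE A : alpha A -> e (idx A) = A.
  move=> aA; rewrite /e; case: pselect => [h|[]]; last by exists A.
  by case: (cid h) => /= B [aB BA]; apply: idx_inj => //; rewrite inE.
have eP i : e i = set0 \/ (alpha (e i) /\ idx (e i) = i).
  by rewrite /e; case: pselect => [h|_]; [right; case: (cid h)|left].
exists e, idx; split => // [i|i j ij].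
  by have [->|[]] := eP i; [left|right].
have [->|[ai Ii]] := eP i; first by rewrite set0I; exact: negligible_set0.
have [->|[aj Ij]] := eP j; first by rewrite setI0; exact: negligible_set0.
by apply: alpha_disjoint => // eij; apply: ij; rewrite -Ii -Ij eij.
Qed.

End partition_enumeration.

(** * The jacobian of one branch *)

Section branch_distortion.
Context {disp} {X : measurableType disp} {R : realType} (m : probability X R).
Variables (T : X -> X) (A : set X).
Hypothesis mpT : measure_preserving m T.
Hypothesis Ta : invertible_on m T A.

Let mA : measurable A. Proof. by case: Ta. Qed.
Let mu := image_measure Ta.
Let nu := charge_of_finite_measure
  (mfrestr (invertible_on_measurable Ta) (invertible_on_lty Ta)).
Let g := fine \o inv_jacobian Ta.

Let muE B : mu B = m (T @` (B `&` A)). Proof. by []. Qed.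
Let nuE B : nu B = m (B `&` A). Proof. by []. Qed.

Let mTB B : measurable B -> measurable (T @` (B `&` A)).
Proof. by move=> mB; case: Ta => _ _ + _; apply => //; exact: measurableI. Qed.

(** A set lies in the preimage of its image and [T] preserves [m], so a null image forces a null
    set. *)
Let nu_mu : nu `<< image_measure Ta.
Proof.
apply/null_content_dominatesP => B mB TB0'.
have TB0 : m (T @` (B `&` A)) = 0%E by exact: TB0'.
change (m (B `&` A) = 0%E).
have : m (T @^-1` (T @` (B `&` A))) = 0%E by case: mpT => _ ->//; exact: mTB.
apply: subset_measure0; [exact: measurableI|by apply: (mp_preimage mpT); exact: mTB|].
by move=> x BAx; exists x.
Qed.

Let g_integrable : (image_measure Ta).-integrable setT (EFin \o g).
Proof.
apply: eq_integrable (Radon_Nikodym_integrable nu_mu) => // x _.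
by rewrite [RHS]/= /inv_jacobian fineK//; exact: Radon_Nikodym_fin_num.
Qed.

Let g_integral B : measurable B ->
  (\int[image_measure Ta]_(x in B) (g x)%:E)%E = m (B `&` A).
Proof.
move=> mB; transitivity (\int[image_measure Ta]_(x in B) inv_jacobian Ta x)%E.
  by apply: eq_integral => x _; rewrite /g /= fineK//; exact: Radon_Nikodym_fin_num.
exact/esym/(Radon_Nikodym_integral nu_mu mB).
Qed.

Let mg : measurable_fun setT g.
Proof. by apply/measurable_EFinP; case/integrableP: g_integrable. Qed.

(** Null subsets of [A] have null images; this nonsingularity is part of [invertible_on]. *)
Let ae_mu (P : X -> Prop) : (\forall x \ae m, A x -> P x) ->
  \forall x \ae (image_measure Ta), A x -> P x.
Proof.
move=> [N [mN N0 PN]]; exists N; split => //.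
rewrite -/mu muE; apply: measure_negligible; first exact: mTB.
case: Ta => _ _ _; apply; first exact: subIsetr.
by exists N; split => // x [].
Qed.

(** The mass of the part of [A] where [g <= 0] is the integral of [g] over it against the image
    measure, hence at most 0. *)
Lemma inv_jacobian_gt0 : \forall x \ae m, A x -> 0 < g x.
Proof.
pose N := A `&` [set x | g x <= 0].
have mN : measurable N.
  apply: measurableI => //.
  rewrite (_ : [set x | _] = g @^-1` `]-oo, 0]); last first.
    by apply/seteqP; split => x /=; rewrite in_itv.
  by rewrite -[X in measurable X]setTI; exact: mg.
exists N; split => //.
- have : m N = (\int[image_measure Ta]_(x in N) (g x)%:E)%E.
    by rewrite g_integral//; congr (m _); rewrite /N setIAC setIid.
  move=> Ni; apply/eqP; rewrite -measure_le0; apply: (le_trans (y := (\int[image_measure Ta]_(x in N) (g x)%:E)%E)).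
    by rewrite -Ni.
  rewrite -(integral0 (image_measure Ta) N).
  apply: le_integral => //; [by apply: integrableS g_integrable|exact: integrable0|].
  by move=> x /set_mem[_] /=; rewrite lee_fin.
- by move=> x /= /not_implyP[Ax] /negP; rewrite -leNgt.
Qed.

(** The pointwise inequality is integrated in [y] over [F], then in [x] over [E], against the image
    measure: the integral of [g] over a set is its mass under [m], and the integral of 1 is the mass
    of its image. *)
Lemma branch_ratio (kappa : R) E F : measurable E -> measurable F ->
  E `<=` A -> F `<=` A ->
  (\forall x \ae m, \forall y \ae m, E x -> F y -> g x <= kappa * g y) ->
  pr m E * pr m (T @` F) <= kappa * (pr m (T @` E) * pr m F).
Proof.
move=> mE mF EA FA H.
have muf B : measurable B -> B `<=` A -> image_measure Ta B = (pr m (T @` B))%:E.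
  move=> mB BA; rewrite -/mu muE -pr_fin; last first.
    by rewrite -(setIidl BA); exact: mTB.
  by rewrite setIidl.
have gi B : measurable B -> (image_measure Ta).-integrable B (EFin \o g).
  by move=> mB; apply: integrableS g_integrable.
have gB B : measurable B -> B `<=` A ->
    (\int[image_measure Ta]_(x in B) (g x)%:E)%E = (pr m B)%:E.
  by move=> mB BA; rewrite g_integral// setIidl// pr_fin.
have le_int B (u v : X -> R) : measurable B -> B `<=` A ->
    (image_measure Ta).-integrable B (EFin \o u) ->
    (image_measure Ta).-integrable B (EFin \o v) ->
    (\forall x \ae m, B x -> u x <= v x) ->
    (\int[image_measure Ta]_(x in B) (u x)%:E <= \int[image_measure Ta]_(x in B) (v x)%:E)%E.
  move=> mB BA iu iv uv.
  have : (0 <= \int[image_measure Ta]_(x in B) ((v x)%:E - (u x)%:E))%E.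
    (* The maximum with 0 is nonnegative everywhere and agrees with the difference almost
       everywhere. *)
    rewrite (ae_eq_integral (fun x => (Num.max (v x - u x) 0)%:E))//.
    - by apply: integral_ge0 => x _; rewrite lee_fin le_max lexx orbT.
    - apply: emeasurable_funB.
      + by case/integrableP: iv.
      + by case/integrableP: iu.
    - apply/measurable_EFinP; apply: measurable_maxr => //.
      apply: measurable_funB; apply/measurable_EFinP.
      + by case/integrableP: iv.
      + by case/integrableP: iu.
    - have /ae_mu : \forall x \ae m, A x -> B x -> u x <= v x.
        by apply: filterS uv => x + _.
      apply: filterS => x + Bx => /(_ (BA _ Bx) Bx) uvx.
      by rewrite -EFinB; congr EFin; rewrite max_l// subr_ge0.
  by rewrite (integralB_EFin mB iv iu) sube_ge0// (integrable_fin_num mB iu).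
have cst_i B (c : R) : measurable B -> (image_measure Ta).-integrable B (EFin \o cst c).
  by move=> mB; exact: finite_measure_integrable_cst.
have H1 : \forall x \ae m, E x -> g x * pr m (T @` F) <= kappa * pr m F.
  apply: filterS H => x Hx Ex.
  rewrite -lee_fin !EFinM -(muf F)// -(gB F)// -(integral_cst (image_measure Ta) mF)//=.
  rewrite -integralZl//; last exact: gi.
  under [leRHS]eq_integral do rewrite -EFinM.
  apply: le_int => //; first exact: cst_i.
    rewrite (_ : _ \o _ = fun y => kappa%:E * (EFin \o g) y)%E; last by apply/funext.
    by apply: integrableZl => //; exact: gi.
  by apply: filterS Hx => y + Fy => /(_ Ex Fy).
rewrite -lee_fin !EFinM -(gB E)// -(muf E)// muleCA.
rewrite [X in (X <= _)%E]muleC -integralZl//; last exact: gi.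
rewrite -EFinM muleC -(integral_cst (image_measure Ta) mE)//.
under eq_integral do rewrite -EFinM.
apply: le_int => //.
- rewrite (_ : _ \o _ = fun y => (pr m (T @` F))%:E * (EFin \o g) y)%E; last by apply/funext.
  by apply: integrableZl => //; exact: gi.
- exact: cst_i.
- by apply: filterS H1 => x + Ex => /(_ Ex); rewrite mulrC.
Qed.

End branch_distortion.

(** * Construction of the model *)

Section gibbs_markov_model.
Context {R : realType} {disp} {X : metricMeasurableType R disp}.
Variables (m : probability X R) (T : X -> X) (alpha : set (set X)).
Hypothesis GM : gibbs_markov m T alpha.
Hypothesis mix : gm_mixing m T alpha.

Let mpT := gm_preserving GM.

Lemma gibbs_markov_model : exists a b s theta C M0 (e : nat -> set X) (idx : set X -> nat),
  [/\ markov_model m T a b s theta C,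
      0 <= M0 /\ (forall w, \forall x \ae m, \forall y \ae m,
        cylinder T a w x -> cylinder T a w y -> mdist x y <= M0 * theta ^+ size w),
      forall i, e i = set0 \/ alpha (e i),
      forall A, alpha A -> e (idx A) = A &
      forall i, a i `<=` e i /\ pr m (e i) = pr m (a i) ].
Proof.
(* The elements are made disjoint by removing the earlier ones, which changes each of them by a null
   set. The images [b i] are those of the trimmed sets, so that [a i] maps into [b i] at every
   point. *)
have [e [idx [eP eI eD]]] := partition_mod0_enum (gm_partition GM).
pose a := seqDU e; pose b i := T @` a i.
have [alP _ alC] := gm_partition GM.
have me i : measurable (e i) by have [->//|/alP[]] := eP i.
have ma i : measurable (a i) by exact: seqDU_measurable.
have ae i : a i `<=` e i by exact: subset_seqDU.
have nea i : m.-negligible (e i `\` a i).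
  apply: (@negligibleS _ _ _ _ (\big[setU/set0]_(k < i) (e i `&` e k))).
    move=> x [ex ax]; have : (\big[setU/set0]_(k < i) e k) x.
      by apply: contrapT => U; apply: ax.
    rewrite -(bigcup_mkord i e) -(bigcup_mkord i (fun k => e i `&` e k)) => -[k ki ek].
    by exists k.
  rewrite -(big_mkord xpredT (fun k => e i `&` e k)) big_nat big_seq_cond.
  apply: negligible_bigsetU => k.
  rewrite mem_index_iota andbb => /andP[_ ki].
  by apply: eD => /esym ik; move: ki; rewrite ik ltnn.
have pea i : pr m (e i) = pr m (a i).
  rewrite (prDI m (me i) (ma i)) (pr_negligible _ (nea i)) ?add0r; last exact: measurableD.
  by congr (pr m _); rewrite setIC; exact: setIidl.
have a0 i : e i = set0 -> a i = set0.
  by move=> e0; apply/seteqP; split => // x /ae; rewrite e0.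
have Te i : alpha (e i) -> invertible_on m T (e i) by move=> /(gm_markov GM)[].
have mb i : measurable (b i).
  have [/a0|/Te [_ _ + _]] := eP i; last by apply.
  by rewrite /b => ->; rewrite image_set0.
have nTea i : m.-negligible (T @` e i `\` b i).
  have [e0|/Te [_ _ _ null]] := eP i.
    by rewrite e0 image_set0 set0D; exact: negligible_set0.
  apply: (@negligibleS _ _ _ _ (T @` (e i `\` a i))).
    move=> _ [[x ex <-] bx]; exists x => //; split => // ax; apply: bx.
    by exists x.
  by apply: null; [exact: subDsetl|exact: nea].
have Acase i : 0 < pr m (a i) -> alpha (e i).
  by have [/a0 ->|//] := eP i; rewrite pr0 ltxx.
have cover : pr m (~` \bigcup_i a i) = 0.
  apply: pr_negligible; first by apply: measurableC; exact: bigcup_measurable.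
  apply: negligibleS alC => x; rewrite -seqDU_bigcup_eq => ex [A aA Ax]; apply: ex.
  by exists (idx A) => //; rewrite eI.
have markov i j : pr m (a j `\` b i) = 0 \/ pr m (a j `&` b i) = 0.
  have [/a0 aj0|aj] := eP j; first by left; rewrite aj0 set0D pr0.
  have [/a0 ai0|ai] := eP i; first by right; rewrite /b ai0 image_set0 setI0 pr0.
  have [_ [beta betaal /= eqb]] := gm_markov GM ai.
  have [ejb|ejb] := pselect (beta (e j)); [left|right]; apply: pr_negligible.
  - exact: measurableD.
  - apply: negligibleS (negligibleU eqb (nTea i)) => x [ax bx].
    have [Tx|Tx] := pselect ((T @` e i) x); [right|left] => //.
    by right; split => //; exists (e j) => //; exact: ae.
  - exact: measurableI.
  - have nn : m.-negligible (\bigcup_k (if `[< beta (e k) >] then e j `&` e k else set0)).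
      apply: negligible_bigcup => k; case: asboolP => [bk|_]; last exact: negligible_set0.
      by apply: eD => jk; apply: ejb; rewrite jk.
    apply: negligibleS (negligibleU eqb nn) => x [ax [z az zx]].
    have [[B bB Bx]|nB] := pselect ((\bigcup_(B in beta) B) x).
      right; exists (idx B) => //; rewrite eI; last exact: betaal.
      by rewrite asboolT//; split => //; exact: ae.
    by left; left; split => //; exists z => //; exact: ae.
have [F [finF Fal Fimg]] := gm_big_image_preimage GM.
have [sF FE] := (finite_seqP F).1 finF.
pose s := map idx sF.
have inF A : F A -> A \in sF by rewrite FE.
have [gamma [/andP[g0 g1] expa]] := gm_expansion GM.
have [M1 M1P] := gm_bounded GM.
pose M0 := Num.max M1 0.
(* Expansion read backwards: after [size w] steps two points of the cylinder are still at distance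
   at most [M0]. *)
have geo w : \forall x \ae m, \forall y \ae m,
    cylinder T a w x -> cylinder T a w y -> mdist x y <= M0 * gamma ^+ size w.
  elim: w => [|i w IHw].
    by apply: aeW => x; apply: aeW => y _ _; rewrite mulr1 le_max M1P.
  have [/a0 ai0|ai] := eP i.
    by apply: aeW => x; apply: aeW => y [] /=; rewrite ai0.
  have := ae_preimage mpT IHw; apply: filterS2 (expa _ ai) => x ex cx.
  have := ae_preimage mpT cx; apply: filterS2 ex => y ey cy /= [ax Tx] [ay Ty].
  have := ey (ae _ _ ax) (ae _ _ ay); rewrite ler_pdivrMl// => /le_trans; apply.
  by rewrite exprS mulrCA ler_wpM2l ?(ltW g0)//; exact: cy.
have [C CP] := gm_distortion GM.
(* [1 - g x / g y] is bounded by [C] times the distance of the images, itself at most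
   [M0 * gamma ^+ size w]; then [1 + z <= expR z]. *)
pose C0 := Num.max C 0 * M0.
have C00 : 0 <= C0 by rewrite mulr_ge0// le_max lexx orbT.
have dist i w E F' : measurable E -> measurable F' ->
    E `<=` cylinder T a w -> F' `<=` cylinder T a w ->
    pr m (a i `&` T @^-1` E) * pr m (b i `&` F') <=
    expR (C0 * gamma ^+ size w) * (pr m (b i `&` E) * pr m (a i `&` T @^-1` F')).
  move=> mE mF' Ew Fw; have [/a0 ai0|ai] := eP i.
    by rewrite /b ai0 image_set0 !set0I pr0 !mul0r mulr0.
  have [Ta dTa] := CP _ ai.
  have Tim B : T @` (a i `&` T @^-1` B) = b i `&` B.
    by apply/seteqP; split=> [_ [x [ax Bx] <-]|_ [[x ax <-] Bx]]; [split => //|]; exists x.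
  have maB B : measurable B -> measurable (a i `&` T @^-1` B).
    by move=> mB; apply: measurableI => //; exact: mp_preimage mpT _ mB.
  have aiB B : a i `&` T @^-1` B `<=` e i by move=> x [/ae].
  rewrite -!Tim; apply: (branch_ratio mpT (maB _ mE) (maB _ mF') (aiB _) (aiB _)).
  set g := _ \o _ in dTa *.
  have gx := inv_jacobian_gt0 mpT Ta.
  have := ae_preimage mpT (geo w); apply: filterS2 dTa => x dx cx.
  have := ae_preimage mpT cx; apply: filterS3 dx gx => y dy gy cy [ax Ex] [ay Fy].
  have gy0 := gy (ae _ _ ay).
  have := dy (ae _ _ ax) (ae _ _ ay); rewrite -/(g x) -/(g y).
  rewrite distrC ler_distl => /andP[_].
  have : C * mdist (T x) (T y) <= C0 * gamma ^+ size w.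
    have dT := cy (Ew _ Ex) (Fw _ Fy).
    apply: (@le_trans _ _ (Num.max C 0 * mdist (T x) (T y))).
      by rewrite ler_wpM2r ?mdist_ge0// le_max lexx.
    by rewrite -mulrA ler_wpM2l// le_max lexx orbT.
  move=> h1 h2; have : g x / g y <= 1 + C0 * gamma ^+ size w by lra.
  move=> /le_trans/(_ (expR_ge1Dx _)).
  by rewrite ler_pdivrMr.
exists a, b, s, gamma, C0, M0, e, idx; split => //; last first.
  by split => //; rewrite le_max lexx orbT.
split => //.
- by rewrite g0.
- exact: trivIset_seqDU.
- by move=> i x ax; exists x.
- move=> i /mapP[A As ->]; have aA : alpha A by apply: Fal; rewrite FE.
  by rewrite -pea eI//; have [mA] := alP _ aA; rewrite pr_fin// lte_fin.
- move=> i /Acase ai; have [_ [B FB sB]] := Fimg _ ai.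
  exists (idx B); first by apply/mapP; exists B => //; exact: inF.
  apply: pr_negligible; first exact: measurableD.
  apply: negligibleS (negligibleU sB (nTea i)) => x [/ae + bx].
  rewrite eI; last exact: Fal.
  move=> Bx.
  by have [Tx|Tx] := pselect ((T @` e i) x); [right|left].
- move=> i /Acase ai; have [[B FB sB] _] := Fimg _ ai.
  exists (idx B); first by apply/mapP; exists B => //; exact: inF.
  apply: pr_negligible; first exact: measurableD.
  have nB := nTea (idx B); rewrite eI in nB; last exact: Fal.
  apply: negligibleS (negligibleU sB nB) => x [/ae ex bx].
  by have [Tx|Tx] := pselect ((T @` B) x); [right|left].
(* If the intersection were null, then after its removal from [e i], together with the trimmed part,
   the image under [iter n T] would miss [a j]. Mixing allows the removal of any null set and
   forbids this. *)
- move=> i j ai0 aj0; have [N NP] := mix (Acase _ ai0) (Acase _ aj0).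
  exists N => n Nn; rewrite lt_neqAle eq_sym pr_ge0 andbT; apply/eqP => n0.
  have mn : measurable (a i `&` iter n T @^-1` a j).
    apply: measurableI => //.
    exact: mp_preimage (measure_preserving_iter mpT n) _ (ma j).
  have nZ := negligibleU (nea i) (pr_eq0_negligible mn n0).
  have H := NP n Nn _ nZ.
  have : pr m (a j) = 0; last by move=> aj; move: aj0; rewrite aj ltxx.
  apply: pr_negligible => //; apply: negligibleS H => x ax.
  split; first exact: ae.
  move=> [z [ez Zz] zx]; apply: Zz.
  have [az|az] := pselect (a i z); last by left.
  by right; split => //=; rewrite /preimage/= zx.
Qed.

End gibbs_markov_model.

(** * Decay of correlations *)

(** For a lag [k] split at p + 1: both the length of the cylinders and the time left for mixing are
    about k/2. *)
Lemma uphalf_bounds k p : uphalf k = p.+1 ->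
  [/\ (p < k)%N, (k <= p * 2 + 2)%N & (k <= (k - p.+1) * 2 + 2)%N].
Proof. by move=> kp; split; lia. Qed.

(** * From bounds on sets to bounds on functions *)

Section measure_domination.
Context d (S : measurableType d) (R : realType) (m : probability S R).
Import HBNNSimple.

(* A bound between the measures [B |-> m (A `&` U @^-1` B)] and [c * m], tested
   on sets, passes to nonnegative functions. *)
Lemma Ex_dominated (U : S -> S) (A : set S) (c : R) (v : S -> R) :
  measure_preserving m U -> measurable A ->
  (forall B, measurable B -> pr m (A `&` U @^-1` B) <= c * pr m B) ->
  integ m v -> (forall x, 0 <= v x) ->
  Ex m (fun x => \1_A x * v (U x)) <= c * Ex m v.
Proof.
move=> mpU mA H iv v0.
have mv : measurable_fun setT (EFin \o v) by apply/measurable_EFinP; exact: integ_measurable iv.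
pose h n : S -> R := nnsfun_approx measurableT mv n.
have h0 n x : 0 <= h n x by rewrite /h.
have mh n : measurable_fun setT (h n) by rewrite /h.
have hv n x : h n x <= v x.
  rewrite -lee_fin /h nnsfun_approxE; apply: (@le_approx _ _ _ setT (EFin \o v)) => //.
  by move=> y _; rewrite lee_fin.
have hcvg x : h ^~ x @ \oo --> v x.
  have := @cvg_nnsfun_approx _ _ _ setT measurableT (EFin \o v) mv (fun y _ => v0 y) x I.
  by move=> /fine_cvgP[_].
have ih n : integ m (h n).
  by apply: (integ_le (mh n) _ iv) => x; rewrite ger0_norm.
have ind01 x : 0 <= (\1_A x : R) <= 1 by rewrite indicE; case: (_ \in _); rewrite /= ?lexx ?ler01.
have step n : Ex m (fun x => \1_A x * h n (U x)) <= c * Ex m (h n).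
  pose s := finmap.enum_fset (fset_set (range (h n))).
  have hE x : h n x = \sum_(y <- s) y * \1_(h n @^-1` [set y]) x.
    rewrite /h fimfunE fsbig_finite//=.
  have mB y : measurable (h n @^-1` [set y]) by rewrite /h; exact: measurable_sfunP.
  have mUB y : measurable (U @^-1` (h n @^-1` [set y])) by exact: (mp_preimage mpU).
  have s0 y : y \in s -> 0 <= y.
    rewrite /s in_fset_set; last exact: fimfunP.
    by rewrite inE => -[x _ <-].
  have -> : (fun x => \1_A x * h n (U x)) =
      fun x => \sum_(0 <= i < size s) (s`_i * \1_(A `&` U @^-1` (h n @^-1` [set s`_i])) x).
    apply/funext => x; rewrite hE (big_nth 0) big_distrr/=; apply: eq_bigr => i _.
    by rewrite mulrCA indicI.
  have -> : Ex m (h n) = Ex m (fun x => \sum_(0 <= i < size s) (s`_i * \1_(h n @^-1` [set s`_i]) x)).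
    by congr (Ex m _); apply/funext => x; rewrite [LHS]hE (big_nth 0).
  rewrite !Ex_sum => [|i|i]; last 2 first.
  - by apply: integZ; exact: integ_indic.
  - by apply: integZ; apply: integ_indic; exact: measurableI.
  rewrite mulr_sumr big_seq_cond [leRHS]big_seq_cond; apply: ler_sum => i.
  rewrite andbT mem_index_iota => /andP[_ si].
  rewrite !ExZ ?Ex_indic//; [|exact: measurableI|exact: integ_indic|].
    by rewrite mulrCA ler_wpM2l ?s0 ?mem_nth//; exact: H.
  by apply: integ_indic; exact: measurableI.
have c1 : (fun n => Ex m (fun x => \1_A x * h n (U x))) @ \oo --> Ex m (fun x => \1_A x * v (U x)).
  apply: (@cvg_Ex _ _ _ _ _ _ (fun x => v (U x))).
  - move=> n; apply: measurable_funM; first exact: measurable_indic.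
    exact: measurableT_comp (mh n) (mp_measurable mpU).
  - apply: measurable_funM; first exact: measurable_indic.
    exact: measurableT_comp (integ_measurable iv) (mp_measurable mpU).
  - exact: integ_comp.
  - move=> n x; rewrite ger0_norm; last by rewrite mulr_ge0 ?h0//; case/andP: (ind01 x).
    have /andP[a0 a1] := ind01 x.
    by apply: (le_trans _ (hv n (U x))); rewrite ler_piMl.
  - by move=> x; apply: cvgMr; exact: hcvg.
have c2 : (fun n => c * Ex m (h n)) @ \oo --> c * Ex m v.
  apply: cvgMr; apply: (@cvg_Ex _ _ _ _ _ _ v) => //; first exact: integ_measurable iv.
  by move=> n x; rewrite ger0_norm.
by apply: (ler_cvg_to c1 c2); apply: nearW.
Qed.

(** Domination bounds an integral from above; applied to the complement of [A], it bounds the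
    integral over [A] from below. The positive and negative parts of [v] are treated separately. *)
Lemma Ex_mixing (U : S -> S) (A : set S) (eps : R) (v : S -> R) :
  measure_preserving m U -> measurable A ->
  (forall B, measurable B ->
    `|pr m (A `&` U @^-1` B) - pr m A * pr m B| <= eps * (pr m A * pr m B)) ->
  integ m v ->
  `|Ex m (fun x => \1_A x * v (U x)) - pr m A * Ex m v| <=
  eps * (pr m A * Ex m (fun x => `|v x|)).
Proof.
move=> mpU mA H iv; have mv := integ_measurable iv.
pose vp x := Num.max (v x) 0; pose vn x := Num.max (- v x) 0.
have vE x : v x = vp x - vn x.
  by rewrite /vp /vn; case: (leP (v x) 0); case: (leP (- v x) 0); lra.
have vaE x : `|v x| = vp x + vn x.
  rewrite /vp /vn; have [h|h] := boolP (0 <= v x).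
    by rewrite ger0_norm// max_l// max_r ?oppr_le0// addr0.
  have {}h : v x < 0 by rewrite ltNge.
  by rewrite ltr0_norm// max_r 1?ltW// max_l ?oppr_ge0 1?ltW// add0r.
have ivp : integ m vp.
  apply: (integ_le _ _ (integ_norm iv)); first exact: measurable_maxr.
  by move=> x; rewrite /vp; case: (leP (v x) 0) => // _; rewrite normr0.
have ivn : integ m vn.
  apply: (integ_le _ _ (integ_norm iv)); first by apply: measurable_maxr => //; exact: measurable_funN.
  by move=> x; rewrite /vn; case: (leP (- v x) 0) => _; rewrite ?normr0// normrN.
have vp0 x : 0 <= vp x by rewrite /vp le_max lexx orbT.
have vn0 x : 0 <= vn x by rewrite /vn le_max lexx orbT.
have mUB B : measurable B -> measurable (U @^-1` B) by move=> mB; exact: (mp_preimage mpU).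
have pAU B : measurable B -> pr m (A `&` U @^-1` B) + pr m (~` A `&` U @^-1` B) = pr m B.
  move=> mB; rewrite -(pr_preimage mpU mB) [RHS](prDI m (mUB _ mB) mA) addrC.
  by congr (pr m _ + pr m _); rewrite ?setDE setIC.
have key w : integ m w -> (forall x, 0 <= w x) ->
    `|Ex m (fun x => \1_A x * w (U x)) - pr m A * Ex m w| <= eps * (pr m A * Ex m w).
  move=> iw w0; rewrite ler_distl; apply/andP; split.
    have : Ex m (fun x => \1_(~` A) x * w (U x)) <= (1 - pr m A + eps * pr m A) * Ex m w.
      apply: Ex_dominated => //; first exact: measurableC.
      move=> B mB; have := H B mB; rewrite ler_distl => /andP[h _].
      by have := pAU B mB; move: h; nra.
    have iwU := integ_comp mpU iw.
    have -> : (fun x => \1_(~` A) x * w (U x)) = fun x => w (U x) - \1_A x * w (U x).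
      apply/funext => x; rewrite !indicE in_setC; case: (_ \in _) => /=; ring.
    rewrite ExB//; last exact: integ_indicM.
    by rewrite (Ex_comp mpU (integ_measurable iw)); lra.
  have : Ex m (fun x => \1_A x * w (U x)) <= (pr m A + eps * pr m A) * Ex m w.
    apply: Ex_dominated => // B mB; have := H B mB; rewrite ler_distl => /andP[_ h].
    by move: h; lra.
  by lra.
have -> : (fun x => `|v x|) = fun x => vp x + vn x by apply/funext.
have -> : (fun x => \1_A x * v (U x)) = fun x => \1_A x * vp (U x) - \1_A x * vn (U x).
  by apply/funext => x; rewrite vE mulrBr.
have -> : Ex m v = Ex m vp - Ex m vn.
  by rewrite -ExB//; congr (Ex m _); apply/funext.
have iA w : integ m w -> integ m (fun x => \1_A x * w (U x)).
  by move=> iw; apply: integ_indicM => //; exact: integ_comp.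
rewrite ExB ?ExD//; [|exact: iA|exact: iA].
have := key _ ivp vp0; have := key _ ivn vn0.
rewrite !ler_distl => /andP[h1 h2] /andP[h3 h4]; apply/andP; split; lra.
Qed.

End measure_domination.

(** * Covariances in the Markov model *)

Section decorrelation.
Context d (S : measurableType d) (R : realType) (m : probability S R).
Variables (T : S -> S) (a b : nat -> set S) (s : seq nat) (theta C : R).
Hypothesis M : markov_model m T a b s theta C.

Let mpT := mm_mp M.
Let ma := mm_a M.
Let theta_gt0 : 0 < theta. Proof. by case/andP: (mm_theta M). Qed.
Let theta_lt1 : theta < 1. Proof. by case/andP: (mm_theta M). Qed.
Let mTn n A : measurable A -> measurable (iter n T @^-1` A).
Proof. exact: (mp_preimage (measure_preserving_iter mpT n)). Qed.
Let mcyl w : measurable (cylinder T a w).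
Proof. exact: (measurable_cylinder M). Qed.

Lemma cylinder_eq_size w w' : size w = size w' ->
  (cylinder T a w `&` cylinder T a w') !=set0 -> w = w'.
Proof.
elim: w w' => [|i w IHw] [|j w']//= [ww'] [x [[ax Tx] [ax' Tx']]].
rewrite (mm_triv M (i := i) (j := j))//; last by exists x.
by rewrite (IHw w')//; exists (T x).
Qed.

Lemma cylinder_cover n : pr m (~` \bigcup_(w in [set w | size w = n]) cylinder T a w) = 0.
Proof.
have nC := pr_eq0_negligible _ (mm_cover M).
have {}nC : m.-negligible (~` \bigcup_i a i).
  by apply: nC; apply: measurableC; exact: bigcup_measurable.
have H : \forall x \ae m, exists2 w, size w = n & cylinder T a w x.
  elim: n => [|n IHn]; first by apply: aeW => x; exists [::].
  have aC : \forall x \ae m, exists i, a i x.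
    apply: negligibleS nC => x/= nx [i _ ax]; apply: nx; exists i => //.
  by apply: filterS2 aC (ae_preimage mpT IHn) => x [i ax] [w <- Tw]; exists (i :: w).
have mU : measurable (\bigcup_(w in [set w | size w = n]) cylinder T a w).
  exact: (measurable_cylinder_bigcup M).
apply: pr_negligible; first exact: measurableC.
by apply: negligibleS H => x /= nx [w wn wx]; apply: nx; exists w.
Qed.

Let symbols (Q : nat -> Prop) := \bigcup_(i in Q) a i.

Let msymbols Q : measurable (symbols Q).
Proof. exact: bigcup_measurable. Qed.

Lemma symbols_upper : exists2 c, 0 <= c & forall (Q : nat -> Prop) k B, (0 < k)%N ->
  measurable B ->
  pr m ((\bigcup_(i in Q) a i) `&` iter k T @^-1` B) <=
  c * (pr m (\bigcup_(i in Q) a i) * pr m B).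
Proof.
have [c c0 cP] := branch_upper M; exists c => // Q [//|k] B _ mB.
have mB' := mTn k mB.
have mkB := mTn k.+1 mB.
have r0 := regular_pr m T a theta.
have s1 := regular_split M r0 (measurableI _ _ (msymbols Q) mkB).
have s2 := regular_split M r0 (msymbols Q).
rewrite mulrC mulrAC -mulrA mulrC.
apply: (ler_series_lim s1 (cvg_seriesZ (c := c * pr m B) s2)) => i.
have [Qi|Qi] := pselect (Q i); last first.
  rewrite (_ : a i `&` _ = set0) ?pr0 ?mulr_ge0 ?pr_ge0//.
  apply/seteqP; split => // x [ax [[j Qj aj] _]]; apply: Qi.
  by rewrite (mm_triv M (i := i) (j := j))//; exists x.
have aQ : a i `<=` symbols Q by move=> x ax; exists i.
rewrite setIA !(setIidl aQ).
rewrite (_ : iter k.+1 T @^-1` B = T @^-1` (iter k T @^-1` B)); last first.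
  by apply/seteqP; split => x /=; rewrite -iterS iterSr.
apply: (le_trans (cP i _ mB')); rewrite (pr_preimage (measure_preserving_iter mpT k))//.
by rewrite -mulrA ler_wpM2l// mulrC.
Qed.

(** After at least one step, a union of symbols and [v \o T^k] are independent up to a constant
    factor; Cauchy-Schwarz then produces the square root of the mass of the union. *)
Lemma Ex_symbols_bound : exists2 c, 0 <= c & forall (Q : nat -> Prop) k u v, (0 < k)%N ->
  sq_integ m u -> sq_integ m v ->
  Ex m (fun x => \1_(\bigcup_(i in Q) a i) x * (`|u x| * `|v (iter k T x)|)) <=
  c * (norm2 m u * Num.sqrt (pr m (\bigcup_(i in Q) a i)) * norm2 m v).
Proof.
have [c c0 cP] := symbols_upper; exists (Num.sqrt c); first exact: sqrtr_ge0.
move=> Q k u v k0 L2u L2v; set A := \bigcup_(i in Q) a i.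
have mA : measurable A := msymbols Q.
have mpk := measure_preserving_iter mpT k.
have L2vk : sq_integ m (fun x => `|v (iter k T x)|).
  by apply: sq_integ_norm; exact: (sq_integ_comp mpk).
have L2Av := sq_integ_indicM mA L2vk.
have := Cauchy_Schwarz_Ex (sq_integ_norm L2u) L2Av.
rewrite norm2_normr (_ : (fun x => `|u x| * _) =
  fun x => \1_A x * (`|u x| * `|v (iter k T x)|)); last by apply/funext => x; rewrite mulrCA.
move=> /(le_trans (ler_norm _))/le_trans; apply.
rewrite [leRHS](_ : _ = norm2 m u * (Num.sqrt c * Num.sqrt (pr m A) * norm2 m v)); last by ring.
rewrite ler_wpM2l ?norm2_ge0// -sqrtrM// /norm2 -sqrtrM; last by rewrite mulr_ge0 ?pr_ge0.
apply: ler_wsqrtr.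
rewrite (_ : (fun x => _) = fun x => \1_A x * (fun y => v y ^+ 2) (iter k T x)); last first.
  apply/funext => x; rewrite exprMn real_normK ?num_real// indicE.
  by case: (_ \in _); rewrite ?expr1n ?expr0n.
apply: (Ex_dominated mpk mA) => [B mB||x]; [|by case: L2v|exact: sqr_ge0].
by rewrite -mulrA; exact: cP.
Qed.

Let indic01 (A : set S) x : 0 <= (\1_A x : R) <= 1.
Proof. by rewrite indicE; case: (_ \in _); rewrite /= ?lexx ?ler01. Qed.

Lemma Ex_series (F : nat -> set S) u : (forall n, measurable (F n)) ->
  trivIset setT F -> pr m (~` \bigcup_n F n) = 0 -> integ m u ->
  series (fun n => Ex m (fun x => \1_(F n) x * u x)) @ \oo --> Ex m u.
Proof.
move=> mF tF F0 iu.
have mU : measurable (\bigcup_n F n) by exact: bigcup_measurable.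
have mu := integ_measurable iu.
have iF n : integ m (fun x => \1_(F n) x * u x) by exact: integ_indicM.
have -> : Ex m u = Ex m (fun x => \1_(\bigcup_n F n) x * u x).
  apply: ae_eq_Ex => //; first by apply: measurable_funM => //; exact: measurable_indic.
  have := pr_eq0_negligible (measurableC mU) F0; apply: negligibleS => x /=.
  by apply: contra_not => Ux; rewrite indicE mem_set// mul1r.
rewrite (_ : series _ = fun n => Ex m (fun x => \sum_(0 <= i < n) \1_(F i) x * u x)); last first.
  by apply/funext => n; rewrite Ex_sum.
have sumE n x : \sum_(0 <= i < n) \1_(F i) x * u x = u x * (\sum_(0 <= i < n) \1_(F i) x).
  by rewrite mulr_sumr; apply: eq_bigr => i _; rewrite mulrC.
have F1 k x : F k x -> forall i, (\1_(F i) x : R) = (i == k)%:R.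
  move=> Fk i; rewrite indicE; congr (_%:R); have [->|ik] := eqVneq i k.
    by rewrite mem_set.
  rewrite memNset// => Fi; move/eqP: ik; apply.
  by apply: tF => //; exists x.
have F2 k x n : F k x -> \sum_(0 <= i < n) (\1_(F i) x : R) = (k < n)%:R.
  move=> Fk; rewrite (eq_bigr (fun i => (i == k)%:R)); last by move=> i _; exact: F1.
  rewrite -natr_sum; congr (_%:R).
  have [kn|kn] := ltnP k n.
    by rewrite (bigD1_seq k) ?mem_index_iota ?iota_uniq//= eqxx big1// => i /negbTE ->.
  rewrite big_nat big1// => i /andP[_ iN].
  by rewrite ltn_eqF// (leq_trans iN).
apply: (@cvg_Ex _ _ _ _ _ _ (fun x => `|u x|)).
- by move=> n; apply: integ_measurable; exact: integ_sum.
- by apply: measurable_funM => //; exact: measurable_indic.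
- exact: integ_norm.
- move=> n x; rewrite sumE normrM.
  have [[k _ Fk]|nF] := pselect ((\bigcup_n F n) x).
    by rewrite (F2 k)//; case: (_ < _)%N; rewrite ?normr1 ?normr0 ?mulr1 ?mulr0.
  rewrite big1 ?normr0 ?mulr0// => i _.
  by rewrite indicE memNset// => Fi; apply: nF; exists i.
- move=> x; have [[k _ Fk]|nF] := pselect ((\bigcup_n F n) x).
    apply: cvg_near_cst; exists k.+1 => // n /= kn.
    by rewrite sumE (F2 k)// kn indicE mem_set ?mulr1 ?mul1r//; exists k.
  apply: cvg_near_cst; apply: nearW => n.
  rewrite sumE big1 ?mulr0 ?indicE ?memNset ?mul0r// => i _.
  by rewrite indicE memNset// => Fi; apply: nF; exists i.
Qed.

(** Words are enumerated through their codes, with the empty set at all other integers, so that the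
    cylinders of one length form a sequence to which countable additivity applies. *)
Lemma cylinder_family j : exists F : nat -> set S,
  [/\ forall n, measurable (F n), trivIset setT F,
      pr m (~` \bigcup_n F n) = 0 &
      forall n, F n = set0 \/ exists2 w, size w = j & F n = cylinder T a w].
Proof.
pose phi : nat -> option (seq nat) := @choice.pickle_inv _.
have phi_inj n n' w : phi n = Some w -> phi n' = Some w -> n = n'.
  move=> nw nw'; have := @choice.pickle_invK (seq nat) n.
  have := @choice.pickle_invK (seq nat) n'.
  by rewrite -/(phi n) -/(phi n') nw nw' => <- <-.
have phi_surj w : exists n, phi n = Some w.
  by exists (choice.pickle w); rewrite /phi choice.pickleK_inv.
move: phi phi_inj phi_surj => phi phi_inj phi_surj.
pose F n : set S := if phi n is Some w then
  (if size w == j then cylinder T a w else set0) else set0.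
have FP n x : F n x -> exists w, [/\ phi n = Some w, size w = j & cylinder T a w x].
  by rewrite /F; case: (phi n) => // w; case: eqP => // wj wx; exists w.
exists F; split.
- move=> n; rewrite /F; case: (phi n) => // w; case: ifP => // _; exact: mcyl.
- move=> n n' _ _ [x [/FP[w [nw wj wx]] /FP[w' [nw' wj' wx']]]].
  have ww : w = w' by apply: cylinder_eq_size; [rewrite wj wj'|exists x].
  by rewrite -ww in nw'; exact: phi_inj nw nw'.
- rewrite (_ : \bigcup_n F n = \bigcup_(w in [set w | size w = j]) cylinder T a w).
    exact: cylinder_cover.
  apply/seteqP; split => x [].
    by move=> n _ /FP[w [_ wj wx]]; exists w.
  move=> w wj wx; have [n nw] := phi_surj w; exists n => //.
  by rewrite /F nw wj eqxx.
- move=> n; rewrite /F; case: (phi n) => [w|]; last by left.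
  by case: eqP => [wj|_]; [right; exists w|left].
Qed.

Definition cov (k : nat) (e v : S -> R) : R :=
  Ex m (fun x => e x * v (iter k T x)) - Ex m e * Ex m v.

(** The product with the mean of [v] also splits over the cylinders of length [j], so the estimates
    on the single cylinders may be summed. *)
Lemma cov_bound k e v y : (0 < k)%N -> sq_integ m e -> sq_integ m v -> integ m y ->
  forall j, (forall w, size w = j ->
    `|Ex m (fun x => \1_(cylinder T a w) x * (e x * v (iter k T x))) -
      Ex m (fun x => \1_(cylinder T a w) x * e x) * Ex m v| <=
    Ex m (fun x => \1_(cylinder T a w) x * y x)) ->
  `|cov k e v| <= Ex m y.
Proof.
move=> k0 L2e L2v iy j H.
have [F [mF tF cF FE]] := cylinder_family j.
have L2vk := sq_integ_comp (measure_preserving_iter mpT k) L2v.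
have s1 := Ex_series mF tF cF (sq_integM L2e L2vk).
have s2 := Ex_series mF tF cF (sq_integ_integ L2e).
have s3 := Ex_series mF tF cF iy.
have bnd n : `|Ex m (fun x => \1_(F n) x * (e x * v (iter k T x))) -
      Ex m (fun x => \1_(F n) x * e x) * Ex m v| <= Ex m (fun x => \1_(F n) x * y x).
  have [->|[w wj ->]] := FE n; last exact: H.
  have z u : (fun x => \1_set0 x * u x) = (fun=> 0 : R).
    by apply/funext => x; rewrite indicE memNset// mul0r.
  by rewrite !z !Ex_cst mul0r subr0 normr0.
have s4 : series (fun n => Ex m (fun x => \1_(F n) x * (e x * v (iter k T x))) -
      Ex m (fun x => \1_(F n) x * e x) * Ex m v) @ \oo --> cov k e v.
  rewrite [X in X @ _ --> _](_ : _ = fun n => series (fun n => Ex m (fun x => \1_(F n) x * (e x * v (iter k T x)))) n -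
      series (fun n => Ex m (fun x => \1_(F n) x * e x)) n * Ex m v); last first.
    by apply/funext => n; rewrite /series/= sumrB mulr_suml.
  by apply: cvgB => //; apply: cvgMl.
rewrite ler_norml; apply/andP; split.
  have := ler_series_lim (cvg_seriesZ (c := -1) s3) s4; rewrite mulN1r; apply => n.
  by rewrite mulN1r; have := bnd n; rewrite ler_norml => /andP[].
apply: (ler_series_lim s4 s3) => n.
by have := bnd n; rewrite ler_norml => /andP[].
Qed.

(* Only the symbols of a set [Q] with small complement, and the size of [e] on
   the latter, matter: this makes [cov] negligible with respect to the
   [L^2]-norm for functions that concentrate. *)
Lemma cov_symbols : exists2 c, 0 <= c & forall k (Q : nat -> Prop) (E0 : R) e v,
  (0 < k)%N -> sq_integ m e -> sq_integ m v -> 0 <= E0 ->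
  (forall i x, ~ Q i -> a i x -> `|e x| <= E0) ->
  `|cov k e v| <= (E0 + c * norm2 m e * Num.sqrt (pr m (\bigcup_(i in Q) a i)) +
    Ex m (fun x => `|e x|)) * norm2 m v.
Proof.
have [c c0 cP] := Ex_symbols_bound; exists c => // k Q E0 e v k0 L2e L2v E00 eE.
have mpk := measure_preserving_iter mpT k.
have L2vk := sq_integ_comp mpk L2v.
have ie := sq_integ_integ L2e; have iv := sq_integ_integ L2v.
have ivk := sq_integ_integ L2vk.
have mQ : measurable (\bigcup_(i in Q) a i) := msymbols Q.
have mU : measurable (\bigcup_i a i) by exact: bigcup_measurable.
rewrite !mulrDl (le_trans (ler_normB _ _))// lerD//; last first.
  rewrite normrM ler_pM//; first exact: Ex_norm.
  exact: norm_Ex_le_norm2.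
have iev := sq_integM (sq_integ_norm L2e) (sq_integ_norm L2vk).
apply: (@le_trans _ _ (Ex m (fun x => `|e x| * `|v (iter k T x)|))).
  apply: Ex_le_norm => //; last by move=> x; rewrite normrM.
  exact: integ_measurable (sq_integM L2e L2vk).
have h := cP Q k e v k0 L2e L2v.
apply: (@le_trans _ _ (Ex m (fun x => E0 * `|v (iter k T x)| +
    \1_(\bigcup_(i in Q) a i) x * (`|e x| * `|v (iter k T x)|)))).
  apply: ae_le_Ex => //.
    by apply: integD; [apply: integZ; exact: integ_norm|exact: integ_indicM].
  have := pr_eq0_negligible (measurableC mU) (mm_cover M); apply: negligibleS => x /=.
  apply: contra_not => -[i _ ax]; have [Qi|Qi] := pselect (Q i).
    rewrite indicE mem_set ?mul1r; last by exists i.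
    by rewrite lerDr mulr_ge0.
  have /andP[i0 _] := indic01 (\bigcup_(i in Q) a i) x.
  by rewrite ler_wpDr ?mulr_ge0// ler_wpM2r//; exact: eE Qi ax.
rewrite ExD; [|by apply: integZ; exact: integ_norm|exact: integ_indicM].
apply: lerD; last by apply: (le_trans h); rewrite !mulrA.
rewrite ExZ; last exact: integ_norm.
rewrite ler_wpM2l// -(norm2_comp mpk (u := v)); last by case: L2v.
exact: Ex_norm_le_norm2.
Qed.

Let Ex_indic_null A u : measurable A -> integ m u -> pr m A = 0 ->
  Ex m (fun x => \1_A x * u x) = 0.
Proof.
move=> mA iu A0; rewrite -[RHS](Ex_cst m 0); apply: ae_eq_Ex => //.
  exact: integ_measurable (integ_indicM mA iu).
apply: negligibleS (pr_eq0_negligible mA A0) => x /= h; apply: contrapT => Ax.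
by apply: h; rewrite indicE memNset// mul0r.
Qed.

Let ae_average F e (o : R) : measurable F -> 0 < pr m F -> integ m e ->
  (\forall x \ae m, \forall y \ae m, F x -> F y -> `|e x - e y| <= o) ->
  \forall x \ae m, F x -> `|e x - Ex m (fun y => \1_F y * e y) / pr m F| <= o.
Proof.
move=> mF F0 ie; apply: filterS => x Hx Fx.
have iFe := integ_indicM mF ie; have iF := integ_indic m mF.
rewrite -(ler_pM2r F0) -[X in _ * X <= _](ger0_norm (ltW F0)) -normrM mulrBl divfK ?gt_eqF//.
rewrite -(Ex_indic m mF) -!ExZ// -ExB//; last exact: integZ.
have iB : integ m (fun y => e x * \1_F y - \1_F y * e y) by apply: integB => //; exact: integZ.
apply: (le_trans (Ex_norm iB)); apply: ae_le_Ex; [exact: integ_norm|exact: integZ|].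
apply: filterS Hx => y Hy; rewrite indicE; have [yF|yF] := boolP (y \in F).
  by rewrite mulr1 mul1r mulr1; apply: Hy => //; exact: set_mem.
by rewrite mulr0 mul0r mulr0 subr0 normr0.
Qed.

(** [e] is replaced by its average on each cylinder of length about k/2, and the averages mix during
    the remaining time. The error is governed by [theta ^+ p * Dn i]: below 1 it is at most its
    power [eta], which is integrable; the symbols where it exceeds 1 have exponentially small mass
    and are handled by Cauchy-Schwarz. The factor [t] scales the Lipschitz bounds, so that one pair
    [K], [r] serves all the functions [cos (t * f)] and [sin (t * f)]. *)
Lemma cov_decay (Dl : S -> R) (Dn : nat -> R) (eta : R) : 0 < eta <= 1 ->
  measurable_fun setT Dl -> (forall x, 0 <= Dl x) -> (forall i, 0 <= Dn i) ->
  (forall i x, a i x -> Dl x = Dn i) -> integ m (fun x => Dl x `^ eta) ->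
  exists K r, [/\ 0 <= K, 0 < r, r < 1 & forall k e v t, (0 < k)%N ->
    sq_integ m e -> sq_integ m v -> 0 <= t ->
    (forall i w, \forall x \ae m, \forall y \ae m,
      cylinder T a (i :: w) x -> cylinder T a (i :: w) y ->
      `|e x - e y| <= t * Dn i * theta ^+ size w) ->
    `|cov k e v| <= K * r ^+ k * (t + norm2 m e) * norm2 m v].
Proof.
move=> /andP[eta0 eta1] mD D0 Dn0 DE iD.
have [rho [C' [rho0 rho1 C'0 mixP]]] := cylinder_mixing M.
have [c c0 cP] := Ex_symbols_bound.
pose beta := theta `^ eta.
have beta0 : 0 < beta by rewrite powR_gt0.
have beta1 : beta < 1.
  rewrite /beta /powR gt_eqF// -expR0 ltr_expR nmulr_llt0//.
  by rewrite ln_lt0// theta_gt0.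
pose Se := Ex m (fun x => Dl x `^ eta).
have Se0 : 0 <= Se by apply: Ex_ge0 => x; exact: powR_ge0.
have powp p z : 0 <= z -> (theta ^+ p * z) `^ eta = beta ^+ p * z `^ eta.
  move=> z0; rewrite powRM// ?exprn_ge0 ?(ltW theta_gt0)//; congr (_ * _).
  elim: p => [|p IHp]; first by rewrite !expr0 powR1.
  by rewrite !exprS powRM ?exprn_ge0 ?(ltW theta_gt0)// IHp.
(* The root of [beta] appears because the bad symbols enter through the square root of their mass;
   the root [r] of [q0], because each estimate uses only half of the lag. *)
pose q0 := Num.max (Num.sqrt beta) rho.
have q00 : 0 < q0 by rewrite lt_max rho0 orbT.
have q01 : q0 < 1 by rewrite gt_max rho1 andbT -sqrtr1 ltr_sqrt.
pose r := Num.sqrt q0.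
have r0 : 0 < r by rewrite sqrtr_gt0.
have r1 : r < 1 by rewrite -[ltRHS]sqrtr1 ltr_sqrt.
have rq : r ^+ 2 = q0 by rewrite sqr_sqrtr// ltW.
exists (((1 + C') * Se + C' + (c + 1) * Num.sqrt Se) / r ^+ 2), r; split => //.
  by rewrite divr_ge0 ?exprn_ge0 ?(ltW r0)// !addr_ge0 ?mulr_ge0 ?addr_ge0 ?sqrtr_ge0.
move=> k e v t k0 L2e L2v t0 He.
have mpk := measure_preserving_iter mpT k.
have L2vk := sq_integ_comp mpk L2v.
have ie := sq_integ_integ L2e; have iv := sq_integ_integ L2v.
have ivk := sq_integ_integ L2vk.
have iev := sq_integM L2e L2vk.
have iaev := sq_integM (sq_integ_norm L2e) (sq_integ_norm L2vk).
have iae := integ_norm ie.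
pose V := norm2 m v; have V0 : 0 <= V := norm2_ge0 m v.
have vV : Ex m (fun x => `|v x|) <= V by exact: Ex_norm_le_norm2.
have [p kp] : exists p, uphalf k = p.+1 by case: (k) k0 => // k' _; exists k'./2; rewrite uphalfE.
have [jk kp1 kp2] := uphalf_bounds kp.
pose bad i := 1 < theta ^+ p * Dn i.
pose B := \bigcup_(i in [set i | bad i]) a i.
have mB : measurable B := msymbols _.
pose eps := C' * rho ^+ (k - p.+1).
have eps0 : 0 <= eps by rewrite mulr_ge0// exprn_ge0// ltW.
have epsC : eps <= C' by rewrite ler_piMr// exprn_ile1// ltW.
(* Coefficient of the oscillation term in the majorant [y]. The other terms of [y] are the mixing of
   the averages and, on bad symbols, the two terms of the covariance. *)
pose k1 := (1 + C') * V * t * beta ^+ p.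
have bp0 : 0 <= beta ^+ p by rewrite exprn_ge0// ltW.
have k10 : 0 <= k1 by rewrite /k1 !mulr_ge0// addr_ge0.
pose y x := k1 * Dl x `^ eta + (eps * V) * `|e x| +
  (\1_B x * (`|e x| * `|v (iter k T x)|) + V * (\1_B x * `|e x|)).
have i1 : integ m (fun x => k1 * Dl x `^ eta) by exact: integZ.
have i2 : integ m (fun x => (eps * V) * `|e x|) by exact: integZ.
have i12 := integD i1 i2.
have i3 : integ m (fun x => \1_B x * (`|e x| * `|v (iter k T x)|)) by exact: integ_indicM.
have i4 : integ m (fun x => V * (\1_B x * `|e x|)) by apply: integZ; exact: integ_indicM.
have i34 := integD i3 i4.
have iy : integ m y by exact: integD.
have y12 x : k1 * Dl x `^ eta + (eps * V) * `|e x| <= y x.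
  by rewrite /y lerDl addr_ge0// !mulr_ge0//; case/andP: (indic01 B x).
have cb : `|cov k e v| <= Ex m y.
  apply: (@cov_bound k e v y k0 L2e L2v iy p.+1) => -[//|i w] [wp].
  set F := cylinder T a (i :: w).
  have mF : measurable F := mcyl _.
  have F01 x := indic01 F x.
  have Fa x : F x -> a i x by case.
  have iFev := integ_indicM mF iev.
  have iFe := integ_indicM mF ie.
  have [F0|F0] := eqVneq (pr m F) 0.
    by rewrite !Ex_indic_null// mul0r subr0 normr0.
  have {}F0 : 0 < pr m F by rewrite lt_neqAle eq_sym F0 pr_ge0.
  have [badi|/negP] := pselect (bad i).
    apply: (le_trans (ler_normB _ _)); rewrite normrM.
    apply: (@le_trans _ _ (Ex m (fun x => \1_F x * (`|e x| * `|v (iter k T x)|)) +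
        Ex m (fun x => \1_F x * `|e x|) * V)).
      apply: lerD; last apply: ler_pM => //.
      + apply: Ex_le_norm; [exact: integ_indicM|exact: integ_measurable iFev|move=> x].
        by rewrite !normrM (ger0_norm (andP (F01 x)).1).
      + apply: Ex_le_norm; [exact: integ_indicM|exact: integ_measurable iFe|move=> x].
        by rewrite !normrM (ger0_norm (andP (F01 x)).1).
      + exact: norm_Ex_le_norm2.
    rewrite mulrC -ExZ; last exact: integ_indicM.
    rewrite -ExD; [|exact: integ_indicM|by apply: integZ; exact: integ_indicM].
    apply: le_Ex; [|exact: integ_indicM|move=> x].
      by apply: integD; [exact: integ_indicM|apply: integZ; exact: integ_indicM].
    rewrite indicE; have [xF|xF] := boolP (x \in F); last by rewrite !mul0r mulr0 addr0.
    rewrite !mul1r /y indicE mem_set; last by exists i => //; exact/Fa/set_mem.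
    rewrite /= mulr1n !mul1r lerDr; apply: addr_ge0.
      by apply: mulr_ge0 => //; exact: powR_ge0.
    by do 2 apply: mulr_ge0 => //.
  rewrite -leNgt => goodi.
  pose av := Ex m (fun x => \1_F x * e x) / pr m F.
  have avE : Ex m (fun x => \1_F x * e x) = av * pr m F by rewrite /av divfK ?gt_eqF.
  pose o := t * Dn i * theta ^+ p.
  have o0 : 0 <= o by rewrite !mulr_ge0// exprn_ge0// ltW.
  have aeo : \forall x \ae m, F x -> `|e x - av| <= o.
    by apply: ae_average => //; have := He i w; rewrite wp.
  have mixF u : integ m u -> `|Ex m (fun x => \1_F x * u (iter k T x)) - pr m F * Ex m u| <=
      eps * (pr m F * Ex m (fun x => `|u x|)).
    move=> iu; apply: Ex_mixing => // B' mB'.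
    have iw0 : i :: w <> [::] by [].
    have := mixP (i :: w) (k - p.+1)%N B' iw0 mB'.
    by rewrite /= wp subnK.
  have iFvk := integ_indicM mF ivk.
  have iFeav : integ m (fun x => \1_F x * ((e x - av) * v (iter k T x))).
    rewrite (_ : (fun x => _) = fun x => \1_F x * (e x * v (iter k T x)) -
      av * (\1_F x * v (iter k T x))); last by apply/funext => x; ring.
    by apply: integB => //; exact: integZ.
  rewrite (_ : _ - _ = Ex m (fun x => \1_F x * ((e x - av) * v (iter k T x))) +
      av * (Ex m (fun x => \1_F x * v (iter k T x)) - pr m F * Ex m v)); last first.
    rewrite avE (_ : (fun x => \1_F x * ((e x - av) * v (iter k T x))) =
      fun x => \1_F x * (e x * v (iter k T x)) - av * (\1_F x * v (iter k T x))).
      by rewrite ExB ?ExZ//; [ring|exact: integZ].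
    by apply/funext => x; ring.
  apply: (@le_trans _ _ (Ex m (fun x => \1_F x * (k1 * Dl x `^ eta + (eps * V) * `|e x|)))); last first.
    apply: le_Ex; [exact: integ_indicM|exact: integ_indicM|move=> x].
    by rewrite ler_wpM2l//; case/andP: (F01 x).
  rewrite (_ : (fun x => \1_F x * (_ + _)) = fun x => \1_F x * (k1 * Dl x `^ eta) +
    (eps * V) * (\1_F x * `|e x|)); last by apply/funext => x; ring.
  have iFae := integ_indicM mF iae.
  rewrite ExD; [|exact: integ_indicM|exact: integZ].
  rewrite (ExZ _ iFae).
  apply: (le_trans (ler_normD _ _)); apply: lerD.
    have -> : Ex m (fun x => \1_F x * (k1 * Dl x `^ eta)) = k1 * Dn i `^ eta * pr m F.
      rewrite -(Ex_indic m mF) -ExZ; last exact: integ_indic.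
      congr (Ex m _); apply/funext => x; rewrite indicE.
      have [xF|xF] := boolP (x \in F); last by rewrite !mul0r mulr0.
      by rewrite (DE i)// ?mulr1 ?mul1r//; exact/Fa/set_mem.
    have h1 : o <= t * beta ^+ p * Dn i `^ eta.
      rewrite /o -!mulrA ler_wpM2l// mulrC -powp//.
      set z := theta ^+ p * Dn i in goodi *.
      have z0 : 0 <= z by rewrite mulr_ge0// exprn_ge0// ltW.
      have [->|zn0] := eqVneq z 0; first by rewrite powR0// gt_eqF.
      have {}z0 : 0 < z by rewrite lt_neqAle eq_sym zn0.
      by rewrite -[leLHS](powRr1 (ltW z0)) ger_powR// z0.
    apply: (@le_trans _ _ (Ex m (fun x => o * (\1_F x * `|v (iter k T x)|)))).
      have iFavk := integ_indicM mF (integ_norm ivk).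
      apply: (le_trans (Ex_norm iFeav)); apply: ae_le_Ex; [exact: integ_norm|exact: integZ|].
      apply: filterS aeo => x aeox; rewrite indicE.
      have [xF|xF] := boolP (x \in F); last by rewrite !mul0r normr0 mulr0.
      by rewrite !mul1r normrM ler_wpM2r//; apply: aeox; exact: set_mem.
    rewrite ExZ; last by apply: integ_indicM => //; exact: integ_norm.
    have := mixF _ (integ_norm iv).
    rewrite [X in _ * (_ * X)](_ : _ = Ex m (fun x => `|v x|)); last first.
      by congr (Ex m _); apply/funext => x; rewrite normr_id.
    rewrite ler_distl => /andP[_ h2].
    have h3 : Ex m (fun x => \1_F x * `|v (iter k T x)|) <= (1 + C') * (pr m F * V).
      apply: (le_trans h2); rewrite mulrDl mul1r lerD//.
        by rewrite ler_wpM2l// ltW.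
      apply: ler_pM => //; first by rewrite mulr_ge0 ?Ex_ge0// ltW.
      by rewrite ler_wpM2l// ltW.
    apply: (le_trans (ler_pM o0 _ h1 h3)).
      by apply: Ex_ge0 => x; rewrite mulr_ge0//; case/andP: (F01 x).
    by rewrite /k1 le_eqVlt; apply/orP; left; apply/eqP; ring.
  rewrite normrM; apply: (@le_trans _ _ (`|av| * (eps * (pr m F * V)))).
    rewrite ler_wpM2l//; apply: (le_trans (mixF _ iv)).
    by rewrite ler_wpM2l// ler_wpM2l// ltW.
  rewrite (_ : `|av| * _ = eps * V * `|av * pr m F|); last first.
    by rewrite [`|av * _|]normrM (ger0_norm (ltW F0)); ring.
  rewrite -avE; apply: ler_wpM2l; first exact: mulr_ge0.
  apply: Ex_le_norm; [exact: integ_indicM|exact: integ_measurable iFe|move=> x].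
  by rewrite normrM (ger0_norm (andP (F01 x)).1).
apply: (le_trans cb); rewrite /y ExD// (ExD i1 i2) (ExD i3 i4) !ExZ//; last exact: integ_indicM.
rewrite -/Se -/V.
have pB : pr m B <= beta ^+ p * Se.
  rewrite -(Ex_indic m mB) -ExZ//; apply: le_Ex; [exact: integ_indic|exact: integZ|move=> x].
  rewrite indicE; have [/set_mem[i /= badi ax]|_] := boolP (x \in B); last first.
    by rewrite mulr_ge0 ?powR_ge0.
  rewrite -powp// (DE i)// (_ : true%:R = 1 `^ eta); last by rewrite powR1.
  apply: ge0_ler_powR; rewrite ?nnegrE ?(ltW eta0) ?ler01// ?(ltW badi)//.
  exact: le_trans (ltW badi).
have sB : Num.sqrt (pr m B) <= q0 ^+ p * Num.sqrt Se.
  apply: (le_trans (ler_wsqrtr pB)); rewrite sqrtrM// ler_wpM2r ?sqrtr_ge0//.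
  have -> : Num.sqrt (beta ^+ p) = Num.sqrt beta ^+ p.
    by elim: (p) => [|p' IH]; rewrite ?expr0 ?sqrtr1// !exprS sqrtrM ?IH// ltW.
  by rewrite lerXn2r// ?nnegrE ?sqrtr_ge0 ?(ltW q00)// le_max lexx.
have h3 : Ex m (fun x => \1_B x * (`|e x| * `|v (iter k T x)|)) <=
    c * (norm2 m e * (q0 ^+ p * Num.sqrt Se) * V).
  apply: (le_trans (cP _ k e v k0 L2e L2v)).
  by rewrite ler_wpM2l// ler_wpM2r// ler_wpM2l// norm2_ge0.
have h4 : Ex m (fun x => \1_B x * `|e x|) <= norm2 m e * (q0 ^+ p * Num.sqrt Se).
  have := Cauchy_Schwarz_Ex (sq_integ_indic m mB) (sq_integ_norm L2e).
  rewrite norm2_normr norm2_indic// => /(le_trans (ler_norm _))/le_trans; apply.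
  by rewrite mulrC ler_wpM2l ?norm2_ge0.
have h2 : Ex m (fun x => `|e x|) <= norm2 m e by exact: Ex_norm_le_norm2.
have bq : beta ^+ p <= q0 ^+ p.
  rewrite lerXn2r// ?nnegrE ?(ltW beta0) ?(ltW q00)//.
  apply: (@le_trans _ _ (Num.sqrt beta)); last by rewrite le_max lexx.
  rewrite -{1}(sqr_sqrtr (ltW beta0)) expr2 ler_piMr ?sqrtr_ge0//.
  by rewrite -sqrtr1 ler_sqrt// ltW.
have rq' : rho ^+ (k - p.+1) <= q0 ^+ (k - p.+1).
  by rewrite lerXn2r// ?nnegrE ?(ltW rho0) ?(ltW q00)// le_max lexx orbT.
have E1 : q0 ^+ p <= r ^+ k / r ^+ 2.
  rewrite ler_pdivlMr ?exprn_gt0// -rq -exprM -exprD.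
  apply: ler_wiXn2l; [exact: ltW|exact: ltW|].
  by rewrite mulnC.
have E2 : q0 ^+ (k - p.+1) <= r ^+ k / r ^+ 2.
  rewrite ler_pdivlMr ?exprn_gt0// -rq -exprM -exprD.
  apply: ler_wiXn2l; [exact: ltW|exact: ltW|].
  by rewrite mulnC.
set W := r ^+ k / r ^+ 2 in E1 E2.
have W0 : 0 <= W by rewrite divr_ge0 ?exprn_ge0 ?(ltW r0).
set N := norm2 m e in h2 h3 h4 *.
have N0 : 0 <= N := norm2_ge0 m e.
set sS := Num.sqrt Se in h3 h4 *; have sS0 : 0 <= sS by exact: sqrtr_ge0.
apply: (@le_trans _ _ (((1 + C') * V * t * W * Se + C' * W * V * N) +
   (c * (N * (W * sS) * V) + V * (N * (W * sS))))).
  apply: lerD; apply: lerD.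
  - rewrite /k1 ler_wpM2r// ler_wpM2l ?mulr_ge0 ?addr_ge0//.
    exact: le_trans bq E1.
  - rewrite /eps ler_pM ?mulr_ge0 ?Ex_ge0 ?exprn_ge0 ?(ltW rho0)//.
    by rewrite ler_wpM2r// ler_wpM2l// (le_trans rq').
  - apply: (le_trans h3); rewrite ler_wpM2l// ler_wpM2r// ler_wpM2l// ler_wpM2r//.
  - rewrite ler_wpM2l//; apply: (le_trans h4); rewrite ler_wpM2l// ler_wpM2r//.
rewrite [leRHS](_ : _ = ((1 + C') * Se + C' + (c + 1) * sS) * W * (t + N) * V); last first.
  by rewrite /W; ring.
have : 0 <= V * W * ((1 + C') * Se * N + C' * t + (c + 1) * sS * t).
  by repeat (apply: mulr_ge0 => // || apply: addr_ge0 => //).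
by lra.
Qed.

Lemma cov_linear k (c : R) (e e' v : S -> R) : (0 < k)%N -> integ m e -> integ m e' ->
  measurable_fun setT v -> (forall x, `|v x| <= 1) ->
  cov k (fun x => c * e x + e' x) v = c * cov k e v + cov k e' v.
Proof.
move=> k0 ie ie' mv v1.
have mvk : measurable_fun setT (fun x => v (iter k T x)).
  exact: measurableT_comp mv (mp_measurable (measure_preserving_iter mpT k)).
have iv w : integ m w -> integ m (fun x => w x * v (iter k T x)).
  move=> iw; apply: (integ_le _ _ (integ_norm iw)).
    by apply: measurable_funM => //; exact: integ_measurable iw.
  by move=> x; rewrite normrM ler_piMr.
rewrite /cov (_ : (fun x => (c * e x + e' x) * _) =
  fun x => c * (e x * v (iter k T x)) + e' x * v (iter k T x)); last first.
  by apply/funext => x; ring.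
rewrite !ExD ?ExZ//; [by ring|exact: iv|exact: integZ|by apply: integZ; exact: iv|exact: iv].
Qed.

Lemma cov_le k (e v : S -> R) : integ m e -> measurable_fun setT v -> (forall x, `|v x| <= 1) ->
  `|cov k e v| <= 2 * Ex m (fun x => `|e x|).
Proof.
move=> ie mv v1; rewrite (le_trans (ler_normB _ _))// mulrDl mul1r lerD//.
  apply: Ex_le_norm; [exact: integ_norm|apply: measurable_funM|move=> x].
  - exact: integ_measurable ie.
  - exact: measurableT_comp mv (mp_measurable (measure_preserving_iter mpT k)).
  - by rewrite normrM ler_piMr.
by rewrite normrM (le_trans (ler_pM _ _ (Ex_norm ie) (Ex_bounded m mv v1)))// mulr1.
Qed.

Hypothesis dense : forall A (eps : R), measurable A -> 0 < eps ->
  exists n (Q : set (seq nat)), (forall w, Q w -> size w = n.+1) /\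
    pr m (A `+` \bigcup_(w in Q) cylinder T a w) <= eps.

(** The delay is uniform over all [v] bounded by 1. This amounts to the convergence in L1 of the
    iterated transfer operator, that is exactness, which is stronger than mixing. *)
Let exact_fun G := forall eps : R, 0 < eps -> exists j0, forall j (v : S -> R), (j0 <= j)%N ->
  measurable_fun setT v -> (forall x, `|v x| <= 1) -> `|cov j G v| <= eps.

Let exact_approx G : integ m G -> (forall eps : R, 0 < eps -> exists G',
  [/\ integ m G', exact_fun G' & Ex m (fun x => `|G x - G' x|) <= eps]) -> exact_fun G.
Proof.
move=> iG H eps e0; have [|G' [iG' exG' GG']] := H (eps / 4); first by rewrite divr_gt0.
have [|j0 Hj] := exG' (eps / 2); first by rewrite divr_gt0.
exists (maxn j0 1) => j v; rewrite geq_max => /andP[j0j j1] mv v1.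
have iB := integB iG iG'.
have -> : cov j G v = 1 * cov j (fun x => G x - G' x) v + cov j G' v.
  rewrite -cov_linear//; congr cov; apply/funext => x; ring.
rewrite mul1r (le_trans (ler_normD _ _))//.
have := Hj j v j0j mv v1; have := cov_le j iB mv v1.
by lra.
Qed.

Let exact_linear (c : R) G G' : integ m G -> integ m G' -> exact_fun G ->
  exact_fun G' -> exact_fun (fun x => c * G x + G' x).
Proof.
move=> iG iG' eG eG' eps e0.
have c1 : 0 < `|c| + 1 by rewrite ltr_wpDl.
have [|j1 H1] := eG (eps / 2 / (`|c| + 1)); first by rewrite !divr_gt0.
have [|j2 H2] := eG' (eps / 2); first by rewrite divr_gt0.
exists (maxn (maxn j1 j2) 1) => j v; rewrite !geq_max => /andP[/andP[J1 J2] J3] mv v1.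
rewrite cov_linear// (le_trans (ler_normD _ _))// normrM.
have := H2 j v J2 mv v1; have := H1 j v J1 mv v1.
move=> h1 h2; have h3 : `|c| * `|cov j G v| <= eps / 2.
  apply: (@le_trans _ _ (`|c| * (eps / 2 / (`|c| + 1)))); first by rewrite ler_wpM2l.
  rewrite mulrA ler_pdivrMr// mulrC ler_wpM2l ?ler_wpDr//.
  by rewrite divr_ge0// ltW.
by lra.
Qed.

(** A union of cylinders of one length mixes with an error uniform in [v], and such unions
    approximate [A] in measure. *)
Let exact_indic A : measurable A -> exact_fun \1_A.
Proof.
move=> mA; have [rho [C' [rho0 rho1 C'0 mixP]]] := cylinder_mixing M.
apply: exact_approx; first exact: integ_indic.
move=> eps e0; have [n [Q [Qn Qeps]]] := dense mA e0.
set U := \bigcup_(w in Q) _ in Qeps.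
have mU : measurable U := measurable_cylinder_bigcup M Q.
exists \1_U; split; first exact: integ_indic; last first.
  rewrite (_ : (fun x => _) = \1_(A `+` U)) ?Ex_indic//.
    by rewrite /setY; apply: measurableU; exact: measurableD.
  apply/funext => x; rewrite !indicE /setY.
  have [xA|xA] := pselect (A x); have [xU|xU] := pselect (U x).
  - by rewrite !(mem_set xA) !(mem_set xU) subrr normr0 memNset// => -[[]|[]].
  - rewrite (mem_set xA) (memNset xU) subr0 normr1 mem_set//; by left.
  - rewrite (memNset xA) (mem_set xU) sub0r normrN normr1 mem_set//; by right.
  - by rewrite (memNset xA) (memNset xU) subrr normr0 memNset// => -[[]|[]].
move=> eps1 e10.
have cr : C' * rho ^+ l @[l --> \oo] --> C' * 0.
  by apply: cvgMr; apply: cvg_expr; rewrite ger0_norm ?ltW.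
have /cvgrPdist_le/(_ eps1 e10) := cr; rewrite mulr0 => -[l0 _ Hl].
exists (l0 + n.+1)%N => j v jn mv v1.
have l0j : (l0 <= j - n.+1)%N by rewrite leq_subRL; [rewrite addnC|exact: leq_trans (leq_addl _ _) jn].
have eps_l : C' * rho ^+ (j - n.+1) <= eps1.
  have /= := Hl (j - n.+1)%N; rewrite sub0r normrN ger0_norm ?mulr_ge0 ?exprn_ge0 ?(ltW rho0)//.
  exact.
set eps' := C' * _ in eps_l.
have eps'0 : 0 <= eps' by rewrite mulr_ge0// exprn_ge0// ltW.
apply: le_trans eps_l; rewrite -[leRHS](Ex_cst m eps').
have nj : (n.+1 <= j)%N by exact: leq_trans (leq_addl _ _) jn.
have L2U := sq_integ_indic m mU; have L2v := sq_integ_bounded m mv v1.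
apply: (@cov_bound j \1_U v _ _ L2U L2v (integ_cst m eps') n.+1).
  exact: leq_trans nj.
move=> w wn; set F := cylinder T a w.
have mF : measurable F := mcyl w.
have -> : Ex m (fun x => \1_F x * eps') = eps' * pr m F.
  rewrite -(Ex_indic m mF) -ExZ; last exact: integ_indic.
  by congr (Ex m _); apply/funext => x; rewrite mulrC.
have [Qw|Qw] := pselect (Q w).
  have FU x : (\1_F x * \1_U x : R) = \1_F x.
    rewrite !indicE; have [xF|xF] := pselect (F x); last by rewrite memNset// mul0r.
    by rewrite (mem_set xF) mem_set ?mulr1//; exists w.
  have -> : (fun x => \1_F x * \1_U x) = (\1_F : S -> R) by apply/funext.
  have -> : (fun x => \1_F x * (\1_U x * v (iter j T x))) = fun x => \1_F x * v (iter j T x).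
    by apply/funext => x; rewrite mulrA FU.
  rewrite Ex_indic//; apply: (@le_trans _ _ (eps' * (pr m F * Ex m (fun x => `|v x|)))).
    apply: (Ex_mixing (measure_preserving_iter mpT j) mF _ (sq_integ_integ L2v)) => B mB.
    have w0 : w <> [::] by move=> w0; rewrite w0 in wn.
    have := mixP w (j - n.+1)%N B w0 mB; rewrite wn subnK//.
  rewrite ler_wpM2l// ler_piMr ?pr_ge0//.
  apply: (le_trans (ler_norm _)); apply: Ex_bounded => [|x]; last by rewrite normr_id.
  exact: measurableT_comp.
have FU x : (\1_F x * \1_U x : R) = 0.
  rewrite !indicE; have [xF|xF] := pselect (F x); last by rewrite memNset// mul0r.
  rewrite (@memNset _ U) ?mulr0// => -[w' Qw' xw'].
  by apply: Qw; rewrite (@cylinder_eq_size w w')//; [rewrite wn Qn|exists x].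
have -> : (fun x => \1_F x * \1_U x) = (fun=> 0 : R) by apply/funext.
have -> : (fun x => \1_F x * (\1_U x * v (iter j T x))) = fun=> 0.
  by apply/funext => x; rewrite mulrA FU mul0r.
by rewrite !Ex_cst mul0r subr0 normr0 mulr_ge0 ?pr_ge0.
Qed.

Import HBSimple.

(** Simple functions are dense in L1, and the covariance with a bounded [v] is controlled by the L1
    norm. *)
Lemma Ex_exact G : integ m G -> forall eps : R, 0 < eps -> exists j0, forall j (v : S -> R),
  (j0 <= j)%N -> measurable_fun setT v -> (forall x, `|v x| <= 1) ->
  `|Ex m (fun x => G x * v (iter j T x)) - Ex m G * Ex m v| <= eps.
Proof.
move=> iG; change (exact_fun G); apply: exact_approx => // eps e0.
have [g_ [ig_ _ Gg]] := approximation_sfun_integrable measurableT iG.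
have fG n : integ m (fun x => `|G x - g_ n x|).
  by apply: integ_norm; apply: integB => //; exact: ig_.
have Gg' : Ex m (fun x => `|G x - g_ n x|) @[n --> \oo] --> 0.
  move: Gg; rewrite (_ : (fun n => _) = fun n => (Ex m (fun x => `|G x - g_ n x|))%:E).
    by move/fine_cvgP => [].
  apply/funext => n; rewrite /Rintegral fineK//; last exact: (integrable_fin_num measurableT (fG n)).
have /cvgrPdist_le/(_ eps e0)[n _ /(_ n (leqnn n))] := Gg'.
rewrite sub0r normrN ger0_norm; last exact: Ex_ge0.
move=> Hn; exists (g_ n); split => //; first exact: ig_.
pose sq := finmap.enum_fset (fset_set (range (g_ n))).
have gE : (g_ n : S -> R) = fun x => \sum_(y <- sq) y * \1_(g_ n @^-1` [set y]) x.
  by apply/funext => x; rewrite {1}fimfunE fsbig_finite//=; exact: fimfunP.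
pose B y : set S := g_ n @^-1` [set y]; have mB y : measurable (B y) by exact: measurable_sfunP.
suff [] : exact_fun (fun x => \sum_(y <- sq) y * \1_(B y) x) /\
    integ m (fun x => \sum_(y <- sq) y * \1_(B y) x) by rewrite -gE.
elim: sq {gE} => [|y t [IHe IHi]].
  rewrite (_ : (fun x => _) = fun=> 0); last by apply/funext => x; rewrite big_nil.
  split; last exact: integ_cst.
  by move=> e' e'0; exists 0%N => j v _ mv v1; rewrite /cov (_ : (fun x => _) = fun=> 0);
    [rewrite !Ex_cst mul0r subr0 normr0 ltW|apply/funext => x; rewrite mul0r].
rewrite (_ : (fun x => _) = fun x => y * \1_(B y) x + \sum_(y <- t) y * \1_(B y) x); last first.
  by apply/funext => x; rewrite big_cons.
split.
  by apply: exact_linear => //; [exact: integ_indic|exact: exact_indic].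
by apply: integD => //; apply: integZ; exact: integ_indic.
Qed.

End decorrelation.

(** * Trigonometric inequalities and Bernstein polynomials *)

Section trigonometric_inequalities.
Context {R : realType}.
Implicit Types x y : R.

Lemma ler_norm_MVT (g g' : R -> R) (M x y : R) : (forall z : R, is_derive z (1 : R) g (g' z)) ->
  (forall z, `|z| <= `|x| + `|y| -> `|g' z| <= M) -> `|g x - g y| <= M * `|x - y|.
Proof.
move=> dg gM.
have cg a b : {within `[a, b], continuous g}.
  apply: continuous_subspaceT => z; apply: differentiable_continuous.
  by apply/derivable1_diffP; have [] := dg z.
have zb (z a b : R) : z \in `[a, b] -> `|z| <= `|a| + `|b|.
  rewrite in_itv/= => /andP[az zb]; rewrite ler_norml.
  have := ler_norm b; have := ler_norm (- a); rewrite normrN.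
  have := normr_ge0 a; have := normr_ge0 b; move=> h1 h2 h3 h4.
  by apply/andP; split; lra.
have [xy|/ltW yx] := leP x y.
  have [c cxy gE] := MVT_segment xy (fun z _ => dg z) (cg x y).
  by rewrite distrC gE normrM [`|x - y|]distrC ler_wpM2r// gM// zb.
have [c cxy ->] := MVT_segment yx (fun z _ => dg z) (cg y x).
by rewrite normrM ler_wpM2r// gM// addrC zb.
Qed.

Lemma sin_lip x y : `|sin x - sin y| <= `|x - y|.
Proof.
rewrite -[leRHS]mul1r; apply: (ler_norm_MVT (g' := @cos R)) => z _.
exact: cos_max.
Qed.

Lemma cos_lip x y : `|cos x - cos y| <= `|x - y|.
Proof.
rewrite -[leRHS]mul1r; apply: (ler_norm_MVT (g' := fun z => - sin z)) => z _.
by rewrite normrN sin_max.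
Qed.

Lemma norm_sin_le x : `|sin x| <= `|x|.
Proof. by have := sin_lip x 0; rewrite sin0 !subr0. Qed.

Lemma onem_cos x : 1 - cos x = 2 * sin (x / 2) ^+ 2.
Proof.
have -> : cos x = cos ((x / 2) *+ 2) by congr cos; rewrite -mulr_natr divfK.
by rewrite cos_mulr2n cos2sin2 mulr2n; ring.
Qed.

Lemma onem_cos_ge0 x : 0 <= 1 - cos x.
Proof. by rewrite subr_ge0 cos_le1. Qed.

Lemma onem_cos_le x : 1 - cos x <= x ^+ 2 / 2.
Proof.
rewrite onem_cos; have := norm_sin_le (x / 2).
rewrite -(@ler_pXn2r _ 2) ?nnegrE// !real_normK ?num_real//.
by move=> h; lra.
Qed.

Lemma sin_sub_le x : `|sin x - x| <= x ^+ 2 / 2 * `|x|.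
Proof.
have := @ler_norm_MVT (fun z => sin z - z) (fun z => cos z - 1) (x ^+ 2 / 2) x 0.
rewrite sin0 !subr0; apply => z; rewrite normr0 addr0 => zx.
rewrite distrC ger0_norm ?onem_cos_ge0// (le_trans (onem_cos_le z))//.
by rewrite ler_wpM2r// -(real_normK (num_real z)) -(real_normK (num_real x)) lerXn2r ?nnegrE.
Qed.

(** With the factor [Num.min 1], the remainder at [x = t * F] is integrable as soon as [F] is in L2,
    and its expectation is o(t^2) without a third moment. *)
Lemma sin_taylor x : `|sin x - x| <= 2 * (x ^+ 2 * Num.min 1 `|x|).
Proof.
have x2 := real_normK (num_real x).
rewrite minEle; case: ifPn => [x1|]; last first.
  rewrite -ltNge => x1; apply: (le_trans (sin_sub_le x)).
  rewrite mulrA ler_wpM2r// mulrC ler_wpM2r ?sqr_ge0//; lra.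
rewrite mulr1 (le_trans (ler_normB _ _))// -x2.
have := norm_sin_le x; nra.
Qed.

Lemma cos_taylor x : `|cos x - 1 + x ^+ 2 / 2| <= x ^+ 2 * Num.min 1 `|x|.
Proof.
have x2 := real_normK (num_real x); have x20 := sqr_ge0 x.
have := onem_cos_ge0 x; have := onem_cos_le x => c1 c2.
rewrite minEle; case: ifPn => [x1|].
  by rewrite ger0_norm; lra.
rewrite -ltNge => x1; have := @ler_norm_MVT (fun z => cos z - 1 + z ^+ 2 / 2)
  (fun z => - sin z + z) (`|x| ^+ 2) x 0.
rewrite cos0 expr0n/= mul0r addr0 subrr !subr0 x2; apply.
  move=> z; apply: is_derive_eq; rewrite /= ?scaler0.
  by rewrite /GRing.scale/= mulr1; field.
move=> z; rewrite normr0 addr0 addrC => zx.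
rewrite distrC (le_trans (sin_sub_le z))// -(real_normK (num_real z)).
have z1 : `|z| <= 1 by lra.
have z0 := normr_ge0 z; have : `|z| * `|z| <= `|x| * `|x| by rewrite ler_pM.
rewrite !expr2; nra.
Qed.

Lemma mulr_sin_cos x y : sin x * cos y = (sin (x + y) + sin (x - y)) / 2.
Proof. by rewrite sinD sinB; field. Qed.

End trigonometric_inequalities.

(* The expectation of [F] under the binomial law with parameters n and p. *)
Fixpoint binomial_mean {R : realType} (p : R) (n : nat) (F : nat -> R) : R :=
  if n is n'.+1 then p * binomial_mean p n' (fun k => F k.+1) +
                     (1 - p) * binomial_mean p n' F
  else F 0%N.

Section bernstein.
Context {R : realType}.
Implicit Types (p : R) (F G : nat -> R).

Lemma binomial_meanD p n F G : binomial_mean p n (fun k => F k + G k) =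
  binomial_mean p n F + binomial_mean p n G.
Proof. by elim: n F G => //= n IH F G; rewrite !IH; ring. Qed.

Lemma binomial_meanZ p n c F : binomial_mean p n (fun k => c * F k) = c * binomial_mean p n F.
Proof. by elim: n F => //= n IH F; rewrite !IH; ring. Qed.

Lemma binomial_mean_cst p n c : binomial_mean p n (fun=> c) = c.
Proof. by elim: n => //= n ->; ring. Qed.

Lemma le_binomial_mean p n F G : 0 <= p <= 1 -> (forall k, F k <= G k) ->
  binomial_mean p n F <= binomial_mean p n G.
Proof.
move=> /andP[p0 p1]; elim: n F G => //= n IH F G FG.
by apply: lerD; rewrite ler_wpM2l ?subr_ge0//; exact: IH.
Qed.

Lemma binomial_mean_var p n c : binomial_mean p n (fun k => (k%:R - c) ^+ 2) =
  n%:R * p * (1 - p) + (n%:R * p - c) ^+ 2.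
Proof.
elim: n c => [|n IH] c /=; first by ring.
rewrite (_ : (fun k => _) = fun k => (k%:R - (c - 1)) ^+ 2); last first.
  by apply/funext => k; rewrite -natr1; congr (_ ^+ 2); ring.
by rewrite !IH -natr1; ring.
Qed.

(** Chebyshev's inequality for the binomial law. Continuity is made uniform at the points [p] of
    [0, 1] by compactness. *)
Lemma bernstein_approx (g : R -> R) (H eps : R) : continuous g -> (forall x, `|g x| <= H) ->
  0 < eps -> exists n, forall p, 0 <= p <= 1 ->
    `|binomial_mean p n.+1 (fun k => g (k%:R / n.+1%:R)) - g p| <= eps.
Proof.
move=> cg gH e0.
have [dl dl0 gdl] : exists2 dl : R, 0 < dl & forall p, 0 <= p <= 1 -> forall y,
    `|p - y| < dl -> `|g p - g y| <= eps / 2.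
  have := @segment_compact R 0 1; move/compact_near_coveringP.
  move=> /(_ R (0^'+) (fun dl p => forall y, `|p - y| < dl -> `|g p - g y| <= eps / 2)).
  case=> [x _ /=|dl /= dl0 Hdl].
    have /cvgrPdist_le/(_ (eps / 4)) := cg x.
    case=> [|r /= r0 Hr]; first by rewrite divr_gt0.
    exists (ball x (r / 2), [set dl : R | dl < r / 2]).
      split => /=; first by apply: nbhsx_ballx; rewrite divr_gt0.
      by exists (r / 2) => /=; [rewrite divr_gt0|move=> z /= + z0; rewrite sub0r normrN gtr0_norm].
    move=> [p dl] [/= xp dlr] y py.
    have h1 : `|g x - g p| <= eps / 4.
      by apply: Hr => /=; apply: (lt_le_trans xp); lra.
    have h2 : `|g x - g y| <= eps / 4.
      apply: Hr => /=; rewrite (_ : x - y = (x - p) + (p - y)); last by ring.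
      by rewrite (le_lt_trans (ler_normD _ _))//; move: xp; rewrite /ball/=; lra.
    rewrite (_ : _ - _ = (g x - g y) - (g x - g p)); last by ring.
    by rewrite (le_trans (ler_normB _ _))//; lra.
  exists (dl / 2); first by rewrite divr_gt0.
  move=> p p01 y py; apply: (Hdl (dl / 2)) => //=.
  - by rewrite sub0r normrN gtr0_norm ?divr_gt0//; lra.
  - by rewrite divr_gt0.
have H0 : 0 <= H := le_trans (normr_ge0 _) (gH 0).
(* Chosen so that [2 * H / (dl ^+ 2 * n.+1%:R) <= eps / 2], which bounds the Chebyshev term since
   [p * (1 - p) <= 1]. *)
pose n := Num.truncn (4 * H / (dl ^+ 2 * eps)).
have nP : 4 * H / (dl ^+ 2 * eps) <= n.+1%:R by exact/ltW/truncnS_gt.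
exists n => p p01; have n0 : (0 : R) < n.+1%:R by rewrite ltr0n.
have gb k : `|g (k%:R / n.+1%:R) - g p| <=
    eps / 2 + 2 * H / (dl ^+ 2 * n.+1%:R ^+ 2) * (k%:R - n.+1%:R * p) ^+ 2.
  set y := k%:R / _; have [pd|pd] := ltP `|p - y| dl.
    rewrite distrC (le_trans (gdl p p01 y pd))// ler_wpDr//.
    by apply: mulr_ge0; rewrite ?sqr_ge0// divr_ge0// mulr_ge0// ?sqr_ge0.
  apply: (@le_trans _ _ (2 * H)).
    by rewrite (le_trans (ler_normB _ _))// mulr2n mulrDl mul1r lerD.
  rewrite ler_wpDl ?divr_ge0 ?(ltW e0)//.
  rewrite [leRHS](_ : _ = 2 * H * ((p - y) ^+ 2 / dl ^+ 2)); last first.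
    by rewrite /y; field; rewrite nat1r (gt_eqF n0) (gt_eqF dl0).
  rewrite ler_peMr ?mulr_ge0// ler_pdivlMr ?exprn_gt0// mul1r.
  by rewrite -(real_normK (num_real (p - y))) lerXn2r ?nnegrE ?(ltW dl0).
have bm := binomial_meanD p n.+1 (fun k => g (k%:R / n.+1%:R)) (fun=> - g p).
rewrite binomial_mean_cst in bm; rewrite -bm.
set K := 2 * H / _ in gb.
have le1 : binomial_mean p n.+1 (fun k => eps / 2 + K * (k%:R - n.+1%:R * p) ^+ 2) <= eps.
  rewrite binomial_meanD binomial_mean_cst binomial_meanZ binomial_mean_var.
  rewrite subrr expr0n addr0 /K.
  rewrite -lerBrDl (_ : eps - eps / 2 = eps / 2); last by field.
  rewrite [leLHS](_ : _ = 2 * H * (p * (1 - p)) / (dl ^+ 2 * n.+1%:R)); last first.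
    by field; rewrite nat1r (gt_eqF n0) (gt_eqF dl0).
  rewrite ler_pdivrMr ?mulr_gt0 ?exprn_gt0//.
  have pp : p * (1 - p) <= 1 by case/andP: p01 => p0 p1; nra.
  apply: (@le_trans _ _ (2 * H)); first by rewrite ler_piMr ?mulr_ge0.
  move: nP; rewrite ler_pdivrMr ?mulr_gt0 ?exprn_gt0//.
  by rewrite mulrCA; lra.
rewrite ler_norml; apply/andP; split.
  rewrite lerNl -mulN1r -binomial_meanZ; apply: le_trans le1.
  apply: le_binomial_mean => // k; rewrite mulN1r.
  by apply: le_trans (gb k); rewrite -normrN ler_norm.
apply: le_trans le1; apply: le_binomial_mean => // k.
exact: le_trans (ler_norm _) (gb k).
Qed.

End bernstein.

(** * Levy's continuity theorem *)

Section expectation_fubini.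
Context d (S : measurableType d) d' (S' : measurableType d') (R : realType).
Variables (m : probability S R) (q : probability S' R).

Lemma integral_Ex (u : S -> R) : integ m u -> (\int[m]_x (u x)%:E)%E = (Ex m u)%:E.
Proof. by move=> iu; rewrite /Rintegral fineK//; exact: (integrable_fin_num measurableT iu). Qed.

Lemma Ex_fubini (F : S * S' -> R) (M : R) : measurable_fun setT F ->
  (forall z, 0 <= F z <= M) ->
  [/\ measurable_fun setT (fun x => Ex q (fun y => F (x, y))),
      measurable_fun setT (fun y => Ex m (fun x => F (x, y))) &
      Ex m (fun x => Ex q (fun y => F (x, y))) = Ex q (fun y => Ex m (fun x => F (x, y)))].
Proof.
move=> mF FM; have F0 z : (0 <= (F z)%:E)%E by rewrite lee_fin; case/andP: (FM z).
have mEF : measurable_fun setT (EFin \o F) by exact/measurable_EFinP.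
have FB z : `|F z| <= M by case/andP: (FM z) => F0z; rewrite ger0_norm.
have iq x : integ q (fun y => F (x, y)).
  apply: (@integ_bounded _ _ _ _ _ M) => [|y]; [|exact: FB]; exact: measurableT_comp mF (pair1_measurable x).
have im y : integ m (fun x => F (x, y)).
  apply: (@integ_bounded _ _ _ _ _ M) => [|x]; [|exact: FB]; exact: measurableT_comp mF (pair2_measurable y).
have mq : measurable_fun setT (fun x => Ex q (fun y => F (x, y))).
  apply/measurable_EFinP; have := measurable_fun_fubini_tonelli_F (m2 := q) (EFin \o F) mEF F0.
  congr (measurable_fun _ _); apply/funext => x; rewrite /fubini_F /=.
  by rewrite (fineK (integrable_fin_num measurableT (iq x))).
have mm : measurable_fun setT (fun y => Ex m (fun x => F (x, y))).
  apply/measurable_EFinP; have := measurable_fun_fubini_tonelli_G (m1 := m) (EFin \o F) mEF F0.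
  congr (measurable_fun _ _); apply/funext => y; rewrite /fubini_G /=.
  by rewrite (fineK (integrable_fin_num measurableT (im y))).
split => //; have := fubini_tonelli (m1 := m) (m2 := q) (EFin \o F) mEF F0.
rewrite /= /Rintegral => E; congr fine.
rewrite (eq_integral (fun x => \int[q]_y (F (x, y))%:E)%E); last first.
  by move=> x _; rewrite (fineK (integrable_fin_num measurableT (iq x))).
rewrite E; apply: eq_integral => y _.
by rewrite (fineK (integrable_fin_num measurableT (im y))).
Qed.

End expectation_fubini.

(** * Averages of 1 - cos over an interval *)

Section sinc.
Context {R : realType}.
Variables (u : R) (u0 : 0 < u).

Let J (y : R) : R := Ex (uniform_prob u0) (fun t : R => 1 - cos (t * y)).

Let measurable_J y : measurable_fun setT (fun t : R => 1 - cos (t * y)).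
Proof.
apply: measurable_funB => //; apply: measurableT_comp; first exact: (continuous_measurable_fun (@continuous_cos R)).
exact: measurable_funM.
Qed.

Let J_bounds y (t : R) : 0 <= 1 - cos (t * y) <= 2.
Proof. by rewrite onem_cos_ge0/=; have := cos_geN1 (t * y); lra. Qed.

Let J_eq y : y != 0 -> J y = 1 - sin (u * y) / (u * y).
Proof.
move=> y0; rewrite /J /Rintegral (integral_uniform u0 (f := fun t => (1 - cos (t * y))%:E)); last 2 first.
- by apply/measurable_EFinP; exact: measurable_J.
- by move=> t; rewrite lee_fin; case/andP: (J_bounds y t).
have dF (t : R) : is_derive t (1 : R) (fun t => t - sin (t * y) / y) (1 - cos (t * y)).
  apply: is_derive_eq; rewrite /= /GRing.scale/= ?mulr0 ?add0r ?addr0 ?mulr1.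
  by field.
have cF (F : R -> R) F' : (forall t : R, is_derive t (1 : R) F (F' t)) -> continuous F.
  by move=> dF' z; apply: differentiable_continuous; apply/derivable1_diffP; have [] := dF' z.
have df (t : R) : is_derive t (1 : R) (fun t : R => 1 - cos (t * y)) (sin (t * y) * y).
  apply: is_derive_eq; rewrite /= /GRing.scale/= ?mulr0 ?add0r ?addr0 ?mulr1.
  by ring.
rewrite (continuous_FTC2 (F := fun t => t - sin (t * y) / y)) //=.
- by rewrite mul0r sin0 mul0r !subr0; field; rewrite y0 gt_eqF.
- by apply: continuous_subspaceT; exact: cF df.
- split => [x _||]; first by have [] := dF x.
    by apply: cvg_at_right_filter; exact: (cF _ _ dF).
  by apply: cvg_at_left_filter; exact: (cF _ _ dF).
- by move=> x _; rewrite derive1E; have [] := dF x.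
Qed.

Lemma uniform_onem_cos_ge (y : R) : 2 < u * `|y| ->
  1 / 2 <= Ex (uniform_prob u0) (fun t : R => 1 - cos (t * y)).
Proof.
move=> uy; have y0 : y != 0 by apply: contraTneq uy => ->; rewrite normr0 mulr0 -leNgt.
rewrite -/(J y) J_eq//.
suff : sin (u * y) / (u * y) <= 1 / 2 by lra.
apply: (le_trans (ler_norm _)); rewrite normf_div normrM (gtr0_norm u0).
rewrite ler_pdivrMr ?(lt_trans _ uy)//.
by apply: (le_trans (sin_max _)); lra.
Qed.

Lemma uniform_onem_cos_le (y : R) :
  Ex (uniform_prob u0) (fun t : R => 1 - cos (t * y)) <= (u * y) ^+ 2 / 2.
Proof.
have [->|y0] := eqVneq y 0.
  rewrite (_ : (fun t => _) = fun=> 0); first by rewrite Ex_cst mulr0 expr0n mul0r.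
  by apply/funext => t; rewrite mulr0 cos0 subrr.
rewrite -/(J y) J_eq//; set x := u * y.
have x0 : x != 0 by rewrite mulf_neq0// gt_eqF.
rewrite (_ : 1 - _ = (x - sin x) / x); last by field.
apply: (le_trans (ler_norm _)); rewrite normf_div ler_pdivrMr ?normr_gt0// distrC.
exact: sin_sub_le.
Qed.

End sinc.

Section tails.
Context {R : realType}.

Lemma measurable_cos_comp {d0} {S0 : measurableType d0} (u : S0 -> R) :
  measurable_fun setT u -> measurable_fun setT (fun x => cos (u x)).
Proof. by move=> mu; apply: measurableT_comp mu; exact: (continuous_measurable_fun (@continuous_cos R)). Qed.

Lemma measurable_sin_comp {d0} {S0 : measurableType d0} (u : S0 -> R) :
  measurable_fun setT u -> measurable_fun setT (fun x => sin (u x)).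
Proof. by move=> mu; apply: measurableT_comp mu; exact: (continuous_measurable_fun (@continuous_sin R)). Qed.

(** For [t] uniform on [0, u], the average of 1 - cos (t y) is 1 - sin (u y) / (u y), hence at least
    1/2 once u |y| > 2. Fubini's theorem turns this bound on the tail into an average of the
    characteristic function near 0. *)
Lemma tail_le_cf {d0} {S0 : measurableType d0} (P0 : probability S0 R) (Y0 : S0 -> R) (u : R)
  (u0 : 0 < u) : measurable_fun setT Y0 ->
  [/\ pr P0 [set x | 2 < u * `|Y0 x|] <=
        2 * Ex (uniform_prob u0) (fun t : R => 1 - Ex P0 (fun x => cos (t * Y0 x))),
      measurable_fun setT (fun t : R => 1 - Ex P0 (fun x => cos (t * Y0 x))) ,
      measurable_fun setT (fun x => Ex (uniform_prob u0) (fun t : R => 1 - cos (t * Y0 x))) &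
      Ex (uniform_prob u0) (fun t : R => 1 - Ex P0 (fun x => cos (t * Y0 x))) =
      Ex P0 (fun x => Ex (uniform_prob u0) (fun t : R => 1 - cos (t * Y0 x)))].
Proof.
move=> mY0; pose F (z : S0 * R) := 1 - cos (z.2 * Y0 z.1).
have mF : measurable_fun setT F.
  apply: measurable_funB => //; apply: measurable_cos_comp; apply: measurable_funM => //.
  exact: measurableT_comp.
have F2 z : 0 <= F z <= 2.
  by rewrite /F onem_cos_ge0/=; have := cos_geN1 (z.2 * Y0 z.1); lra.
have [m1 m2 E] := Ex_fubini P0 (uniform_prob u0) mF F2.
have E1 : (fun t : R => 1 - Ex P0 (fun x => cos (t * Y0 x))) = fun t => Ex P0 (fun x => F (x, t)).
  apply/funext => t; rewrite ExB ?Ex_cst//; first exact: integ_cst.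
  apply: (@integ_bounded _ _ _ _ _ 1); last by move=> x; exact: cos_max.
  by apply: measurable_cos_comp; exact: measurable_funM.
rewrite E1; split => //; rewrite -E.
have iE : integ P0 (fun x => Ex (uniform_prob u0) (fun t => F (x, t))).
  apply: (@integ_bounded _ _ _ _ _ 2) => // x; apply: Ex_bounded.
    by apply: measurableT_comp mF _; exact: pair1_measurable.
  by move=> t; case/andP: (F2 (x, t)) => h1 h2; rewrite ger0_norm.
have mA : measurable [set x | 2 < u * `|Y0 x|].
  rewrite (_ : [set x | _] = (fun x => u * `|Y0 x|) @^-1` `]2, +oo[); last first.
    by apply/seteqP; split => x /=; rewrite in_itv/= andbT.
  rewrite -[X in measurable X]setTI.
  by apply: measurable_funM => //; exact: measurableT_comp.
rewrite -Ex_indic// -ExZ//; apply: le_Ex; [exact: integ_indic|exact: integZ|move=> x].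
rewrite indicE; have [/set_mem/= xA|_] := boolP (x \in _).
  by have := uniform_onem_cos_ge u0 xA; rewrite /F/=; lra.
by apply: mulr_ge0 => //; apply: Ex_ge0 => t; case/andP: (F2 (x, t)).
Qed.

End tails.

(** * Tightness from characteristic functions *)

Section tightness.
Context d (S : measurableType d) d' (S' : measurableType d') (R : realType).
Variables (P : probability S R) (Q : probability S' R).
Variables (Y : nat -> S -> R) (W : S' -> R).
Hypotheses (mY : forall n, measurable_fun setT (Y n)) (mW : measurable_fun setT W).

(** The average of the characteristic function of [W] over [0, 1/(k+1)] is close to 1 for large [k];
    with this interval fixed, dominated convergence in [n] passes the bound on to [Y n]. *)
Lemma tight_of_cf : (forall t : R,
    (fun n => Ex P (fun x => cos (t * Y n x))) @ \oo --> Ex Q (fun x => cos (t * W x))) ->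
  forall eps : R, 0 < eps -> exists2 K : R, 0 < K & \forall n \near \oo,
    pr P [set x | K < `|Y n x|] <= eps.
Proof.
move=> YW eps e0.
have k0 k : 0 < k.+1%:R^-1 :> R by rewrite invr_gt0.
have cJ : (fun k => Ex Q (fun x => Ex (uniform_prob (k0 k)) (fun t : R => 1 - cos (t * W x)))) @ \oo
    --> Ex Q (fun=> 0 : R).
  apply: (@cvg_Ex _ _ _ _ _ _ (fun=> 2)) => //.
  - by move=> k; have [] := tail_le_cf Q (k0 k) mW.
  - exact: integ_cst.
  - move=> k x; apply: Ex_bounded.
      apply: measurable_funB => //; apply: measurable_cos_comp; exact: measurable_funM.
    move=> t; rewrite ger0_norm ?onem_cos_ge0//.
    by have := cos_geN1 (t * W x); lra.
  - move=> x; apply: (@squeeze_cvgr _ _ _ _ (fun=> 0) (fun k => (k.+1%:R^-1 * W x) ^+ 2 / 2)).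
    + apply: nearW => k; rewrite uniform_onem_cos_le andbT.
      by apply: Ex_ge0 => t; exact: onem_cos_ge0.
    + exact: cvg_cst.
    + rewrite (_ : 0 = (0 * W x) ^+ 2 / 2); last by rewrite mul0r expr0n mul0r.
      apply: cvgMl; apply: (@cvg_comp _ _ _ (fun k => k.+1%:R^-1 * W x) (fun z => z ^+ 2) _ (nbhs (0 * W x))).
        by apply: cvgMl; exact: cvg_harmonic.
      exact: exprn_continuous.
have [k Hk] : exists k, Ex Q (fun x => Ex (uniform_prob (k0 k)) (fun t : R => 1 - cos (t * W x))) <= eps / 4.
  move: cJ; rewrite Ex_cst => /cvgrPdist_le/(_ (eps / 4)).
  case=> [|k _ /(_ k (leqnn k))/=]; first by rewrite divr_gt0.
  rewrite sub0r normrN => h; exists k; exact: le_trans (ler_norm _) h.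
exists (2 * k.+1%:R); first by rewrite mulr_gt0.
have [_ _ _ EW] := tail_le_cf Q (k0 k) mW; rewrite -EW in Hk.
have cY : (fun n => Ex (uniform_prob (k0 k)) (fun t : R => 1 - Ex P (fun x => cos (t * Y n x)))) @ \oo -->
    Ex (uniform_prob (k0 k)) (fun t : R => 1 - Ex Q (fun x => cos (t * W x))).
  apply: (@cvg_Ex _ _ _ _ _ _ (fun=> 2)) => //.
  - by move=> n; have [] := tail_le_cf P (k0 k) (mY n).
  - by have [] := tail_le_cf Q (k0 k) mW.
  - exact: integ_cst.
  - move=> n t; rewrite (le_trans (ler_normB _ _))// normr1 -[2]/(1 + 1) lerD2l.
    apply: Ex_bounded; last by move=> x; exact: cos_max.
    by apply: measurable_cos_comp; exact: measurable_funM.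
  - by move=> t; apply: cvgB; [exact: cvg_cst|exact: YW].
have /cvgrPdist_le/(_ (eps / 4)) := cY.
case=> [|N _ HN]; first by rewrite divr_gt0.
exists N => // n /HN/= Hn.
have [+ _ _ _] := tail_le_cf P (k0 k) (mY n).
rewrite (_ : [set x | _ < _ * _] = [set x | 2 * k.+1%:R < `|Y n x|]); last first.
  by apply/seteqP; split => x /=; rewrite ltr_pdivlMl// mulrC.
move=> h; apply: (le_trans h); move: Hn; rewrite ler_distlC => /andP[_].
have aux (a b e : R) : b <= e / 4 -> a <= b + e / 4 -> 2 * a <= e by lra.
exact: aux Hk.
Qed.

End tightness.

(** * From characteristic functions to bounded continuous functions *)

Section levy.
Context d (S : measurableType d) d' (S' : measurableType d') (R : realType).
Variables (P : probability S R) (Q : probability S' R).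
Variables (Y : nat -> S -> R) (W : S' -> R).
Hypotheses (mY : forall n, measurable_fun setT (Y n)) (mW : measurable_fun setT W).

Hypothesis cf_cos : forall t : R,
  (fun n => Ex P (fun x => cos (t * Y n x))) @ \oo --> Ex Q (fun x => cos (t * W x)).
Hypothesis cf_sin : forall t : R,
  (fun n => Ex P (fun x => sin (t * Y n x))) @ \oo --> Ex Q (fun x => sin (t * W x)).

(** Test functions for which convergence holds even after multiplication by a cosine of any
    frequency and phase. By the product formulas, this extra factor makes the class stable under
    multiplication by sines. *)
Let good (G : R -> R) := [/\ measurable_fun setT G, exists M, forall x, `|G x| <= M &
  forall t s : R, (fun n => Ex P (fun x => G (Y n x) * cos (t * Y n x + s))) @ \oo -->
    Ex Q (fun x => G (W x) * cos (t * W x + s))].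

Let good_linear (c : R) G G' : good G -> good G' -> good (fun x => c * G x + G' x).
Proof.
move=> [mG [M GM] cG] [mG' [M' GM'] cG']; split.
- by apply: measurable_funD => //; exact: measurable_funM.
- exists (`|c| * M + M') => x; rewrite (le_trans (ler_normD _ _))// normrM lerD//.
  by rewrite ler_wpM2l.
- move=> t s; have E (d0 : measure_display) (S0 : measurableType d0) (P0 : probability S0 R) (Y0 : S0 -> R) :
      measurable_fun setT Y0 ->
      Ex P0 (fun x => (c * G (Y0 x) + G' (Y0 x)) * cos (t * Y0 x + s)) =
      c * Ex P0 (fun x => G (Y0 x) * cos (t * Y0 x + s)) + Ex P0 (fun x => G' (Y0 x) * cos (t * Y0 x + s)).
    move=> mY0; have mc : measurable_fun setT (fun x => cos (t * Y0 x + s)).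
      by apply: measurable_cos_comp; apply: measurable_funD => //; exact: measurable_funM.
    have iG : integ P0 (fun x => G (Y0 x) * cos (t * Y0 x + s)).
      apply: (@integ_bounded _ _ _ _ _ M); first by apply: measurable_funM => //; exact: measurableT_comp.
      by move=> x; rewrite normrM (le_trans _ (GM (Y0 x)))// ler_piMr// cos_max.
    have iG' : integ P0 (fun x => G' (Y0 x) * cos (t * Y0 x + s)).
      apply: (@integ_bounded _ _ _ _ _ M'); first by apply: measurable_funM => //; exact: measurableT_comp.
      by move=> x; rewrite normrM (le_trans _ (GM' (Y0 x)))// ler_piMr// cos_max.
    rewrite -ExZ// -ExD//; last exact: integZ.
    by congr (Ex _ _); apply/funext => x; ring.
  rewrite E//; under eq_fun do rewrite E//.
  by apply: cvgD; [apply: cvgMr; exact: cG|exact: cG'].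
Qed.

Let good_cst c : good (fun=> c).
Proof.
split => //; first by exists `|c|.
move=> t s; have E (d0 : measure_display) (S0 : measurableType d0) (P0 : probability S0 R) (Y0 : S0 -> R) :
    measurable_fun setT Y0 -> Ex P0 (fun x => c * cos (t * Y0 x + s)) =
    (c * cos s) * Ex P0 (fun x => cos (t * Y0 x)) - (c * sin s) * Ex P0 (fun x => sin (t * Y0 x)).
  move=> mY0; have mt : measurable_fun setT (fun x => t * Y0 x) by exact: measurable_funM.
  have ic : integ P0 (fun x => cos (t * Y0 x)).
    by apply: (@integ_bounded _ _ _ _ _ 1); [exact: measurable_cos_comp|move=> x; exact: cos_max].
  have ins : integ P0 (fun x => sin (t * Y0 x)).
    by apply: (@integ_bounded _ _ _ _ _ 1); [exact: measurable_sin_comp|move=> x; exact: sin_max].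
  rewrite -!ExZ// -ExB//; [|exact: integZ|exact: integZ].
  by congr (Ex _ _); apply/funext => x; rewrite cosD; ring.
rewrite E//; under eq_fun do rewrite E//.
by apply: cvgB; apply: cvgMr; [exact: cf_cos|exact: cf_sin].
Qed.

Let good_sin (a : R) G : good G -> good (fun x => sin (a * x) * G x).
Proof.
move=> [mG [M GM] cG].
have ms : measurable_fun setT (fun x : R => sin (a * x)).
  by apply: measurable_sin_comp; exact: measurable_funM.
split; first exact: measurable_funM.
  by exists M => x; rewrite normrM (le_trans _ (GM x))// ler_piMl// sin_max.
move=> t s; have E (d0 : measure_display) (S0 : measurableType d0) (P0 : probability S0 R) (Y0 : S0 -> R) :
    measurable_fun setT Y0 ->
    Ex P0 (fun x => sin (a * Y0 x) * G (Y0 x) * cos (t * Y0 x + s)) =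
    2^-1 * Ex P0 (fun x => G (Y0 x) * cos ((a + t) * Y0 x + (s - pi / 2))) +
    2^-1 * Ex P0 (fun x => G (Y0 x) * cos ((a - t) * Y0 x + (- s - pi / 2))).
  move=> mY0; have iG b r : integ P0 (fun x => G (Y0 x) * cos (b * Y0 x + r)).
    apply: (@integ_bounded _ _ _ _ _ M).
      apply: measurable_funM; first exact: measurableT_comp.
      by apply: measurable_cos_comp; apply: measurable_funD => //; exact: measurable_funM.
    by move=> x; rewrite normrM (le_trans _ (GM (Y0 x)))// ler_piMr// cos_max.
  rewrite -!ExZ// -ExD//; [|exact: integZ|exact: integZ].
  congr (Ex _ _); apply/funext => x; rewrite mulrAC mulr_sin_cos.
  rewrite (_ : (a + t) * Y0 x + (s - _) = a * Y0 x + (t * Y0 x + s) - pi / 2); last by ring.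
  rewrite (_ : (a - t) * Y0 x + _ = a * Y0 x - (t * Y0 x + s) - pi / 2); last by ring.
  by rewrite !cosBpihalf; ring.
rewrite E//; under eq_fun do rewrite E//.
by apply: cvgD; apply: cvgMr; exact: cG.
Qed.

(** Each trial in the recursion of [binomial_mean] multiplies by an affine function of
    [sin (a * x)], an operation under which the class is stable. *)
Let good_binomial (a : R) n F : good (fun x => binomial_mean ((1 + sin (a * x)) / 2) n F).
Proof.
elim: n F => [|n IH] F /=; first exact: good_cst.
set p := fun x => (1 + sin (a * x)) / 2.
rewrite (_ : (fun x => _) = fun x =>
    2^-1 * binomial_mean (p x) n (fun k => F k.+1) +
    (2^-1 * (sin (a * x) * binomial_mean (p x) n (fun k => F k.+1)) +
    (2^-1 * binomial_mean (p x) n F +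
     ((- 2^-1) * (sin (a * x) * binomial_mean (p x) n F) + 0)))); last first.
  by apply/funext => x; rewrite /p; field.
by do 4!(apply: good_linear; [try exact: good_sin; exact: IH|]); exact: good_cst.
Qed.

(** On |x| <= K the function [h] is a continuous function of (1 + sin (x / K)) / 2, because x / K
    stays in [-1, 1] where the sine is injective. Its Bernstein polynomials are good test functions,
    and tightness controls |x| > K. *)
Theorem levy_continuity : cvg_in_distribution P Y Q W.
Proof.
move=> h ch [M [Mr hM']]; pose H := M + 1.
have hM x : `|h x| <= H by apply: hM' => //; rewrite ltrDl.
have H0 : 0 <= H := le_trans (normr_ge0 _) (hM 0).
have mh : measurable_fun setT h := continuous_measurable_fun ch.
have ih (d0 : measure_display) (S0 : measurableType d0) (P0 : probability S0 R) (Y0 : S0 -> R) :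
    measurable_fun setT Y0 -> integ P0 (fun x => h (Y0 x)).
  by move=> mY0; apply: (integ_bounded _ _ (fun x => hM (Y0 x))); exact: measurableT_comp.
rewrite (integral_Ex (ih _ _ Q W mW)).
under eq_fun do rewrite (integral_Ex (ih _ _ P _ (mY _))).
apply: cvg_EFin; first exact: nearW.
apply/cvgrPdist_le => eps e0.
(* The tails of [W] and of [Y n] cost [2 * H * del] each, the two polynomial approximations and the
   comparison of the polynomials [3 * del] in all; the constant leaves room. *)
have [del [del0 delH]] : exists del : R, 0 < del /\ del * (8 * H + 3) <= eps.
  exists (eps / (8 * H + 3)); split; first by rewrite divr_gt0// ltr_wpDl// mulr_ge0.
  by rewrite divfK// gt_eqF// ltr_wpDl// mulr_ge0.
have [K1 K10 tY] := tight_of_cf mY mW cf_cos del0.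
have cW (t : R) : (fun _ : nat => Ex Q (fun x => cos (t * W x))) @ \oo --> Ex Q (fun x => cos (t * W x)).
  exact: cvg_cst.
(* Tightness of [W] alone, seen as a constant sequence. *)
have [K2 K20 [n2 _ /(_ _ (leqnn _)) tW]] := tight_of_cf (Y := fun=> W) (fun=> mW) mW cW del0.
pose K := Num.max K1 K2; have K0 : 0 < K by rewrite lt_max K10.
pose s : R := sin 1.
have pi1 : 1 <= pi / 2 :> R := pihalf_ge1 R.
have s01 : 0 < s < 1.
  have sE : s ^+ 2 = 1 - cos 1 ^+ 2 by rewrite /s sin2cos2.
  have c1 : 0 < cos 1 :> R := @cos1_gt0 R.
  have s0 : 0 < s by rewrite /s sin2_gt0// ltr01 /= ltr1n.
  by rewrite s0 /= -(@ltr_pXn2r _ 2) ?nnegrE ?(ltW s0)// expr1n sE ltrBlDr ltrDl exprn_gt0.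
(* A clamp to [-s, s]: as [s = sin 1 < 1], its values stay in the open interval where [asin] is
   continuous. *)
pose cl (z : R) : R := (`|z + s| - `|z - s|) / 2.
have clE z : `|z| <= s -> cl z = z.
  rewrite ler_norml => /andP[z1 z2]; rewrite /cl ger0_norm; last by rewrite -lerBlDr sub0r.
  by rewrite ler0_norm ?subr_le0//; field.
have cl_s z : `|cl z| <= s.
  rewrite /cl normrM normfV (@ger0_norm _ 2)// ler_pdivrMr// (le_trans (ler_dist_dist _ _))//.
  rewrite (_ : _ - _ = s * 2); last by ring.
  by rewrite ger0_norm// mulr_ge0//; case/andP: s01 => /ltW.
pose g (p : R) : R := h (K * asin (cl (2 * p - 1))).
have cg : continuous g.
  move=> p; have c1 : {for p, continuous (fun p : R => 2 * p - 1 : R)}.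
    by apply: cvgB; [apply: cvgMr; exact: cvg_id|exact: cvg_cst].
  have c2 : {for p, continuous (fun p : R => cl (2 * p - 1))}.
    apply: cvgMl; apply: cvgB; apply: cvg_norm.
      by apply: cvgD; [exact: c1|exact: cvg_cst].
    by apply: cvgB; [exact: c1|exact: cvg_cst].
  have c3 : {for cl (2 * p - 1), continuous (@asin R)}.
    apply: continuous_asin; have := cl_s (2 * p - 1); rewrite ler_norml.
    by case/andP: s01 => _ s1 /andP[h1 h2]; apply/andP; split; [apply: lt_le_trans h1; rewrite ltrN2|exact: le_lt_trans s1].
  have c4 : {for p, continuous (fun p : R => K * asin (cl (2 * p - 1)))}.
    by apply: cvgMr; exact: (continuous_comp c2 c3).
  exact: (continuous_comp c4 (ch _)).
have [N HN] := bernstein_approx cg (fun x => hM _) del0.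
set F := fun k => _ in HN; pose B x := binomial_mean ((1 + sin (K^-1 * x)) / 2) N.+1 F.
have p01 (x : R) : 0 <= (1 + sin (K^-1 * x)) / 2 <= 1.
  have := sin_geN1 (K^-1 * x); have := sin_le1 (K^-1 * x) => h1 h2.
  by apply/andP; split; lra.
have hB x : `|h x - B x| <= del + (2 * H) * (K < `|x|)%R%:R.
  have Bg := HN _ (p01 x); set p := _ / 2 in Bg.
  have [xK|xK] := ltP K `|x|.
    rewrite mulr1 (_ : _ - _ = (h x - g p) - (B x - g p)); last by ring.
    rewrite (le_trans (ler_normB _ _))// addrC lerD// (le_trans (ler_normB _ _))//.
    by rewrite mulr2n mulrDl mul1r lerD// hM.
  rewrite mulr0 addr0; suff -> : h x = g p by rewrite distrC.
  have x1 : -1 <= K^-1 * x <= 1.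
    by rewrite -ler_norml normrM gtr0_norm ?invr_gt0// ler_pdivrMl// mulr1.
  have sx : `|sin (K^-1 * x)| <= s.
    have ms (y : R) : 0 <= y <= 1 -> sin y <= s.
      move=> /andP[y0 y1]; have [->//|yn] := eqVneq y 1.
      apply/ltW; rewrite ltr_sin ?in_itv/=; first by rewrite lt_neqAle yn.
        by apply/andP; split; lra.
      by apply/andP; split; lra.
    case/andP: x1 => x1 x2; have [x0|x0] := leP 0 (K^-1 * x).
      rewrite ger0_norm ?ms ?x0//; apply: sin_ge0_pi; rewrite x0 /=.
      by have := pihalf_ge1 R; lra.
    rewrite -normrN -sinN ger0_norm ?ms//; first by apply/andP; split; lra.
    by apply: sin_ge0_pi; apply/andP; split; [lra|have := pihalf_ge1 R; lra].
  rewrite /g (_ : 2 * p - 1 = sin (K^-1 * x)); last by rewrite /p; field.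
  rewrite clE// sinK ?in_itv/=; first by rewrite mulrA divff ?mul1r// gt_eqF.
  by case/andP: x1 => h1 h2; apply/andP; split; lra.
have [mB [MB BM] cB] := good_binomial K^-1 N.+1 F.
have EhB (d0 : measure_display) (S0 : measurableType d0) (P0 : probability S0 R) (Y0 : S0 -> R) (K' : R) :
    measurable_fun setT Y0 -> K' <= K -> pr P0 [set x | K' < `|Y0 x|] <= del ->
    `|Ex P0 (fun x => h (Y0 x)) - Ex P0 (fun x => B (Y0 x))| <= del + 2 * H * del.
  move=> mY0 KK tY0.
  have mA (c : R) : measurable [set x | c < `|Y0 x|].
    rewrite (_ : [set x | _] = (fun x => `|Y0 x|) @^-1` `]c, +oo[); last first.
      by apply/seteqP; split => x /=; rewrite in_itv/= andbT.
    by rewrite -[X in measurable X]setTI; exact: measurableT_comp.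
  have iB : integ P0 (fun x => B (Y0 x)).
    by apply: (@integ_bounded _ _ _ _ _ MB) => [|x]; [exact: (measurableT_comp mB mY0)|exact: BM].
  rewrite -ExB//; last exact: ih.
  apply: (@le_trans _ _ (Ex P0 (fun x => del + (2 * H) * \1_[set x | K < `|Y0 x|] x))).
    apply: Ex_le_norm => [||x].
    - by apply: integD; [exact: integ_cst|apply: integZ; exact: integ_indic].
    - by apply: measurable_funB; [exact: measurableT_comp|exact: (measurableT_comp mB mY0)].
    - have := hB (Y0 x); rewrite indicE; have [xA|xA] := boolP (x \in _).
        by rewrite (set_mem xA).
      by case: ltP => // xA'; move/negP: xA; case; exact: mem_set.
  rewrite ExD ?ExZ ?Ex_cst ?Ex_indic//; last 3 first.
  - exact: integ_indic.
  - exact: integ_cst.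
  - by apply: integZ; exact: integ_indic.
  rewrite lerD2l ler_wpM2l ?mulr_ge0//; apply: le_trans tY0; apply: le_pr => // x /=.
  exact: le_lt_trans.
have /cvgrPdist_le/(_ del del0) : (fun n => Ex P (fun x => B (Y n x))) @ \oo --> Ex Q (fun x => B (W x)).
  have := cB 0 0; under eq_fun do under [X in Rintegral _ _ X]eq_fun do rewrite mul0r addr0 cos0 mulr1.
  by under [X in _ --> Rintegral _ _ X -> _]eq_fun do rewrite mul0r addr0 cos0 mulr1.
case=> n1 _ Hn1; case: tY => n3 _ Hn3.
exists (maxn n1 n3) => // n /=; rewrite geq_max => /andP[/Hn1/= h1 /Hn3/= h3].
have e1 := EhB _ _ Q W K2 mW _ tW; have e2 := EhB _ _ P (Y n) K1 (mY n) _ h3.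
have {}e1 := e1 (ltac:(by rewrite le_max lexx orbT)); have {}e2 := e2 (ltac:(by rewrite le_max lexx)).
rewrite (_ : _ - _ = (Ex Q (fun x => h (W x)) - Ex Q (fun x => B (W x))) +
  ((Ex Q (fun x => B (W x)) - Ex P (fun x => B (Y n x))) -
  (Ex P (fun x => h (Y n x)) - Ex P (fun x => B (Y n x))))); last by ring.
rewrite (le_trans (ler_normD _ _))//; apply: le_trans delH.
have := ler_normB (Ex Q (fun x => B (W x)) - Ex P (fun x => B (Y n x)))
  (Ex P (fun x => h (Y n x)) - Ex P (fun x => B (Y n x))).
have : 0 <= H * del by rewrite mulr_ge0// ltW.
by lra.
Qed.

End levy.

(** * Characteristic functions of independent sums *)

Section step_approximation.
Context d (S : measurableType d) (R : realType).

Let sum_indic_truncn (y : R) N : 0 <= y <= N%:R ->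
  \sum_(0 <= k < N) (k.+1%:R <= y)%R%:R = (Num.truncn y)%:R :> R.
Proof.
move=> /andP[y0 yN]; have tN : (Num.truncn y <= N)%N.
  by rewrite -(ler_nat R) (le_trans _ yN)// truncn_le.
rewrite -natr_sum; congr (_%:R).
rewrite (eq_bigr (fun k => (k < Num.truncn y)%N : nat)); last by move=> k _; rewrite truncn_gt_nat.
rewrite (@big_cat_nat _ _ _ (Num.truncn y))//= big_nat (eq_bigr (fun=> 1%N)); last by move=> k /andP[_ ->].
rewrite -big_nat sum_nat_const_nat subn0 muln1 big_nat_cond big1 ?addn0// => k /andP[/andP[tk _] _].
by rewrite ltnNge tk.
Qed.

Lemma unit_step_approx (u : S -> R) N : (forall x, 0 <= u x <= 1) -> forall x, (0 < N)%N ->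
  `|u x - \sum_(0 <= k < N) N%:R^-1 * \1_[set z | k.+1%:R <= N%:R * u z] x| <= N%:R^-1.
Proof.
move=> u01 x N0; have N0' : (0 : R) < N%:R by rewrite ltr0n.
have y01 : 0 <= N%:R * u x <= N%:R.
  by case/andP: (u01 x) => h0 h1; rewrite mulr_ge0//= ler_piMr.
rewrite -mulr_sumr (eq_bigr (fun k => (k.+1%:R <= N%:R * u x)%R%:R)); last first.
  move=> k _; rewrite indicE; congr (nat_of_bool _)%:R; apply/idP/idP; first by move/set_mem.
  by move=> ?; exact: mem_set.
rewrite (sum_indic_truncn y01) -{1}[u x](mulKf (lt0r_neq0 N0')) -mulrBr normrM gtr0_norm ?invr_gt0//.
rewrite ler_piMr ?invr_ge0 ?(ltW N0')//.
case/andP: y01 => y0 _; have /andP[t1 t2] := truncn_itv y0.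
by rewrite ger0_norm ?subr_ge0// lerBlDl -natr1 in t2 *; rewrite ltW// addrC.
Qed.

Lemma measurable_level (u : S -> R) (N k : nat) : measurable_fun setT u ->
  measurable [set z | k.+1%:R <= N%:R * u z].
Proof.
move=> mu; rewrite (_ : [set z | _] = (fun z => N%:R * u z) @^-1` `[k.+1%:R, +oo[); last first.
  by apply/seteqP; split => x /=; rewrite in_itv/= andbT.
by rewrite -[X in measurable X]setTI; exact: (measurable_funM _ mu).
Qed.

End step_approximation.

(** * Transfer of expectations between variables *)

Section transfer.
Context d (S : measurableType d) d' (S' : measurableType d') (R : realType).
Variables (P : probability S R) (P' : probability S' R).

(* With [w = 1] and [c = 1] this compares two variables with the same law; with
   [w] a function of independent variables it is the product rule. *)
Lemma Ex_transfer (Z : S -> R) (Z' : S' -> R) (w : S -> R) (c : R) (g : R -> R) :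
  measurable_fun setT Z -> measurable_fun setT Z' -> integ P w ->
  (forall L, measurable L -> Ex P (fun x => \1_(Z @^-1` L) x * w x) = c * pr P' (Z' @^-1` L)) ->
  measurable_fun setT g -> (forall x, `|g x| <= 1) ->
  Ex P (fun x => g (Z x) * w x) = c * Ex P' (fun x => g (Z' x)).
Proof.
move=> mZ mZ' iw H mg g1.
have mpre d0 (S0 : measurableType d0) (U : S0 -> R) L : measurable_fun setT U -> measurable L ->
    measurable (U @^-1` L).
  by move=> mU mL; rewrite -[X in measurable X]setTI; exact: mU.
pose h x := (1 + g x) / 2.
have h01 x : 0 <= h x <= 1.
  by have := g1 x; rewrite ler_norml => /andP[a b]; rewrite /h; apply/andP; split; lra.
have mh : measurable_fun setT h by apply: measurable_funM => //; exact: measurable_funD.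
pose L N k := [set z : R | k.+1%:R <= N%:R * h z].
have mL N k : measurable (L N k) := measurable_level N k mh.
pose hN N z : R := \sum_(0 <= k < N) N%:R^-1 * \1_(L N k) z.
have hNE N z : (0 < N)%N -> `|h z - hN N z| <= N%:R^-1 := unit_step_approx h01 z.
have mhN N : measurable_fun setT (hN N).
  rewrite /hN.
  by apply: measurable_sum => k; apply: measurable_funM => //; exact: measurable_indic.
have iZ' (u : R -> R) : measurable_fun setT u -> (forall x, `|u x| <= 1) -> integ P' (fun x => u (Z' x)).
  by move=> mu u1; apply: (@integ_bounded _ _ _ _ _ 1) => //; exact: measurableT_comp.
have iLw A : measurable A -> integ P (fun x => \1_(Z @^-1` A) x * w x).
  by move=> mA; apply: integ_indicM => //; exact: mpre.
have iLZ' A : measurable A -> integ P' (fun x => \1_A (Z' x) : R).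
  by move=> mA; exact: (integ_indic P' (mpre _ _ _ _ mZ' mA)).
have iuw (u : R -> R) (r : R) : measurable_fun setT u -> (forall x, `|u x| <= r) ->
    integ P (fun x => u (Z x) * w x).
  move=> mu u1; apply: (integ_le _ _ (integZ r (integ_norm iw))).
    by apply: measurable_funM; [exact: measurableT_comp|exact: integ_measurable iw].
  by move=> x; rewrite normrM ler_wpM2r.
have EN N : Ex P (fun x => hN N (Z x) * w x) = c * Ex P' (fun x => hN N (Z' x)).
  rewrite /hN; under eq_fun do rewrite mulr_suml.
  rewrite (_ : (fun x => _) = fun x => \sum_(0 <= k < N) N%:R^-1 * (\1_(Z @^-1` L N k) x * w x)); last first.
    by apply/funext => x; apply: eq_bigr => k _; rewrite mulrA.
  rewrite Ex_sum; last by move=> k; apply: integZ; exact: iLw.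
  rewrite Ex_sum; last by move=> k; apply: integZ; exact: iLZ'.
  rewrite mulr_sumr; apply: eq_bigr => k _.
  rewrite ExZ; last exact: iLw.
  rewrite H// ExZ; last exact: iLZ'.
  rewrite -(Ex_indic P' (mpre _ _ _ _ mZ' (mL N k))); ring.
have h1 x : `|h x| <= 1 by case/andP: (h01 x) => h0 h1; rewrite ger0_norm.
have hN2 N x : `|hN N x| <= 2.
  case: N => [|N]; first by rewrite /hN big_geq// normr0.
  rewrite -[hN _ _](subrK (h x)) (le_trans (ler_normD _ _))//.
  rewrite -[2]/(1 + 1) lerD// distrC (le_trans (hNE _ _ _))// invf_le1 ?ltr0n//.
  by rewrite ler1n.
have Eh : Ex P (fun x => h (Z x) * w x) = c * Ex P' (fun x => h (Z' x)).
  apply/eqP; rewrite -subr_eq0 -normr_le0; apply/ler_addgt0Pl => eps e0; rewrite addr0.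
  set K := Ex P (fun x => `|w x|) + `|c|.
  have K0 : 0 <= K by rewrite addr_ge0// Ex_ge0.
  pose N := (Num.truncn (K / eps)).+1.
  have KN : K / N%:R <= eps.
    rewrite ler_pdivrMr ?ltr0n// mulrC -ler_pdivrMr//; exact/ltW/truncnS_gt.
  apply: le_trans KN.
  rewrite (_ : _ - _ = Ex P (fun x => (h (Z x) - hN N (Z x)) * w x) -
     c * Ex P' (fun x => h (Z' x) - hN N (Z' x))); last first.
    rewrite (_ : (fun x => (_ - _) * w x) = fun x => h (Z x) * w x - hN N (Z x) * w x); last first.
      by apply/funext => x; ring.
    rewrite ExB ?EN; [|exact: (iuw _ 1)|exact: (iuw _ 2)].
    rewrite ExB; [by ring|exact: iZ'|].
    by apply: (@integ_bounded _ _ _ _ _ 2) => //; exact: measurableT_comp.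
  rewrite (le_trans (ler_normB _ _))// /K mulrDl lerD//.
    rewrite mulrC -ExZ; last exact: integ_norm.
    apply: Ex_le_norm; [by apply: integZ; exact: integ_norm| |].
      apply: measurable_funM; last exact: integ_measurable iw.
      by apply: measurable_funB; exact: measurableT_comp.
    by move=> x; rewrite normrM ler_wpM2r// hNE.
  rewrite normrM ler_wpM2l//; apply: Ex_bounded => [|x]; last exact: hNE.
  by apply: measurable_funB; exact: measurableT_comp.
have HT : Ex P w = c.
  have := H setT measurableT; rewrite !preimage_setT prT mulr1 => <-; congr (Ex P _).
  by apply/funext => x; rewrite indicT mul1r.
rewrite (_ : (fun x => g (Z x) * w x) = fun x => 2 * (h (Z x) * w x) - w x); last first.
  by apply/funext => x; rewrite /h; field.
rewrite ExB//; last by apply: integZ; exact: (iuw _ 1).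
rewrite ExZ ?Eh ?HT; last exact: (iuw _ 1).
rewrite (_ : (fun x => g (Z' x)) = fun x => 2 * h (Z' x) - 1); last first.
  by apply/funext => x; rewrite /h; field.
rewrite ExB ?ExZ ?Ex_cst; [by ring|exact: iZ'|by apply: integZ; exact: iZ'|exact: integ_cst].
Qed.

Lemma Ex_same_law (Z : {RV P >-> R}) (Z' : {RV P' >-> R}) (g : R -> R) : same_law Z Z' ->
  measurable_fun setT g -> (forall x, `|g x| <= 1) ->
  Ex P (fun x => g (Z x)) = Ex P' (fun x => g (Z' x)).
Proof.
move=> ZZ' mg g1; rewrite -[RHS]mul1r.
rewrite -(@Ex_transfer Z Z' (fun=> 1) 1 g)//; last 2 first.
- exact: integ_cst.
- move=> L mL; rewrite mul1r; under eq_fun do rewrite mulr1.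
  have mZL : measurable (Z @^-1` L) by rewrite -[X in measurable X]setTI; exact: measurable_funP.
  by rewrite Ex_indic// /pr; have := ZZ' L mL; rewrite /distribution /pushforward => ->.
by congr (Ex P _); apply/funext => x; rewrite mulr1.
Qed.

End transfer.

(* The real and imaginary parts of the n-th power of the complex number a + ib. *)
Fixpoint cpow {R : realType} (a b : R) (n : nat) : R * R :=
  if n is n'.+1 then
    let p := cpow a b n' in (p.1 * a - p.2 * b, p.2 * a + p.1 * b)
  else (1, 0).

Section characteristic_functions.
Context d (S : measurableType d) (R : realType) (P : probability S R).

Lemma integ_cos (u : S -> R) : measurable_fun setT u -> integ P (fun x => cos (u x)).
Proof.
by move=> mu; apply: (@integ_bounded _ _ _ _ _ 1); [exact: measurable_cos_comp|move=> x; exact: cos_max].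
Qed.

Lemma integ_sin (u : S -> R) : measurable_fun setT u -> integ P (fun x => sin (u x)).
Proof.
by move=> mu; apply: (@integ_bounded _ _ _ _ _ 1); [exact: measurable_sin_comp|move=> x; exact: sin_max].
Qed.

Lemma cvg_cf d' (S' : measurableType d') (Q : probability S' R) (Y : nat -> S -> R) (W : S' -> R) :
  (forall n, measurable_fun setT (Y n)) -> measurable_fun setT W ->
  cvg_in_distribution P Y Q W -> forall t : R,
  ((fun n => Ex P (fun x => cos (t * Y n x))) @ \oo --> Ex Q (fun x => cos (t * W x))) /\
  ((fun n => Ex P (fun x => sin (t * Y n x))) @ \oo --> Ex Q (fun x => sin (t * W x))).
Proof.
move=> mY mW YW t.
have H (h : R -> R) : continuous h -> (forall x, `|h x| <= 1) ->
    (fun n => Ex P (fun x => h (Y n x))) @ \oo --> Ex Q (fun x => h (W x)).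
  move=> ch h1; have hb : bounded_fun h.
    by exists 1; split => // x x1 y _; exact: le_trans (h1 y) (ltW x1).
  have mh := continuous_measurable_fun ch.
  have iW : integ Q (fun x => h (W x)) by apply: (@integ_bounded _ _ _ _ _ 1) => //; exact: measurableT_comp.
  have := YW h ch hb; rewrite (integral_Ex iW).
  under eq_fun => n.
    rewrite integral_Ex; last by apply: (@integ_bounded _ _ _ _ _ 1) => //; exact: measurableT_comp.
    over.
  by move/fine_cvgP => [].
split; apply: (H (fun y => _ (t * y))) => x; try exact: cos_max; try exact: sin_max.
  by apply: continuous_comp; [apply: cvgMr; exact: cvg_id|exact: continuous_cos].
by apply: continuous_comp; [apply: cvgMr; exact: cvg_id|exact: continuous_sin].
Qed.

Let mpre (U : S -> R) L : measurable_fun setT U -> measurable L -> measurable (U @^-1` L).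
Proof. by move=> mU mL; rewrite -[X in measurable X]setTI; exact: mU. Qed.

Let mcos (t : R) : measurable_fun setT (fun y : R => cos (t * y)).
Proof. by apply: measurable_cos_comp; exact: measurable_funM. Qed.

Let msin (t : R) : measurable_fun setT (fun y : R => sin (t * y)).
Proof. by apply: measurable_sin_comp; exact: measurable_funM. Qed.

Lemma independent2_Ex (Z Z' : {RV P >-> R}) (g h : R -> R) : independent2 Z Z' ->
  measurable_fun setT g -> (forall x, `|g x| <= 1) ->
  measurable_fun setT h -> (forall x, `|h x| <= 1) ->
  Ex P (fun x => g (Z x) * h (Z' x)) = Ex P (fun x => g (Z x)) * Ex P (fun x => h (Z' x)).
Proof.
move=> ZZ' mg g1 mh h1; rewrite mulrC.
have ih : integ P (fun x => h (Z' x)).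
  by apply: (@integ_bounded _ _ _ _ _ 1) => //; exact: measurableT_comp.
apply: (@Ex_transfer _ _ _ _ _ P P Z Z (fun x => h (Z' x))) => // L mL.
have mZL : measurable (Z @^-1` L) by exact: mpre.
have iL := integ_indic P mZL.
rewrite mulrC -(@Ex_transfer _ _ _ _ _ P P Z' Z' \1_(Z @^-1` L) (pr P (Z @^-1` L)) h)//.
  by congr (Ex P _); apply/funext => x; rewrite mulrC.
move=> A mA; have mZA : measurable (Z' @^-1` A) by exact: mpre.
rewrite (_ : (fun x => _) = \1_(Z @^-1` L `&` Z' @^-1` A)); last first.
  by apply/funext => x; rewrite indicI mulrC.
rewrite Ex_indic; last exact: measurableI.
apply: EFin_inj; rewrite -pr_fin; last exact: measurableI.
by rewrite ZZ'// EFinM -!pr_fin.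
Qed.

(** Mutual independence speaks only of rectangles. The induction on [n] therefore carries the
    indicator of an event on variables of index at least [n], and each variable peeled off the sum
    joins this event. *)
Lemma independent_sum_cf (Z : nat -> {RV P >-> R}) (t a b : R) :
  mutually_independent Z ->
  (forall k, Ex P (fun x => cos (t * Z k x)) = a) ->
  (forall k, Ex P (fun x => sin (t * Z k x)) = b) -> forall n,
  Ex P (fun x => cos (t * \sum_(0 <= k < n) Z k x)) = (cpow a b n).1 /\
  Ex P (fun x => sin (t * \sum_(0 <= k < n) Z k x)) = (cpow a b n).2.
Proof.
move=> indZ cZ sZ n.
have mS k : measurable_fun setT (fun x => \sum_(0 <= i < k) Z i x).
  by apply: measurable_sum => i; exact: measurable_funP.
have mtS k : measurable_fun setT (fun x => t * \sum_(0 <= i < k) Z i x) by exact: measurable_funM.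
pose B (s : seq nat) (A : nat -> set R) := \bigcap_(i in [set` s]) (Z i @^-1` A i).
have mB s A : (forall i, measurable (A i)) -> measurable (B s A).
  by move=> mA; apply: fin_bigcap_measurable => // i _; exact: mpre.
have prB s A i L : (forall i, measurable (A i)) -> measurable L -> uniq (i :: s) ->
    pr P (Z i @^-1` L `&` B s A) = pr P (Z i @^-1` L) * pr P (B s A).
  move=> mA mL /= /andP[ins us]; pose A' j := if j == i then L else A j.
  have mA' j : measurable (A' j) by rewrite /A'; case: ifP.
  have BE : B s A = B s A'.
    apply: eq_bigcapr => j /= js; rewrite /A'; case: eqP => // ji.
    by rewrite -ji js in ins.
  have -> : Z i @^-1` L `&` B s A = B (i :: s) A'.
    rewrite BE /B; apply/seteqP; split => x.
      move=> [Lx Bx] j /=; rewrite inE => /predU1P[->|js]; first by rewrite /A' eqxx.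
      exact: Bx.
    move=> Bx; split; first by have := Bx i; rewrite /A' /= eqxx; apply; rewrite mem_head.
    by move=> j /= js; apply: Bx; rewrite /= inE js orbT.
  apply: EFin_inj; rewrite EFinM -!pr_fin//; [|exact: mB|exact: mpre|exact: mB].
  rewrite /B (indZ (i :: s) A')/= ?ins// big_cons /A' eqxx; congr (_ * _)%E.
  by rewrite -[RHS]/(P (B s A)) BE /B (indZ s A').
suff H s A : uniq s -> (forall i, i \in s -> (n <= i)%N) -> (forall i, measurable (A i)) ->
    Ex P (fun x => \1_(B s A) x * cos (t * \sum_(0 <= k < n) Z k x)) = (cpow a b n).1 * pr P (B s A) /\
    Ex P (fun x => \1_(B s A) x * sin (t * \sum_(0 <= k < n) Z k x)) = (cpow a b n).2 * pr P (B s A).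
  have B0 : B [::] (fun=> setT) = setT by apply/seteqP; split => x // _ i.
  have [] := H [::] (fun=> setT) => //; rewrite B0 prT !mulr1 => <- <-.
  by split; congr (Ex P _); apply/funext => x; rewrite indicT mul1r.
elim: n s A => [|n IH] s A us sn mA.
  under eq_fun do rewrite big_geq// mulr0 cos0 mulr1.
  under [in X in _ /\ X]eq_fun do rewrite big_geq// mulr0 sin0 mulr0.
  by rewrite Ex_cst mul0r mul1r Ex_indic//; exact: mB.
have uns : uniq (n :: s).
  by rewrite /= us andbT; apply/negP => /sn; rewrite ltnn.
have icS k : integ P (fun x => cos (t * \sum_(0 <= i < k) Z i x)) by exact: integ_cos.
have isS k : integ P (fun x => sin (t * \sum_(0 <= i < k) Z i x)) by exact: integ_sin.
have step (w : S -> R) c : integ P w -> (forall L, measurable L ->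
      Ex P (fun x => \1_(Z n @^-1` L `&` B s A) x * w x) = c * pr P (Z n @^-1` L `&` B s A)) ->
    forall g : R -> R, measurable_fun setT g -> (forall x : R, `|g x| <= 1) ->
    integ P (fun x => g (Z n x) * (\1_(B s A) x * w x)) /\
    Ex P (fun x => g (Z n x) * (\1_(B s A) x * w x)) = (c * pr P (B s A)) * Ex P (fun x => g (Z n x)).
  move=> iw Hw g mg g1; have iBw : integ P (fun x => \1_(B s A) x * w x).
    by apply: integ_indicM => //; exact: mB.
  split.
    apply: (integ_le _ _ (integ_norm iBw)).
      by apply: measurable_funM; [exact: measurableT_comp|exact: integ_measurable iBw].
    by move=> x; rewrite normrM ler_piMl.
  apply: Ex_transfer => // L mL; rewrite (mulrAC c) -mulrA -prB// -Hw//.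
  by congr (Ex P _); apply/funext => x; rewrite indicI mulrA.
have HL L : measurable L ->
    Ex P (fun x => \1_(Z n @^-1` L `&` B s A) x * cos (t * \sum_(0 <= k < n) Z k x)) =
      (cpow a b n).1 * pr P (Z n @^-1` L `&` B s A) /\
    Ex P (fun x => \1_(Z n @^-1` L `&` B s A) x * sin (t * \sum_(0 <= k < n) Z k x)) =
      (cpow a b n).2 * pr P (Z n @^-1` L `&` B s A).
  move=> mL; pose A' j := if j == n then L else A j.
  have mA' j : measurable (A' j) by rewrite /A'; case: ifP.
  have -> : Z n @^-1` L `&` B s A = B (n :: s) A'.
    rewrite /B; apply/seteqP; split => x.
      move=> [Lx Bx] j /=; rewrite inE => /predU1P[->|js]; first by rewrite /A' eqxx.
      by rewrite /A'; case: eqP => [->//|_]; exact: Bx.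
    move=> Bx; split; first by have := Bx n; rewrite /A' /= eqxx; apply; rewrite mem_head.
    move=> j /= js; have := Bx j; rewrite /A'/= inE js orbT; case: eqP => [jn|_]; last exact.
    by have := sn j js; rewrite jn ltnn.
  apply: IH => // i; rewrite inE => /predU1P[->//|/sn]; exact: ltnW.
have [i1 E1] := step _ _ (icS n) (fun L mL => (HL L mL).1) _ (mcos t) (fun x => cos_max _).
have [i2 E2] := step _ _ (icS n) (fun L mL => (HL L mL).1) _ (msin t) (fun x => sin_max _).
have [i3 E3] := step _ _ (isS n) (fun L mL => (HL L mL).2) _ (mcos t) (fun x => cos_max _).
have [i4 E4] := step _ _ (isS n) (fun L mL => (HL L mL).2) _ (msin t) (fun x => sin_max _).
split.
  rewrite -[LHS]/(Ex P _) (_ : (fun x => _) = fun x =>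
      cos (t * Z n x) * (\1_(B s A) x * cos (t * \sum_(0 <= k < n) Z k x)) -
      sin (t * Z n x) * (\1_(B s A) x * sin (t * \sum_(0 <= k < n) Z k x))); last first.
    by apply/funext => x; rewrite big_nat_recr//= mulrDr cosD; ring.
  by rewrite ExB// E1 E4 cZ sZ /=; ring.
rewrite -[LHS]/(Ex P _) (_ : (fun x => _) = fun x =>
    cos (t * Z n x) * (\1_(B s A) x * sin (t * \sum_(0 <= k < n) Z k x)) +
    sin (t * Z n x) * (\1_(B s A) x * cos (t * \sum_(0 <= k < n) Z k x))); last first.
  by apply/funext => x; rewrite big_nat_recr//= mulrDr sinD; ring.
by rewrite ExD// E2 E3 cZ sZ /=; ring.
Qed.

End characteristic_functions.

(** * The normal characteristic function *)

Section normal_characteristic_function.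
Context {R : realType}.
Variables (s : R) (s0 : 0 < s).

Notation mu := (@lebesgue_measure R).
Let p : R -> R := normal_pdf 0 s.

Let sn0 : s != 0. Proof. by rewrite gt_eqF. Qed.

Let s22 : s ^+ 2 *+ 2 = 2 * s ^+ 2. Proof. by rewrite mulr2n; ring. Qed.

Let p_ge0 x : 0 <= p x. Proof. exact: normal_pdf_ge0. Qed.

Let mp : measurable_fun setT p. Proof. exact: measurable_normal_pdf. Qed.

Let pE x : p x = normal_peak s * expR (- x ^+ 2 / (s ^+ 2 *+ 2)).
Proof. by rewrite /p normal_pdfE// /normal_fun subr0. Qed.

Let is_derive_p (x : R) : is_derive x (1 : R) p (- (x / s ^+ 2) * p x).
Proof.
rewrite (_ : p = fun x => normal_peak s * expR (- x ^+ 2 / (s ^+ 2 *+ 2))); last first.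
  by apply/funext => y; exact: pE.
apply: is_derive_eq; rewrite /GRing.scale/= s22.
by field.
Qed.

Let dom : charge_of_finite_measure (normal_prob 0 s) `<< mu.
Proof. exact: (normal_prob_dominates 0 s). Qed.

Let integ_pdf (h : R -> R) : measurable_fun setT h -> (forall x, `|h x| <= 1) ->
  (\int[normal_prob 0 s]_x (h x)%:E = \int[mu]_x (h x * p x)%:E)%E.
Proof.
move=> mh h1.
have ih : integ (normal_prob 0 s) h by apply: (@integ_bounded _ _ _ _ _ 1).
rewrite -(Radon_Nikodym_change_of_variables (mu := mu) (normal_prob_dominates 0 s) measurableT ih).
apply: ae_eq_integral => //.
- by apply: emeasurable_funM; [exact/measurable_EFinP|exact: (measurable_int _ (Radon_Nikodym_integrable dom))].
- by apply/measurable_EFinP; exact: measurable_funM.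
- have : ae_eq mu setT (Radon_Nikodym (charge_of_finite_measure (normal_prob 0 s)) mu) (EFin \o p).
    apply: integral_ae_eq => //.
    + exact: Radon_Nikodym_integrable dom.
    + exact/measurable_EFinP.
    + by move=> E _ mE; rewrite -Radon_Nikodym_integral.
  by apply: filterS => x /(_ I) /= E _; rewrite E// EFinM.
Qed.

(** A Gaussian density with twice the variance, suitably scaled, absorbs the factor |x|. It is the
    integrable majorant for [p] and [x * p], and its boundedness controls [x * p] at infinity. *)
Let xp_le : exists C (q : R -> R), [/\ 0 <= C, mu.-integrable setT (EFin \o q),
  (forall x, 0 <= q x) & forall x, p x <= q x /\ `|x| * p x <= q x /\ q x <= C].
Proof.
pose r := Num.sqrt 2 * s; have r0 : 0 < r by rewrite mulr_gt0// sqrtr_gt0.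
have rn0 : r != 0 by rewrite gt_eqF.
have r2 : r ^+ 2 = s ^+ 2 *+ 2 by rewrite /r exprMn sqr_sqrtr// mulr2n; ring.
have pr0 := normal_peak_gt0 rn0; have ps0 := normal_peak_gt0 sn0.
pose K := normal_peak s * (1 + 4 * s ^+ 2) / normal_peak r.
have K0 : 0 < K by rewrite divr_gt0// mulr_gt0// ltr_wpDr// mulr_ge0// sqr_ge0.
exists (K * normal_peak r), (fun x => K * normal_pdf 0 r x); split.
- by rewrite mulr_ge0// ltW.
- rewrite (_ : _ \o _ = fun x => (K%:E * (normal_pdf 0 r x)%:E)%E)//.
  by apply: integrableZl => //; exact: integrable_normal_pdf.
- by move=> x; rewrite mulr_ge0// ?(ltW K0)// normal_pdf_ge0.
move=> x; rewrite pE normal_pdfE// /normal_fun subr0 r2.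
set y := x ^+ 2 / (s ^+ 2 *+ 2 *+ 2).
have y0 : 0 <= y by rewrite divr_ge0 ?sqr_ge0// !mulrn_wge0// sqr_ge0.
have -> : - x ^+ 2 / (s ^+ 2 *+ 2 *+ 2) = - y by rewrite /y mulNr.
have -> : - x ^+ 2 / (s ^+ 2 *+ 2) = - y - y.
  by rewrite /y s22 (_ : 2 * s ^+ 2 *+ 2 = 4 * s ^+ 2); [field|ring].
rewrite expRD; set e := expR (- y).
have e0 : 0 < e by exact: expR_gt0.
have x2 : x ^+ 2 = 4 * s ^+ 2 * y by rewrite /y s22 (_ : 2 * s ^+ 2 *+ 2 = 4 * s ^+ 2); [field|ring].
have eb : (1 + y) * e <= 1.
  by rewrite /e expRN ler_pdivrMr ?expR_gt0// mul1r expR_ge1Dx.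
have xb : `|x| <= 1 + x ^+ 2 by rewrite -(real_normK (num_real x)); have := sqr_ge0 (`|x| - 1); nra.
have s2 := sqr_ge0 s.
have E : K * (normal_peak r * e) = normal_peak s * ((1 + 4 * s ^+ 2) * e).
  by rewrite /K; field; rewrite gt_eqF.
have e1 : e <= 1 by rewrite -expR0 ler_expR lerNl oppr0.
have b1 : (1 + 4 * s ^+ 2 * y) * e <= 1 + 4 * s ^+ 2.
  apply: (@le_trans _ _ ((1 + 4 * s ^+ 2) * ((1 + y) * e))).
    rewrite mulrA ler_wpM2r ?(ltW e0)//; nra.
  by rewrite ler_piMr// addr_ge0// mulr_ge0.
rewrite E; split; last split.
- rewrite ler_wpM2l ?(ltW ps0)// ler_wpM2r ?(ltW e0)//.
  by apply: (le_trans e1); rewrite lerDl mulr_ge0.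
- rewrite mulrCA ler_wpM2l ?(ltW ps0)// mulrA ler_wpM2r ?(ltW e0)//.
  by apply: le_trans b1; rewrite ler_wpM2r ?(ltW e0)// -x2.
- rewrite /K divfK ?gt_eqF// ler_wpM2l ?(ltW ps0)// ler_piMr//.
  by rewrite addr_ge0// mulr_ge0.
Qed.

Let psi (a t : R) : R := \int[mu]_x (cos (t * x + a) * p x).

Let is_derive_cos (a t x : R) :
  is_derive t (1 : R) (fun t => cos (t * x + a) * p x) (- x * sin (t * x + a) * p x).
Proof.
apply: is_derive_eq; rewrite /GRing.scale/= ?mulr0 ?add0r ?addr0 ?mulr1.
by ring.
Qed.

(** Stein's identity: the derivative of [sin (t * x + a) * p x] has integral 0 over the line. *)
Let by_parts (a t : R) :
  (\int[mu]_x (- x * sin (t * x + a) * p x)) = - (s ^+ 2 * t) * psi a t.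
Proof.
have [C [q [C0 iq q0 pq]]] := xp_le.
pose F x := sin (t * x + a) * p x.
pose f x := t * (cos (t * x + a) * p x) + (s ^+ 2)^-1 * (- x * sin (t * x + a) * p x).
have dF (x : R) : is_derive x (1 : R) F (f x).
  have := is_derive_p x => dp.
  apply: is_derive_eq; rewrite /GRing.scale/= /f ?mulr0 ?add0r ?addr0 ?mulr1.
  by ring.
have mc : measurable_fun setT (fun x => cos (t * x + a) * p x).
  by apply: measurable_funM => //; apply: measurable_cos_comp; apply: measurable_funD => //; exact: measurable_funM.
have ms : measurable_fun setT (fun x : R => - x * sin (t * x + a) * p x).
  apply: measurable_funM => //; apply: measurable_funM; first exact: oppr_measurable.
  by apply: measurable_sin_comp; apply: measurable_funD => //; exact: measurable_funM.
have ic : mu.-integrable setT (EFin \o (fun x => cos (t * x + a) * p x)).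
  apply: le_integrable iq => //; first exact/measurable_EFinP.
  move=> x _; rewrite /= lee_fin normrM (ger0_norm (p_ge0 x)) (ger0_norm (q0 x)).
  by apply: le_trans (pq x).1; rewrite ler_piMl ?cos_max.
have is_ : mu.-integrable setT (EFin \o (fun x => - x * sin (t * x + a) * p x)).
  apply: le_integrable iq => //; first exact/measurable_EFinP.
  move=> x _; rewrite /= lee_fin !normrM normrN (ger0_norm (p_ge0 x)) (ger0_norm (q0 x)).
  apply: le_trans (pq x).2.1; rewrite mulrAC ler_piMr ?sin_max//.
  by rewrite mulr_ge0.
have cF (G G' : R -> R) : (forall x : R, is_derive x (1 : R) G (G' x)) -> continuous G.
  by move=> dG z; apply: differentiable_continuous; apply/derivable1_diffP; have [] := dG z.
have cp : continuous p := cF _ _ is_derive_p.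
have cf : continuous f.
  have ct b : continuous (fun x : R => t * x + b).
    by move=> x; apply: cvgD; [apply: cvgMr; exact: cvg_id|exact: cvg_cst].
  move=> x; apply: cvgD; apply: cvgMr.
    by apply: cvgM; [exact: (continuous_comp (ct a x) (@continuous_cos R _))|exact: cp].
  apply: cvgM; last exact: cp.
  apply: cvgM; first by apply: cvgN; exact: cvg_id.
  exact: (continuous_comp (ct a x) (@continuous_sin R _)).
have mf : measurable_fun setT f := continuous_measurable_fun cf.
have iF : mu.-integrable setT (EFin \o f).
  rewrite (_ : EFin \o f = (fun x => (t%:E * (cos (t * x + a) * p x)%:E)%E) \+
    (fun x => ((s ^+ 2)^-1%:E * (- x * sin (t * x + a) * p x)%:E)%E))//.
  by apply: integrableD => //; exact: integrableZl.
have If : (\int[mu]_x f x) = t * psi a t + (s ^+ 2)^-1 * (\int[mu]_x (- x * sin (t * x + a) * p x)).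
  rewrite /f RintegralD//; last 2 first.
  - by rewrite (_ : _ \o _ = fun x => (t%:E * (cos (t * x + a) * p x)%:E)%E)//; exact: integrableZl.
  - by rewrite (_ : _ \o _ = fun x => ((s ^+ 2)^-1%:E * (- x * sin (t * x + a) * p x)%:E)%E)//; exact: integrableZl.
  by rewrite !RintegralZl.
suff I0 : (\int[mu]_x f x) = 0.
  rewrite I0 in If; move: If; set X := (\int[mu]_x (- x * _ * _)) => If.
  apply: (mulfI (x := (s ^+ 2)^-1)); first by rewrite invr_neq0// expf_neq0.
  have -> : s ^- 2 * (- (s ^+ 2 * t) * psi a t) = - (t * psi a t) by field.
  by apply/eqP; rewrite -addr_eq0 addrC -If.
pose I_ n : set R := `[- n.+1%:R, n.+1%:R]%classic.
have cI : (fun n => (\int[mu]_x (f x * \1_(I_ n) x)%:E)%E) @ \oo --> (\int[mu]_x (f x)%:E)%E.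
  have [] := @dominated_convergence _ _ _ mu setT measurableT
    (fun n x => (f x * \1_(I_ n) x)%:E) (EFin \o f) (fun x => `|(EFin \o f) x|%E).
  - move=> n; apply/measurable_EFinP; apply: measurable_funM => //.
    by apply: measurable_indic; exact: measurable_itv.
  - exact/measurable_EFinP.
  - apply: aeW => x _; apply: cvg_EFin; first exact: nearW.
    apply: cvg_near_cst; exists (Num.truncn `|x|).+1 => // n /= xn.
    rewrite indicE mem_set ?mulr1//= /I_/= in_itv/= -ler_norml.
    apply: ltW; apply: (lt_le_trans (truncnS_gt _)); rewrite ler_nat.
    by rewrite (leq_trans xn).
  - exact: integrable_abse.
  - apply: aeW => x n _; rewrite /= lee_fin normrM ler_piMr//.
    by rewrite indicE; case: (_ \in _); rewrite ?normr1 ?normr0.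
  by move=> _ _.
have EI n : (\int[mu]_x (f x * \1_(I_ n) x)%:E = (F n.+1%:R - F (- n.+1%:R))%:E)%E.
  rewrite EFinB -(@continuous_FTC2 _ f F) //.
  - rewrite [RHS]integral_mkcond; apply: eq_integral => x _.
    by rewrite patchE indicE /I_; case: ifPn => _; rewrite ?mulr1 ?mulr0.
  - by rewrite (@lt_trans _ _ 0)// ?ltr0n// oppr_lt0 ltr0n.
  - exact: continuous_subspaceT.
  - split => [x _||]; first by have [] := dF x.
      by apply: cvg_at_right_filter; exact: (cF _ _ dF).
    by apply: cvg_at_left_filter; exact: (cF _ _ dF).
  - by move=> x _; rewrite derive1E; have [] := dF x.
(* [|x| * p x] is bounded, so [F] is O(1/n) at the two end points. *)
have F0 : (fun n => F n.+1%:R - F (- n.+1%:R)) @ \oo --> (0 : R).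
  apply: norm_cvg0; apply: (@squeeze_cvgr _ _ _ _ (fun=> 0) (fun n => 2 * C * n.+1%:R^-1)).
  - apply: nearW => n; rewrite normr_ge0/=.
    have n0 : 0 < n.+1%:R :> R by rewrite ltr0n.
    have Fb (x : R) : `|x| = n.+1%:R -> `|F x| <= C * n.+1%:R^-1.
      move=> xn; rewrite ler_pdivlMr// mulrC -xn /F normrM (ger0_norm (p_ge0 x)).
      apply: (le_trans _ (pq x).2.2); apply: le_trans (pq x).2.1.
      by rewrite mulrCA ler_piMl ?sin_max// mulr_ge0.
    rewrite (le_trans (ler_normB _ _))// mulrDl mul1r mulrDl lerD// Fb//.
      by rewrite ger0_norm// ltW.
    by rewrite normrN ger0_norm// ltW.
  - exact: cvg_cst.
  - by rewrite -[X in _ --> X](mulr0 (2 * C)); apply: cvgMr; exact: cvg_harmonic.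
rewrite /Rintegral; move: cI; under eq_fun do rewrite EI.
move=> cI; have cE : (fun n => (F n.+1%:R - F (- n.+1%:R))%:E) @ \oo --> (0 : R)%:E.
  by apply: cvg_EFin F0; exact: nearW.
by rewrite (cvg_unique _ cI cE).
Qed.

Let is_derive_psi (a t : R) : is_derive t (1 : R) (psi a) (- (s ^+ 2 * t) * psi a t).
Proof.
have [C [q [C0 iq q0 pq]]] := xp_le.
pose g (t x : R) := cos (t * x + a) * p x.
have dg (u x : R) : partial1of2 g u x = - x * sin (u * x + a) * p x.
  by rewrite partial1of2E; have [] := is_derive_cos a u x.
have ta : (`]t - 1, t + 1[%classic : set R) t by rewrite /= in_itv/=; apply/andP; split; lra.
have ig (u : R) : `]t - 1, t + 1[%classic u -> mu.-integrable setT (EFin \o g u).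
  move=> _; apply: le_integrable iq => //.
    apply/measurable_EFinP; apply: measurable_funM => //; apply: measurable_cos_comp.
    by apply: measurable_funD => //; exact: measurable_funM.
  move=> x _; rewrite /= lee_fin /g normrM (ger0_norm (p_ge0 x)) (ger0_norm (q0 x)).
  by apply: le_trans (pq x).1; rewrite ler_piMl ?cos_max.
have dg1 (u x : R) : `]t - 1, t + 1[%classic u -> setT x -> derivable (g ^~ x) u 1.
  by move=> _ _; have [] := is_derive_cos a u x.
have gb (u x : R) : `]t - 1, t + 1[%classic u -> setT x -> `|partial1of2 g u x| <= q x.
  move=> _ _; rewrite dg !normrM normrN (ger0_norm (p_ge0 x)).
  by apply: le_trans (pq x).2.1; rewrite mulrAC ler_piMr ?sin_max// mulr_ge0.
rewrite -by_parts; apply: DeriveDef.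
  exact: (derivable_under_integral measurableT ta ig dg1 q0 iq gb).
rewrite -derive1E (differentiation_under_integral measurableT ta ig dg1 q0 iq gb).
by apply: eq_Rintegral => x _; rewrite dg.
Qed.

(** [psi a] solves a linear differential equation, so its quotient by the expected Gaussian factor
    is constant. The phase [a] treats cosine and sine at once. *)
Lemma normal_cf (a t : R) :
  Ex (normal_prob 0 s) (fun x : R => cos (t * x + a)) = cos a * expR (- (s ^+ 2 * t ^+ 2 / 2)).
Proof.
have mc u : measurable_fun setT (fun x : R => cos (u * x + a)).
  by apply: measurable_cos_comp; apply: measurable_funD => //; exact: measurable_funM.
have E u : Ex (normal_prob 0 s) (fun x : R => cos (u * x + a)) = psi a u.
  rewrite /Rintegral integ_pdf// => x; exact: cos_max.
have dG (u : R) : is_derive u (1 : R) (fun u => psi a u * expR (s ^+ 2 * u ^+ 2 / 2)) 0.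
  have dpsi := is_derive_psi a u.
  apply: is_derive_eq; rewrite /GRing.scale/=.
  by field.
have := is_derive_0_is_cst t 0 dG.
rewrite -(E 0) expr0n mulr0 mul0r expR0 mulr1.
rewrite (_ : (fun x : R => cos (0 * x + a)) = fun=> cos a); last first.
  by apply/funext => x; rewrite mul0r add0r.
rewrite Ex_cst E expRN => <-; rewrite mulfK// gt_eqF// expR_gt0//.
Qed.

End normal_characteristic_function.

(** * Locally Lipschitz observables *)

Section cylinder_approximation.
Context d (S : measurableType d) (R : realType) (m : probability S R).
Variables (T : S -> S) (a b : nat -> set S) (s : seq nat) (theta C : R).
Hypothesis M : markov_model m T a b s theta C.

Let cyl_union (Q : set (seq nat)) := \bigcup_(w in Q) cylinder T a w.

Let mcyl_union Q : measurable (cyl_union Q).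
Proof. exact: (measurable_cylinder_bigcup M). Qed.

Let mY (A B : set S) : measurable A -> measurable B -> measurable (A `+` B).
Proof. by move=> mA mB; apply: measurableU; exact: measurableD. Qed.

Lemma pr_eventually0 (G : nat -> set S) : (forall n, measurable (G n)) ->
  (forall x, \forall n \near \oo, ~ G n x) -> (fun n => pr m (G n)) @ \oo --> (0 : R).
Proof.
move=> mG G0; under eq_fun do rewrite -Ex_indic//; rewrite -(Ex_cst m 0).
apply: (@cvg_Ex _ _ _ _ _ _ (fun=> 1)) => //.
- exact: integ_cst.
- by move=> n x; rewrite indicE; case: (_ \in _); rewrite ?normr1 ?normr0 ?ler01.
- move=> x; apply: cvg_near_cst; have := G0 x; apply: filterS => n nG.
  by rewrite indicE memNset.
Qed.

(** Approximation is required at all large lengths, so that two sets can be approximated by words of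
    one common length when unions are taken. *)
Definition cylinder_approximable (A : set S) := measurable A /\
  forall eps : R, 0 < eps -> exists n0, forall n, (n0 <= n)%N ->
    exists Q : set (seq nat), (forall w, Q w -> size w = n.+1) /\
      pr m (A `+` \bigcup_(w in Q) cylinder T a w) <= eps.

Let approx0 : cylinder_approximable set0.
Proof.
split => // eps e0; exists 0%N => n _; exists set0; split => //.
by rewrite bigcup_set0 (_ : _ `+` _ = set0) ?pr0 ?ltW//; rewrite /setY setDv setU0.
Qed.

Let approxC A : cylinder_approximable A -> cylinder_approximable (~` A).
Proof.
move=> [mA HA]; split; first exact: measurableC.
move=> eps e0; have [n0 Hn0] := HA eps e0; exists n0 => n /Hn0[Q [Qn QA]].
exists [set w | size w = n.+1 /\ ~ Q w]; split; first by move=> w [].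
set N := ~` \bigcup_(w in [set w | size w = n.+1]) cylinder T a w.
have mN : measurable N by apply: measurableC; exact: mcyl_union.
apply: (@le_trans _ _ (pr m ((A `+` cyl_union Q) `|` N))).
  apply: le_pr; [by apply: mY; [exact: measurableC|exact: mcyl_union]|
    by apply: measurableU => //; exact: mY|].
  move=> x [[nAx nUx]|[[w [wn nQw] xw] nnA]]; last first.
    left; left; split; first exact: contrapT.
    move=> [w' Qw' xw']; apply: nQw; rewrite (@cylinder_eq_size _ _ _ _ _ _ _ _ _ _ M w w')//.
      by rewrite wn Qn.
    by exists x.
  have [[w wn xw]|nx] := pselect ((\bigcup_(w in [set w | size w = n.+1]) cylinder T a w) x); last by right.
  left; right; split => //; exists w => //; apply: contrapT => nQ.
  by apply: nUx; exists w.
rewrite (le_trans (prU_le _ (mY mA (mcyl_union Q)) mN))// /N (cylinder_cover M) addr0//.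
Qed.

Let approxU A B : cylinder_approximable A -> cylinder_approximable B ->
  cylinder_approximable (A `|` B).
Proof.
move=> [mA HA] [mB HB]; split; first exact: measurableU.
move=> eps e0; have e20 : 0 < eps / 2 by rewrite divr_gt0.
have [n1 Hn1] := HA _ e20; have [n2 Hn2] := HB _ e20.
exists (maxn n1 n2) => n; rewrite geq_max => /andP[/Hn1[Q1 [Q1n Q1A]] /Hn2[Q2 [Q2n Q2B]]].
exists (Q1 `|` Q2); split; first by move=> w [/Q1n|/Q2n].
apply: (@le_trans _ _ (pr m ((A `+` cyl_union Q1) `|` (B `+` cyl_union Q2)))).
  apply: le_pr; [by apply: mY; [exact: measurableU|exact: mcyl_union]|
    by apply: measurableU; apply: mY|].
  rewrite bigcup_setU => x [[[Ax|Bx] nU]|[[Ux|Ux] nAB]].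
  - by left; left; split => // Ux; apply: nU; left.
  - by right; left; split => // Ux; apply: nU; right.
  - by left; right; split => // Ax; apply: nAB; left.
  - by right; right; split => // Ax; apply: nAB; right.
rewrite (le_trans (prU_le _ (mY mA (mcyl_union Q1)) (mY mB (mcyl_union Q2))))//.
by rewrite [leRHS]splitr lerD.
Qed.

Let approx_bigcup (F : nat -> set S) : (forall k, cylinder_approximable (F k)) ->
  cylinder_approximable (\bigcup_k F k).
Proof.
move=> HF; have mF k := (HF k).1.
have mUF : measurable (\bigcup_k F k) by exact: bigcup_measurable.
split => // eps e0.
pose U K := \big[setU/set0]_(k < K) F k.
have HU K : cylinder_approximable (U K).
  rewrite /U; elim: K => [|K IH]; first by rewrite big_ord0.
  by rewrite big_ord_recr; exact: approxU.
have : (fun K => pr m (\bigcup_k F k `\` U K)) @ \oo --> (0 : R).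
  apply: pr_eventually0 => [K|x]; first by apply: measurableD => //; exact: (HU K).1.
  have [[k _ Fkx]|nFx] := pselect ((\bigcup_k F k) x); last by apply: nearW => K [].
  exists k.+1 => // K /= kK [_]; apply; rewrite /U -bigcup_mkord.
  by exists k.
have e20 : 0 < eps / 2 by rewrite divr_gt0.
move=> /cvgrPdist_le/(_ _ e20)[K _ /(_ K (leqnn K))] /=; rewrite sub0r normrN => UK.
have {}UK := le_trans (ler_norm _) UK.
have [n0 Hn0] := (HU K).2 _ e20; exists n0 => n /Hn0[Q [Qn QU]]; exists Q; split => //.
have mUK := (HU K).1.
apply: (@le_trans _ _ (pr m ((\bigcup_k F k `\` U K) `|` (U K `+` cyl_union Q)))).
  apply: le_pr; [by apply: mY => //; exact: mcyl_union|
    by apply: measurableU; [exact: measurableD|exact: mY]|].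
  move=> x [[Fx nU]|[Ux nF]].
    have [UKx|UKx] := pselect (U K x); last by left.
    by right; left.
  right; right; split => // UKx; apply: nF.
  by move: UKx; rewrite /U -bigcup_mkord => -[k _ Fk]; exists k.
by rewrite (le_trans (prU_le _ (measurableD mUF mUK) (mY mUK (mcyl_union Q))))// [leRHS]splitr lerD.
Qed.

Lemma cylinder_approximable_sigma_algebra : sigma_algebra setT cylinder_approximable.
Proof.
split; [exact: approx0|by move=> A HA; rewrite setTD; exact: approxC|exact: approx_bigcup].
Qed.

End cylinder_approximation.

(** * Cylinders generate the measurable sets modulo 0 *)

Section metric_approximation.
Context {R : realType} {d} {X : metricMeasurableType R d}.
Variables (m : probability X R) (T : X -> X).
Variables (a b : nat -> set X) (s : seq nat) (theta C M0 : R).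
Hypothesis M : markov_model m T a b s theta C.
Hypothesis geo : forall w, \forall x \ae m, \forall y \ae m,
  cylinder T a w x -> cylinder T a w y -> mdist x y <= M0 * theta ^+ size w.
Hypothesis bor : borel_mod0 m.

Lemma ae_forall_seq (P : seq nat -> X -> Prop) :
  (forall w, \forall x \ae m, P w x) -> \forall x \ae m, forall w, P w x.
Proof.
move=> H; have H' : forall k, \forall x \ae m, forall w, choice.pickle w = k -> P w x.
  move=> k; have [[w wk]|nw] := pselect (exists w : seq nat, choice.pickle w = k).
    apply: filterS (H w) => x Pwx w' w'k.
    by rewrite (_ : w' = w)//; apply: (pcan_inj choice.pickleK); rewrite w'k.
  by apply: aeW => x w wk; exfalso; apply: nw; exists w.
by apply: filterS (ae_foralln H') => x Px w; exact: Px erefl.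
Qed.

(** Cylinders around almost every point shrink to it, so the cylinders contained in [U] modulo 0
    exhaust [U] as their length grows. *)
Lemma open_cylinder_approximable (U : set X) : open U -> cylinder_approximable m T a U.
Proof.
move=> oU; have mU := bor.1 _ oU; split => // eps e0.
have mcyl w : measurable (cylinder T a w) := measurable_cylinder M w.
have [theta0 theta1] : 0 < theta /\ theta < 1 by apply/andP; exact: mm_theta M.
pose Q n := [set w | size w = n.+1 /\ pr m (cylinder T a w `\` U) = 0].
pose V n := \bigcup_(w in Q n) cylinder T a w.
have mV n : measurable (V n) := measurable_cylinder_bigcup M _.
have VU n : pr m (V n `\` U) = 0.
  apply: pr_negligible; first exact: measurableD.
  rewrite /V setD_bigcupl.
  have : \forall x \ae m, forall w, Q n w -> ~ (cylinder T a w `\` U) x.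
    apply: ae_forall_seq => w; have [[_ w0]|nQ] := pselect (Q n w); last by apply: aeW.
    have nC := pr_eq0_negligible (measurableD (mcyl w) mU) w0.
    by apply: negligibleS nC => x /= h; apply: contrapT => nx; apply: h.
  apply: negligibleS => x [w Qw xw] /= h; exact: (h w Qw xw).
have good : \forall x \ae m, (forall w, \forall y \ae m,
    cylinder T a w x -> cylinder T a w y -> mdist x y <= M0 * theta ^+ size w) /\
    (forall n, exists2 w, size w = n & cylinder T a w x).
  apply: filterI; first exact: ae_forall_seq.
  apply: ae_foralln => n; have mU' : measurable (\bigcup_(w in [set w | size w = n]) cylinder T a w).
    exact: (measurable_cylinder_bigcup M).
  have := pr_eq0_negligible (measurableC mU') (cylinder_cover M n).
  by apply: negligibleS => x /= h [w wn xw]; apply: h; exists w.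
have [N [mN N0 goodN]] := good.
have prN : pr m N = 0 by rewrite /pr N0.
have : (fun n => pr m ((U `\` V n) `\` N)) @ \oo --> (0 : R).
  apply: pr_eventually0 => [n|x]; first by apply: measurableD => //; exact: measurableD.
  have [Ux|nUx] := pselect (U x); last by apply: nearW => n [[]].
  have [Nx|nNx] := pselect (N x); first by apply: nearW => n [].
  have [gx1 gx2] : (forall w, \forall y \ae m,
      cylinder T a w x -> cylinder T a w y -> mdist x y <= M0 * theta ^+ size w) /\
      (forall n, exists2 w, size w = n & cylinder T a w x).
    by apply: contrapT => h; apply: nNx; exact: goodN.
  have /nbhs_ballP[r /= r0 rU] : nbhs x U by exact: open_nbhs_nbhs.
  have cM : M0 * theta ^+ n @[n --> \oo] --> M0 * 0.
    by apply: cvgMr; apply: cvg_expr; rewrite ger0_norm ?ltW.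
  rewrite mulr0 in cM; have /cvgrPdist_lt/(_ r r0)[n0 _ Hn0] := cM.
  exists n0 => // n /= n0n [[_ nV] _]; apply: nV; have [w wn xw] := gx2 n.+1.
  exists w => //; split => //; apply: pr_negligible; first exact: measurableD.
  apply: negligibleS (gx1 w) => y [yw nUy] /= /(_ xw yw) h; apply: nUy; apply: rU.
  rewrite ballEmdist /=; apply: (le_lt_trans h); rewrite wn.
  by have := Hn0 n.+1 (leqW n0n); rewrite /= sub0r normrN; apply: le_lt_trans; exact: ler_norm.
move=> /cvgrPdist_le/(_ _ e0)[n0 _ Hn0]; exists n0 => n /Hn0/=; rewrite sub0r normrN => Un.
exists (Q n); split; first by move=> w [].
apply: le_trans (le_trans (ler_norm _) Un).
apply: (@le_trans _ _ (pr m ((((U `\` V n) `\` N) `|` N) `|` (V n `\` U)))).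
  apply: le_pr.
  - by apply: measurableU; apply: measurableD => //; exact: (mV n).
  - apply: measurableU; last exact: measurableD.
    by apply: measurableU => //; apply: measurableD => //; exact: measurableD.
  - move=> x [UV|VU']; last by right.
    by left; have [Nx|nN] := pselect (N x); [right|left].
have m1 : measurable ((U `\` V n) `\` N) by apply: measurableD => //; exact: measurableD.
rewrite (le_trans (prU_le _ (measurableU _ _ m1 mN) (measurableD (mV n) mU)))// VU addr0.
by rewrite (le_trans (prU_le _ m1 mN))// prN addr0.
Qed.

Lemma measurable_cylinder_approximable (A : set X) (eps : R) : measurable A -> 0 < eps ->
  exists n (Q : set (seq nat)), (forall w, Q w -> size w = n.+1) /\
    pr m (A `+` \bigcup_(w in Q) cylinder T a w) <= eps.
Proof.
move=> mA e0; have [B sB AB] := bor.2 A mA.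
have [mB /(_ eps e0)[n /(_ n (leqnn n))[Q [Qn QB]]]] : cylinder_approximable m T a B.
  apply: sB; split; first exact: (cylinder_approximable_sigma_algebra M).
  exact: open_cylinder_approximable.
exists n, Q; split => //.
have mU : measurable (\bigcup_(w in Q) cylinder T a w).
  exact: (measurable_cylinder_bigcup M).
have mY (E F : set X) : measurable E -> measurable F -> measurable (E `+` F).
  by move=> mE mF; apply: measurableU; exact: measurableD.
apply: le_trans QB.
apply: (@le_trans _ _ (pr m ((A `+` B) `|` (B `+` \bigcup_(w in Q) cylinder T a w)))).
  apply: le_pr; [exact: mY|by apply: measurableU; exact: mY|].
  move=> x [[Ax nU]|[Ux nA]].
    by have [Bx|nB] := pselect (B x); [right; left|left; left].
  by have [Bx|nB] := pselect (B x); [left; right|right; right].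
rewrite (le_trans (prU_le _ (mY _ _ mA mB) (mY _ _ mB mU)))//.
by rewrite (pr_negligible (mY _ _ mA mB) AB) add0r.
Qed.

End metric_approximation.

(** [Dl] is the function equal to [Dn i] on [a i]: the moment condition needs a function on the
    space, the Lipschitz bounds need a number for each symbol. *)
Record regular_observable {d} {S : measurableType d} {R : realType} (m : probability S R)
  (T : S -> S) (a : nat -> set S) (theta eta : R) (f Dl : S -> R) (Dn : nat -> R) : Prop :=
  RegularObservable {
  ro_eta : 0 < eta <= 1 ;
  ro_f : measurable_fun setT f ;
  ro_Dl : measurable_fun setT Dl ;
  ro_Dl_ge0 : forall x, 0 <= Dl x ;
  ro_Dn_ge0 : forall i, 0 <= Dn i ;
  ro_DlE : forall i x, a i x -> Dl x = Dn i ;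
  ro_integ : integ m (fun x => Dl x `^ eta) ;
  ro_lip : forall i w, \forall x \ae m, \forall y \ae m,
    cylinder T a (i :: w) x -> cylinder T a (i :: w) y ->
    `|f x - f y| <= Dn i * theta ^+ size w ;
  ro_bounded : forall i, exists B, forall x, a i x -> `|f x| <= B }.

Section gibbs_markov_observable.
Context {R : realType} {d} {X : metricMeasurableType R d}.
Variables (m : probability X R) (T : X -> X) (alpha : set (set X)) (f : X -> R) (eta : R).
Hypothesis eta01 : 0 < eta <= 1.

Let g A : \bar R := (m A * lipschitz_const f A `^ eta)%E.

Hypothesis Df : (\esum_(A in alpha) g A < +oo)%E.
Hypothesis alP : forall A, alpha A -> measurable A /\ (0 < m A)%E.

Lemma lipschitz_const_ge0 A : (0 <= lipschitz_const f A)%E.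
Proof. by apply: le_ereal_inf_tmp => _ [K [K0 _] <-]; rewrite lee_fin. Qed.

Let g_ge0 A : (0 <= g A)%E.
Proof. by rewrite /g mule_ge0 ?poweR_ge0. Qed.

(** An infinite constant on a set of positive mass would make one term of the sum infinite. *)
Let lip_lty A : alpha A -> (lipschitz_const f A < +oo)%E.
Proof.
move=> aA; have [_ mA0] := alP aA; have eta0 : eta != 0 by case/andP: eta01 => /gt_eqF ->.
apply: (lty_poweRy eta0); rewrite ltey; apply/eqP => lA.
have : (g A <= \esum_(A in alpha) g A)%E.
  apply: esum_ge; exists [set A]; last by rewrite fsbig_set1.
  by split => // B ->.
rewrite /g lA gt0_muley// => h; have := le_lt_trans h Df.
by rewrite ltxx.
Qed.

Lemma lipschitz_const_bound A x y : (lipschitz_const f A < +oo)%E -> A x -> A y ->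
  `|f x - f y| <= fine (lipschitz_const f A) * mdist x y.
Proof.
move=> lA Ax Ay.
have lfin : lipschitz_const f A \is a fin_num by rewrite ge0_fin_numE ?lipschitz_const_ge0.
have [xy|nxy] := eqVneq x y; first by rewrite xy subrr normr0 mdistxx mulr0.
have dxy : 0 < mdist x y by rewrite mdist_gt0.
rewrite -ler_pdivrMr// -lee_fin fineK//; apply: le_ereal_inf_tmp => _ [K [K0 HK] <-].
by rewrite lee_fin ler_pdivrMr// HK.
Qed.

Lemma gibbs_markov_observable (a b : nat -> set X) (s : seq nat) (theta C M0 : R)
    (e : nat -> set X) :
  measurable_fun setT f -> markov_model m T a b s theta C -> 0 <= M0 ->
  (forall w, \forall x \ae m, \forall y \ae m,
    cylinder T a w x -> cylinder T a w y -> mdist x y <= M0 * theta ^+ size w) ->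
  bounded_metric X ->
  (forall i, e i = set0 \/ alpha (e i)) ->
  (forall i, a i `<=` e i /\ pr m (e i) = pr m (a i)) ->
  exists Dl Dn, regular_observable m T a theta eta f Dl Dn.
Proof.
move=> mf M M00 geo [Md Mdist] eP ae_.
have [eta0 eta1] := andP eta01.
have [theta0 theta1] : 0 < theta /\ theta < 1 by apply/andP; exact: mm_theta M.
have ma := mm_a M; have ta := mm_triv M.
pose L i := fine (lipschitz_const f (e i)).
have L0 i : 0 <= L i by rewrite fine_ge0// lipschitz_const_ge0.
have me i : measurable (e i) by have [->//|/alP[]] := eP i.
have Lf i x y : a i x -> a i y -> `|f x - f y| <= L i * mdist x y.
  move=> /(ae_ i).1 ex /(ae_ i).1 ey; apply: lipschitz_const_bound => //.
  by have [e0|/lip_lty//] := eP i; rewrite e0 in ex.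
pose Dn i := M0 * L i.
have Dn0 i : 0 <= Dn i by rewrite mulr_ge0.
(* The default symbol 0, taken outside the [a i], is cancelled by the indicator in [Dl]. *)
pose lab x := xget 0%N [set i | a i x].
have labE i x : a i x -> lab x = i.
  move=> ax; have la : a (lab x) x by exact: (xgetPex 0%N (ex_intro (fun i => a i x) i ax)).
  by apply: ta => //; exists x.
pose A := \bigcup_i a i.
have mA : measurable A by exact: bigcup_measurable.
pose Dl x := \1_A x * Dn (lab x).
have DlE i x : a i x -> Dl x = Dn i.
  by move=> ax; rewrite /Dl (labE _ _ ax) indicE mem_set ?mul1r//; exists i.
have DlN x : ~ A x -> Dl x = 0 by move=> nA; rewrite /Dl indicE memNset// mul0r.
have mDl : measurable_fun setT Dl.
  move=> _ B mB; rewrite setTI.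
  have -> : Dl @^-1` B = (\bigcup_(i in [set i | B (Dn i)]) a i) `|`
      (if 0 \in B then ~` A else set0).
    apply/seteqP; split => x /=.
      have [[i _ ax]|nA] := pselect (A x); first by rewrite (DlE i)// => Bi; left; exists i.
      by rewrite DlN// => B0; right; rewrite mem_set.
    move=> [[i Bi ax]|]; first by rewrite (DlE i).
    by case: ifPn => // /set_mem B0 nA; rewrite DlN.
  apply: measurableU; first by apply: bigcup_measurable => i _; exact: ma.
  by case: ifP => // _; exact: measurableC.
have Dl0 x : 0 <= Dl x by rewrite /Dl mulr_ge0.
have mDe : measurable_fun setT (fun x => Dl x `^ eta).
  by apply: (measurableT_comp (measurable_powR _)).
exists Dl, Dn; split => //.
- apply/integrableP; split; first exact/measurable_EFinP.
  rewrite (eq_integral (fun x => (Dl x `^ eta)%:E)); last first.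
    by move=> x _; rewrite /= ger0_norm ?powR_ge0.
  have -> : (\int[m]_x (Dl x `^ eta)%:E = \int[m]_(x in A) (Dl x `^ eta)%:E)%E.
    rewrite [RHS]integral_mkcond; apply: eq_integral => x _; rewrite patchE.
    case: ifPn => // /negP nA; rewrite DlN ?powR0 ?gt_eqF//.
    by move=> Ax; apply: nA; exact: mem_set.
  rewrite ge0_integral_bigcup//; last 2 first.
  - by apply/measurable_EFinP; exact: measurable_funTS.
  - by move=> x _; rewrite lee_fin powR_ge0.
  have Ei i : (\int[m]_(x in a i) (Dl x `^ eta)%:E = (M0 `^ eta)%:E * g (e i))%E.
    rewrite (eq_integral (fun=> (Dn i `^ eta)%:E)); last first.
      by move=> x /set_mem ax; rewrite (DlE i).
    rewrite integral_cst// [X in (_ * X)%E](_ : _ = (pr m (a i))%:E); last exact: pr_fin.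
    rewrite /g; have [e0|ai] := eqVneq (e i) set0.
      by rewrite -(ae_ i).2 e0 pr0 measure0 mul0e !mule0.
    have {}ai : alpha (e i) by have [e0|//] := eP i; rewrite e0 eqxx in ai.
    rewrite /Dn powRM// EFinM (pr_fin m (me i)) (ae_ i).2.
    have lfin : lipschitz_const f (e i) \is a fin_num.
      by rewrite ge0_fin_numE ?lipschitz_const_ge0// lip_lty.
    by rewrite -(fineK lfin) poweR_EFin -!EFinM; congr EFin; rewrite /L; ring.
  under eq_eseriesr do rewrite Ei.
  rewrite nneseriesZl//.
  suff h : (\sum_(0 <= i <oo) g (e i) < +oo)%E.
    by rewrite lte_mul_pinfty// lee_fin powR_ge0.
  apply: le_lt_trans Df; rewrite nneseries_esumT//.
  pose I := [set i | e i <> set0].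
  have -> : (\esum_(i in [set: nat]) g (e i) = \esum_(i in I) g (e i))%E.
    rewrite [RHS]esum_mkcond; apply: eq_esum => i _; case: ifPn => // /negP iI.
    have -> : e i = set0 by apply: contrapT => h; apply: iI; exact: mem_set.
    by rewrite /g measure0 mul0e.
  have eI : set_inj I e.
    move=> i j /set_mem Ii /set_mem Ij eij; apply: contrapT => /eqP ij.
    have aei : alpha (e i) by have [e0|//] := eP i; case: (Ii e0).
    have := (alP aei).2; rewrite (pr_fin m (me i)) lte_fin => p0.
    have dij : a i `&` a j = set0.
      by apply/seteqP; split => // x aa; move/eqP: ij; apply; apply: ta => //; exists x.
    have : pr m (a i `|` a j) <= pr m (e i).
      apply: le_pr => //; first exact: measurableU.
      by move=> x [/(ae_ i).1//|/(ae_ j).1]; rewrite eij.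
    rewrite (prDI m (measurableU _ _ (ma i) (ma j)) (ma j)).
    have -> : (a i `|` a j) `\` a j = a i.
      rewrite setDUl setDv setU0; apply/seteqP; split => x; first by case.
      by move=> ax; split => // ax'; have : (a i `&` a j) x by []; rewrite dij.
    have -> : (a i `|` a j) `&` a j = a j by rewrite setIUl setIid dij set0U.
    by rewrite -(ae_ i).2 -(ae_ j).2 -eij; move: p0; lra.
  rewrite -(esum_image I e g eI) -(setIidr (A := alpha) (B := e @` I)); last first.
    by move=> _ [i Ii <-]; have [e0|//] := eP i; case: (Ii e0).
  rewrite esum_mkcondr; apply: le_esum => B aB; case: ifP => // _.
- move=> i w; apply: filterS (geo (i :: w)) => x; apply: filterS => y H cx cy.
  apply: (le_trans (Lf i x y cx.1 cy.1)); rewrite /Dn.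
  rewrite (mulrC M0) -mulrA ler_wpM2l//; apply: (le_trans (H cx cy)); rewrite ler_wpM2l//=.
  by rewrite exprS ler_piMl ?exprn_ge0 ?(ltW theta0)// ltW.
- move=> i; have [[x0 ax0]|nx] := pselect (exists x0, a i x0); last first.
    by exists 0 => x ax; exfalso; apply: nx; exists x.
  exists (L i * Md + `|f x0|) => x ax; rewrite -[f x](subrK (f x0)).
  by rewrite (le_trans (ler_normD _ _))// lerD2r (le_trans (Lf i x x0 ax ax0))// ler_wpM2l.
Qed.

End gibbs_markov_observable.

(** * The central limit theorem *)

Section birkhoff.
Context {S : Type} {R : realType} (T : S -> S) (f : S -> R).

Lemma birkhoff_sumS n x : birkhoff_sum T f n.+1 x = f x + birkhoff_sum T f n (T x).
Proof.
rewrite /birkhoff_sum big_nat_recl//=; congr (_ + _).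
by apply: eq_bigr => k _; rewrite -iterSr.
Qed.

Lemma birkhoff_sumD j n x : birkhoff_sum T f (j + n) x =
  birkhoff_sum T f j x + birkhoff_sum T f n (iter j T x).
Proof.
elim: j x => [|j IH] x; first by rewrite {2}/birkhoff_sum big_geq// add0r add0n.
by rewrite addSn !birkhoff_sumS IH addrA -iterSr.
Qed.

End birkhoff.

Lemma measurable_birkhoff_sum d (S : measurableType d) (R : realType) (T : S -> S) (f : S -> R) n :
  measurable_fun setT T -> measurable_fun setT f -> measurable_fun setT (birkhoff_sum T f n).
Proof.
move=> mT mf; apply: measurable_sum => k; elim: k => [|k IH]; first exact: mf.
rewrite (_ : (fun x => _) = (fun x => f (iter k T x)) \o T).
  exact: measurableT_comp IH mT.
by apply/funext => x /=; rewrite -iterS iterSr.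
Qed.

Lemma perturbed_geometric {R : realType} (b d : nat -> R) (q : R) n : `|q| <= 1 ->
  (forall k, (k < n)%N -> `|b k.+1 - q * b k| <= d k) ->
  `|b n - q ^+ n * b 0%N| <= \sum_(0 <= k < n) d k.
Proof.
move=> q1; elim: n => [|n IH] H; first by rewrite big_geq// expr0 mul1r subrr normr0.
rewrite big_nat_recr//= (_ : _ - _ = q * (b n - q ^+ n * b 0%N) + (b n.+1 - q * b n)); last first.
  by rewrite exprS; ring.
rewrite (le_trans (ler_normD _ _))// lerD//; last exact: H.
rewrite normrM (le_trans (ler_piMl _ q1))//.
by apply: IH => k kn; apply: H; exact: ltnW.
Qed.

Lemma sin_sub_sqr {R : realType} (x : R) : (sin x - x) ^+ 2 <= 4 * (x ^+ 2 * Num.min 1 `|x|).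
Proof.
have x2 := real_normK (num_real x); have x20 := sqr_ge0 x.
rewrite -(real_normK (num_real (sin x - x))) minEle; case: ifPn => [x1|].
  have h : `|sin x - x| <= 2 * `|x|.
    by rewrite (le_trans (ler_normB _ _))//; have := norm_sin_le x; lra.
  have : `|sin x - x| ^+ 2 <= (2 * `|x|) ^+ 2 by rewrite lerXn2r// nnegrE// mulr_ge0.
  by rewrite exprMn x2 mulr1; lra.
rewrite -ltNge => x1; have h : `|sin x - x| <= `|x| * `|x|.
  apply: (le_trans (sin_sub_le x)); rewrite -x2 expr2.
  have := normr_ge0 x; set y := `|x| in x1 *; nra.
have : `|sin x - x| ^+ 2 <= (`|x| * `|x|) ^+ 2 by rewrite lerXn2r// nnegrE// mulr_ge0.
rewrite -x2; have := normr_ge0 x; set y := `|x| in x1 * => y0.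
rewrite !expr2; have : y * y * (y * y) <= y * y * y by rewrite ler_wpM2l ?mulr_ge0// ler_piMr// ltW.
have : 0 <= y * y * y by rewrite !mulr_ge0.
lra.
Qed.

Lemma onem_cos_sqr {R : realType} (x : R) : (cos x - 1) ^+ 2 <= x ^+ 2 * Num.min 1 `|x|.
Proof.
have x2 := real_normK (num_real x); have x20 := sqr_ge0 x.
have c0 := onem_cos_ge0 x; have c1 := onem_cos_le x; have c2 := cos_geN1 x.
rewrite (_ : (cos x - 1) ^+ 2 = (1 - cos x) * (1 - cos x)); last by ring.
rewrite minEle; case: ifPn => [x1|].
  rewrite mulr1; have : (1 - cos x) * (1 - cos x) <= 2 * (1 - cos x) by rewrite ler_wpM2r//; lra.
  lra.
rewrite -ltNge => x1; apply: (@le_trans _ _ (x ^+ 2 / 2 * (x ^+ 2 / 2))).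
  by apply: ler_pM => //; lra.
rewrite -x2; have := normr_ge0 x; set y := `|x| in x1 * => y0.
rewrite !expr2; have : y * y * (y * y) <= y * y * y by rewrite ler_wpM2l ?mulr_ge0// ler_piMr// ltW.
have : 0 <= y * y * y by rewrite !mulr_ge0.
lra.
Qed.

Lemma expR_approx {R : realType} (x : R) : 0 <= x -> `|expR (- x) - (1 - x)| <= x ^+ 2.
Proof.
move=> x0; have h1 := expR_ge1Dx (- x).
rewrite ger0_norm; last by rewrite subr_ge0.
have [x1|x1] := leP 1 x.
  have : expR (- x) <= 1 by rewrite -expR0 ler_expR lerNl oppr0.
  have : x <= x ^+ 2 by rewrite expr2 ler_peMl.
  lra.
have e : expR (- x) <= (1 + x)^-1.
  by rewrite expRN lef_pV2 ?posrE ?expR_gt0 ?expR_ge1Dx// ltr_wpDr.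
have : (1 + x)^-1 <= 1 - x + x ^+ 2.
  rewrite -div1r ler_pdivrMr; last by rewrite ltr_wpDr.
  rewrite (_ : (1 - x + x ^+ 2) * (1 + x) = 1 + x ^+ 3); last by ring.
  by rewrite lerDl exprn_ge0.
lra.
Qed.

Lemma geometric_sum_le {R : realType} (K r : R) n k : 0 <= K -> 0 < r -> r < 1 ->
  \sum_(n <= i < n + k) K * r ^+ i <= K / (1 - r) * r ^+ n.
Proof.
move=> K0 r0 r1; have C0 : 0 <= K / (1 - r) by rewrite divr_ge0// subr_ge0 ltW.
elim: k n => [|k IH] n; first by rewrite addn0 big_geq// mulr_ge0 ?exprn_ge0 ?(ltW r0).
rewrite addnS big_nat_recl ?leq_addr//=.
have -> : \sum_(n <= i < n + k) K * r ^+ i.+1 = r * \sum_(n <= i < n + k) K * r ^+ i.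
  by rewrite mulr_sumr; apply: eq_bigr => i _; rewrite exprS; ring.
apply: (@le_trans _ _ (K * r ^+ n + r * (K / (1 - r) * r ^+ n))).
  by rewrite lerD2l ler_wpM2l ?IH// ltW.
rewrite (_ : _ + _ = K / (1 - r) * r ^+ n)//.
by field; rewrite subr_eq0 gt_eqF.
Qed.

(** * Perturbed recursion for square integrable functions *)

Section central_limit.
Context d (S : measurableType d) (R : realType) (m : probability S R).
Variables (T : S -> S) (F : S -> R) (K r : R).
Hypotheses (mpT : measure_preserving m T) (L2F : sq_integ m F) (EF0 : Ex m F = 0).
Hypotheses (K0 : 0 <= K) (r0 : 0 < r) (r1 : r < 1).
Hypothesis dec : forall k v, (0 < k)%N -> sq_integ m v ->
  `|Ex m (fun x => F x * v (iter k T x))| <= K * r ^+ k * norm2 m v.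
Hypothesis exactT : forall G : S -> R, integ m G -> forall eps : R, 0 < eps -> exists j0,
  forall j (v : S -> R), (j0 <= j)%N -> measurable_fun setT v -> (forall x, `|v x| <= 1) ->
  `|Ex m (fun x => G x * v (iter j T x)) - Ex m G * Ex m v| <= eps.

Let mF : measurable_fun setT F := sq_integ_measurable L2F.
Let iF : integ m F := sq_integ_integ L2F.
Let mpk k := measure_preserving_iter mpT k.
Let mTk k : measurable_fun setT (iter k T) := mp_measurable (mpk k).

Let C := K / (1 - r).

Let C0 : 0 <= C. Proof. by rewrite divr_ge0// subr_ge0 ltW. Qed.

Let geom n k : \sum_(n <= i < n + k) K * r ^+ i <= C * r ^+ n.
Proof. exact: geometric_sum_le. Qed.

Definition corr_sum N (v : S -> R) := \sum_(1 <= k < N.+1) Ex m (fun x => F x * v (iter k T x)).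

Lemma corr_sum_bound N v : sq_integ m v -> `|corr_sum N v| <= C * norm2 m v.
Proof.
move=> L2v; apply: (le_trans (ler_norm_sum _ _ _)).
apply: (@le_trans _ _ ((\sum_(1 <= k < N.+1) K * r ^+ k) * norm2 m v)).
  rewrite mulr_suml big_nat [leRHS]big_nat; apply: ler_sum => k /andP[k0 _]; exact: dec.
rewrite ler_wpM2r ?norm2_ge0//; apply: (le_trans (geom 1 N)).
by rewrite expr1 ler_piMr// ltW.
Qed.

Let rho k := Ex m (fun x => F x * F (iter k T x)).

Let L2Fv (v : S -> R) : measurable_fun setT v -> (forall x, `|v x| <= 1) -> sq_integ m (fun x => F x * v x).
Proof. exact: sq_integM_bounded. Qed.

Let Fv_norm (v : S -> R) : measurable_fun setT v -> (forall x, `|v x| <= 1) ->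
  norm2 m (fun x => F x * v x) <= norm2 m F.
Proof.
move=> mv v1; apply: le_norm2 => //; first exact: L2Fv.
by move=> x; rewrite normrM ler_piMr.
Qed.

Let om (t : R) := Ex m (fun x => F x ^+ 2 * Num.min 1 `|t * F x|).

Let min1 (y : R) : 0 <= y -> 0 <= Num.min 1 y <= 1.
Proof. by move=> y0; rewrite le_min ler01 y0 ge_min lexx. Qed.

Let mmin (t : R) (u : S -> R) : measurable_fun setT u ->
  measurable_fun setT (fun x => Num.min 1 `|t * u x|).
Proof.
move=> mu; apply: measurable_minr => //; apply: measurableT_comp => //.
exact: measurable_funM.
Qed.

Let iom t : integ m (fun x => F x ^+ 2 * Num.min 1 `|t * F x|).
Proof.
apply: (integ_le _ _ L2F.2).
  by apply: measurable_funM; [exact: measurable_funX|exact: mmin].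
move=> x; have /andP[h0 h1] := min1 (normr_ge0 (t * F x)).
by rewrite normrM (ger0_norm (sqr_ge0 _)) (ger0_norm h0) ler_piMr ?sqr_ge0.
Qed.

Let om_ge0 t : 0 <= om t.
Proof.
apply: Ex_ge0 => x; have /andP[h0 h1] := min1 (normr_ge0 (t * F x)).
by rewrite mulr_ge0// sqr_ge0.
Qed.

Let cvg_min (G u : S -> R) : integ m G -> measurable_fun setT u -> forall eps : R, 0 < eps ->
  exists2 t0 : R, 0 < t0 & forall t, `|t| <= t0 ->
    Ex m (fun x => `|G x| * Num.min 1 `|t * u x|) <= eps.
Proof.
move=> iG mu eps e0; have mG := integ_measurable iG.
have iGm (t : R) : integ m (fun x => `|G x| * Num.min 1 `|t * u x|).
  apply: (integ_le _ _ (integ_norm iG)).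
    by apply: measurable_funM; [exact: measurableT_comp|exact: mmin].
  move=> x; have /andP[h0 h1] := min1 (normr_ge0 (t * u x)).
  by rewrite ger0_norm ?mulr_ge0// ler_piMr.
have : (fun i : nat => Ex m (fun x => `|G x| * Num.min 1 `|i.+1%:R^-1 * u x|)) @ \oo --> Ex m (fun=> 0 : R).
  apply: (@cvg_Ex _ _ _ _ _ _ (fun x => `|G x|)).
  - by move=> i; exact: integ_measurable (iGm _).
  - by [].
  - exact: integ_norm.
  - move=> i x; have /andP[h0 h1] := min1 (normr_ge0 (i.+1%:R^-1 * u x)).
    by rewrite ger0_norm ?mulr_ge0// ler_piMr.
  - move=> x; apply: (@squeeze_cvgr _ _ _ _ (fun=> 0) (fun i => `|G x| * `|i.+1%:R^-1 * u x|)).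
    + apply: nearW => i; have /andP[h0 h1] := min1 (normr_ge0 (i.+1%:R^-1 * u x)).
      by rewrite mulr_ge0//= ler_wpM2l// ge_min lexx orbT.
    + exact: cvg_cst.
    + rewrite -[X in _ --> X](_ : `|G x| * `|0 * u x| = 0); last by rewrite mul0r normr0 mulr0.
      by apply: cvgMr; apply: cvg_norm; apply: cvgMl; exact: cvg_harmonic.
rewrite Ex_cst => /cvgrPdist_le/(_ eps e0)[i _ /(_ i (leqnn i))] /=.
rewrite sub0r normrN => h; exists i.+1%:R^-1; first by rewrite invr_gt0.
move=> t ti; apply: le_trans (le_trans (ler_norm _) h); apply: le_Ex => // x.
rewrite ler_wpM2l// le_min ge_min lexx/= ge_min; apply/orP; right.
by rewrite !normrM ler_wpM2r// (le_trans ti)// ler_norm.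
Qed.

(** Real part of expi (t S_n + p); [Vs] is the imaginary part. The free phase [p] makes statements
    about [Vc] alone sufficient. *)
Let Vc (t p : R) n x := cos (t * birkhoff_sum T F n x + p).
Let Vs (t p : R) n x := sin (t * birkhoff_sum T F n x + p).

Let mS n : measurable_fun setT (birkhoff_sum T F n).
Proof. by apply: measurable_birkhoff_sum => //; exact: mp_measurable mpT. Qed.

Let marg t p n : measurable_fun setT (fun x => t * birkhoff_sum T F n x + p).
Proof. by apply: measurable_funD => //; exact: measurable_funM. Qed.

Let mVc t p n : measurable_fun setT (Vc t p n). Proof. exact: measurable_cos_comp. Qed.
Let mVs t p n : measurable_fun setT (Vs t p n). Proof. exact: measurable_sin_comp. Qed.
Let Vc1 t p n x : `|Vc t p n x| <= 1. Proof. exact: cos_max. Qed.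
Let Vs1 t p n x : `|Vs t p n x| <= 1. Proof. exact: sin_max. Qed.

Let VcS t p n x : Vc t p n.+1 x = cos (t * F x) * Vc t p n (T x) - sin (t * F x) * Vs t p n (T x).
Proof. by rewrite /Vc /Vs birkhoff_sumS mulrDr -addrA cosD. Qed.

Let VsS t p n x : Vs t p n.+1 x = cos (t * F x) * Vs t p n (T x) + sin (t * F x) * Vc t p n (T x).
Proof. by rewrite /Vc /Vs birkhoff_sumS mulrDr -addrA sinD; ring. Qed.

Let mcomp k (v : S -> R) : measurable_fun setT v -> measurable_fun setT (fun x => v (iter k T x)).
Proof. by move=> mv; exact: measurableT_comp mv (mTk k). Qed.

(** Real part of the corrected expectation of expi (t S_n + p), with the functional truncated at [N]
    lags. The truncation is chosen after [t]. *)
Let bb t p N n := Ex m (Vc t p n) - t * corr_sum N (Vs t p n).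

Let AA t p N n := Ex m (fun x => F x ^+ 2 * Vc t p n (T x)) / 2 +
  \sum_(1 <= k < N.+1) Ex m (fun x => F x * F (iter k T x) * Vc t p n (iter k.+1 T x)).

Let mtF (t : R) : measurable_fun setT (fun x => t * F x).
Proof. exact: measurable_funM. Qed.

Let corr_sumD N u v : sq_integ m u -> sq_integ m v ->
  corr_sum N (fun x => u x + v x) = corr_sum N u + corr_sum N v.
Proof.
move=> L2u L2v; rewrite /corr_sum -big_split/=; apply: eq_bigr => k _.
under eq_fun do rewrite mulrDr.
by rewrite ExD//; apply: sq_integM => //; exact: (sq_integ_comp (mpk k)).
Qed.

(** The term of first order in the expectation is cancelled by the correction: composition with [T]
    shifts the lags by one, and the lag 1 that gets lost is exactly this term. Second order leaves
    [AA], and the new lag N + 1 gives the last error. *)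
Let step_err t p N n :
  `|bb t p N n.+1 - bb t p N n + t ^+ 2 * AA t p N n| <=
  t ^+ 2 * (3 * om t + 3 * C * Num.sqrt (om t)) + `|t| * (K * r ^+ N.+1).
Proof.
pose Tc x := Vc t p n (T x); pose Ts x := Vs t p n (T x).
have mTc : measurable_fun setT Tc := mcomp 1 (mVc t p n).
have mTs : measurable_fun setT Ts := mcomp 1 (mVs t p n).
pose c x := cos (t * F x) - 1; pose q x := sin (t * F x) - t * F x.
have mc : measurable_fun setT c by apply: measurable_funB => //; exact: measurable_cos_comp.
have mq : measurable_fun setT q by apply: measurable_funB => //; exact: measurable_sin_comp.
have L2c : sq_integ m c.
  apply: (@sq_integ_bounded _ _ _ _ _ 2) => // x.
  by rewrite (le_trans (ler_normB _ _))// normr1 -[2]/(1 + 1) lerD2r cos_max.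
have L2q : sq_integ m q.
  apply: sq_integB; last exact: sq_integZ.
  by apply: (@sq_integ_bounded _ _ _ _ _ 1) => [|x]; [exact: measurable_sin_comp|exact: sin_max].
have t2om : integ m (fun x => t ^+ 2 * (F x ^+ 2 * Num.min 1 `|t * F x|)) := integZ _ (iom t).
have Nc : norm2 m c <= `|t| * Num.sqrt (om t).
  rewrite /norm2 -sqrtr_sqr -sqrtrM ?sqr_ge0// ler_wsqrtr// /om -ExZ//.
  apply: le_Ex => //; first exact: L2c.2.
  by move=> x; rewrite /c (le_trans (onem_cos_sqr _))// exprMn mulrA.
have Nq : norm2 m q <= 2 * (`|t| * Num.sqrt (om t)).
  have -> : 2 * (`|t| * Num.sqrt (om t)) = Num.sqrt (4 * (t ^+ 2 * om t)).
    rewrite sqrtrM// sqrtrM ?sqr_ge0// sqrtr_sqr (_ : 4 = 2 ^+ 2 :> R); last by ring.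
    by rewrite sqrtr_sqr (@ger0_norm _ 2).
  rewrite ler_wsqrtr// /om -!ExZ//; apply: le_Ex; [exact: L2q.2|exact: integZ|].
  by move=> x; rewrite /q (le_trans (sin_sub_sqr _))// exprMn (mulrA (t ^+ 2)).
have mul1 (u v : S -> R) : sq_integ m u -> measurable_fun setT v -> (forall x, `|v x| <= 1) ->
    sq_integ m (fun x => u x * v x) /\ norm2 m (fun x => u x * v x) <= norm2 m u.
  move=> L2u mv v1; have h := sq_integM_bounded L2u mv v1; split => //.
  by apply: le_norm2 => // x; rewrite normrM ler_piMr.
have [L2cs Ncs] := mul1 _ _ L2c mTs (fun x => Vs1 t p n (T x)).
have [L2qc Nqc] := mul1 _ _ L2q mTc (fun x => Vc1 t p n (T x)).
have L2Fc : sq_integ m (fun x => F x * Tc x) := L2Fv mTc (fun x => Vc1 t p n (T x)).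
have L2Ts : sq_integ m Ts by apply: (@sq_integ_bounded _ _ _ _ _ 1) => // x; exact: Vs1.
have WS : corr_sum N (Vs t p n.+1) = corr_sum N Ts + corr_sum N (fun x => c x * Ts x) +
    (corr_sum N (fun x => q x * Tc x) + t * corr_sum N (fun x => F x * Tc x)).
  have -> : t * corr_sum N (fun x => F x * Tc x) = corr_sum N (fun x => t * (F x * Tc x)).
    rewrite /corr_sum mulr_sumr; apply: eq_bigr => k _; rewrite -ExZ.
      by congr (Ex m _); apply/funext => x; ring.
    by apply: sq_integM => //; exact: (sq_integ_comp (mpk k) L2Fc).
  have L2t := sq_integZ t L2Fc.
  rewrite -!corr_sumD//; [|exact: sq_integD|exact: sq_integD].
  by congr corr_sum; apply/funext => x; rewrite VsS /c /q /Ts /Tc; ring.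
have WT : corr_sum N Ts = corr_sum N (Vs t p n) - Ex m (fun x => F x * Ts x) +
    Ex m (fun x => F x * Vs t p n (iter N.+1 T x)).
  rewrite /corr_sum.
  have -> : \sum_(1 <= k < N.+1) Ex m (fun x => F x * Ts (iter k T x)) =
      \sum_(2 <= k < N.+2) Ex m (fun x => F x * Vs t p n (iter k T x)).
    by rewrite [RHS]big_add1/=.
  case: (N) => [|N']; first by rewrite !big_geq// sub0r addNr.
  by rewrite big_nat_recr//= (@big_ltn _ _ _ 1)// /Ts; ring.
have WF : corr_sum N (fun x => F x * Tc x) =
    \sum_(1 <= k < N.+1) Ex m (fun x => F x * F (iter k T x) * Vc t p n (iter k.+1 T x)).
  by apply: eq_bigr => k _; congr (Ex m _); apply/funext => x; rewrite /Tc mulrA.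
have iv (u : S -> R) : measurable_fun setT u -> (forall x, `|u x| <= 1) -> integ m u.
  by move=> mu u1; exact: (integ_bounded m mu u1).
pose c2 x := c x + t ^+ 2 / 2 * F x ^+ 2.
have i1 : integ m (fun x => c2 x * Tc x).
  rewrite (_ : (fun x => _) = fun x => c x * Tc x + t ^+ 2 / 2 * (F x ^+ 2 * Tc x)); last first.
    by apply/funext => x; rewrite /c2; ring.
  apply: integD; first exact: sq_integ_integ (mul1 _ _ L2c mTc (fun x => Vc1 t p n (T x))).1.
  apply: integZ; rewrite (_ : (fun x => _) = fun x => F x * (F x * Tc x)).
    exact: sq_integM.
  by apply/funext => x; ring.
have i2 : integ m (fun x => q x * Ts x).
  exact: sq_integ_integ (mul1 _ _ L2q mTs (fun x => Vs1 t p n (T x))).1.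
have i3 : integ m (fun x => F x * Ts x) by exact: sq_integM.
have i4 : integ m (fun x => F x ^+ 2 * Tc x).
  by rewrite (_ : (fun x => _) = fun x => F x * (F x * Tc x));
    [exact: sq_integM|apply/funext => x; ring].
have i5 : integ m Tc by apply: iv => // x; exact: Vc1.
have VS : Ex m (Vc t p n.+1) = Ex m (Vc t p n) + Ex m (fun x => c2 x * Tc x) -
    (t ^+ 2 / 2 * Ex m (fun x => F x ^+ 2 * Tc x)) -
    (Ex m (fun x => q x * Ts x) + t * Ex m (fun x => F x * Ts x)).
  rewrite -(Ex_comp mpT (mVc t p n)) -!ExZ// -!ExD//; last exact: integZ.
  rewrite -ExB//; [|exact: integD|exact: integZ].
  rewrite -ExB//; [|by apply: integB; [exact: integD|exact: integZ]|by apply: integD => //; exact: integZ].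
  by congr (Ex m _); apply/funext => x; rewrite VcS /c2 /c /q /Tc /Ts; field.
set a1 := Ex m (fun x => c2 x * Tc x) in VS.
set a2 := Ex m (fun x => q x * Ts x) in VS.
set a3 := corr_sum N (fun x => c x * Ts x) in WS.
set a4 := corr_sum N (fun x => q x * Tc x) in WS.
set a5 := Ex m (fun x => F x * Vs t p n (iter N.+1 T x)) in WT.
have -> : bb t p N n.+1 - bb t p N n + t ^+ 2 * AA t p N n =
    a1 - a2 - t * a3 - t * a4 - t * a5.
  by rewrite /bb /AA VS WS WT WF /Tc; field.
have b1 : `|a1| <= t ^+ 2 * om t.
  rewrite /a1 /om -ExZ//; apply: Ex_le_norm => //; first exact: integ_measurable i1.
  move=> x; rewrite normrM; apply: (@le_trans _ _ `|c2 x|); first by rewrite ler_piMr ?Vc1.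
  rewrite /c2 /c; have := cos_taylor (t * F x); rewrite exprMn.
  by rewrite (_ : t ^+ 2 * F x ^+ 2 / 2 = t ^+ 2 / 2 * F x ^+ 2); [rewrite mulrA|ring].
have b2 : `|a2| <= 2 * (t ^+ 2 * om t).
  rewrite /a2 /om -!ExZ//; apply: Ex_le_norm; [exact: integZ|exact: integ_measurable i2|].
  move=> x; rewrite normrM; apply: (@le_trans _ _ `|q x|); first by rewrite ler_piMr ?Vs1.
  by rewrite /q (le_trans (sin_taylor _))// exprMn (mulrA (t ^+ 2)).
have b3 : `|a3| <= C * (`|t| * Num.sqrt (om t)).
  by apply: (le_trans (corr_sum_bound N L2cs)); rewrite ler_wpM2l// (le_trans Ncs).
have b4 : `|a4| <= C * (2 * (`|t| * Num.sqrt (om t))).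
  by apply: (le_trans (corr_sum_bound N L2qc)); rewrite ler_wpM2l// (le_trans Nqc).
have b5 : `|a5| <= K * r ^+ N.+1.
  apply: (le_trans (dec (ltn0Sn N) (sq_integ_bounded m (mVs t p n) (Vs1 t p n)))).
  by rewrite ler_piMr ?mulr_ge0 ?exprn_ge0 ?(ltW r0)// (norm2_bounded m (mVs t p n) (Vs1 t p n)).
have n3 : `|t * a3| <= `|t| * (C * (`|t| * Num.sqrt (om t))) by rewrite normrM ler_wpM2l.
have n4 : `|t * a4| <= `|t| * (C * (2 * (`|t| * Num.sqrt (om t)))) by rewrite normrM ler_wpM2l.
have n5 : `|t * a5| <= `|t| * (K * r ^+ N.+1) by rewrite normrM ler_wpM2l.
apply: (@le_trans _ _ (t ^+ 2 * om t + 2 * (t ^+ 2 * om t) + `|t| * (C * (`|t| * Num.sqrt (om t)))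
  + `|t| * (C * (2 * (`|t| * Num.sqrt (om t)))) + `|t| * (K * r ^+ N.+1))).
  do 4!(rewrite (le_trans (ler_normB _ _))// lerD//).
rewrite -(real_normK (num_real t)).
by rewrite le_eqVlt; apply/orP; left; apply/eqP; ring.
Qed.

Let iG k : integ m (fun x => F x * F (iter k T x)).
Proof. by apply: sq_integM => //; exact: (sq_integ_comp (mpk k)). Qed.

(** Dropping the first [j0] terms of the Birkhoff sum changes the phase by a quantity that is small
    with [t]. What is left depends only on the orbit after time k + 1 + j0, and exactness decouples
    it from [F * F \o T^k]. *)
Let asymp k (eps : R) : 0 < eps -> exists j (t0 : R), 0 < t0 /\ forall t p n, `|t| <= t0 -> (j <= n)%N ->
  `|Ex m (fun x => F x * F (iter k T x) * Vc t p n (iter k.+1 T x)) - rho k * Ex m (Vc t p n)| <= eps.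
Proof.
move=> e0; have [j0 Hj] := exactT (iG k) (divr_gt0 e0 (ltr0n R 3)).
pose G x := F x * F (iter k T x).
have mSk : measurable_fun setT (fun x => birkhoff_sum T F j0 (iter k.+1 T x)) := mcomp k.+1 (mS j0).
have [|t1 t10 Ht1] := @cvg_min (fun x => 2 * G x) (fun x => birkhoff_sum T F j0 (iter k.+1 T x)) (integZ 2 (iG k)) mSk (eps / 3).
  by rewrite divr_gt0.
have rk0 : 0 < `|rho k| + 1 by rewrite ltr_wpDl.
have [|t2 t20 Ht2] := @cvg_min (fun=> 2) (birkhoff_sum T F j0) (integ_cst m 2) (mS j0) (eps / 3 / (`|rho k| + 1)).
  by rewrite !divr_gt0.
exists j0, (Num.min t1 t2); split; first by rewrite lt_min t10.
move=> t p n; rewrite le_min => /andP[tt1 tt2] jn.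
have nE : n = (j0 + (n - j0))%N by rewrite subnKC.
pose V x := Vc t p (n - j0) x.
have dV x : `|Vc t p n x - V (iter j0 T x)| <= 2 * Num.min 1 `|t * birkhoff_sum T F j0 x|.
  have h1 : `|Vc t p n x - V (iter j0 T x)| <= 2.
    by rewrite (le_trans (ler_normB _ _))// -[2]/(1 + 1) lerD// Vc1.
  have h2 : `|Vc t p n x - V (iter j0 T x)| <= `|t * birkhoff_sum T F j0 x|.
    rewrite /Vc {1}nE birkhoff_sumD /V /Vc (le_trans (cos_lip _ _))//.
    by rewrite (_ : _ - _ = t * birkhoff_sum T F j0 x)//; ring.
  rewrite minEle; case: ifP => _; first by rewrite mulr1.
  by apply: (le_trans h2); have := normr_ge0 (t * birkhoff_sum T F j0 x); lra.
have mV : measurable_fun setT V := mVc t p (n - j0).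
have iV j (v : S -> R) : measurable_fun setT v -> (forall x, `|v x| <= 1) ->
    integ m (fun x => G x * v (iter j T x)).
  move=> mv v1; apply: (integ_le _ _ (integ_norm (iG k))).
    by apply: measurable_funM; [exact: integ_measurable (iG k)|exact: mcomp].
  by move=> x; rewrite normrM ler_piMr.
have E1 : `|Ex m (fun x => G x * Vc t p n (iter k.+1 T x)) -
    Ex m (fun x => G x * V (iter (k.+1 + j0) T x))| <= eps / 3.
  have i1 := iV k.+1 _ (mVc t p n) (Vc1 t p n).
  have i2 := iV (k.+1 + j0)%N _ mV (Vc1 t p (n - j0)).
  rewrite -ExB//; apply: le_trans (Ht1 t tt1); apply: Ex_le_norm.
  - apply: (integ_le _ _ (integ_norm (integZ 2 (iG k)))).
      apply: measurable_funM; last exact: mmin.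
      by apply: measurableT_comp => //; exact: integ_measurable (integZ 2 (iG k)).
    move=> x; have /andP[h0 h1] := min1 (normr_ge0 (t * birkhoff_sum T F j0 (iter k.+1 T x))).
    by rewrite normrM normr_id (ger0_norm h0) ler_piMr.
  - exact: integ_measurable (integB i1 i2).
  - move=> x; rewrite -mulrBr addnC iterD [leLHS]normrM [`|2 * _|]normrM (ger0_norm (ler0n _ 2)).
    by rewrite (mulrC 2) -mulrA ler_wpM2l.
have E2 : `|Ex m (Vc t p n) - Ex m V| <= eps / 3 / (`|rho k| + 1).
  have iVc : integ m (Vc t p n) := integ_bounded m (mVc t p n) (Vc1 t p n).
  have iVj : integ m V := integ_bounded m mV (Vc1 t p (n - j0)).
  rewrite -(Ex_comp (mpk j0) mV) -ExB//; last exact: (integ_comp (mpk j0)).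
  apply: le_trans (Ht2 t tt2); apply: Ex_le_norm.
  - apply: (@integ_bounded _ _ _ _ _ 2); first by apply: measurable_funM => //; exact: mmin.
    move=> x; have /andP[h0 h1] := min1 (normr_ge0 (t * birkhoff_sum T F j0 x)).
    by rewrite normrM normr_id (ger0_norm h0) (ger0_norm (ler0n _ 2)) ler_piMr.
  - by apply: measurable_funB => //; exact: mcomp.
  - by move=> x; rewrite (ger0_norm (ler0n _ 2)).
have E3 := Hj (k.+1 + j0)%N V (leq_addl _ _) mV (Vc1 t p (n - j0)).
rewrite -/(rho k) -/G in E3.
rewrite (_ : _ - _ = (Ex m (fun x => G x * Vc t p n (iter k.+1 T x)) -
    Ex m (fun x => G x * V (iter (k.+1 + j0) T x))) +
  ((Ex m (fun x => G x * V (iter (k.+1 + j0) T x)) - rho k * Ex m V) -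
    rho k * (Ex m (Vc t p n) - Ex m V))); last by rewrite /G; ring.
rewrite (le_trans (ler_normD _ _))//.
have E4 : `|rho k * (Ex m (Vc t p n) - Ex m V)| <= eps / 3.
  rewrite normrM (le_trans (ler_wpM2l _ E2))// mulrCA ler_piMr ?divr_ge0 ?(ltW e0)//.
  by rewrite ler_pdivrMr// mul1r lerDl.
apply: (@le_trans _ _ (eps / 3 + (eps / 3 + eps / 3))); last by rewrite le_eqVlt; apply/orP; left; apply/eqP; field.
by rewrite lerD// (le_trans (ler_normB _ _))// lerD.
Qed.

Variable sigma2 : R.
Hypothesis cvg_sigma2 : (fun N => rho 0 + 2 * \sum_(1 <= k < N.+1) rho k) @ \oo --> sigma2.

Let F2 := norm2 m F.

Let tail_bound k0 N t p n : (k0 <= N)%N ->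
  `|\sum_(k0.+1 <= k < N.+1) Ex m (fun x => F x * F (iter k T x) * Vc t p n (iter k.+1 T x))| <=
  C * r ^+ k0 * F2.
Proof.
move=> kN; apply: (le_trans (ler_norm_sum _ _ _)).
apply: (@le_trans _ _ ((\sum_(k0.+1 <= k < N.+1) K * r ^+ k) * F2)).
  rewrite mulr_suml big_nat [leRHS]big_nat; apply: ler_sum => k /andP[k1 _].
  have k0' : (0 < k)%N := leq_trans (ltn0Sn _) k1.
  have mTc : measurable_fun setT (fun x => Vc t p n (T x)) := mcomp 1 (mVc t p n).
  have L2 := L2Fv mTc (fun x => Vc1 t p n (T x)).
  have := dec k0' L2; rewrite (_ : (fun x => F x * (_ * _)) =
    fun x => F x * F (iter k T x) * Vc t p n (iter k.+1 T x)); last first.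
    by apply/funext => x; rewrite mulrA.
  move/le_trans; apply; rewrite ler_wpM2l ?mulr_ge0 ?exprn_ge0 ?(ltW r0)//.
  by apply: Fv_norm => // x; exact: Vc1.
rewrite ler_wpM2r ?norm2_ge0// -(subnKC kN) -addSn; apply: (le_trans (geom _ _)).
by rewrite ler_wpM2l// exprS ler_piMl ?exprn_ge0 ?(ltW r0)// ltW.
Qed.

Let AA_bound t p N n : `|AA t p N n| <= F2 ^+ 2 + C * F2.
Proof.
rewrite (le_trans (ler_normD _ _))// lerD//.
  have iFV : integ m (fun x => F x ^+ 2 * Vc t p n (T x)).
    apply: (integ_le _ _ L2F.2).
      by apply: measurable_funM; [exact: measurable_funX|exact: (mcomp 1 (mVc t p n))].
    by move=> x; rewrite normrM (ger0_norm (sqr_ge0 _)) ler_piMr ?sqr_ge0 ?Vc1.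
  have h : `|Ex m (fun x => F x ^+ 2 * Vc t p n (T x))| <= F2 ^+ 2.
    rewrite norm2K; apply: Ex_le_norm => //; [exact: L2F.2|exact: integ_measurable iFV|].
    by move=> x; rewrite normrM (ger0_norm (sqr_ge0 _)) ler_piMr ?sqr_ge0 ?Vc1.
  rewrite normrM; have := normr_ge0 (Ex m (fun x => F x ^+ 2 * Vc t p n (T x))).
  by rewrite (ger0_norm (_ : 0 <= 2^-1))//; lra.
by have := @tail_bound 0 N t p n (leq0n _); rewrite expr0 mulr1.
Qed.

(** Lags up to [k0] are finitely many and get decoupled one by one; later lags are small uniformly
    in [t] and [n] by the decay. *)
Let AA_asymp (eps : R) : 0 < eps -> exists k0 j (t0 : R), 0 < t0 /\ forall t p n N,
  `|t| <= t0 -> (j <= n)%N -> (k0 <= N)%N ->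
  `|AA t p N n - sigma2 / 2 * Ex m (Vc t p n)| <= eps.
Proof.
move=> e0; have e30 : 0 < eps / 3 by rewrite divr_gt0.
have cr : C * r ^+ k * F2 @[k --> \oo] --> C * 0 * F2.
  by apply: cvgMl; apply: cvgMr; apply: cvg_expr; rewrite ger0_norm ?ltW.
rewrite mulr0 mul0r in cr.
have /cvgrPdist_le/(_ _ e30)[ka _ Ha] := cr.
have /cvgrPdist_le/(_ _ e30)[kb _ Hb] := cvg_sigma2.
pose k0 := maxn ka kb.
have {}Ha : C * r ^+ k0 * F2 <= eps / 3.
  have := Ha k0 (leq_maxl _ _); rewrite /= sub0r normrN; apply: le_trans; exact: ler_norm.
have {}Hb := Hb k0 (leq_maxr _ _).
have dl0 : 0 < eps / 3 / k0.+1%:R by rewrite divr_gt0.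
set dl := _ / k0.+1%:R in dl0.
have [j [t0 [t00 Hj]]] : exists j (t0 : R), 0 < t0 /\ forall k, (k < k0.+1)%N -> forall t p n,
    `|t| <= t0 -> (j <= n)%N ->
    `|Ex m (fun x => F x * F (iter k T x) * Vc t p n (iter k.+1 T x)) - rho k * Ex m (Vc t p n)|
      <= dl.
  elim: (k0.+1) => [|k [j [t0 [t00 Hk]]]]; first by exists 0%N, 1; split.
  have [j' [t0' [t00' Hk']]] := asymp k dl0.
  exists (maxn j j'), (Num.min t0 t0'); split; first by rewrite lt_min t00.
  move=> i; rewrite ltnS leq_eqVlt => /orP[/eqP ->|ik] t p n; rewrite le_min geq_max => /andP[h1 h2] /andP[h3 h4].
    exact: Hk'.
  exact: Hk.
exists k0, j, t0; split => // t p n N tt0 jn kN.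
have V1 : `|Ex m (Vc t p n)| <= 1 := Ex_bounded m (mVc t p n) (Vc1 t p n).
pose a k := Ex m (fun x => F x * F (iter k T x) * Vc t p n (iter k.+1 T x)).
have a0 : Ex m (fun x => F x ^+ 2 * Vc t p n (T x)) = a 0%N by [].
have AE : AA t p N n = a 0%N / 2 + \sum_(1 <= k < k0.+1) a k + \sum_(k0.+1 <= k < N.+1) a k.
  by rewrite /AA a0 -addrA -big_cat_nat.
set s0 := rho 0 + _ in Hb.
have -> : AA t p N n - sigma2 / 2 * Ex m (Vc t p n) =
    ((a 0%N - rho 0 * Ex m (Vc t p n)) / 2 + \sum_(1 <= k < k0.+1) (a k - rho k * Ex m (Vc t p n)))
    + (\sum_(k0.+1 <= k < N.+1) a k - (sigma2 - s0) / 2 * Ex m (Vc t p n)).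
  by rewrite AE sumrB -mulr_suml /s0; field.
have b1 : `|(a 0%N - rho 0 * Ex m (Vc t p n)) / 2 + \sum_(1 <= k < k0.+1) (a k - rho k * Ex m (Vc t p n))| <= eps / 3.
  apply: (le_trans (ler_normD _ _)).
  apply: (@le_trans _ _ (\sum_(0 <= k < k0.+1) dl)); last first.
    by rewrite sumr_const_nat subn0 -[_ *+ _]mulr_natr divfK// pnatr_eq0.
  rewrite [leRHS]big_ltn// lerD//.
    rewrite normrM (ger0_norm (_ : 0 <= 2^-1))//.
    have := Hj 0%N (ltn0Sn _) t p n tt0 jn; rewrite -/(a 0%N).
    by have := normr_ge0 (a 0%N - rho 0 * Ex m (Vc t p n)); lra.
  apply: (le_trans (ler_norm_sum _ _ _)).
  by apply: ler_sum_nat => k /andP[_ kk0]; exact: Hj.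
have b2 : `|\sum_(k0.+1 <= k < N.+1) a k| <= eps / 3 := le_trans (tail_bound t p n kN) Ha.
have b3 : `|(sigma2 - s0) / 2 * Ex m (Vc t p n)| <= eps / 3.
  rewrite normrM; apply: (@le_trans _ _ `|(sigma2 - s0) / 2|); first by rewrite ler_piMr.
  rewrite normrM (ger0_norm (_ : 0 <= 2^-1))//; have := normr_ge0 (sigma2 - s0).
  by move: Hb; lra.
apply: (@le_trans _ _ (eps / 3 + (eps / 3 + eps / 3))); last by rewrite le_eqVlt; apply/orP; left; apply/eqP; field.
by rewrite (le_trans (ler_normD _ _))// lerD// (le_trans (ler_normB _ _))// lerD.
Qed.

Hypothesis sigma2_ge0 : 0 <= sigma2.

Let om_small (eps : R) : 0 < eps -> exists2 t0 : R, 0 < t0 & forall t, `|t| <= t0 ->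
  3 * om t + 3 * C * Num.sqrt (om t) <= eps.
Proof.
move=> e0; pose dl := Num.min (eps / 6) ((eps / (6 * (C + 1))) ^+ 2).
have C1 : 0 < C + 1 by rewrite ltr_wpDl.
have dl0 : 0 < dl by rewrite lt_min divr_gt0//= exprn_gt0// divr_gt0// mulr_gt0.
have [t0 t00 Ht] := cvg_min L2F.2 mF dl0; exists t0 => // t /Ht h.
have {}h : om t <= dl.
  apply: le_trans h; rewrite /om le_eqVlt; apply/orP; left; apply/eqP; congr (Ex m _).
  by apply/funext => x; rewrite (ger0_norm (sqr_ge0 _)).
have h1 : om t <= eps / 6 by apply: (le_trans h); rewrite ge_min lexx.
have h2 : Num.sqrt (om t) <= eps / (6 * (C + 1)).
  have e60 : 0 <= eps / (6 * (C + 1)) by rewrite divr_ge0 ?(ltW e0)// mulr_ge0// ltW.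
  rewrite -(ger0_norm e60) -sqrtr_sqr ler_wsqrtr//.
  by apply: (le_trans h); rewrite ge_min lexx orbT.
have h3 : C * Num.sqrt (om t) <= eps / 6.
  apply: (@le_trans _ _ (C * (eps / (6 * (C + 1))))); first by rewrite ler_wpM2l.
  rewrite (_ : _ * _ = (C / (C + 1)) * (eps / 6)); last by field; rewrite gt_eqF.
  rewrite ler_piMl ?divr_ge0 ?(ltW e0)// ler_pdivrMr// mul1r lerDl//.
by rewrite -mulrA; move: h1 h3; lra.
Qed.

Let q (t : R) := expR (- (t ^+ 2 * (sigma2 / 2))).

Let q01 t : 0 <= q t <= 1.
Proof.
rewrite expR_ge0/= -expR0 ler_expR lerNl oppr0 mulr_ge0 ?sqr_ge0//.
by rewrite divr_ge0.
Qed.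

Let bb_V t p N n : `|Ex m (Vc t p n) - bb t p N n| <= `|t| * C.
Proof.
rewrite /bb opprB addrC subrK normrM ler_wpM2l//.
have L2V := sq_integ_bounded m (mVs t p n) (Vs1 t p n).
apply: (le_trans (corr_sum_bound N L2V)).
by rewrite ler_piMr// (norm2_bounded m (mVs t p n) (Vs1 t p n)).
Qed.

(** Exactness acts only after [j] steps. The earlier ones get a crude bound of order [t ^+ 2],
    harmless because their number is fixed while [t] tends to 0. *)
Let step (eps : R) : 0 < eps -> exists k0 j (t0 C1 : R), [/\ 0 < t0, 0 <= C1 & forall t p N n,
  `|t| <= t0 -> (k0 <= N)%N -> K * r ^+ N.+1 <= eps * `|t| ->
  `|bb t p N n.+1 - q t * bb t p N n| <= t ^+ 2 * C1 /\
  ((j <= n)%N -> `|bb t p N n.+1 - q t * bb t p N n| <= t ^+ 2 * (eps * 5))].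
Proof.
move=> e0; have [k0 [j [t1 [t10 H1]]]] := AA_asymp e0.
have [t2 t20 H2] := om_small e0.
pose D := 1 + sigma2 / 2 * C + (sigma2 / 2) ^+ 2 * (1 + C).
have s20 : 0 <= sigma2 / 2 by rewrite divr_ge0.
have D0 : 0 < D.
  rewrite /D -addrA ltr_pwDl//.
  by repeat (apply: mulr_ge0 => // || apply: addr_ge0 => //).
pose t3 := Num.min 1 (eps / D); have t30 : 0 < t3 by rewrite lt_min ltr01 divr_gt0.
exists k0, j, (Num.min (Num.min t1 t2) t3), (2 * eps + (F2 ^+ 2 + C * F2) + sigma2 / 2 * (1 + C)).
have F20 : 0 <= F2 by exact: norm2_ge0.
split.
- by rewrite lt_min t30 lt_min t10 t20.
- repeat (apply: mulr_ge0 => // || apply: addr_ge0 => //); rewrite ?ltW// sqr_ge0//.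
move=> t p N n; rewrite !le_min => /andP[/andP[tt1 tt2] /andP[tt3 tt4]] kN KN.
have t2E := real_normK (num_real t).
have b1 := step_err t p N n; set a1 := _ - _ + _ in b1.
have {}b1 : `|a1| <= t ^+ 2 * (2 * eps).
  apply: (le_trans b1); rewrite (_ : 2 * eps = eps + eps); last by ring.
  rewrite [leRHS]mulrDr lerD//.
    by rewrite ler_wpM2l ?sqr_ge0// H2.
  by rewrite -t2E expr2 -mulrA ler_wpM2l// [leRHS]mulrC.
have b2 := AA_bound t p N n.
have bbV := bb_V t p N n; have V1 : `|Ex m (Vc t p n)| <= 1 := Ex_bounded m (mVc t p n) (Vc1 t p n).
have bb1 : `|bb t p N n| <= 1 + C.
  rewrite -[bb _ _ _ _](subrK (Ex m (Vc t p n))) addrC (le_trans (ler_normD _ _))// lerD// distrC.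
  by rewrite (le_trans bbV)// ler_piMl.
set x := t ^+ 2 * (sigma2 / 2); have x0 : 0 <= x by rewrite mulr_ge0// sqr_ge0.
have qx : `|q t - (1 - x)| <= x ^+ 2 := expR_approx x0.
have qx' : `|1 - q t| <= x.
  have /andP[_ q1] := q01 t; rewrite ger0_norm ?subr_ge0//.
  by have := expR_ge1Dx (- x); rewrite -/(q t); lra.
have t20' := sqr_ge0 t.
split.
  rewrite (_ : _ - _ = a1 - t ^+ 2 * AA t p N n + (1 - q t) * bb t p N n); last by rewrite /a1; ring.
  apply: (@le_trans _ _ (t ^+ 2 * (2 * eps) + t ^+ 2 * (F2 ^+ 2 + C * F2) + x * (1 + C))).
    rewrite (le_trans (ler_normD _ _))// lerD//.
      by rewrite (le_trans (ler_normB _ _))// lerD// normrM (ger0_norm t20') ler_wpM2l.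
    by rewrite normrM ler_pM.
  by rewrite /x le_eqVlt; apply/orP; left; apply/eqP; ring.
move=> jn; have b3 := H1 t p n N tt1 jn kN.
rewrite (_ : _ - _ = a1 - t ^+ 2 * (AA t p N n - sigma2 / 2 * Ex m (Vc t p n)) -
  (x * (Ex m (Vc t p n) - bb t p N n) + (q t - (1 - x)) * bb t p N n)); last by rewrite /a1 /x; ring.
have c1 : `|t ^+ 2 * (AA t p N n - sigma2 / 2 * Ex m (Vc t p n))| <= t ^+ 2 * eps.
  by rewrite normrM (ger0_norm t20') ler_wpM2l.
have c2 : `|x * (Ex m (Vc t p n) - bb t p N n) + (q t - (1 - x)) * bb t p N n| <= t ^+ 2 * eps.
  apply: (le_trans (ler_normD _ _)); rewrite [`|x * _|]normrM [`|_ * bb _ _ _ _|]normrM (ger0_norm x0).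
  have d1 : x * `|Ex m (Vc t p n) - bb t p N n| <= t ^+ 2 * (`|t| * (sigma2 / 2 * C)).
    rewrite /x -mulrA ler_wpM2l// (le_trans (ler_wpM2l _ bbV))//.
    by rewrite le_eqVlt; apply/orP; left; apply/eqP; ring.
  have d2 : `|q t - (1 - x)| * `|bb t p N n| <= t ^+ 2 * (`|t| * ((sigma2 / 2) ^+ 2 * (1 + C))).
    apply: (@le_trans _ _ (x ^+ 2 * (1 + C))); first exact: ler_pM.
    rewrite [leLHS](_ : _ = t ^+ 2 * (`|t| * (`|t| * ((sigma2 / 2) ^+ 2 * (1 + C))))); last first.
      by rewrite /x -t2E; ring.
    rewrite ler_wpM2l// ler_wpM2l// ler_piMl// mulr_ge0 ?sqr_ge0// addr_ge0//.
  apply: (le_trans (lerD d1 d2)); rewrite -mulrDr ler_wpM2l// -mulrDr.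
  apply: (@le_trans _ _ (`|t| * D)).
    by rewrite ler_wpM2l// /D -addrA lerDr.
  by rewrite -ler_pdivlMr.
rewrite (_ : t ^+ 2 * (eps * 5) = t ^+ 2 * (2 * eps) + t ^+ 2 * eps + t ^+ 2 * eps + t ^+ 2 * eps); last by ring.
rewrite (le_trans (ler_normB _ _))//; apply: (@le_trans _ _ (t ^+ 2 * (2 * eps) + t ^+ 2 * eps + t ^+ 2 * eps)).
  by rewrite lerD// (le_trans (ler_normB _ _))// lerD.
by rewrite lerDl mulr_ge0// ltW.
Qed.

Theorem central_limit_cf (s p : R) :
  (fun n => Ex m (fun x => cos (s / Num.sqrt n%:R * birkhoff_sum T F n x + p))) @ \oo -->
  cos p * expR (- (sigma2 * s ^+ 2 / 2)).
Proof.
have [->|s0] := eqVneq s 0.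
  rewrite expr0n mulr0 mul0r oppr0 expR0 mulr1.
  rewrite (_ : (fun n => _) = fun=> cos p); first exact: cvg_cst.
  apply/funext => n; rewrite (_ : (fun x => _) = fun=> cos p) ?Ex_cst//.
  by apply/funext => x; rewrite !mul0r add0r.
apply/cvgrPdist_le => eps e0.
have s20 : 0 < s ^+ 2 by rewrite lt_neqAle sqr_ge0 andbT eq_sym expf_neq0.
(* The n fine errors [t ^+ 2 * (e1 * 5)] add up to [eps / 3], because n t^2 = s^2. *)
pose e1 := eps / (15 * s ^+ 2); have e10 : 0 < e1 by rewrite divr_gt0// mulr_gt0.
have [k0 [j [t0 [C1 [t00 C10 Hs]]]]] := step e10.
have cvg1 (c : R) : c * n.+1%:R^-1 @[n --> \oo] --> 0.
  by rewrite -[X in _ --> X](mulr0 c); apply: cvgMr; exact: cvg_harmonic.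
pose tn (n : nat) : R := s / Num.sqrt n%:R.
have tn2 n : (0 < n)%N -> tn n ^+ 2 = s ^+ 2 * n%:R^-1.
  by move=> n0; rewrite /tn exprMn exprVn sqr_sqrtr.
have e30 : 0 < eps / 3 by rewrite divr_gt0.
have e4 : 0 < eps / (3 * (C + 1)) by rewrite divr_gt0// mulr_gt0// ltr_wpDl.
pose t1 := Num.min t0 (eps / (3 * (C + 1))).
have t10 : 0 < t1 by rewrite lt_min t00.
have /cvgrPdist_le/(_ _ (exprn_gt0 2 t10))[na _ Ha] := cvg1 (s ^+ 2).
have /cvgrPdist_le/(_ _ e30)[nb _ Hb] := cvg1 (j%:R * C1 * s ^+ 2).
exists (maxn na nb).+1 => // -[//|n]; rewrite /= ltnS geq_max => /andP[/Ha/= ha /Hb/= hb].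
rewrite sub0r normrN ger0_norm in ha; last by rewrite mulr_ge0// sqr_ge0.
have jC0 : 0 <= j%:R * C1 * s ^+ 2 by rewrite mulr_ge0 ?sqr_ge0// mulr_ge0.
rewrite sub0r normrN (ger0_norm (divr_ge0 jC0 (ler0n _ _))) in hb.
set t := tn n.+1; have t2 : t ^+ 2 = s ^+ 2 * n.+1%:R^-1 by exact: tn2.
have tt1 : `|t| <= t1.
  by rewrite -(@ler_pXn2r _ 2) ?nnegrE ?(ltW t10)// real_normK ?num_real// t2.
have tn0 : 0 < `|t|.
  by rewrite normr_gt0 /t /tn mulf_neq0// invr_neq0// sqrtr_eq0 -ltNge ltr0n.
have tt0 : `|t| <= t0 by apply: (le_trans tt1); rewrite ge_min lexx.
have tC : `|t| * C <= eps / 3.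
  have tt2 : `|t| <= eps / (3 * (C + 1)) by apply: (le_trans tt1); rewrite ge_min lexx orbT.
  apply: (le_trans (ler_wpM2r C0 tt2)).
  rewrite [leLHS](_ : _ = (C / (C + 1)) * (eps / 3)); last by field; rewrite gt_eqF// ltr_wpDl.
  by rewrite ler_piMl ?(ltW e30)// ler_pdivrMr ?ltr_wpDl// mul1r lerDl.
(* The truncation depends on [t]: the lag it leaves out is multiplied by [t] only and must itself be
   of order [t]. *)
have [N [kN KN]] : exists N, (k0 <= N)%N /\ K * r ^+ N.+1 <= e1 * `|t|.
  have cr : K * r ^+ N @[N --> \oo] --> K * 0.
    by apply: cvgMr; apply: cvg_expr; rewrite ger0_norm ?ltW.
  rewrite mulr0 in cr; have /cvgrPdist_le/(_ _ (mulr_gt0 e10 tn0))[N1 _ H1] := cr.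
  exists (maxn k0 N1); split; first exact: leq_maxl.
  have /= := H1 (maxn k0 N1).+1 (leq_trans (leq_maxr _ _) (leqnSn _)).
  by rewrite sub0r normrN; apply: le_trans; exact: ler_norm.
pose dk k := if (k < j)%N then t ^+ 2 * C1 else t ^+ 2 * (e1 * 5).
have /andP[q0 q1] := q01 t.
have Hd k : (k < n.+1)%N -> `|bb t p N k.+1 - q t * bb t p N k| <= dk k.
  move=> _; have [h1 h2] := Hs t p N k tt0 kN KN; rewrite /dk.
  by case: ltnP => // jk; exact: h2.
have nq : `|q t| <= 1 by rewrite ger0_norm.
have := perturbed_geometric nq Hd.
have -> : bb t p N 0 = cos p.
  rewrite /bb /corr_sum (_ : Vc t p 0 = fun=> cos p); last first.
    by apply/funext => x; rewrite /Vc /birkhoff_sum big_geq// mulr0 add0r.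
  rewrite Ex_cst (_ : Vs t p 0 = fun=> sin p); last first.
    by apply/funext => x; rewrite /Vs /birkhoff_sum big_geq// mulr0 add0r.
  rewrite big1 ?mulr0 ?subr0// => k _; under eq_fun do rewrite mulrC.
  by rewrite ExZ// EF0 mulr0.
have -> : q t ^+ n.+1 = expR (- (sigma2 * s ^+ 2 / 2)).
  rewrite /q -expRM_natl; congr expR; rewrite t2; field.
  by rewrite nat1r pnatr_eq0.
rewrite [_ * cos p]mulrC => main.
have sd : \sum_(0 <= k < n.+1) dk k <= eps / 3 + eps / 3.
  apply: (@le_trans _ _ (\sum_(0 <= k < n.+1) ((k < j)%N%:R * (t ^+ 2 * C1) + t ^+ 2 * (e1 * 5)))).
    apply: ler_sum => k _; rewrite /dk; case: ltnP => _; rewrite ?mul1r ?mul0r ?add0r// lerDl.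
    by rewrite mulr_ge0 ?sqr_ge0// mulr_ge0// ltW.
  rewrite big_split/= -mulr_suml sumr_const_nat subn0 lerD//.
    apply: le_trans hb; rewrite t2.
    rewrite [leRHS](_ : _ = j%:R * (s ^+ 2 / n.+1%:R * C1)); last by ring.
    rewrite ler_wpM2r//; first by rewrite mulr_ge0// divr_ge0 ?sqr_ge0.
    rewrite -natr_sum ler_nat; elim: (n.+1) => [|n' IH]; first by rewrite big_geq.
    rewrite big_nat_recr//=; case: ltnP => h; last by rewrite addn0.
    rewrite addn1 (leq_ltn_trans _ h)//.
    rewrite (leq_trans (n := \sum_(0 <= i < n') 1))//; first by apply: leq_sum => i _; case: (_ < _)%N.
    by rewrite sum_nat_const_nat subn0 muln1.
  rewrite -[_ *+ _]mulr_natr t2 /e1 le_eqVlt; apply/orP; left; apply/eqP; field.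
  by rewrite s0 nat1r pnatr_eq0.
have bV := bb_V t p N n.+1.
rewrite -/(Vc t p n.+1) in bV *.
rewrite distrC (_ : _ - _ = (Ex m (Vc t p n.+1) - bb t p N n.+1) +
  (bb t p N n.+1 - cos p * expR (- (sigma2 * s ^+ 2 / 2)))); last by rewrite /t /tn /Vc; ring.
rewrite (le_trans (ler_normD _ _))//; move: bV tC main sd; lra.
Qed.

End central_limit.

(** * Representation of functionals on L2 *)

Section truncation.
Context d (S : measurableType d) (R : realType) (m : probability S R).

(** Large values are replaced by 0 and not clamped, so that [trunc h n x * h x] is the square of
    [trunc h n x]. *)
Definition trunc (u : S -> R) (n : nat) x := if `|u x| <= n%:R then u x else 0.

Lemma measurable_trunc u n : measurable_fun setT u -> measurable_fun setT (trunc u n).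
Proof.
move=> mu; rewrite (_ : trunc u n = fun x => \1_[set x | `|u x| <= n%:R] x * u x).
  apply: measurable_funM => //; apply: measurable_indic.
  rewrite (_ : [set x | _] = (fun x => `|u x|) @^-1` `]-oo, n%:R]).
    by rewrite -[X in measurable X]setTI; exact: (measurableT_comp _ mu).
  by apply/seteqP; split => x /=; rewrite in_itv.
apply/funext => x; rewrite /trunc indicE; case: ifP => h1; first by rewrite mem_set ?mul1r.
by rewrite memNset ?mul0r//= h1.
Qed.

Lemma norm_trunc_le (u : S -> R) n x : `|trunc u n x| <= n%:R.
Proof. by rewrite /trunc; case: ifP => // _; rewrite normr0. Qed.

Lemma trunc_le (u : S -> R) n x : `|trunc u n x| <= `|u x|.
Proof. by rewrite /trunc; case: ifP => // _; rewrite normr0. Qed.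

Lemma trunc_cvg (u : S -> R) x : trunc u ^~ x @ \oo --> u x.
Proof.
apply: cvg_near_cst; exists (Num.truncn `|u x|).+1 => // n /= xn.
rewrite /trunc ifT// ltW// (lt_le_trans (truncnS_gt _))// ler_nat//.
Qed.

Lemma sq_integ_trunc (h : S -> R) (C : R) : measurable_fun setT h ->
  (forall n, Ex m (fun x => trunc h n x ^+ 2) <= C) -> sq_integ m h.
Proof.
move=> mh b; split => //.
apply/integrableP; split; first by apply/measurable_EFinP; exact: measurable_funX.
rewrite (eq_integral (fun x => limn (fun n => (trunc h n x ^+ 2)%:E))); last first.
  move=> x _; apply/esym/cvg_lim => //=; rewrite ger0_norm ?sqr_ge0//.
  apply: cvg_EFin; first exact: nearW.
  exact: (cvgM (trunc_cvg (u := h) (x := x)) (trunc_cvg (u := h) (x := x))).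
apply: (@le_lt_trans _ _ C%:E); last by rewrite ltry.
have mt n : measurable_fun setT (fun x => (trunc h n x ^+ 2)%:E).
  by apply/measurable_EFinP; apply: measurable_funX; exact: measurable_trunc.
rewrite monotone_convergence//.
- apply: lime_le.
    apply: ereal_nondecreasing_is_cvgn => n n' nn'; apply: ge0_le_integral => //.
    + by move=> x _; rewrite lee_fin sqr_ge0.
    + by move=> x _; rewrite lee_fin /trunc; case: ifP => [h1|_]; rewrite ?expr0n ?sqr_ge0//
        ifT// (le_trans h1)// ler_nat.
  apply: nearW => n; have L2t := sq_integ_bounded m (measurable_trunc n mh) (norm_trunc_le h n).
  by rewrite (integral_Ex L2t.2) lee_fin.
- by move=> n x _; rewrite lee_fin sqr_ge0.
- move=> x _ n n' nn'; rewrite lee_fin /trunc; case: ifP => [h1|_]; rewrite ?expr0n ?sqr_ge0//.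
  by rewrite ifT// (le_trans h1)// ler_nat.
Qed.

End truncation.

(** * Functionals represented on indicators *)

Section bounded_functional.
Context d (S : measurableType d) (R : realType) (m : probability S R).

Variables (L : (S -> R) -> R) (C : R).
Hypothesis C0 : 0 <= C.
Hypothesis LD : forall (c : R) u v, sq_integ m u -> sq_integ m v ->
  L (fun x => c * u x + v x) = c * L u + L v.
Hypothesis LB : forall u, sq_integ m u -> `|L u| <= C * norm2 m u.
Variable h : S -> R.
Hypothesis ih : integ m h.
Hypothesis Lh : forall B, measurable B -> L \1_B = Ex m (fun x => \1_B x * h x).

Let L2b (u : S -> R) (M : R) : measurable_fun setT u -> (forall x, `|u x| <= M) -> sq_integ m u.
Proof. exact: sq_integ_bounded. Qed.

Let L0 : L (fun=> 0) = 0.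
Proof.
have := LB (sq_integ_cst m 0); rewrite /norm2 expr0n/= Ex_cst sqrtr0 mulr0.
by rewrite normr_le0 => /eqP.
Qed.

Let L_sum n (c : R) (B : nat -> set S) : (forall k, measurable (B k)) ->
  L (fun x => \sum_(0 <= k < n) c * \1_(B k) x) = \sum_(0 <= k < n) c * L \1_(B k).
Proof.
move=> mB; elim: n => [|n IH].
  by rewrite [RHS]big_geq// -[RHS]L0; congr L; apply/funext => x; rewrite big_geq.
rewrite big_nat_recr//= -IH addrC -LD.
- by congr L; apply/funext => x; rewrite big_nat_recr//= addrC.
- exact: sq_integ_indic.
- apply: (@L2b _ (n%:R * `|c|)); first by apply: measurable_sum => k; exact: measurable_funM.
  move=> x; rewrite (le_trans (ler_norm_sum _ _ _))//.
  apply: (@le_trans _ _ (\sum_(0 <= k < n) `|c|)); last by rewrite sumr_const_nat subn0 mulr_natl.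
  apply: ler_sum => k _.
  by rewrite normrM indicE; case: (_ \in _); rewrite ?normr1 ?mulr1 ?normr0 ?mulr0.
Qed.

Let ihv (v : S -> R) (M : R) : measurable_fun setT v -> (forall x, `|v x| <= M) ->
  integ m (fun x => v x * h x).
Proof.
move=> mv vM; apply: (integ_le _ _ (integZ M (integ_norm ih))).
  by apply: measurable_funM => //; exact: integ_measurable ih.
by move=> x; rewrite normrM ler_wpM2r.
Qed.

(** Step functions approximate [u] uniformly, and both sides are continuous for uniform
    convergence. *)
Let L_unit (u : S -> R) : measurable_fun setT u -> (forall x, 0 <= u x <= 1) ->
  L u = Ex m (fun x => u x * h x).
Proof.
move=> mu u01; apply/eqP; rewrite -subr_eq0 -normr_le0; apply/ler_addgt0Pl => eps e0; rewrite addr0.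
set K := C + Ex m (fun x => `|h x|); have K0 : 0 <= K by rewrite addr_ge0// Ex_ge0.
pose N := (Num.truncn (K / eps)).+1.
have KN : K / N%:R <= eps.
  rewrite ler_pdivrMr ?ltr0n// mulrC -ler_pdivrMr//; exact/ltW/truncnS_gt.
apply: le_trans KN.
pose B k := [set z | k.+1%:R <= N%:R * u z].
have mB k : measurable (B k) := measurable_level N k mu.
pose v (x : S) : R := \sum_(0 <= k < N) N%:R^-1 * \1_(B k) x.
have uv x : `|u x - v x| <= N%:R^-1 := unit_step_approx u01 x (ltn0Sn _).
have mv : measurable_fun setT v.
  by apply: measurable_sum => k; exact: measurable_funM.
have u1 x : `|u x| <= 1 by case/andP: (u01 x) => h0 h1; rewrite ger0_norm.
have v2 x : `|v x| <= 2.
  rewrite -[v x](subrK (u x)) (le_trans (ler_normD _ _))// -[2]/(1 + 1) lerD// distrC.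
  by rewrite (le_trans (uv x))// invf_le1 ?ltr0n// ler1n.
have L2u := L2b mu u1; have L2v := L2b mv v2.
have muv : measurable_fun setT (fun x => u x - v x) by exact: measurable_funB.
have iLv : L v = Ex m (fun x => v x * h x).
  rewrite /v L_sum//.
  transitivity (Ex m (fun x => \sum_(0 <= k < N) N%:R^-1 * (\1_(B k) x * h x))); last first.
    by congr (Ex m _); apply/funext => x; rewrite mulr_suml; apply: eq_bigr => k _; rewrite mulrA.
  rewrite Ex_sum; last by move=> k; apply: integZ; exact: integ_indicM.
  by apply: eq_bigr => k _; rewrite Lh// ExZ//; exact: integ_indicM.
have Lu : L u = L (fun x => u x - v x) + L v.
  have := LD 1 (sq_integB L2u L2v) L2v; rewrite mul1r => <-.
  by congr L; apply/funext => x; ring.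
have Eu : Ex m (fun x => u x * h x) = Ex m (fun x => (u x - v x) * h x) + Ex m (fun x => v x * h x).
  rewrite -ExD; [|exact: (ihv (M := N%:R^-1))|exact: (ihv (M := 2))].
  by congr (Ex m _); apply/funext => x; ring.
rewrite Lu Eu iLv opprD addrACA subrr addr0 (le_trans (ler_normB _ _))// /K mulrDl lerD//.
  rewrite (le_trans (LB (sq_integB L2u L2v)))// ler_wpM2l//.
  exact: norm2_bounded.
rewrite mulrC -ExZ; last exact: integ_norm.
apply: Ex_le_norm; first by apply: integZ; exact: integ_norm.
  by apply: measurable_funM => //; exact: integ_measurable ih.
by move=> x; rewrite normrM ler_wpM2r.
Qed.

Let L_bounded (u : S -> R) (M : R) : measurable_fun setT u -> (forall x, `|u x| <= M) ->
  L u = Ex m (fun x => u x * h x).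
Proof.
move=> mu uM; have M1 : 0 < M + 1 by rewrite ltr_wpDl// (le_trans (normr_ge0 _) (uM point)).
pose w x := (u x / (M + 1) + 1) / 2.
have mw : measurable_fun setT w by apply: measurable_funM => //; apply: measurable_funD => //; exact: measurable_funM.
have w01 x : 0 <= w x <= 1.
  have : `|u x / (M + 1)| <= 1.
    rewrite normrM normfV (gtr0_norm M1) ler_pdivrMr// mul1r (le_trans (uM x))// lerDl//.
  by rewrite ler_norml => /andP[a b]; rewrite /w; apply/andP; split; lra.
have w1 x : `|w x| <= 1 by case/andP: (w01 x) => h0 h1; rewrite ger0_norm.
have L2w := L2b mw w1.
have c01 (x : S) : 0 <= (1 : R) <= 1 by rewrite ler01 lexx.
have mc1 : measurable_fun setT (fun _ : S => 1 : R) by [].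
have uE : u = fun x => (2 * (M + 1)) * w x + (- (M + 1)) * 1.
  by apply/funext => x; rewrite /w; field; rewrite gt_eqF.
have L2c := sq_integZ (- (M + 1)) (sq_integ_cst m 1).
rewrite {1}uE LD// (L_unit mw w01).
have -> : L (fun=> - (M + 1) * 1) = - (M + 1) * L (fun=> 1).
  have E := LD (- (M + 1)) (sq_integ_cst m 1) (sq_integ_cst m 0); rewrite L0 in E.
  by rewrite -[RHS]addr0 -E; congr L; apply/funext => x; rewrite addr0.
rewrite (L_unit mc1 c01) -!ExZ -?ExD.
- by congr (Ex m _); apply/funext => x; rewrite [in RHS]uE; ring.
- by apply: integZ; exact: (ihv (M := 1)).
- by apply: integZ; apply: (ihv (M := 1)) => // x; rewrite normr1.
- by apply: (ihv (M := 1)) => // x; rewrite normr1.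
- exact: (ihv (M := 1)).
Qed.

(** Tested on [trunc h n], the functional returns the square of its norm; boundedness then makes
    this norm at most [C], for every [n]. *)
Lemma representer_sq_integ : sq_integ m h.
Proof.
have mh := integ_measurable ih.
have b n : Ex m (fun x => trunc h n x ^+ 2) <= C ^+ 2.
  have L2t := L2b (measurable_trunc n mh) (norm_trunc_le h n).
  have := LB L2t; rewrite (L_bounded (measurable_trunc n mh) (norm_trunc_le h n)).
  rewrite (_ : (fun x => _ * _) = fun x => trunc h n x ^+ 2); last first.
    by apply/funext => x; rewrite /trunc; case: ifP; rewrite ?mul0r ?expr0n.
  rewrite -norm2K ger0_norm ?sqr_ge0//; have := norm2_ge0 m (trunc h n).
  set y := norm2 _ _ => y0; rewrite expr2 => yC.
  have [->|y1] := eqVneq y 0; first by rewrite mulr0 sqr_ge0.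
  have yp : 0 < y by rewrite lt_neqAle eq_sym y1.
  by rewrite ler_pM2r// in yC; rewrite -expr2 lerXn2r ?nnegrE.
exact: (@sq_integ_trunc _ _ _ _ _ (C ^+ 2)).
Qed.

Lemma representerE u : sq_integ m u -> L u = Ex m (fun x => u x * h x).
Proof.
move=> L2u; have mu := sq_integ_measurable L2u; have L2h := representer_sq_integ.
have L2t n := L2b (measurable_trunc n mu) (norm_trunc_le u n).
have c1 : (fun n => norm2 m (fun x => u x - trunc u n x)) @ \oo --> (0 : R).
  rewrite /norm2 -[X in _ --> X](_ : Num.sqrt (Ex m (fun=> 0)) = 0); last by rewrite Ex_cst sqrtr0.
  apply: continuous_cvg; first exact: sqrt_continuous.
  apply: (@cvg_Ex _ _ _ _ _ _ (fun x => 4 * u x ^+ 2)) => //.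
  - by move=> n; apply: measurable_funX; apply: measurable_funB => //; exact: measurable_trunc.
  - by apply: integZ; exact: L2u.2.
  - move=> n x; rewrite ger0_norm ?sqr_ge0// -(real_normK (num_real (_ - _))).
    apply: (@le_trans _ _ ((`|u x| + `|u x|) ^+ 2)).
      rewrite lerXn2r ?nnegrE ?addr_ge0// (le_trans (ler_normB _ _))// lerD2l.
      exact: trunc_le.
    by rewrite -(real_normK (num_real (u x))) le_eqVlt; apply/orP; left; apply/eqP; ring.
  - move=> x; rewrite -[X in _ --> X](_ : (u x - u x) ^+ 2 = 0); last by rewrite subrr expr0n.
    have c : (fun n => u x - trunc u n x) @ \oo --> u x - u x.
      by apply: cvgB; [exact: cvg_cst|exact: trunc_cvg].
    exact: (cvgM c c).
have b n : `|L u - Ex m (fun x => u x * h x)| <=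
    (C + norm2 m h) * norm2 m (fun x => u x - trunc u n x).
  have L2d := sq_integB L2u (L2t n).
  have -> : L u = L (fun x => u x - trunc u n x) + Ex m (fun x => trunc u n x * h x).
    rewrite -(L_bounded (measurable_trunc n mu) (norm_trunc_le u n)).
    have := LD 1 L2d (L2t n); rewrite mul1r => <-.
    by congr L; apply/funext => x; ring.
  have -> : Ex m (fun x => u x * h x) =
      Ex m (fun x => (u x - trunc u n x) * h x) + Ex m (fun x => trunc u n x * h x).
    rewrite -ExD; [|exact: sq_integM|exact: sq_integM].
    by congr (Ex m _); apply/funext => x; ring.
  rewrite opprD addrACA subrr addr0 (le_trans (ler_normB _ _))// mulrDl lerD//; first exact: LB.
  by rewrite mulrC; exact: Cauchy_Schwarz_Ex.
apply/eqP; rewrite -subr_eq0 -normr_le0.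
have c2 : (fun n => (C + norm2 m h) * norm2 m (fun x => u x - trunc u n x)) @ \oo --> (C + norm2 m h) * 0.
  exact: cvgMr.
rewrite mulr0 in c2; rewrite -(cvg_lim _ c2)//.
by apply: limr_ge; [apply/cvg_ex; exists 0|apply: nearW].
Qed.

End bounded_functional.

(** * Riesz representation *)

Section riesz_representation.
Context d (S : measurableType d) (R : realType) (m : probability S R).
Variables (L : (S -> R) -> R) (C : R).
Hypothesis C0 : 0 <= C.
Hypothesis LD : forall (c : R) u v, sq_integ m u -> sq_integ m v ->
  L (fun x => c * u x + v x) = c * L u + L v.
Hypothesis LB : forall u, sq_integ m u -> `|L u| <= C * norm2 m u.

Let tail (B : nat -> set S) n := \bigcup_(i in [set i | (n <= i)%N]) B i.

Let tail_indic (B : nat -> set S) n : trivIset setT B ->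
  \1_(tail B n) = (fun x => 1 * \1_(B n) x + \1_(tail B n.+1) x) :> (S -> R).
Proof.
move=> tB; apply/funext => x; rewrite mul1r !indicE.
have [/set_mem Bx|/negP nBx] := boolP (x \in B n).
  rewrite mem_set; last by exists n => //=.
  rewrite memNset ?addr0// => -[i /= ni Bi].
  by move/trivIsetP: tB => /(_ n i I I); rewrite neq_ltn ni => /(_ isT)/seteqP[/(_ x) + _]; apply.
rewrite add0r; congr (nat_of_bool _)%:R; apply/idP/idP => /set_mem[i /= ni Bi]; apply/mem_set; exists i => //=.
  by rewrite ltn_neqAle ni andbT; apply/eqP => ni'; apply: nBx; apply/mem_set; rewrite ni'.
exact: ltnW.
Qed.

(** The remainder after n sets is the value on the indicator of a tail, at most [C] times the square
    root of its mass. *)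
Let L_sigma_additive : semi_sigma_additive (fun B => (L \1_B)%:E).
Proof.
move=> B mB tB mUB.
have mt n : measurable (tail B n) by exact: bigcup_measurable.
have UE : \bigcup_n B n = tail B 0 by apply: eq_bigcupl; split.
have LE n : L \1_(\bigcup_n B n) - \sum_(0 <= i < n) L \1_(B i) = L \1_(tail B n).
  elim: n => [|n IH]; first by rewrite big_geq// subr0 UE.
  rewrite big_nat_recr//= opprD addrA IH tail_indic// LD ?mul1r; [ring|exact: sq_integ_indic|exact: sq_integ_indic].
have prE n : pr m (\bigcup_n B n) - \sum_(0 <= i < n) pr m (B i) = pr m (tail B n).
  elim: n => [|n IH]; first by rewrite big_geq// subr0 UE.
  rewrite big_nat_recr//= opprD addrA IH -!Ex_indic// tail_indic// ExD.
  - by under eq_fun do rewrite mul1r; ring.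
  - by under eq_fun do rewrite mul1r; exact: integ_indic.
  - exact: integ_indic.
have c0 : (fun n => pr m (tail B n)) @ \oo --> (0 : R).
  rewrite -(subrr (pr m (\bigcup_n B n))); under eq_fun do rewrite -prE.
  by apply: cvgB; [exact: cvg_cst|exact: pr_bigcup_series].
have c1 : (fun n => C * Num.sqrt (pr m (tail B n))) @ \oo --> (0 : R).
  rewrite -[X in _ --> X](mulr0 C) -[X in C * X]sqrtr0; apply: cvgMr.
  by apply: continuous_cvg => //; exact: sqrt_continuous.
under eq_fun do rewrite sumEFin.
apply: cvg_EFin; first exact: nearW.
apply/cvgrPdist_le => eps e0; move/cvgrPdist_le/(_ eps e0): c1 => -[n0 _ Hn].
exists n0 => // n /= n0n; rewrite LE; apply: le_trans (Hn n n0n).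
rewrite sub0r normrN (le_trans (LB (sq_integ_indic m (mt n))))// norm2_indic// ler_norm//.
Qed.

Let L0 : L \1_set0 = 0.
Proof.
have := LB (sq_integ_indic m measurable0); rewrite norm2_indic// pr0 sqrtr0 mulr0.
by rewrite normr_le0 => /eqP.
Qed.

(** The values on indicators form a charge dominated by [m]; its Radon-Nikodym derivative is the
    representing function. *)
Lemma riesz_L2 : exists2 h, sq_integ m h &
  forall u, sq_integ m u -> L u = Ex m (fun x => u x * h x).
Proof.
have n0 : (L \1_set0)%:E = 0%E by rewrite L0.
have nf : forall B, measurable B -> (L \1_B)%:E \is a fin_num by [].
pose nu : {charge set S -> \bar R} :=
  HB.pack (fun B : set S => (L \1_B)%:E) (isCharge.Build _ _ _ (fun B => (L \1_B)%:E) n0 nf L_sigma_additive).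
have nuE B : nu B = (L \1_B)%:E by [].
have num : nu `<< m.
  apply/null_content_dominatesP => A mA mA0; rewrite nuE.
  have := LB (sq_integ_indic m mA); rewrite norm2_indic// /pr mA0 sqrtr0 mulr0.
  by rewrite normr_le0 => /eqP ->.
pose h := fine \o Radon_Nikodym nu m.
have hE x : (h x)%:E = Radon_Nikodym nu m x by rewrite /h/= fineK// Radon_Nikodym_fin_num.
have ih : integ m h.
  rewrite /integ (_ : EFin \o h = Radon_Nikodym nu m); first exact: Radon_Nikodym_integrable.
  by apply/funext => x; exact: hE.
have Lh B : measurable B -> L \1_B = Ex m (fun x => \1_B x * h x).
  move=> mB; have := Radon_Nikodym_integral num mB; rewrite nuE => E.
  rewrite /Rintegral (_ : (\int[m]_x (\1_B x * h x)%:E)%E = (L \1_B)%:E)// E.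
  rewrite [RHS]integral_mkcond; apply: eq_integral => x _; rewrite patchE indicE.
  by case: ifP => xB; rewrite ?mul1r ?mul0r// hE.
have L2h := representer_sq_integ C0 LD LB ih Lh; exists h => [|u L2u]; first exact: L2h.
exact: (representerE C0 LD LB ih Lh L2u).
Qed.

End riesz_representation.

(** * Gordin's decomposition *)

Section martingale_coboundary.
Context d (S : measurableType d) (R : realType) (m : probability S R).
Variables (T : S -> S) (F : S -> R) (K r : R).
Hypotheses (mpT : measure_preserving m T) (L2F : sq_integ m F).
Hypotheses (K0 : 0 <= K) (r0 : 0 < r) (r1 : r < 1).
Hypothesis dec : forall k v, (0 < k)%N -> sq_integ m v ->
  `|Ex m (fun x => F x * v (iter k T x))| <= K * r ^+ k * norm2 m v.

Lemma corr_sum_series N v :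
  corr_sum m T F N v = series (fun k => Ex m (fun x => F x * v (iter k.+1 T x))) N.
Proof. by rewrite /corr_sum big_add1. Qed.

Lemma corr_sum_cvg v : sq_integ m v -> cvgn (fun N => corr_sum m T F N v).
Proof.
move=> L2v; under eq_fun do rewrite corr_sum_series.
apply: normed_cvg; apply: series_le_cvg (is_cvg_geometric_series (a := K * r * norm2 m v) (z := r) _).
- by move=> n /=.
- by move=> n; rewrite /geometric/= !mulr_ge0 ?exprn_ge0 ?norm2_ge0 ?(ltW r0).
- by move=> n; apply: (le_trans (dec _ L2v)) => //; rewrite exprS le_eqVlt; apply/orP; left; apply/eqP; rewrite /geometric/=; ring.
- by rewrite gtr0_norm.
Qed.

Let W v : R := limn (fun N => corr_sum m T F N v).

Let WB v : sq_integ m v -> `|W v| <= K / (1 - r) * norm2 m v.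
Proof.
move=> L2v; have cW := corr_sum_cvg L2v.
rewrite /W -(cvg_lim _ (cvg_norm cW))//.
apply: limr_le; first by apply/cvg_ex; exists `|W v|; exact: cvg_norm.
by apply: nearW => N; exact: corr_sum_bound.
Qed.

Let iFv k v : sq_integ m v -> integ m (fun x => F x * v (iter k T x)).
Proof. by move=> L2v; apply: sq_integM => //; exact: (sq_integ_comp (measure_preserving_iter mpT k) L2v). Qed.

Let WD (c : R) u v : sq_integ m u -> sq_integ m v ->
  W (fun x => c * u x + v x) = c * W u + W v.
Proof.
move=> L2u L2v; apply: cvg_lim => //.
rewrite (_ : (fun N => _) = fun N => c * corr_sum m T F N u + corr_sum m T F N v).
  by apply: cvgD; [apply: cvgMr|]; exact: corr_sum_cvg.
apply/funext => N; rewrite /corr_sum mulr_sumr -big_split/=; apply: eq_bigr => k _.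
rewrite -ExZ -?ExD; [|exact/integZ/iFv|exact: iFv|exact: iFv].
by congr (Ex m _); apply/funext => x; ring.
Qed.

(** Composition with [T] raises every lag by one, so the series loses its first term. *)
Let W_comp v : sq_integ m v -> W (fun x => v (T x)) = W v - Ex m (fun x => F x * v (T x)).
Proof.
move=> L2v; apply: cvg_lim => //.
rewrite (_ : (fun N => _) = fun N => corr_sum m T F N.+1 v - Ex m (fun x => F x * v (T x))).
  apply: cvgB; last exact: cvg_cst.
  by rewrite (cvg_shiftS (fun N => corr_sum m T F N v)); exact: corr_sum_cvg.
apply/funext => N; rewrite !corr_sum_series /series/= big_nat_recl//= addrC addKr.
by apply: eq_bigr => k _; congr (Ex m _); apply/funext => x; rewrite -iterS -iterSr.
Qed.

(* Gordin's decomposition: with [W v = Ex(h v)], the function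
   [F + h - h \o T] is orthogonal to all the [v \o T]. *)
Lemma martingale_coboundary : exists2 h, sq_integ m h &
  Ex m (fun x => (F x + h x - h (T x)) ^+ 2) =
    Ex m (fun x => F x ^+ 2) + 2 * limn (fun N => corr_sum m T F N F).
Proof.
have C0 : 0 <= K / (1 - r) by rewrite divr_ge0// subr_ge0 ltW.
have [h L2h hE] := riesz_L2 C0 WD WB; exists h => //.
have L2hT := sq_integ_comp mpT L2h.
(* Orthogonality to [h \o T]. With it, the square has the expectation of [F ^+ 2 + 2 * F * h], and
   the expectation of [F * h] is the functional at [F]. *)
have E1 : Ex m (fun x => h (T x) * h x) = Ex m (fun x => h x * h x) - Ex m (fun x => F x * h (T x)).
  by rewrite -hE// W_comp// hE.
have E2 : Ex m (fun x => h (T x) * h (T x)) = Ex m (fun x => h x * h x).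
  apply: (Ex_comp mpT (u := fun x => h x * h x)).
  by apply: measurable_funM; exact: sq_integ_measurable L2h.
have E3 := hE _ L2F; rewrite /W in E3; rewrite E3.
have -> : (fun x => (F x + h x - h (T x)) ^+ 2) = fun x => F x ^+ 2 + 2 * (F x * h x) + h x * h x +
    h (T x) * h (T x) + (- 2) * (F x * h (T x)) + (- 2) * (h (T x) * h x).
  by apply/funext => x; ring.
have iFF := L2F.2; have iFh := sq_integM L2F L2h; have ihh := sq_integM L2h L2h.
have ihh' := sq_integM L2hT L2hT; have iFh' := sq_integM L2F L2hT; have ih'h := sq_integM L2hT L2h.
have i1 := integZ 2 iFh; have i2 := integZ (- 2) iFh'; have i3 := integZ (- 2) ih'h.
have j1 := integD iFF i1; have j2 := integD j1 ihh; have j3 := integD j2 ihh'; have j4 := integD j3 i2.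
rewrite (ExD j4 i3) (ExD j3 i2) (ExD j2 ihh') (ExD j1 ihh) (ExD iFF i1) !ExZ// E2 E1; ring.
Qed.

End martingale_coboundary.

(** * Measurable coboundaries are bounded *)

(** A ratio z / (x + y) in [0, 1] is at most its power [p]; the bounds for x and y add up. *)
Lemma powR_subadd (R : realType) (x y p : R) : 0 <= x -> 0 <= y -> 0 < p <= 1 ->
  (x + y) `^ p <= x `^ p + y `^ p.
Proof.
move=> x0 y0 /andP[p0 p1]; have [s0|sn0] := eqVneq (x + y) 0.
  by rewrite s0 powR0 ?gt_eqF// addr_ge0 ?powR_ge0.
have s0 : 0 < x + y by rewrite lt_neqAle eq_sym sn0 addr_ge0.
have H z : 0 <= z -> z <= x + y -> z / (x + y) * (x + y) `^ p <= z `^ p.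
  move=> z0 zs; have [->|zn0] := eqVneq z 0; first by rewrite !mul0r powR_ge0.
  have zp : 0 < z by rewrite lt_neqAle eq_sym zn0.
  have z1 : 0 < z / (x + y) <= 1 by rewrite divr_gt0//= ler_pdivrMr// mul1r.
  rewrite -[X in _ <= X `^ _](divfK sn0 z) powRM ?divr_ge0 ?(ltW s0)// ler_wpM2r ?powR_ge0//.
  exact: ger1_powR.
have := lerD (H x x0 _) (H y y0 _); rewrite -!mulrDl divff// mul1r; apply.
  by rewrite lerDl.
by rewrite lerDr.
Qed.

Section almost_everywhere.
Context d (S : measurableType d) (R : realType) (m : probability S R).

Lemma ae_exists (A : set S) (P : S -> Prop) : measurable A -> 0 < pr m A ->
  (\forall x \ae m, P x) -> exists2 x, A x & P x.
Proof.
move=> mA A0 Pae; apply: contrapT => nex.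
have : pr m A = 0.
  apply: pr_negligible => //; apply: negligibleS Pae => x Ax Px.
  by apply: nex; exists x.
by move=> A0'; rewrite A0' ltxx in A0.
Qed.

Lemma ae_pr_eq0 (A : set S) : measurable A -> (\forall x \ae m, ~ A x) -> pr m A = 0.
Proof.
by move=> mA H; apply: pr_negligible => //; apply: negligibleS H => x Ax; exact.
Qed.

Lemma pr_eq0_ae (A : set S) : measurable A -> pr m A = 0 -> \forall x \ae m, ~ A x.
Proof.
move=> mA A0; have := pr_eq0_negligible mA A0; apply: negligibleS => x /=.
exact: contrapT.
Qed.

Lemma le_pr_ae (A B : set S) : measurable A -> measurable B ->
  (\forall x \ae m, A x -> B x) -> pr m A <= pr m B.
Proof.
move=> mA mB AB; rewrite (prDI m mA mB) [X in X + _](_ : _ = 0); last first.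
  apply: ae_pr_eq0; first exact: measurableD.
  by apply: filterS AB => x ABx [Ax nB]; exact/nB/ABx.
by rewrite add0r le_pr//; exact: measurableI.
Qed.

Lemma measurable_dist_gt (u : S -> R) (v c : R) : measurable_fun setT u ->
  measurable [set x | c < `|u x - v|].
Proof.
move=> mu; rewrite (_ : [set x | _] = (fun x => `|u x - v|) @^-1` `]c, +oo[); last first.
  by apply/seteqP; split => x /=; rewrite in_itv/= andbT.
rewrite -[X in measurable X]setTI; apply: measurableT_comp => //.
exact: measurable_funB.
Qed.

Lemma measurable_norm_gt (u : S -> R) (c : R) : measurable_fun setT u ->
  measurable [set x | c < `|u x|].
Proof.
by move=> mu; have := measurable_dist_gt 0 c mu; under eq_set do rewrite subr0.
Qed.

Lemma norm_gt_eventually_small (u : S -> R) (del : R) : measurable_fun setT u -> 0 < del ->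
  exists n : nat, pr m [set x | n%:R < `|u x|] <= del.
Proof.
move=> mu d0; have : (fun n : nat => pr m [set x | n%:R < `|u x|]) @ \oo --> (0 : R).
  apply: pr_eventually0 => [n|x]; first exact: measurable_norm_gt.
  exists (Num.truncn `|u x|).+1 => // n /= xn; apply/negP; rewrite -leNgt.
  by rewrite ltW// (lt_le_trans (truncnS_gt _))// ler_nat.
move=> /cvgrPdist_le/(_ del d0)[n _ /(_ n (leqnn n))] /=.
by rewrite sub0r normrN => h; exists n; exact: le_trans (ler_norm _) h.
Qed.

End almost_everywhere.

Section bounded_coboundary.
Context d (S : measurableType d) (R : realType) (m : probability S R).
Variables (T : S -> S) (a b : nat -> set S) (s : seq nat) (theta C eta : R).
Variables (f Dl : S -> R) (Dn : nat -> R).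
Hypothesis M : markov_model m T a b s theta C.
Hypothesis O : regular_observable m T a theta eta f Dl Dn.
Hypothesis dense : forall A (eps : R), measurable A -> 0 < eps ->
  exists n (Q : set (seq nat)), (forall w, Q w -> size w = n.+1) /\
    pr m (A `+` \bigcup_(w in Q) cylinder T a w) <= eps.

Let mpT := mm_mp M.
Let theta_gt0 : 0 < theta. Proof. by case/andP: (mm_theta M). Qed.
Let theta_lt1 : theta < 1. Proof. by case/andP: (mm_theta M). Qed.
Let eta_gt0 : 0 < eta. Proof. by case/andP: (ro_eta O). Qed.
Let mcyl w : measurable (cylinder T a w) := measurable_cylinder M w.
Let mTn n A : measurable A -> measurable (iter n T @^-1` A).
Proof. exact: (mp_preimage (measure_preserving_iter mpT n)). Qed.

(** Bound for the oscillation of the Birkhoff sum over the cylinder: each letter contributes its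
    constant times [theta] to the number of letters that follow, since these letters are still
    common to both orbits. *)
Fixpoint word_osc (w : seq nat) : R :=
  if w is i :: w' then Dn i * theta ^+ size w' + word_osc w' else 0.

Let osc n x := \sum_(0 <= k < n) Dl (iter k T x) * theta ^+ (n.-1 - k).

Let oscS n x : osc n.+1 x = Dl x * theta ^+ n + osc n (T x).
Proof.
rewrite /osc big_nat_recl//= subn0; congr (_ + _).
rewrite !big_nat; apply: eq_bigr => k /andP[_ kn].
by rewrite -iterS iterSr; congr (_ * _ ^+ _); lia.
Qed.

Let osc_ge0 n x : 0 <= osc n x.
Proof.
by apply: sumr_ge0 => k _; rewrite mulr_ge0 ?(ro_Dl_ge0 O)// exprn_ge0// ltW.
Qed.

Let oscE w x : cylinder T a w x -> osc (size w) x = word_osc w.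
Proof.
elim: w x => [x _|i w IH x /= [ax Tx]]; first by rewrite /osc big_geq.
by rewrite oscS IH// (ro_DlE O ax).
Qed.

Let mosc n : measurable_fun setT (osc n).
Proof.
apply: measurable_sum => k; apply: measurable_funM => //.
exact: (measurableT_comp (ro_Dl O) (mp_measurable (measure_preserving_iter mpT k))).
Qed.

(** The power [eta] is subadditive, so the moment of the sum is bounded by a geometric series,
    uniformly in the length. *)
Let osc_moment : exists2 B : R, 0 < B & forall n,
  integ m (fun x => osc n x `^ eta) /\ Ex m (fun x => osc n x `^ eta) <= B.
Proof.
pose E0 := Ex m (fun x => Dl x `^ eta); pose q := theta `^ eta.
have E0_ge0 : 0 <= E0 by apply: Ex_ge0 => x; exact: powR_ge0.
have q0 : 0 < q by rewrite powR_gt0.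
have q1 : q < 1.
  by rewrite /q /powR gt_eqF// -expR0 ltr_expR pmulr_rlt0// ln_lt0 ?theta_gt0.
have B0 : 0 <= E0 / (1 - q) by rewrite divr_ge0// subr_ge0 ltW.
exists (E0 / (1 - q) + 1); first by rewrite ltr_wpDl.
suff H n : integ m (fun x => osc n x `^ eta) /\ Ex m (fun x => osc n x `^ eta) <= E0 * (1 - q ^+ n) / (1 - q).
  move=> n; split; first by case: (H n).
  apply: (le_trans (H n).2); apply: (@le_trans _ _ (E0 / (1 - q))); last by rewrite lerDl.
  rewrite ler_pM2r ?invr_gt0 ?subr_gt0// ler_piMr// gerBl exprn_ge0// ltW//.
elim: n => [|n [IH1 IH2]].
  rewrite (_ : (fun x => _) = fun=> 0); first by rewrite Ex_cst expr0 subrr mulr0 mul0r; split => //; exact: integ_cst.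
  by apply/funext => x; rewrite /osc big_geq// powR0// gt_eqF.
have i1 : integ m (fun x => q ^+ n * Dl x `^ eta) := integZ _ (ro_integ O).
have i2 := integ_comp mpT IH1.
have le x : osc n.+1 x `^ eta <= q ^+ n * Dl x `^ eta + osc n (T x) `^ eta.
  rewrite oscS; apply: (le_trans (powR_subadd _ _ (ro_eta O))) => //.
    by rewrite mulr_ge0 ?(ro_Dl_ge0 O)// exprn_ge0// ltW.
  rewrite lerD2r powRM ?(ro_Dl_ge0 O) ?exprn_ge0 ?(ltW theta_gt0)// mulrC.
  rewrite ler_wpM2r ?powR_ge0// le_eqVlt; apply/orP; left; apply/eqP.
  elim: n {IH1 IH2 i1 i2} => [|n IH]; first by rewrite !expr0 powR1.
  by rewrite !exprS powRM ?exprn_ge0 ?(ltW theta_gt0)// IH.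
have i3 : integ m (fun x => osc n.+1 x `^ eta).
  apply: (integ_le _ _ (integD i1 i2)).
    by apply: (measurableT_comp (measurable_powR _)).
  by move=> x; rewrite ger0_norm ?powR_ge0.
split => //; apply: (le_trans (le_Ex i3 (integD i1 i2) le)); rewrite (ExD i1 i2) ExZ; last exact: ro_integ O.
rewrite (Ex_comp mpT (u := fun x => osc n x `^ eta)); last exact: integ_measurable IH1.
apply: (@le_trans _ _ (q ^+ n * E0 + E0 * (1 - q ^+ n) / (1 - q))); first by rewrite lerD2l.
rewrite le_eqVlt; apply/orP; left; apply/eqP; rewrite exprS; field.
by rewrite subr_eq0 gt_eqF.
Qed.

Let osc_tight : exists2 K : R, 0 <= K & forall n, pr m [set x | K < osc n x] <= 4^-1.
Proof.
have [B B0 HB] := osc_moment; exists ((4 * B) `^ eta^-1); first exact: powR_ge0.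
move=> n; have [io Eo] := HB n.
have B4 : 0 < 4 * B by rewrite mulr_gt0.
have := markov_Ex io (fun x => powR_ge0 (osc n x) eta) B4.
rewrite (_ : [set x | _] = [set x | (4 * B) `^ eta^-1 < osc n x]); last first.
  have h : 4 * B = (4 * B) `^ eta^-1 `^ eta.
    by rewrite -powRrM mulVf ?gt_eqF// powRr1// ltW.
  apply/seteqP; split => x /=.
    rewrite {1}h !ltNge => /negP hx; apply/negP => hx'; apply: hx.
    by apply: ge0_ler_powR; rewrite ?nnegrE ?powR_ge0// ltW.
  by move=> hx; rewrite {1}h gt0_ltr_powR// nnegrE ?powR_ge0.
move=> /le_trans; apply; rewrite ler_pdivrMr// mulrA mulVf// mul1r//.
Qed.

Lemma birkhoff_sum_osc w : \forall x \ae m, \forall y \ae m,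
  cylinder T a w x -> cylinder T a w y ->
  `|birkhoff_sum T f (size w) x - birkhoff_sum T f (size w) y| <= word_osc w.
Proof.
elim: w => [|i w IH]; first by apply: aeW => x; apply: aeW => y _ _; rewrite /birkhoff_sum !big_geq// subrr normr0.
apply: filterS2 (ro_lip O i w) (ae_preimage mpT IH) => x Lx IHx.
apply: filterS2 Lx (ae_preimage mpT IHx) => y Ly IHy wx wy.
rewrite /= !birkhoff_sumS opprD addrACA (le_trans (ler_normD _ _))// lerD//; first exact: Ly.
by apply: IHy; [case: wx|case: wy].
Qed.

Let word_bound w : exists B, forall x, cylinder T a w x -> `|birkhoff_sum T f (size w) x| <= B.
Proof.
elim: w => [|i w [B HB]]; first by exists 0 => x _; rewrite /birkhoff_sum big_geq// normr0.
have [B' HB'] := ro_bounded O i; exists (B' + B) => x [ax Tx] /=.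
by rewrite birkhoff_sumS (le_trans (ler_normD _ _))// lerD ?HB ?HB'.
Qed.

Variables (u : S -> R) (c : R).
Hypothesis mu : measurable_fun setT u.
Hypothesis cob : \forall x \ae m, f x = u x - u (T x) + c.

Lemma birkhoff_sum_coboundary n :
  \forall x \ae m, birkhoff_sum T f n x = u x - u (iter n T x) + n%:R * c.
Proof.
elim: n => [|n IH]; first by apply: aeW => x; rewrite /birkhoff_sum big_geq// subrr mul0r addr0.
apply: filterS2 cob (ae_preimage mpT IH) => x fx Sx.
by rewrite birkhoff_sumS fx Sx iterSr -natr1; ring.
Qed.

Let gt v L := [set x | L < `|u x - v|].
Let mgt v L : measurable (gt v L). Proof. exact: measurable_dist_gt. Qed.

(** After the word, [u] is its initial value minus a Birkhoff sum, up to a constant, and this sum is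
    bounded on the cylinder because [f] is bounded on each symbol. The lower bound on cylinders
    shows that the image fills [b (last i w)]. *)
Let spread i w (M1 : R) : 0 < pr m (cylinder T a (i :: w)) ->
  pr m (a i `&` gt 0 M1) = 0 -> exists M2, pr m (b (last i w) `&` gt 0 M2) = 0.
Proof.
move=> w0 u1; have [B HB] := word_bound (i :: w).
exists (M1 + B + `|(size w).+1%:R * c|); set M2 := _ + _ + _.
have [c0 c00 /(_ w i _ (mgt 0 M2)) cl] := cylinder_lower M.
have E : pr m (cylinder T a (i :: w) `&` iter (size w).+1 T @^-1` gt 0 M2) = 0.
  apply: ae_pr_eq0; first by apply: measurableI => //; exact: mTn.
  apply: filterS2 (pr_eq0_ae (measurableI _ _ (mm_a M i) (mgt 0 M1)) u1) (birkhoff_sum_coboundary (size w).+1).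
  move=> x nx Sx [wx]; rewrite /gt/= subr0 -/(iter (size w).+1 T x); apply/negP; rewrite -leNgt.
  have ux : `|u x| <= M1.
    by rewrite leNgt; apply/negP => h; apply: nx; split; [case: wx|rewrite /gt/= subr0].
  have := HB x wx; rewrite /= => Sb.
  rewrite (_ : u _ = u x - birkhoff_sum T f (size w).+1 x + (size w).+1%:R * c); last by rewrite Sx; ring.
  by rewrite (le_trans (ler_normD _ _))// /M2 lerD2r (le_trans (ler_normB _ _))// lerD.
move: cl; rewrite E => cl; apply/eqP; rewrite eq_le pr_ge0 andbT.
have cw : 0 < c0 * pr m (cylinder T a (i :: w)) by rewrite mulr_gt0.
by rewrite -(ler_pM2l cw) mulr0 -mulrA.
Qed.

Let last_pos i w : 0 < pr m (cylinder T a (i :: w)) -> 0 < pr m (a (last i w)).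
Proof.
elim: w i => [|j w IH] i /=; first by rewrite preimage_setT setIT.
move=> h; apply: IH; apply: (lt_le_trans h); rewrite -(pr_preimage mpT (mcyl (j :: w))).
apply: le_pr; last by move=> x [].
  exact: (mcyl (i :: j :: w)).
exact: (mp_preimage mpT (mcyl (j :: w))).
Qed.

Let cylinder_image i w x : cylinder T a (i :: w) x -> b (last i w) (iter (size w).+1 T x).
Proof.
elim: w i x => [|j w IH] i x [ax Tx] /=; first exact: mm_image M _ _ ax.
by have := IH _ _ Tx; rewrite -iterSr.
Qed.

Let common_bound (t : seq nat) : (forall i, i \in t -> exists M1, pr m (b i `&` gt 0 M1) = 0) ->
  exists M1, forall i, i \in t -> pr m (b i `&` gt 0 M1) = 0.
Proof.
elim: t => [|i t IH] H; first by exists 0.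
have [M1 HM1] := H i (mem_head _ _); have [j jt|M2 HM2] := IH; first by apply: H; rewrite inE jt orbT.
have mono M0 j : M0 <= Num.max M1 M2 -> pr m (b j `&` gt 0 M0) = 0 -> pr m (b j `&` gt 0 (Num.max M1 M2)) = 0.
  move=> le; apply: pr_sub0; [by apply: measurableI => //; exact: mm_b M _|by apply: measurableI => //; exact: mm_b M _|].
  by move=> x [bx gx]; split => //; exact: le_lt_trans gx.
exists (Num.max M1 M2) => j; rewrite inE => /predU1P[->|jt].
  by apply: mono HM1; rewrite le_max lexx.
by apply: mono (HM2 j jt); rewrite le_max lexx orbT.
Qed.

Let family_le (A B : set S) (e : R) n : measurable A -> measurable B ->
  (forall w, size w = n -> e * pr m (cylinder T a w `&` A) <= pr m (cylinder T a w `&` B)) ->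
  e * pr m A <= pr m B.
Proof.
move=> mA mB H; have [F [mF tF F0 FP]] := cylinder_family M n.
have h G : measurable G -> series (fun k => pr m (F k `&` G)) @ \oo --> pr m G.
  move=> mG; have := Ex_series mF tF F0 (integ_indic m mG).
  rewrite (_ : (fun k => Ex m _) = fun k => pr m (F k `&` G)) ?Ex_indic//; apply/funext => k.
  by rewrite -Ex_indic; [congr (Ex m _); rewrite indicI|exact: measurableI].
apply: (ler_series_lim (cvg_seriesZ (c := e) (h _ mA)) (h _ mB)) => k.
by case: (FP k) => [->|[w wn ->]]; rewrite ?set0I ?pr0 ?mulr0//; exact: H.
Qed.

(** [L] must not depend on [eps]. On a word where |u| <= n0 outside a small proportion and where
    Birkhoff sums oscillate by at most [K], the coboundary equation makes [u] after the word
    constant up to 2 n0 + K. Tightness of the oscillation, uniform in the length, provides such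
    words. *)
Let good_word : exists2 L : R, 0 <= L & forall eps : R, 0 < eps <= 2^-1 -> exists i w v,
  [/\ 0 < pr m (cylinder T a (i :: w)) &
     pr m (cylinder T a (i :: w) `&` iter (size w).+1 T @^-1` gt v L) <=
     eps * pr m (cylinder T a (i :: w))].
Proof.
have q0 : (0 : R) < 4^-1 by rewrite invr_gt0.
have [n0 Hn0] := norm_gt_eventually_small m mu q0; have [K K0 HK] := osc_tight.
pose G := ~` [set x | n0%:R < `|u x|].
have mN : measurable [set x | n0%:R < `|u x|] := measurable_norm_gt _ mu.
have mG : measurable G by exact: measurableC.
exists (n0%:R + n0%:R + K); first by rewrite !addr_ge0.
move=> eps /andP[e0 e1]; have e8 : 0 < eps / 8 by rewrite divr_gt0.
have [n [Q [Qn Qe]]] := dense mG e8.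
pose Q' := [set w | Q w /\ word_osc w <= K].
pose U := \bigcup_(w in Q) cylinder T a w; pose U' := \bigcup_(w in Q') cylinder T a w.
have mcup (Q0 : set (seq nat)) : measurable (\bigcup_(w in Q0) cylinder T a w).
  exact: (measurable_cylinder_bigcup M).
have [w [wn' w0 wG]] : exists w, [/\ Q' w, 0 < pr m (cylinder T a w) &
    pr m (cylinder T a w `\` G) <= eps * pr m (cylinder T a w)].
  apply: contrapT => nex.
  (* Otherwise a proportion at least [eps] of the good words would lie outside [G]. They have total
     mass at least 7/16, while the approximation leaves only [eps / 8] outside [G]. *)
  have : eps * pr m U' <= pr m (U' `\` G).
    apply: (@family_le _ _ _ n.+1); [exact: mcup|by apply: measurableD => //; exact: mcup|].
    move=> w wn; have [Q'w|nQ'w] := pselect (Q' w); last first.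
      rewrite (_ : _ `&` U' = set0) ?pr0 ?mulr0 ?pr_ge0//.
      apply/seteqP; split => // x [wx [w' Q'w' w'x]]; apply: nQ'w.
      rewrite (@cylinder_eq_size _ _ _ _ _ _ _ _ _ _ M w w')//; last by exists x.
      by rewrite wn Qn//; case: Q'w'.
    have wU : cylinder T a w `<=` U' by move=> x wx; exists w.
    rewrite setIDA !(setIidl wU).
    have [w0|] := eqVneq (pr m (cylinder T a w)) 0; first by rewrite w0 mulr0 pr_ge0.
    move=> wn0; rewrite leNgt; apply/negP => lt; apply: nex; exists w; split => //.
      by rewrite lt_neqAle eq_sym wn0 pr_ge0.
    exact: ltW.
  have U'G : pr m (U' `\` G) <= eps / 8.
    apply: le_trans Qe; apply: le_pr.
    - by apply: measurableD => //; exact: mcup.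
    - by apply: measurableU; apply: measurableD => //; exact: mcup.
    - by move=> x [[w [Qw _] wx] nG]; right; split => //; exists w.
  have U'l : 1 - 4^-1 - 4^-1 - eps / 8 <= pr m U'.
    apply: (@le_trans _ _ (pr m setT - 4^-1 - 4^-1 - eps / 8)); first by rewrite prT.
    rewrite !lerBlDr.
    have mK : measurable [set x | K < osc n.+1 x].
      rewrite (_ : [set x | _] = (osc n.+1) @^-1` `]K, +oo[).
        by rewrite -[X in measurable X]setTI; exact: mosc.
      by apply/seteqP; split => x /=; rewrite in_itv/= andbT.
    have mGU : measurable (G `\` U) by apply: measurableD => //; exact: mcup.
    have m1 := measurableU _ _ (mcup Q') mGU; have m2 := measurableU _ _ m1 mK.
    have m3 := measurableU _ _ m2 mN.
    (* A point lies in a good word, or in [G] outside the selected words, or has large oscillation,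
       or has |u| above [n0]. *)
    apply: (@le_trans _ _ (pr m (((U' `|` (G `\` U)) `|` [set x | K < osc n.+1 x]) `|` [set x | n0%:R < `|u x|]))).
      apply: le_pr => // x _.
      have [nG|Gx] := pselect ([set x | n0%:R < `|u x|] x); first by right.
      left; have [Kx|Kx] := pselect ([set x | K < osc n.+1 x] x); first by right.
      left; have [[w Qw wx]|nU] := pselect (U x); last by right.
      left; exists w => //; split => //; rewrite -(oscE wx) (Qn _ Qw) leNgt; exact/negP.
    apply: (le_trans (prU_le m m2 mN)); apply: lerD => //.
    apply: (le_trans (prU_le m m1 mK)); apply: lerD => //.
    apply: (le_trans (prU_le m (mcup Q') mGU)); apply: lerD => //.
    apply: le_trans Qe; apply: le_pr => //; last by move=> x ?; left.
    by apply: measurableU; apply: measurableD => //; exact: mcup.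
  move=> h; nra.
have [Qw wK] := wn'; have wn := Qn _ Qw; case: w wn wK w0 wG {wn' Qw} => [//|i w] wn wK w0 wG.
have [x0 [wx0 Gx0] [S0 B0]] : exists2 x, (cylinder T a (i :: w) `&` G) x &
    birkhoff_sum T f (size (i :: w)) x = u x - u (iter (size (i :: w)) T x) + (size (i :: w))%:R * c /\
    \forall y \ae m, cylinder T a (i :: w) x -> cylinder T a (i :: w) y ->
    `|birkhoff_sum T f (size (i :: w)) x - birkhoff_sum T f (size (i :: w)) y| <= word_osc (i :: w).
  apply: ae_exists; first by exact: measurableI.
    by have := prDI m (mcyl (i :: w)) mG; nra.
  by apply: filterS2 (birkhoff_sum_coboundary (size (i :: w))) (birkhoff_sum_osc (i :: w)) => x; split.
exists i, w, (u (iter (size w).+1 T x0)); split => //.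
apply: le_trans wG; apply: le_pr_ae.
- by apply: measurableI => //; exact: mTn.
- exact: measurableD.
- apply: filterS2 B0 (birkhoff_sum_coboundary (size w).+1) => y By Sy [wy guy]; split => // Gy.
  have {}By := By wx0 wy; have {}guy : n0%:R + n0%:R + K < `|u (iter (size w).+1 T y) - u (iter (size w).+1 T x0)| := guy.
  move: guy; rewrite ltNge => /negP; apply.
  rewrite /= in S0 By; rewrite Sy S0 in By.
  have gu x : G x -> `|u x| <= n0%:R by rewrite leNgt => /negP.
  have := gu _ Gx0; have := gu _ Gy; move: By wK => /=.
  rewrite !ler_norml => /andP[h1 h2] h3 /andP[h4 h5] /andP[h6 h7].
  by apply/andP; split; lra.
Qed.

(** A small exceptional mass in the image of a word gives a small one in some [a j] with [j] in [s].
    As [s] is finite while [eps] is arbitrary, some [a j] has no exceptional mass at all. From there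
    mixing reaches every symbol of [s], and the images of these cover the space. *)
Lemma coboundary_bounded : exists M1 : R, \forall x \ae m, `|u x| <= M1.
Proof.
have [L L0 HL] := good_word.
have [c0 c00 cl] := cylinder_lower M.
have [e e0 es] := seq_lower (mm_pos M).
have e4 : 0 < e / 4 by rewrite divr_gt0.
have [n0 Hn0] := norm_gt_eventually_small m mu e4.
pose M1 := n0%:R + L + L.
have step (eps : R) : 0 < eps -> exists2 j, j \in s & pr m (a j `&` gt 0 M1) <= eps.
  (* The factor [c0] is lost between the cylinder and its image. The bound by [e / 4] leaves points
     of [a j] where [u] is both close to [v] and at most [n0] in absolute value, which bounds
     [v]. *)
  move=> eps0; pose del := Num.min 2^-1 (c0 * Num.min eps (e / 4)).
  have m0 : 0 < Num.min eps (e / 4) by rewrite lt_min eps0.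
  have d0 : 0 < del by rewrite lt_min invr_gt0 ltr0n/= mulr_gt0.
  have [|i [w [v [w0 wv]]]] := HL del; first by rewrite d0 ge_min lexx.
  have bv : pr m (b (last i w) `&` gt v L) <= Num.min eps (e / 4).
    have := le_trans (cl w i _ (mgt v L)) wv; rewrite mulrCA [leRHS]mulrC ler_pM2l// => h.
    by rewrite -(ler_pM2l c00) (le_trans h)// ge_min lexx orbT.
  have l0 := last_pos w0.
  have [j js jb] := mm_big_image M l0; exists j => //.
  have av : pr m (a j `&` gt v L) <= Num.min eps (e / 4).
    apply: le_trans bv; apply: le_pr_ae.
    - by apply: measurableI => //; exact: mm_a M _.
    - by apply: measurableI => //; exact: mm_b M _.
    - have := pr_eq0_ae (measurableD (mm_a M j) (mm_b M _)) jb; apply: filterS => x nx [ajx gx].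
      by split => //; apply: contrapT => nb; apply: nx.
  move: av; rewrite le_min => /andP[av1 av2].
  have vle : `|v| <= n0%:R + L.
    have mN := measurable_norm_gt n0%:R mu.
    have [x [ajx nx]] : exists x, a j x /\ (~ (gt v L) x /\ `|u x| <= n0%:R).
      apply: contrapT => nex.
      have : pr m (a j) <= pr m (a j `&` gt v L) + pr m [set x | n0%:R < `|u x|].
        apply: le_trans (prU_le m (measurableI _ _ (mm_a M j) (mgt v L)) mN).
        apply: le_pr; [exact: mm_a M _|by apply: measurableU => //; apply: measurableI => //; exact: mm_a M _|].
        move=> x ajx; have [g|ng] := pselect (gt v L x); first by left.
        right; rewrite /= ltNge; apply/negP => ux; apply: nex; exists x.
        by split => //; split.
      have := es _ js; move: av2 Hn0; lra.
    case: nx => /negP; rewrite -leNgt !ler_norml => /andP[h1 h2] /andP[h3 h4].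
    by apply/andP; split; lra.
  apply: le_trans av1; apply: le_pr.
  - by apply: measurableI => //; exact: mm_a M _.
  - by apply: measurableI => //; exact: mm_a M _.
  - move=> x [ajx]; rewrite /gt/= subr0 => M1x; split => //; rewrite ltNge; apply/negP => h.
    have := ler_normD (u x - v) v; rewrite subrK; move: M1x; rewrite /M1; lra.
(* Otherwise the exceptional masses over the finite list [s] would have a positive lower bound. *)
have [j js j0] : exists2 j, j \in s & pr m (a j `&` gt 0 M1) = 0.
  apply: contrapT => nex.
  have [|e' e'0 He'] := @seq_lower R (fun j => pr m (a j `&` gt 0 M1)) s.
    move=> j js; rewrite lt_neqAle pr_ge0 andbT; apply/negP => /eqP j0; apply: nex.
    by exists j.
  have e'2 : 0 < e' / 2 by rewrite divr_gt0.
  have [j js jl] := step _ e'2; have := He' j js; lra.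
have onb i : i \in s -> exists M2, pr m (b i `&` gt 0 M2) = 0.
  move=> si; have ai := mm_pos M si.
  have [N /(_ _ (ltnSn N)) jN] := mm_mixing M (mm_pos M js) ai.
  pose A := a j `&` iter N.+1 T @^-1` a i.
  have mA : measurable A by apply: measurableI; [exact: mm_a M _|apply: mTn; exact: mm_a M _].
  (* A word of length N + 1 that starts in [a j] and leads into [a i]: by the Markov property the
     image of its last letter contains [a i]. *)
  have [w [wn wA]] : exists w, size w = N.+1 /\ 0 < pr m (cylinder T a w `&` A).
    apply: contrapT => nex; have : 1 * pr m A <= pr m set0.
      apply: (@family_le _ _ _ N.+1) => // w wn; rewrite setI0 pr0 mul1r leNgt.
      by apply/negP => h; apply: nex; exists w.
    by rewrite pr0 mul1r leNgt jN.
  case: w wn wA => [//|j' w] [wn] wA.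
  have jj : j' = j.
    have [x [[/= xj' _] [xj _]]] : (cylinder T a (j' :: w) `&` A) !=set0.
      apply/set0P; apply/negP => /eqP E; by rewrite E pr0 ltxx in wA.
    by apply: (mm_triv M) => //; exists x.
  subst j'.
  have cA : pr m (cylinder T a (j :: w) `&` A) <= pr m (cylinder T a (j :: w)).
    by apply: le_pr => //; exact: measurableI.
  have [M2 b0] := spread (lt_le_trans wA cA) j0.
  have mba : measurable (b (last j w) `&` a i) by apply: measurableI; [exact: mm_b M _|exact: mm_a M _].
  have ba : 0 < pr m (b (last j w) `&` a i).
    apply: (lt_le_trans wA); rewrite -(pr_preimage (measure_preserving_iter mpT N.+1) mba).
    apply: le_pr; [exact: measurableI|exact: mTn|].
    by move=> x [wx [_ ax]]; split => //; move: (cylinder_image wx); rewrite wn.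
  have ab : pr m (a i `\` b (last j w)) = 0.
    by case: (mm_markov M (last j w) i) => // E; rewrite setIC E ltxx in ba.
  have a0 : pr m (a i `&` gt 0 M2) = 0.
    apply: ae_pr_eq0; first by apply: measurableI => //; exact: mm_a M _.
    have mb' : measurable (b (last j w) `&` gt 0 M2) by apply: measurableI => //; exact: mm_b M _.
    apply: filterS2 (pr_eq0_ae (measurableD (mm_a M i) (mm_b M _)) ab) (pr_eq0_ae mb' b0).
    by move=> x n1 n2 [ax gx]; apply: n2; split => //; apply: contrapT => nb; apply: n1.
  by apply: (@spread i [::] M2) => //=; rewrite preimage_setT setIT.
have [M2 HM2] : exists M2, forall i, i \in s -> pr m (b i `&` gt 0 M2) = 0 := common_bound onb.
exists M2; have := pr_image_sum M (mgt 0 M2).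
rewrite big_seq big1; last by move=> i si; exact: HM2.
move=> h; have h0 : pr m (gt 0 M2) = 0 by apply/eqP; rewrite eq_le h pr_ge0.
by apply: filterS (pr_eq0_ae (mgt 0 M2) h0) => x; rewrite /gt/= subr0 leNgt => /negP.
Qed.
End bounded_coboundary.

(** * Limit law of coboundaries *)

Section coboundary_limit.
Context d (S : measurableType d) (R : realType) (m : probability S R).
Variables (T : S -> S).
Hypothesis mpT : measure_preserving m T.
Hypothesis exactT : forall G : S -> R, integ m G -> forall eps : R, 0 < eps -> exists j0,
  forall j (v : S -> R), (j0 <= j)%N -> measurable_fun setT v -> (forall x, `|v x| <= 1) ->
  `|Ex m (fun x => G x * v (iter j T x)) - Ex m G * Ex m v| <= eps.

(** The addition formulas split the cosine and sine of [t * (u - u \o T^n)] into products, to which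
    exactness applies with [G] a bounded function of [u]. *)
Lemma cvg_coboundary (Y : nat -> S -> R) (u : {RV m >-> R}) :
  (forall n, measurable_fun setT (Y n)) ->
  (forall n, \forall x \ae m, Y n x = u x - u (iter n T x)) ->
  forall d' (S' : measurableType d') (P : probability S' R) (Z Z' : {RV P >-> R}),
  independent2 Z Z' -> same_law Z u -> same_law Z' u ->
  cvg_in_distribution m Y P (Z \- Z').
Proof.
move=> mY Yu d' S' P Z Z' ZZ' Zu Z'u.
have mc t : measurable_fun setT (fun x : R => cos (t * x)).
  by apply: measurable_cos_comp; exact: measurable_funM.
have ms t : measurable_fun setT (fun x : R => sin (t * x)).
  by apply: measurable_sin_comp; exact: measurable_funM.
have c1 t x : `|cos (t * x) : R| <= 1 := cos_max _.
have s1 t x : `|sin (t * x) : R| <= 1 := sin_max _.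
pose a t := Ex m (fun x => cos (t * u x)); pose b t := Ex m (fun x => sin (t * u x)).
have Zc t : Ex P (fun x => cos (t * Z x)) = a t := Ex_same_law Zu (mc t) (c1 t).
have Zs t : Ex P (fun x => sin (t * Z x)) = b t := Ex_same_law Zu (ms t) (s1 t).
have Z'c t : Ex P (fun x => cos (t * Z' x)) = a t := Ex_same_law Z'u (mc t) (c1 t).
have Z's t : Ex P (fun x => sin (t * Z' x)) = b t := Ex_same_law Z'u (ms t) (s1 t).
have mu : measurable_fun setT u by [].
have mcu t : measurable_fun setT (fun x => cos (t * u x)) by exact: measurableT_comp (mc t) mu.
have msu t : measurable_fun setT (fun x => sin (t * u x)) by exact: measurableT_comp (ms t) mu.
have mTn n : measurable_fun setT (iter n T) := mp_measurable (measure_preserving_iter mpT n).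
have lim (g h : R -> R) : measurable_fun setT (fun x => g (u x)) -> measurable_fun setT (fun x => h (u x)) ->
    (forall x, `|g x| <= 1) -> (forall x, `|h x| <= 1) ->
    (fun n => Ex m (fun x => g (u x) * h (u (iter n T x)))) @ \oo --> Ex m (fun x => g (u x)) * Ex m (fun x => h (u x)).
  move=> mg mh g1 h1; apply/cvgrPdist_le => eps e0.
  have ig : integ m (fun x => g (u x)) by apply: (@integ_bounded _ _ _ _ _ 1).
  have [j0 Hj] := exactT ig e0; exists j0 => // n /= jn.
  by rewrite distrC; apply: (Hj n (fun x => h (u x))).
have iP (g h : R -> R) : measurable_fun setT g -> measurable_fun setT h ->
    (forall x, `|g x| <= 1) -> (forall x, `|h x| <= 1) -> integ P (fun x => g (Z x) * h (Z' x)).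
  move=> mg mh g1 h1; apply: (@integ_bounded _ _ _ _ _ 1).
    by apply: measurable_funM; [exact: measurableT_comp mg _|exact: measurableT_comp mh _].
  by move=> x; rewrite normrM mulr_ile1.
have iM n (g h : R -> R) : measurable_fun setT (fun x => g (u x)) -> measurable_fun setT (fun x => h (u x)) ->
    (forall x, `|g x| <= 1) -> (forall x, `|h x| <= 1) -> integ m (fun x => g (u x) * h (u (iter n T x))).
  move=> mg mh g1 h1; apply: (@integ_bounded _ _ _ _ _ 1).
    by apply: measurable_funM => //; exact: measurableT_comp mh (mTn n).
  by move=> x; rewrite normrM mulr_ile1.
have mt t n : measurable_fun setT (fun x => t * Y n x) by exact: measurable_funM.
have mt' t n : measurable_fun setT (fun x => t * (u x - u (iter n T x))).
  by apply: measurable_funM => //; apply: measurable_funB => //; exact: measurableT_comp mu (mTn n).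
apply: levy_continuity => //.
- move=> t.
  have -> : Ex P (fun x => cos (t * (Z \- Z') x)) = a t * a t + b t * b t.
    have := independent2_Ex ZZ' (mc t) (c1 t) (mc t) (c1 t); rewrite Zc Z'c => <-.
    have := independent2_Ex ZZ' (ms t) (s1 t) (ms t) (s1 t); rewrite Zs Z's => <-.
    rewrite -(ExD (iP _ _ (mc t) (mc t) (c1 t) (c1 t)) (iP _ _ (ms t) (ms t) (s1 t) (s1 t))).
    by congr (Ex P _); apply/funext => x; rewrite /= mulrBr cosB.
  rewrite (_ : (fun n => _) = fun n => Ex m (fun x => cos (t * u x) * cos (t * u (iter n T x))) +
      Ex m (fun x => sin (t * u x) * sin (t * u (iter n T x)))).
    by apply: cvgD; [exact: (lim (fun y => cos (t * y)) (fun y => cos (t * y)))|exact: (lim (fun y => sin (t * y)) (fun y => sin (t * y)))].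
  apply/funext => n; rewrite -ExD; [|exact: (iM n (fun y => cos (t * y)) (fun y => cos (t * y)))|exact: (iM n (fun y => sin (t * y)) (fun y => sin (t * y)))].
  rewrite (@ae_eq_Ex _ _ _ _ _ (fun x => cos (t * (u x - u (iter n T x))))).
  + by congr (Ex m _); apply/funext => x; rewrite mulrBr cosB.
  + exact: measurable_cos_comp.
  + exact: measurable_cos_comp.
  + by apply: filterS (Yu n) => x ->.
- move=> t.
  have -> : Ex P (fun x => sin (t * (Z \- Z') x)) = b t * a t - a t * b t.
    have := independent2_Ex ZZ' (ms t) (s1 t) (mc t) (c1 t); rewrite Zs Z'c => <-.
    have := independent2_Ex ZZ' (mc t) (c1 t) (ms t) (s1 t); rewrite Zc Z's => <-.
    rewrite -(ExB (iP _ _ (ms t) (mc t) (s1 t) (c1 t)) (iP _ _ (mc t) (ms t) (c1 t) (s1 t))).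
    by congr (Ex P _); apply/funext => x; rewrite /= mulrBr sinB.
  rewrite (_ : (fun n => _) = fun n => Ex m (fun x => sin (t * u x) * cos (t * u (iter n T x))) -
      Ex m (fun x => cos (t * u x) * sin (t * u (iter n T x)))).
    by apply: cvgB; [exact: (lim (fun y => sin (t * y)) (fun y => cos (t * y)))|exact: (lim (fun y => cos (t * y)) (fun y => sin (t * y)))].
  apply/funext => n; rewrite -ExB; [|exact: (iM n (fun y => sin (t * y)) (fun y => cos (t * y)))|exact: (iM n (fun y => cos (t * y)) (fun y => sin (t * y)))].
  rewrite (@ae_eq_Ex _ _ _ _ _ (fun x => sin (t * (u x - u (iter n T x))))).
  + by congr (Ex m _); apply/funext => x; rewrite mulrBr sinB.
  + exact: measurable_sin_comp.
  + exact: measurable_sin_comp.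
  + by apply: filterS (Yu n) => x ->.
Qed.

End coboundary_limit.

(** * Heavy tails *)

Section distributional_comparison.
Context (R : realType) d1 (S1 : measurableType d1) d2 (S2 : measurableType d2).
Variables (P1 : probability S1 R) (P2 : probability S2 R).
Variables (U1 : nat -> S1 -> R) (U2 : nat -> S2 -> R) (D : R -> R) (t1 K0 t0 : R).
Hypotheses (mU1 : forall n, measurable_fun setT (U1 n)) (mU2 : forall n, measurable_fun setT (U2 n)).
Hypotheses (t1_gt0 : 0 < t1) (D_gt0 : forall t, 0 < `|t| <= t1 -> 0 < D t).
Hypothesis D2 : forall t, D (2 * t) <= 4 * D t.
Hypotheses (K0_gt0 : 0 < K0) (t0_gt0 : 0 < t0).
Hypothesis cf_small : forall n t p, 0 < `|t| <= t0 -> K0 <= n%:R * D t ->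
  `|Ex P1 (fun x => cos (t * U1 n x + p))| <= 4^-1.
Hypothesis cf_close : forall eps : R, 0 < eps -> exists2 t2 : R, 0 < t2 &
  forall n t p, 0 < `|t| <= t2 ->
    `|Ex P1 (fun x => cos (t * U1 n x + p)) - Ex P2 (fun x => cos (t * U2 n x + p))| <=
    eps + n%:R * (eps * D t).
Variables (A B : nat -> R).
Hypothesis B_gt0 : forall n, 0 < B n.
Context d' (S' : measurableType d') (Q : probability S' R).
Variable W : S' -> R.
Hypothesis mW : measurable_fun setT W.

Let Y1 n x := (U1 n x - A n) / B n.
Let Y2 n x := (U2 n x - A n) / B n.

Let mY1 n : measurable_fun setT (Y1 n).
Proof. by apply: measurable_funM => //; apply: measurable_funB. Qed.
Let mY2 n : measurable_fun setT (Y2 n).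
Proof. by apply: measurable_funM => //; apply: measurable_funB. Qed.

Hypothesis YW : cvg_in_distribution P1 Y1 Q W.

Let argE (s p y : R) n : s * ((y - A n) / B n) + p = s / B n * y + (p - s / B n * A n).
Proof. by ring. Qed.

(** Tightness at level 1/8: for |s| <= 1/(2K) the cosine loses at most 1/4 where |Y1| <= K, and at
    most 2 elsewhere. *)
Let cf_near1 : exists2 s0 : R, 0 < s0 & \forall n \near \oo, forall s, `|s| <= s0 ->
  2^-1 <= Ex P1 (fun x => cos (s * Y1 n x)).
Proof.
have e8 : (0 : R) < 8^-1 by rewrite invr_gt0.
have [K K_gt0 HK] := tight_of_cf mY1 mW (fun t => (cvg_cf mY1 mW YW t).1) e8.
exists (2 * K)^-1; first by rewrite invr_gt0 mulr_gt0.
apply: filterS HK => n HK s sK.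
have mA : measurable [set x | K < `|Y1 n x|] := measurable_norm_gt K (mY1 n).
have ic : integ P1 (fun x => cos (s * Y1 n x)) by apply: integ_cos; exact: measurable_funM.
have ii : integ P1 (fun x => 2 * \1_[set x | K < `|Y1 n x|] x) := integZ 2 (integ_indic P1 mA).
have : Ex P1 (fun x => 1 - cos (s * Y1 n x)) <= Ex P1 (fun x => 4^-1 + 2 * \1_[set x | K < `|Y1 n x|] x).
  apply: le_Ex => [||x]; [exact: integB (integ_cst _ _) ic|exact: integD (integ_cst _ _) ii|].
  rewrite indicE; have [/set_mem xA|/negP nA] := boolP (x \in _).
    by rewrite /= mulr1n mulr1; have := cos_geN1 (s * Y1 n x); lra.
  have {nA}Yx : `|Y1 n x| <= K by rewrite leNgt; apply/negP => h; apply: nA; exact/mem_set.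
  rewrite /= mulr0n mulr0 addr0; have : `|s * Y1 n x| <= 2^-1.
    rewrite normrM (le_trans (ler_pM _ _ sK Yx))// invfM mulfVK// gt_eqF//.
  by have := onem_cos_le (s * Y1 n x); rewrite ler_norml => h /andP[h1 h2]; nra.
rewrite (ExB (integ_cst _ _) ic) (ExD (integ_cst _ _) ii) !Ex_cst ExZ; last exact: integ_indic.
by rewrite Ex_indic//; lra.
Qed.

(** A value [n%:R * D >= K0] would push the characteristic function below 1/4 whatever the phase,
    hence whatever the centering [A n]. *)
Let D_near : exists2 s0 : R, 0 < s0 & \forall n \near \oo, forall s, 0 < `|s| <= s0 -> `|s / B n| <= t0 ->
  n%:R * D (s / B n) < K0.
Proof.
have [s0 s0_gt0 Hs] := cf_near1; exists s0 => //.
apply: filterS Hs => n Hs s /andP[s_gt0 ss0] sB; rewrite ltNge; apply/negP => K0n.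
have sB0 : 0 < `|s / B n| <= t0 by rewrite sB andbT normrM normfV mulr_gt0// invr_gt0 normr_gt0 gt_eqF.
have := cf_small (- (s / B n * A n)) sB0 K0n; have := Hs s ss0.
rewrite (_ : (fun x => cos (s * _)) = fun x => cos (s / B n * U1 n x + - (s / B n * A n))); last first.
  by apply/funext => x; rewrite -[s * _]addr0 argE sub0r.
by rewrite ler_norml => h /andP[_ h2]; lra.
Qed.

(** At a fixed argument [tau], [n%:R * D tau] exceeds [K0] for large [n]. If [B n] were bounded, s =
    tau * B n would stay within reach of the preceding bound, which forbids this. *)
Let B_infty (M : R) : \forall n \near \oo, M < B n.
Proof.
have [s0 s0_gt0 Hs] := D_near.
pose M' := Num.max M 1; have M'0 : 0 < M' by rewrite lt_max ltr01 orbT.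
pose tau := Num.min (Num.min t0 t1) (s0 / M').
have tau0 : 0 < tau by rewrite !lt_min t0_gt0 t1_gt0 divr_gt0.
have Dtau : 0 < D tau by apply: D_gt0; rewrite gtr0_norm// tau0 /tau !ge_min lexx orbT.
have near_n : \forall n \near \oo, K0 / D tau <= n%:R.
  exists (Num.truncn (K0 / D tau)).+1 => // n /= h.
  by rewrite ltW// (lt_le_trans (truncnS_gt _))// ler_nat.
apply: filterS2 Hs near_n => n Hs nK; rewrite ltNge; apply/negP => BM.
have BM' : B n <= M' by rewrite le_max BM.
have Bn := B_gt0 n.
have tB : tau * B n / B n = tau by rewrite mulfK// gt_eqF.
have := Hs (tau * B n); rewrite tB gtr0_norm ?mulr_gt0//= gtr0_norm// => h.
have {}h : n%:R * D tau < K0.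
  apply: h; last by rewrite /tau !ge_min lexx.
  apply: (@le_trans _ _ (s0 / M' * M')); last by rewrite mulfVK// gt_eqF.
  by apply: ler_pM => //; rewrite ?ge_min ?lexx ?orbT// ltW.
by move: nK; rewrite ler_pdivrMr// leNgt h.
Qed.

Let arg_small (s tau : R) : 0 < tau -> \forall n \near \oo, `|s / B n| <= tau.
Proof.
move=> tau0; apply: filterS (B_infty (`|s| / tau)) => n; rewrite ltr_pdivrMr// => h.
by rewrite normrM normfV (gtr0_norm (B_gt0 n)) ler_pdivrMr// mulrC ltW.
Qed.

(** The doubling inequality for [D] extends the bound from small [s] to all [s], at the cost of a
    factor 4 for each doubling. *)
Let D_bounded s : s != 0 -> exists2 C : R, 0 <= C & \forall n \near \oo, n%:R * D (s / B n) <= C.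
Proof.
have [s0 s0_gt0 Hs] := D_near.
have H j : forall s, s != 0 -> `|s| <= 2 ^+ j * s0 -> \forall n \near \oo, n%:R * D (s / B n) <= 4 ^+ j * K0.
  elim: j => [|j IH] {}s sn0 sj.
    rewrite expr0 mul1r in sj; apply: filterS2 Hs (arg_small s t0_gt0) => n Hs sB.
    by rewrite expr0 mul1r ltW// Hs// normr_gt0 sn0.
  have s2 : s / 2 != 0 by rewrite mulf_neq0// invr_eq0.
  have s2j : `|s / 2| <= 2 ^+ j * s0.
    by rewrite normrM normfV (@ger0_norm _ 2)// ler_pdivrMr// mulrAC -exprSr.
  apply: filterS (IH _ s2 s2j) => n h.
  rewrite (_ : s / B n = 2 * (s / 2 / B n)); last by field; rewrite gt_eqF.
  apply: (@le_trans _ _ (n%:R * (4 * D (s / 2 / B n)))); first by rewrite ler_wpM2l.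
  by rewrite mulrCA [leRHS](_ : _ = 4 * (4 ^+ j * K0)) ?ler_wpM2l// exprS mulrA.
move=> sn0; pose j := Num.truncn (`|s| / s0).
exists (4 ^+ j.+1 * K0); first by rewrite mulr_ge0 ?exprn_ge0 ?(ltW K0_gt0).
apply: H => //; rewrite -ler_pdivrMr// ltW// (lt_le_trans (truncnS_gt _))// -/j.
by rewrite -natrX ler_nat ltnW// ltn_expl.
Qed.

Let cf_diff s p : s != 0 ->
  (fun n => Ex P1 (fun x => cos (s * Y1 n x + p)) - Ex P2 (fun x => cos (s * Y2 n x + p))) @ \oo --> (0 : R).
Proof.
move=> sn0; apply/cvgrPdist_le => eps e0.
have [C C0 HC] := D_bounded sn0.
have C1 : 0 < C + 1 by rewrite ltr_wpDl.
have [t2 t20 Ht] := cf_close (divr_gt0 e0 C1).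
apply: filterS2 HC (arg_small s t20) => n HC sB.
rewrite sub0r normrN.
have sB0 : 0 < `|s / B n| <= t2 by rewrite sB andbT normr_gt0 mulf_neq0// invr_eq0 gt_eqF.
have := Ht n (s / B n) (p - s / B n * A n) sB0.
rewrite (_ : (fun x => cos (s * Y1 n x + p)) = fun x => cos (s / B n * U1 n x + (p - s / B n * A n))); last first.
  by apply/funext => x; rewrite argE.
rewrite (_ : (fun x => cos (s * Y2 n x + p)) = fun x => cos (s / B n * U2 n x + (p - s / B n * A n))); last first.
  by apply/funext => x; rewrite argE.
move=> /le_trans; apply.
apply: (@le_trans _ _ (eps / (C + 1) * (1 + C))).
  by rewrite mulrDr mulr1 lerD2l mulrCA ler_wpM2l// divr_ge0// ltW.
by rewrite [1 + C]addrC mulfVK// gt_eqF.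
Qed.

Lemma cvg_in_distribution_compare : cvg_in_distribution P2 Y2 Q W.
Proof.
have sinE (y : R) : sin y = cos (y + - (pi / 2)) by rewrite cosD cosN sinN cos_pihalf sin_pihalf; ring.
apply: levy_continuity => // s.
(* At frequency 0 both sides are constant; [D] is controlled only at nonzero arguments. *)
- have [->|sn0] := eqVneq s 0.
    under eq_fun do under eq_fun do rewrite mul0r cos0.
    rewrite (_ : (fun x => cos (0 * W x)) = fun=> 1); first by rewrite !Ex_cst; exact: cvg_cst.
    by apply/funext => x; rewrite mul0r cos0.
  have [c1 _] := cvg_cf mY1 mW YW s.
  rewrite (_ : (fun n => _) = fun n => Ex P1 (fun x => cos (s * Y1 n x)) -
    (Ex P1 (fun x => cos (s * Y1 n x + 0)) - Ex P2 (fun x => cos (s * Y2 n x + 0)))).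
    by rewrite -[X in _ --> X]subr0; apply: cvgB c1 _; exact: cf_diff.
  apply/funext => n.
  rewrite -[LHS](subKr (Ex P1 (fun x => cos (s * Y1 n x)))).
  by congr (_ - (Ex P1 _ - Ex P2 _)); apply/funext => x; rewrite addr0.
- have [->|sn0] := eqVneq s 0.
    under eq_fun do under eq_fun do rewrite mul0r sin0.
    rewrite (_ : (fun x => sin (0 * W x)) = fun=> 0); first by rewrite !Ex_cst; exact: cvg_cst.
    by apply/funext => x; rewrite mul0r sin0.
  have [_ c1] := cvg_cf mY1 mW YW s.
  rewrite (_ : (fun n => _) = fun n => Ex P1 (fun x => sin (s * Y1 n x)) -
    (Ex P1 (fun x => cos (s * Y1 n x + - (pi / 2))) - Ex P2 (fun x => cos (s * Y2 n x + - (pi / 2))))).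
    by rewrite -[X in _ --> X]subr0; apply: cvgB c1 _; exact: cf_diff.
  apply/funext => n.
  rewrite -[LHS](subKr (Ex P1 (fun x => sin (s * Y1 n x)))).
  by congr (_ - (Ex P1 _ - Ex P2 _)); apply/funext => x; rewrite sinE.
Qed.

End distributional_comparison.

(** * Complex moduli in real coordinates *)

Section complex_modulus.
Context {R : realType}.
Implicit Types (a b x y u v : R).

Definition cmod x y : R := Num.sqrt (x ^+ 2 + y ^+ 2).

Lemma cmod_ge0 x y : 0 <= cmod x y. Proof. exact: sqrtr_ge0. Qed.

Lemma sqr_cmod x y : cmod x y ^+ 2 = x ^+ 2 + y ^+ 2.
Proof. by rewrite sqr_sqrtr// addr_ge0 ?sqr_ge0. Qed.

Lemma norm_le_cmod x y : `|x| <= cmod x y /\ `|y| <= cmod x y.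
Proof.
by split; rewrite -(@ler_pXn2r _ 2) ?nnegrE ?cmod_ge0// sqr_cmod real_normK ?num_real// ?lerDl ?lerDr sqr_ge0.
Qed.

Lemma cmod_le x y : cmod x y <= `|x| + `|y|.
Proof.
rewrite -(@ler_pXn2r _ 2) ?nnegrE ?cmod_ge0 ?addr_ge0// sqr_cmod.
rewrite -(real_normK (num_real x)) -(real_normK (num_real y)).
have := normr_ge0 x; have := normr_ge0 y; nra.
Qed.

Lemma cmodD x y u v : cmod (x + u) (y + v) <= cmod x y + cmod u v.
Proof.
have A0 := cmod_ge0 x y; have B0 := cmod_ge0 u v.
rewrite -(@ler_pXn2r _ 2) ?nnegrE ?cmod_ge0 ?addr_ge0// sqr_cmod.
have A2 := sqr_cmod x y; have B2 := sqr_cmod u v.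
have AB0 : 0 <= cmod x y * cmod u v by rewrite mulr_ge0.
have CS : x * u + y * v <= cmod x y * cmod u v.
  apply: (le_trans (ler_norm _)); rewrite -(@ler_pXn2r _ 2) ?nnegrE// real_normK ?num_real//.
  by rewrite exprMn A2 B2; have := sqr_ge0 (x * v - y * u); nra.
rewrite [leRHS]sqrrD A2 B2 -mulr_natr; nra.
Qed.

Lemma cmodM a b x y : cmod (a * x - b * y) (a * y + b * x) = cmod a b * cmod x y.
Proof.
rewrite -sqrtrM ?addr_ge0 ?sqr_ge0//; congr Num.sqrt; ring.
Qed.

Lemma cmod_cpow a b n : cmod (cpow a b n).1 (cpow a b n).2 = cmod a b ^+ n.
Proof.
elim: n => [|n IH]; first by rewrite /= /cmod expr0n/= addr0 expr1n sqrtr1.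
rewrite exprS -IH -cmodM /=; congr cmod; ring.
Qed.

Lemma perturbed_cpow a b (x y : nat -> R) rho n : a ^+ 2 + b ^+ 2 <= 1 ->
  (forall k, `|x k.+1 - (a * x k - b * y k)| <= rho) ->
  (forall k, `|y k.+1 - (a * y k + b * x k)| <= rho) ->
  `|x n - ((cpow a b n).1 * x 0%N - (cpow a b n).2 * y 0%N)| <= n%:R * (2 * rho).
Proof.
move=> ab Hx Hy.
have ab1 : cmod a b <= 1 by rewrite -sqrtr1 ler_wsqrtr.
suff H : cmod (x n - ((cpow a b n).1 * x 0%N - (cpow a b n).2 * y 0%N))
    (y n - ((cpow a b n).1 * y 0%N + (cpow a b n).2 * x 0%N)) <= n%:R * (2 * rho).
  by apply: le_trans H; case: (norm_le_cmod (x n - ((cpow a b n).1 * x 0%N - (cpow a b n).2 * y 0%N))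
    (y n - ((cpow a b n).1 * y 0%N + (cpow a b n).2 * x 0%N))).
elim: n => [|n IH] /=.
  by rewrite !mul1r !mul0r subr0 addr0 !subrr /cmod expr0n/= addr0 sqrtr0.
move: IH; set p := (cpow a b n).1; set q := (cpow a b n).2 => IH.
set X := x n - _ in IH; set Y := y n - _ in IH.
rewrite [X in cmod X _](_ : _ = (a * X - b * Y) + (x n.+1 - (a * x n - b * y n))); last by rewrite /X /Y; ring.
rewrite [X in cmod _ X](_ : _ = (a * Y + b * X) + (y n.+1 - (a * y n + b * x n))); last by rewrite /X /Y; ring.
apply: (le_trans (cmodD _ _ _ _)); rewrite cmodM -natr1 mulrDl mul1r lerD//.
  by apply: le_trans IH; rewrite ler_piMl// cmod_ge0.
by apply: (le_trans (cmod_le _ _)); rewrite -[2 in leRHS]/(1 + 1) mulrDl mul1r lerD.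
Qed.

End complex_modulus.

(** * Norms of expi (t f) - 1 when f is not in L2 *)

Section heavy_tail.
Context d (S : measurableType d) (R : realType) (m : probability S R).
Variable f : S -> R.
Hypothesis mf : measurable_fun setT f.
Hypothesis nL2 : ~ sq_integ m f.

(** The squared L2 norm of expi (t f) - 1, the scale against which all errors are measured. *)
Definition charD (t : R) : R := 2 * (1 - Ex m (fun x => cos (t * f x))).

Let mtf t : measurable_fun setT (fun x => t * f x).
Proof. exact: measurable_funM. Qed.

Let icos t : integ m (fun x => cos (t * f x)) := integ_cos m (mtf t).

Let charDE t : charD t = Ex m (fun x => 2 * (1 - cos (t * f x))).
Proof. by rewrite ExZ; [rewrite ExB ?Ex_cst//; exact: integ_cst|apply: integB => //; exact: integ_cst]. Qed.

Let iD t : integ m (fun x => 2 * (1 - cos (t * f x))).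
Proof. by apply: integZ; apply: integB => //; exact: integ_cst. Qed.

Lemma charD_ge0 t : 0 <= charD t.
Proof. by rewrite charDE; apply: Ex_ge0 => x; rewrite mulr_ge0// onem_cos_ge0. Qed.

Lemma charD_double t : charD (2 * t) <= 4 * charD t.
Proof.
rewrite !charDE -ExZ//; apply: le_Ex => // [|x]; first exact: integZ.
have -> : cos (2 * t * f x) = 2 * cos (t * f x) ^+ 2 - 1.
  by rewrite (_ : 2 * t * f x = (t * f x) *+ 2) ?cos_mulr2n ?mulr2n; ring.
by have := cos_le1 (t * f x); have := cos_geN1 (t * f x); nra.
Qed.

(** For small y one has 2 (1 - cos y) >= y^2 / 2. On |f| <= n this gives t^2 / 2 times a truncated
    second moment, which is unbounded in n. *)
Lemma charD_large (eps : R) : 0 < eps -> exists2 t0, 0 < t0 & forall t, `|t| <= t0 ->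
  t ^+ 2 <= eps * charD t.
Proof.
move=> e0; have [n nA] : exists n, 2 / eps < Ex m (fun x => trunc f n x ^+ 2).
  apply: contrapT => nex; apply: nL2; apply: (@sq_integ_trunc _ _ _ _ _ (2 / eps)) => // n.
  by rewrite leNgt; apply/negP => h; apply: nex; exists n.
exists (4 * n.+1%:R)^-1; first by rewrite invr_gt0 mulr_gt0// ltr0n.
move=> t tn; have L2t := sq_integ_bounded m (measurable_trunc n mf) (norm_trunc_le f n).
have le : t ^+ 2 / 2 * Ex m (fun x => trunc f n x ^+ 2) <= charD t.
  rewrite charDE -ExZ; last exact: L2t.2.
  apply: le_Ex => // [|x]; first by apply: integZ; exact: L2t.2.
  rewrite /trunc; case: ifP => [fn|_]; last by rewrite expr0n mulr0 mulr_ge0// onem_cos_ge0.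
  set y := t * f x; have y4 : `|y| <= 4^-1.
    rewrite normrM (le_trans (ler_pM _ _ tn fn))// invfM -mulrA ler_piMr ?invr_ge0// mulrC.
    by rewrite ler_pdivrMr ?ltr0n// mul1r ler_nat.
  have := cos_taylor y; have y2 := sqr_ge0 y; have ym : Num.min 1 `|y| <= 4^-1 by rewrite ge_min y4 orbT.
  have : y ^+ 2 * Num.min 1 `|y| <= y ^+ 2 * 4^-1 by rewrite ler_wpM2l.
  rewrite [t ^+ 2 / 2 * _](_ : _ = y ^+ 2 / 2); last by rewrite /y exprMn; ring.
  by move=> h1; rewrite ler_norml => /andP[h2 h3]; lra.
have e2 : 0 < 2 / eps by rewrite divr_gt0.
have t2 := sqr_ge0 t.
have h : t ^+ 2 / 2 * (2 / eps) <= charD t by apply: le_trans le; rewrite ler_wpM2l// ?divr_ge0// ltW.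
rewrite -ler_pdivrMl// (le_trans _ h)// le_eqVlt; apply/orP; left; apply/eqP; field.
by rewrite gt_eqF.
Qed.

Lemma charD_large1 (eps : R) : 0 < eps -> exists2 t0, 0 < t0 & forall t, `|t| <= t0 ->
  `|t| <= eps * Num.sqrt (charD t).
Proof.
move=> e0; have [|t0 t00 H] := @charD_large (eps ^+ 2); first by rewrite exprn_gt0.
exists t0 => // t tt0; rewrite -sqrtr_sqr -[X in X * _](ger0_norm (ltW e0)) -sqrtr_sqr.
by rewrite -sqrtrM ?sqr_ge0// ler_wsqrtr// H.
Qed.

Lemma charD_gt0 : exists2 t0, 0 < t0 & forall t, 0 < `|t| <= t0 -> 0 < charD t.
Proof.
have [t0 t00 H] := charD_large ltr01; exists t0 => // t /andP[tp tt0].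
apply: lt_le_trans (_ : t ^+ 2 <= _); last by have := H t tt0; rewrite mul1r.
by rewrite -(real_normK (num_real t)) exprn_gt0.
Qed.

(* The properties shared by the real and imaginary parts of [expi (t f) - 1]. *)
Definition char_part (t : R) (e : S -> R) :=
  [/\ measurable_fun setT e, forall x, `|e x| <= 2, forall x, `|e x| <= `|t * f x|,
      forall x y, `|e x - e y| <= `|t| * `|f x - f y| & norm2 m e <= Num.sqrt (charD t)].

Let char_part_norm2 t e : (forall x, e x ^+ 2 <= 2 * (1 - cos (t * f x))) ->
  measurable_fun setT e -> (forall x, `|e x| <= 2) -> norm2 m e <= Num.sqrt (charD t).
Proof.
move=> le me e2; apply: ler_wsqrtr; rewrite charDE; apply: le_Ex => //.
exact: (sq_integ_bounded m me e2).2.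
Qed.

Lemma char_part_cos t : char_part t (fun x => cos (t * f x) - 1).
Proof.
have mc : measurable_fun setT (fun x => cos (t * f x) - 1).
  by apply: measurable_funB => //; exact: measurable_cos_comp.
have b x : `|cos (t * f x) - 1| <= 2.
  by rewrite ler_norml; have := cos_le1 (t * f x); have := cos_geN1 (t * f x) => h1 h2; apply/andP; split; lra.
split => //.
- by move=> x; have := cos_lip (t * f x) 0; rewrite cos0 subr0.
- by move=> x y; rewrite opprB addrA subrK (le_trans (cos_lip _ _))// -mulrBr normrM.
- apply: char_part_norm2 => // x.
  by have := cos_le1 (t * f x); have := cos_geN1 (t * f x); nra.
Qed.

Lemma char_part_sin t : char_part t (fun x => sin (t * f x)).
Proof.
have mc : measurable_fun setT (fun x => sin (t * f x)) by exact: measurable_sin_comp.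
have b x : `|sin (t * f x)| <= 2 by rewrite (le_trans (sin_max _))// ler1n.
split => //.
- by move=> x; exact: norm_sin_le.
- by move=> x y; rewrite (le_trans (sin_lip _ _))// -mulrBr normrM.
- apply: char_part_norm2 => // x.
  by have := cos2Dsin2 (t * f x); have := cos_le1 (t * f x); have := cos_geN1 (t * f x); nra.
Qed.

(** Where |f| <= n the function is at most n |t|, negligible with respect to the square root of
    [charD]; elsewhere Cauchy-Schwarz brings in the square root of a small mass. *)
Lemma char_part_L1 (eps : R) : 0 < eps -> exists2 t0, 0 < t0 & forall t e, `|t| <= t0 ->
  char_part t e -> Ex m (fun x => `|e x|) <= eps * Num.sqrt (charD t).
Proof.
move=> e0; have q0 : 0 < (eps / 2) ^+ 2 by rewrite exprn_gt0// divr_gt0.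
have [n Hn] := norm_gt_eventually_small m mf q0.
have [|t0 t00 Ht] := @charD_large1 (eps / 2 / n.+1%:R); first by rewrite !divr_gt0// ltr0n.
exists t0 => // t e tt0 [me e2 ef _ en].
pose A := [set x | n%:R < `|f x|].
have mA : measurable A := measurable_norm_gt _ mf.
have L2e := sq_integ_bounded m me e2.
have L2A := sq_integ_indic m mA.
have iA := sq_integM L2A (sq_integ_norm L2e).
have ie := integ_norm (sq_integ_integ L2e).
have tn0 : 0 <= `|t| * n.+1%:R by rewrite mulr_ge0.
apply: (@le_trans _ _ (Ex m (fun x => `|t| * n.+1%:R + \1_A x * `|e x|))).
  apply: le_Ex => // [|x]; first by apply: integD => //; exact: integ_cst.
  rewrite indicE; have [/set_mem xA|/negP nA] := boolP (x \in A); first by rewrite mul1r lerDr.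
  rewrite mul0r addr0 (le_trans (ef x))// normrM ler_wpM2l//.
  rewrite (@le_trans _ _ n%:R) ?ler_nat// leNgt; apply/negP => h; apply: nA; exact/mem_set.
rewrite (ExD (integ_cst _ _) iA) Ex_cst [X in _ <= X * _]splitr mulrDl; apply: lerD.
  by rewrite -ler_pdivlMr ?ltr0n// mulrAC Ht.
apply: (le_trans (ler_norm _)); apply: (le_trans (Cauchy_Schwarz_Ex L2A (sq_integ_norm L2e))).
rewrite norm2_normr norm2_indic//; apply: ler_pM => //; rewrite ?norm2_ge0//.
rewrite -[leRHS]ger0_norm ?divr_ge0 ?(ltW e0)// -sqrtr_sqr ler_wsqrtr//.
Qed.

(** The cosine part has L1 norm [charD t / 2]. As this is at most a small multiple of the square
    root of [charD t], the root itself is small. *)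
Lemma charD_le (eps : R) : 0 < eps -> exists2 t0, 0 < t0 & forall t, `|t| <= t0 -> charD t <= eps.
Proof.
move=> e0; pose c := Num.min 1 eps.
have c0 : 0 < c by rewrite lt_min ltr01.
have [t0 t00 H] := char_part_L1 (divr_gt0 c0 (ltr0n R 2)).
exists t0 => // t tt0; have D0 := charD_ge0 t.
have := H t _ tt0 (char_part_cos t).
have -> : Ex m (fun x => `|cos (t * f x) - 1|) = charD t / 2.
  rewrite /charD mulrAC mulfV// mul1r -{2}(Ex_cst m 1) -ExB; [|exact: integ_cst|by []].
  by congr (Ex m _); apply/funext => x; rewrite ler0_norm ?opprB// subr_le0 cos_le1.
have s2 := sqr_sqrtr D0; have s0 := sqrtr_ge0 (charD t).
set s := Num.sqrt _ in s0 s2 *; rewrite -s2 => h.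
have c1 : c <= 1 by rewrite ge_min lexx. have ce : c <= eps by rewrite ge_min lexx orbT.
have sc : s <= c.
  have [->|sn0] := eqVneq s 0; first exact: ltW.
  have sp : 0 < s by rewrite lt_neqAle eq_sym sn0.
  by rewrite -(ler_pM2r sp); nra.
apply: le_trans ce; nra.
Qed.

End heavy_tail.

(** * Covariances of expi (t f) - 1 *)

Section heavy_tail_decorrelation.
Context d (S : measurableType d) (R : realType) (m : probability S R).
Variables (T : S -> S) (a b : nat -> set S) (s : seq nat) (theta C eta : R).
Variables (f Dl : S -> R) (Dn : nat -> R).
Hypothesis M : markov_model m T a b s theta C.
Hypothesis O : regular_observable m T a theta eta f Dl Dn.
Hypothesis nL2 : ~ sq_integ m f.

Let mf := ro_f O.
Let D := charD m f.
Let sD t := Num.sqrt (D t).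

Let f_bounded (I : nat) : exists2 B : R, 0 <= B & forall i x, (i < I)%N -> a i x -> `|f x| <= B.
Proof.
elim: I => [|I [B B0 HB]]; first by exists 0.
have [B' HB'] := ro_bounded O I; exists (Num.max B B'); first by rewrite le_max B0.
move=> i x; rewrite ltnS leq_eqVlt => /predU1P[->|iI] ax.
  by rewrite le_max HB' ?orbT.
by rewrite le_max (HB i).
Qed.

Let tail_symbols (eps : R) : 0 < eps -> exists I : nat,
  pr m (\bigcup_(i in [set i | (I <= i)%N]) a i) <= eps.
Proof.
move=> e0; have : (fun I : nat => pr m (\bigcup_(i in [set i | (I <= i)%N]) a i)) @ \oo --> (0 : R).
  apply: pr_eventually0 => [I|x].
    by apply: bigcup_measurable => i _; exact: mm_a M i.
  have [[i ax]|nx] := pselect (exists i, a i x).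
    exists i.+1 => // I /= iI [j /= Ij aj].
    have ji : j = i by apply: (mm_triv M) => //; exists x.
    by rewrite ji leqNgt iI in Ij.
  by exists 0%N => // I _ [j _ aj]; apply: nx; exists j.
move=> /cvgrPdist_le/(_ eps e0)[n _ /(_ n (leqnn n))] /=.
by rewrite sub0r normrN => h; exists n; exact: le_trans (ler_norm _) h.
Qed.

Let geometric_small (c r eps : R) : 0 <= c -> 0 < r -> r < 1 -> 0 < eps ->
  exists k0, forall k, (k0 <= k)%N -> c * r ^+ k <= eps.
Proof.
move=> c0 r0 r1 e0; have : (fun k : nat => c * r ^+ k) @ \oo --> c * 0.
  by apply: cvgMr; apply: cvg_expr; rewrite gtr0_norm.
rewrite mulr0 => /cvgrPdist_le/(_ eps e0)[k0 _ Hk]; exists k0 => k kk.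
by have := Hk k kk; rewrite /= sub0r normrN; apply: le_trans; exact: ler_norm.
Qed.

(** Up to lag [k1], the symbols of large index have small mass and [f] is bounded on the finitely
    many others, so each covariance is small with respect to the L2 norm. Beyond, the exponential
    decay is summed. [K] depends on [t], so that lag K + 1 falls below [eps * D t], a smaller order
    than [sD t]. *)
Lemma char_part_decorrelation (eps : R) : 0 < eps -> exists2 t0, 0 < t0 & forall t, 0 < `|t| <= t0 ->
  exists K (del : nat -> R), [/\ forall k, 0 <= del k,
    \sum_(1 <= k < K.+1) del k <= eps * sD t, del K.+1 <= eps * D t &
    forall k e v, (0 < k)%N -> char_part m f t e -> sq_integ m v ->
      `|cov m T k e v| <= del k * norm2 m v].
Proof.
move=> e0.
have [K1 [r [K10 r0 r1 dec]]] := cov_decay M (ro_eta O) (ro_Dl O) (ro_Dl_ge0 O) (ro_Dn_ge0 O) (ro_DlE O) (ro_integ O).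
have [c c0 sym] := cov_symbols M.
have e2 : 0 < eps / 2 by rewrite divr_gt0.
have cK : 0 <= 2 * K1 / (1 - r) by rewrite divr_ge0 ?mulr_ge0// subr_ge0 ltW.
have [k1 Hk1] := geometric_small cK r0 r1 e2.
(* Half of [eps] is shared among the lags up to [k1]; each share is divided again among the three
   terms of the bound by symbols. *)
pose e' := eps / 2 / k1.+1%:R; have e'0 : 0 < e' by rewrite !divr_gt0// ltr0n.
have e'3 : 0 < e' / 3 by rewrite divr_gt0.
have c1 : 0 < c + 1 by rewrite ltr_wpDl.
have q0 : 0 < (e' / 3 / (c + 1)) ^+ 2 by rewrite exprn_gt0// divr_gt0.
have [I HI] := tail_symbols q0.
have [B B0 HB] := f_bounded I.
have B1 : 0 < B + 1 by rewrite ltr_wpDl.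
have [ta ta0 Ha] := charD_large1 mf nL2 (divr_gt0 e'3 B1).
have [tb tb0 Hb] := charD_large1 mf nL2 ltr01.
have [tc tc0 Hc] := char_part_L1 mf nL2 e'3.
have [td td0 Hd] := charD_gt0 mf nL2.
exists (Num.min (Num.min ta tb) (Num.min tc td)); first by rewrite !lt_min ta0 tb0 tc0.
move=> t /andP[tp]; rewrite !le_min => /andP[/andP[tta ttb] /andP[ttc ttd]].
have Dt : 0 < D t by apply: Hd; rewrite tp.
have s0 : 0 < sD t by rewrite sqrtr_gt0.
have [k2 Hk2] : exists k2, forall k, (k2 <= k)%N -> 2 * K1 * r ^+ k <= eps * sD t.
  by apply: geometric_small; rewrite ?mulr_ge0 ?mulr_gt0.
pose del k := if (k <= k1)%N then e' * sD t else 2 * K1 * r ^+ k * sD t.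
exists (maxn k1 k2), del; split.
- by move=> k; rewrite /del; case: ifP => _; rewrite !mulr_ge0 ?exprn_ge0// ltW.
- have kk : (1 <= k1.+1 <= (maxn k1 k2).+1)%N by apply/andP; split => //; rewrite ltnS leq_maxl.
  have [h1 h2] := andP kk; rewrite (@big_cat_nat _ _ _ k1.+1)//= [X in X * _](splitr eps) mulrDl; apply: lerD.
    rewrite (@eq_big_nat _ _ _ _ _ _ (fun=> e' * sD t)); last by move=> k /andP[_]; rewrite /del ltnS => ->.
    rewrite sumr_const_nat subSS subn0 -[X in X <= _]mulr_natl mulrA ler_wpM2r ?(ltW s0)//.
    rewrite /e' mulrC mulrAC ler_pdivrMr ?ltr0n// ler_wpM2l ?(ltW e2)// ler_nat//.
  rewrite (@eq_big_nat _ _ _ _ _ _ (fun k => (2 * K1 * r ^+ k) * sD t)); last first.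
    by move=> k /andP[k1k _]; rewrite /del leqNgt k1k.
  rewrite -mulr_suml ler_wpM2r ?(ltW s0)//.
  rewrite -(subnKC h2); apply: (le_trans (geometric_sum_le _ _ _ r0 r1)); first by rewrite mulr_ge0.
  by apply: Hk1; exact: ltnW.
- rewrite /del leqNgt ltnS leq_maxl/= -[D t]sqr_sqrtr ?(ltW Dt)// -/(sD t) expr2 mulrA.
  by rewrite ler_wpM2r ?(ltW s0)// Hk2// leqW// leq_maxr.
- move=> k e v k0 cp L2v; have [me e2' ef el en] := cp.
  have L2e := sq_integ_bounded m me e2'.
  rewrite /del; case: ifPn => [kk1|_].
    apply: (le_trans (sym k [set i | (I <= i)%N] (`|t| * B) e v k0 L2e L2v _ _)).
    + by rewrite mulr_ge0.
    + move=> i x /negP; rewrite -ltnNge => iI ax; rewrite (le_trans (ef x))// normrM ler_wpM2l//.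
      exact: HB iI ax.
    rewrite ler_wpM2r ?norm2_ge0//.
    have -> : e' * sD t = e' / 3 * sD t + e' / 3 * sD t + e' / 3 * sD t by field.
    apply: lerD; last exact: Hc.
    apply: lerD.
      apply: (@le_trans _ _ (`|t| * (B + 1))); first by rewrite ler_wpM2l// lerDl.
      by rewrite -ler_pdivlMr// mulrAC Ha.
    apply: (@le_trans _ _ (c * sD t * (e' / 3 / (c + 1)))).
      apply: ler_pM; [by rewrite mulr_ge0 ?norm2_ge0|exact: sqrtr_ge0|by rewrite ler_wpM2l|].
      rewrite (_ : e' / 3 / (c + 1) = Num.sqrt ((e' / 3 / (c + 1)) ^+ 2)) ?ler_wsqrtr//.
      by rewrite sqrtr_sqr ger0_norm// ltW// divr_gt0.
    rewrite [leLHS](_ : _ = e' / 3 * sD t * (c / (c + 1))); last by field; rewrite gt_eqF.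
    by apply: ler_piMr; [apply: mulr_ge0; exact: ltW|rewrite ler_pdivrMr// mul1r lerDl].
  apply: (le_trans (dec k e v `|t| k0 L2e L2v (normr_ge0 t) _)).
    move=> i w; apply: filterS (ro_lip O i w) => x; apply: filterS => y Hxy wx wy.
    by rewrite (le_trans (el x y))// -mulrA ler_wpM2l// Hxy.
  rewrite ler_wpM2r ?norm2_ge0// [leRHS](_ : _ = K1 * r ^+ k * (sD t + sD t)); last by ring.
  by rewrite ler_wpM2l ?mulr_ge0 ?exprn_ge0 ?(ltW r0)// lerD//; have := Hb t ttb; rewrite mul1r.
Qed.

End heavy_tail_decorrelation.

(** * Recursion for the characteristic function *)

Section perturbed_recursion.
Context d (S : measurableType d) (R : realType) (m : probability S R).
Variables (T : S -> S) (f : S -> R).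
Hypothesis mpT : measure_preserving m T.
Hypothesis mf : measurable_fun setT f.

Let mT : measurable_fun setT T := mp_measurable mpT.
Let D := charD m f.
Let sD t := Num.sqrt (D t).
Let ec t x := cos (t * f x) - 1.
Let es t x := sin (t * f x).
Let phic t := Ex m (fun x => cos (t * f x)).
Let phis t := Ex m (fun x => sin (t * f x)).

Let mtf t : measurable_fun setT (fun x => t * f x).
Proof. exact: measurable_funM. Qed.
Let cpc t : char_part m f t (ec t) := char_part_cos m mf t.
Let cps t : char_part m f t (es t) := char_part_sin m mf t.
Let L2ec t : sq_integ m (ec t). Proof. by case: (cpc t) => me e2 _ _ _; exact: sq_integ_bounded me e2. Qed.
Let L2es t : sq_integ m (es t). Proof. by case: (cps t) => me e2 _ _ _; exact: sq_integ_bounded me e2. Qed.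
Let nec t : norm2 m (ec t) <= sD t. Proof. by case: (cpc t). Qed.
Let nes t : norm2 m (es t) <= sD t. Proof. by case: (cps t). Qed.

Let phicE t : phic t = 1 + Ex m (ec t).
Proof. by rewrite /ec ExB; [rewrite Ex_cst addrCA subrr addr0|exact: integ_cos|exact: integ_cst]. Qed.

Lemma charD_le4 t : charD m f t <= 4.
Proof.
have := Ex_bounded m (measurable_cos_comp (mtf t)) (fun x => cos_max _).
by rewrite /charD ler_norml => /andP[h _]; lra.
Qed.

Lemma sqr_char_le1 t : phic t ^+ 2 + phis t ^+ 2 <= 1.
Proof.
have b1 := norm_Ex_le_norm2 (sq_integ_bounded m (measurable_cos_comp (mtf t)) (fun x => cos_max _)).
have b2 := norm_Ex_le_norm2 (sq_integ_bounded m (measurable_sin_comp (mtf t)) (fun x => sin_max _)).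
have c1 : phic t ^+ 2 <= Ex m (fun x => cos (t * f x) ^+ 2).
  by rewrite -norm2K -(real_normK (num_real (phic t))) lerXn2r ?nnegrE ?norm2_ge0.
have c2 : phis t ^+ 2 <= Ex m (fun x => sin (t * f x) ^+ 2).
  by rewrite -norm2K -(real_normK (num_real (phis t))) lerXn2r ?nnegrE ?norm2_ge0.
apply: (le_trans (lerD c1 c2)); rewrite -ExD.
- by under eq_fun do rewrite cos2Dsin2; rewrite Ex_cst.
- exact: (sq_integ_bounded m (measurable_cos_comp (mtf t)) (fun x => cos_max _)).2.
- exact: (sq_integ_bounded m (measurable_sin_comp (mtf t)) (fun x => sin_max _)).2.
Qed.

Let cov_comp k e v : measurable_fun setT v -> cov m T k e (fun x => v (T x)) = cov m T k.+1 e v.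
Proof. by move=> mv; rewrite /cov (Ex_comp mpT mv). Qed.

Let iev k e v : sq_integ m e -> sq_integ m v -> integ m (fun x => e x * v (iter k T x)).
Proof. by move=> L2e L2v; apply: sq_integM => //; exact: (sq_integ_comp (measure_preserving_iter mpT k) L2v). Qed.

Let covD k e v q : sq_integ m e -> sq_integ m v -> sq_integ m q ->
  cov m T k e (fun x => v x + q x) = cov m T k e v + cov m T k e q.
Proof.
move=> L2e L2v L2q; rewrite /cov (ExD (sq_integ_integ L2v) (sq_integ_integ L2q)).
rewrite (_ : (fun x => e x * _) = fun x => e x * v (iter k T x) + e x * q (iter k T x)).
  by rewrite (ExD (iev k L2e L2v) (iev k L2e L2q)); ring.
by apply/funext => x; rewrite mulrDr.
Qed.

Let covN k e v : sq_integ m e -> sq_integ m v -> cov m T k e (fun x => - v x) = - cov m T k e v.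
Proof.
move=> L2e L2v; rewrite /cov (ExN (sq_integ_integ L2v)).
rewrite (_ : (fun x => e x * _) = fun x => - (e x * v (iter k T x))).
  by rewrite (ExN (iev k L2e L2v)); ring.
by apply/funext => x; rewrite mulrN.
Qed.

Section fixed_time.
Variables (t eps : R) (K : nat) (del : nat -> R).
Hypotheses (eps0 : 0 <= eps) (del0 : forall k, 0 <= del k).
Hypothesis del_sum : \sum_(1 <= k < K.+1) del k <= eps * sD t.
Hypothesis del_last : del K.+1 <= eps * D t.
Hypothesis del_cov : forall k e v, (0 < k)%N -> char_part m f t e -> sq_integ m v ->
  `|cov m T k e v| <= del k * norm2 m v.

Let D0 : 0 <= D t := charD_ge0 m mf t.
Let s0 : 0 <= sD t. Proof. exact: sqrtr_ge0. Qed.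
Let s2 : sD t ^+ 2 = D t. Proof. exact: sqr_sqrtr. Qed.

(* [csig k V1 V2] is the real part of the covariance of [expi (t f) - 1] and
   [(V1 + i V2) \o iter k T]. *)
Let csig k V1 V2 := cov m T k (ec t) V1 - cov m T k (es t) V2.
Let sig V1 V2 := \sum_(1 <= k < K.+1) csig k V1 V2.
(** Real part of the corrected expectation of V1 + i V2. The imaginary part is the same expression
    for - i (V1 + i V2), that is [beta V2 (neg V1)]. *)
Let beta V1 V2 := Ex m V1 + sig V1 V2.
Let next (V1 V2 : S -> R) x := cos (t * f x) * V1 (T x) - sin (t * f x) * V2 (T x).
Let bd (V : S -> R) := measurable_fun setT V /\ forall x, `|V x| <= 1.
Let neg (V : S -> R) x := - V x.

Let bd_neg V : bd V -> bd (neg V).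
Proof. by move=> [mV V1]; split => [|x]; [exact: measurableT_comp|rewrite normrN]. Qed.
Let bdL2 V : bd V -> sq_integ m V. Proof. by move=> [mV V1]; exact: sq_integ_bounded mV V1. Qed.
Let bd_norm2 V : bd V -> norm2 m V <= 1. Proof. by move=> [mV V1]; exact: norm2_bounded. Qed.

Let csig_le k V1 V2 y : (0 < k)%N -> sq_integ m V1 -> sq_integ m V2 ->
  norm2 m V1 <= y -> norm2 m V2 <= y -> `|csig k V1 V2| <= del k * (2 * y).
Proof.
move=> k0 L1 L2 y1 y2; apply: (le_trans (ler_normB _ _)); rewrite (_ : 2 * y = y + y); last by ring.
rewrite mulrDr lerD//.
  by apply: (le_trans (del_cov k0 (cpc t) L1)); rewrite ler_wpM2l.
by apply: (le_trans (del_cov k0 (cps t) L2)); rewrite ler_wpM2l.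
Qed.

Let sig_le V1 V2 y : sq_integ m V1 -> sq_integ m V2 -> 0 <= y ->
  norm2 m V1 <= y -> norm2 m V2 <= y -> `|sig V1 V2| <= eps * sD t * (2 * y).
Proof.
move=> L1 L2 y0 y1 y2; apply: (le_trans (ler_norm_sum _ _ _)).
apply: (@le_trans _ _ ((\sum_(1 <= k < K.+1) del k) * (2 * y))).
  by rewrite mulr_suml big_nat [leRHS]big_nat; apply: ler_sum => k /andP[k0 _]; exact: csig_le.
by rewrite ler_wpM2r// mulr_ge0.
Qed.

Let beta_near V1 V2 : bd V1 -> bd V2 -> `|beta V1 V2 - Ex m V1| <= eps * sD t * 2.
Proof.
move=> b1 b2; rewrite /beta addrC addKr -[2 in leRHS]mulr1.
by apply: sig_le; [exact: bdL2|exact: bdL2|exact: ler01|exact: bd_norm2|exact: bd_norm2].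
Qed.

Let beta_neg V1 V2 : bd V1 -> bd V2 -> beta (neg V1) (neg V2) = - beta V1 V2.
Proof.
move=> b1 b2; rewrite /beta (ExN (sq_integ_integ (bdL2 b1))) opprD; congr (_ + _).
rewrite /sig -sumrN; apply: eq_bigr => k _.
by rewrite /csig !covN ?opprD//; exact: bdL2.
Qed.

Let q (V1 V2 : S -> R) x := ec t x * V1 (T x) - es t x * V2 (T x).

Let nextE V1 V2 : next V1 V2 = fun x => V1 (T x) + q V1 V2 x.
Proof. by apply/funext => x; rewrite /next /q /ec /es; ring. Qed.

Let prod_norm2 e V : sq_integ m e -> bd V -> sq_integ m (fun x => e x * V (T x)) /\
  norm2 m (fun x => e x * V (T x)) <= norm2 m e.
Proof.
move=> L2e [mV V1]; have L2 : sq_integ m (fun x => e x * V (T x)).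
  by apply: (sq_integM_bounded (M := 1) L2e) => //; exact: measurableT_comp mV mT.
by split => //; apply: le_norm2 => // x; rewrite normrM ler_piMr.
Qed.

Let q_norm2 V1 V2 : bd V1 -> bd V2 -> sq_integ m (q V1 V2) /\ norm2 m (q V1 V2) <= 2 * sD t.
Proof.
move=> b1 b2; have [L1 n1] := prod_norm2 (L2ec t) b1; have [L2 n2] := prod_norm2 (L2es t) (bd_neg b2).
have -> : q V1 V2 = fun x => ec t x * V1 (T x) + es t x * neg V2 (T x).
  by apply/funext => x; rewrite /q /neg mulrN.
split; first exact: sq_integD.
apply: (le_trans (norm2D L1 L2)); rewrite (_ : 2 * sD t = sD t + sD t); last by ring.
by rewrite lerD ?(le_trans n1) ?(le_trans n2).
Qed.

(** [next V1 V2] is [V1 \o T] plus a part of L2 norm at most [2 * sD t]. On [V1 \o T] the lags move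
    up by one: the covariance of lag 1 contained in the expectation completes the sum, and only lag
    K + 1 is left over. On the other part the correction is of second order. The errors 2, 4, 2 and
    2 add up to 10. *)
Let beta_step V1 V2 : bd V1 -> bd V2 ->
  `|beta (next V1 V2) (next V2 (neg V1)) - (phic t * beta V1 V2 - phis t * beta V2 (neg V1))| <=
  10 * (eps * D t).
Proof.
move=> b1 b2; have b1' := bd_neg b1.
have [Lq1 nq1] := q_norm2 b1 b2; have [Lq2 nq2] := q_norm2 b2 b1'.
have L1T := sq_integ_comp mpT (bdL2 b1); have L2T := sq_integ_comp mpT (bdL2 b2).
have Esig : sig (next V1 V2) (next V2 (neg V1)) =
    \sum_(1 <= k < K.+1) csig k.+1 V1 V2 + sig (q V1 V2) (q V2 (neg V1)).
  rewrite /sig -big_split/=; apply: eq_bigr => k _; rewrite /csig !nextE.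
  rewrite (covD k (L2ec t) L1T Lq1) (covD k (L2es t) L2T Lq2) (cov_comp k (ec t) b1.1) (cov_comp k (es t) b2.1); ring.
have Eex : Ex m (next V1 V2) = phic t * Ex m V1 - phis t * Ex m V2 + csig 1 V1 V2.
  have [Lp1 _] := prod_norm2 (L2ec t) b1; have [Lp2 _] := prod_norm2 (L2es t) b2.
  rewrite nextE (ExD (sq_integ_integ L1T) (sq_integ_integ Lq1)) (Ex_comp mpT b1.1).
  rewrite (ExB (sq_integ_integ Lp1) (sq_integ_integ Lp2)) phicE /csig /cov/=; rewrite /phis -/(es t); ring.
have Etel : csig 1 V1 V2 + \sum_(1 <= k < K.+1) csig k.+1 V1 V2 = sig V1 V2 + csig K.+1 V1 V2.
  rewrite /sig -(@big_add1 _ _ _ 1 K.+2 xpredT (fun k => csig k V1 V2))/=.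
  by rewrite -(big_nat_recr K.+1)//= [RHS]big_ltn.
have -> : beta (next V1 V2) (next V2 (neg V1)) - (phic t * beta V1 V2 - phis t * beta V2 (neg V1)) =
    csig K.+1 V1 V2 + sig (q V1 V2) (q V2 (neg V1)) - Ex m (ec t) * sig V1 V2 + phis t * sig V2 (neg V1).
  rewrite /beta Eex Esig [X in _ + (X + _) - _](_ : _ = sig V1 V2 + csig K.+1 V1 V2 - csig 1 V1 V2); last by rewrite -Etel; ring.
  by rewrite phicE; ring.
have h1 : `|csig K.+1 V1 V2| <= eps * D t * 2.
  apply: (le_trans (csig_le (y := 1) _ (bdL2 b1) (bdL2 b2) (bd_norm2 b1) (bd_norm2 b2))) => //.
  by rewrite mulr1 ler_wpM2r.
have h2 : `|sig (q V1 V2) (q V2 (neg V1))| <= eps * D t * 4.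
  apply: (le_trans (sig_le Lq1 Lq2 _ nq1 nq2)); first by rewrite mulr_ge0.
  by rewrite -s2 le_eqVlt; apply/orP; left; apply/eqP; ring.
have sl V V' : bd V -> bd V' -> `|sig V V'| <= eps * sD t * 2.
  by move=> b b'; have := beta_near b b'; rewrite /beta addrC addKr.
have pl (p : R) V V' : `|p| <= sD t -> bd V -> bd V' -> `|p * sig V V'| <= eps * D t * 2.
  move=> ps b b'; rewrite normrM; apply: (le_trans (ler_pM (normr_ge0 _) (normr_ge0 _) ps (sl _ _ b b'))).
  by rewrite -s2 le_eqVlt; apply/orP; left; apply/eqP; ring.
have pc : `|Ex m (ec t)| <= sD t := le_trans (norm_Ex_le_norm2 (L2ec t)) (nec t).
have ps : `|phis t| <= sD t := le_trans (norm_Ex_le_norm2 (L2es t)) (nes t).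
have h3 := pl _ _ _ pc b1 b2; have h4 := pl _ _ _ ps b2 b1'.
apply: (le_trans (ler_normD _ _)); have := ler_normB (csig K.+1 V1 V2 + sig (q V1 V2) (q V2 (neg V1))) (Ex m (ec t) * sig V1 V2).
have := ler_normD (csig K.+1 V1 V2) (sig (q V1 V2) (q V2 (neg V1))).
move: h1 h2 h3 h4; lra.
Qed.

Variable G : S -> R.
Hypothesis mG : measurable_fun setT G.

(** [G] is a phase at the end of the orbit: it lets the recursion stop early, with the rest of a
    longer Birkhoff sum stored in [G]. *)
Let arg n x := t * birkhoff_sum T f n x + G (iter n T x).

Let marg n : measurable_fun setT (arg n).
Proof.
apply: measurable_funD.
  by apply: measurable_funM => //; exact: measurable_birkhoff_sum.
exact: measurableT_comp mG (mp_measurable (measure_preserving_iter mpT n)).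
Qed.

Let Vc n x := cos (arg n x).
Let Vs n x := sin (arg n x).

Let bc n : bd (Vc n). Proof. by split => [|x]; [exact: measurable_cos_comp|exact: cos_max]. Qed.
Let bs n : bd (Vs n). Proof. by split => [|x]; [exact: measurable_sin_comp|exact: sin_max]. Qed.

Let argS n x : arg n.+1 x = t * f x + arg n (T x).
Proof. by rewrite /arg birkhoff_sumS iterSr mulrDr addrA. Qed.

Let VcS n : Vc n.+1 = next (Vc n) (Vs n).
Proof. by apply/funext => x; rewrite /Vc /Vs /next argS cosD. Qed.
Let VsS n : Vs n.+1 = next (Vs n) (neg (Vc n)).
Proof. by apply/funext => x; rewrite /Vc /Vs /next /neg argS sinD; ring. Qed.
Let VcSN n : neg (Vc n.+1) = next (neg (Vc n)) (neg (Vs n)).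
Proof. by apply/funext => x; rewrite /neg VcS /next; ring. Qed.

(** As [sD t <= 2], each of the three corrections to be removed costs [4 * eps]. The factor 20 is
    twice the 10 of one step, for the real and imaginary parts. *)
Lemma char_recursion n : `|Ex m (Vc n) - ((cpow (phic t) (phis t) n).1 * Ex m (Vc 0%N) -
    (cpow (phic t) (phis t) n).2 * Ex m (Vs 0%N))| <= 12 * eps + n%:R * (20 * (eps * D t)).
Proof.
pose x k := beta (Vc k) (Vs k); pose y k := beta (Vs k) (neg (Vc k)).
have Hx k : `|x k.+1 - (phic t * x k - phis t * y k)| <= 10 * (eps * D t).
  by rewrite /x /y VcS VsS; exact: beta_step.
have Hy k : `|y k.+1 - (phic t * y k + phis t * x k)| <= 10 * (eps * D t).
  rewrite /x /y VcSN VsS -[beta (Vc k) (Vs k)]opprK -beta_neg// mulrN.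
  exact: (beta_step (bs k) (bd_neg (bc k))).
have := perturbed_cpow n (sqr_char_le1 t) Hx Hy.
set p1 := (cpow _ _ _).1; set p2 := (cpow _ _ _).2 => H.
have [pl1 pl2] : `|p1| <= 1 /\ `|p2| <= 1.
  have [h1 h2] := norm_le_cmod p1 p2.
  have h3 : cmod p1 p2 <= 1.
    rewrite cmod_cpow exprn_ile1 ?cmod_ge0// -sqrtr1 ler_wsqrtr//; exact: sqr_char_le1.
  by split; [exact: le_trans h1 h3|exact: le_trans h2 h3].
have sd : eps * sD t * 2 <= eps * 4.
  rewrite -mulrA ler_wpM2l//; have := charD_le4 t; rewrite -/(D t) -s2; have := s0; nra.
have n1 := le_trans (beta_near (bc n) (bs n)) sd.
have n2 := le_trans (beta_near (bc 0) (bs 0)) sd.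
have n3 := le_trans (beta_near (bs 0) (bd_neg (bc 0))) sd.
rewrite -/(x n) in n1; rewrite -/(x 0%N) in n2; rewrite -/(y 0%N) in n3.
have m2 : `|p1 * (x 0%N - Ex m (Vc 0%N))| <= eps * 4.
  by rewrite normrM; apply: le_trans n2; rewrite ler_piMl.
have m3 : `|p2 * (y 0%N - Ex m (Vs 0%N))| <= eps * 4.
  by rewrite normrM; apply: le_trans n3; rewrite ler_piMl.
have -> : Ex m (Vc n) - (p1 * Ex m (Vc 0%N) - p2 * Ex m (Vs 0%N)) =
  (x n - (p1 * x 0%N - p2 * y 0%N)) - (x n - Ex m (Vc n)) + p1 * (x 0%N - Ex m (Vc 0%N)) -
  p2 * (y 0%N - Ex m (Vs 0%N)) by ring.
move: H n1 m2 m3; rewrite !ler_norml => /andP[a1 a2] /andP[b1 b2] /andP[c1 c2] /andP[d1 d2].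
by apply/andP; split; lra.
Qed.

End fixed_time.
End perturbed_recursion.

(** * Equivalence with independent sums *)

Section heavy_tail_limit.
Context d (S : measurableType d) (R : realType) (m : probability S R).
Variables (T : S -> S) (a b : nat -> set S) (s : seq nat) (theta C eta : R).
Variables (f Dl : S -> R) (Dn : nat -> R).
Hypothesis M : markov_model m T a b s theta C.
Hypothesis O : regular_observable m T a theta eta f Dl Dn.
Hypothesis nL2 : ~ sq_integ m f.

Let mpT := mm_mp M.
Let mT : measurable_fun setT T := mp_measurable mpT.
Let mf := ro_f O.
Let D := charD m f.
Let pow t n := cpow (Ex m (fun x => cos (t * f x))) (Ex m (fun x => sin (t * f x))) n.
Let mS n : measurable_fun setT (birkhoff_sum T f n).
Proof. exact: measurable_birkhoff_sum. Qed.

Let cf_birkhoff (eps : R) : 0 < eps -> exists2 t0, 0 < t0 & forall t, 0 < `|t| <= t0 ->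
  forall n (G : S -> R), measurable_fun setT G ->
  `|Ex m (fun x => cos (t * birkhoff_sum T f n x + G (iter n T x))) -
    ((pow t n).1 * Ex m (fun x => cos (G x)) - (pow t n).2 * Ex m (fun x => sin (G x)))| <=
  eps + n%:R * (eps * D t).
Proof.
move=> e0; have e20 : 0 < eps / 20 by rewrite divr_gt0.
have [t0 t00 Ht] := char_part_decorrelation M O nL2 e20.
exists t0 => // t tt0 n G mG; have [K [del [del0 dsum dlast dcov]]] := Ht t tt0.
have := char_recursion mpT mf (ltW e20) del0 dsum dlast dcov mG n.
rewrite -/(pow t n).
rewrite (_ : (fun x => cos (t * birkhoff_sum T f 0 x + G (iter 0 T x))) = fun x => cos (G x)); last first.
  by apply/funext => x; rewrite /birkhoff_sum big_geq// mulr0 add0r.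
rewrite (_ : (fun x => sin (t * birkhoff_sum T f 0 x + G (iter 0 T x))) = fun x => sin (G x)); last first.
  by apply/funext => x; rewrite /birkhoff_sum big_geq// mulr0 add0r.
move=> /le_trans; apply; apply: lerD; first lra.
by rewrite ler_wpM2l// le_eqVlt; apply/orP; left; apply/eqP; rewrite /D; field.
Qed.

(** The sine part of the characteristic function is small with respect to the square root of [D t],
    so the squared modulus is at most [1 - D t / 2], and its n-th power at most exp (- n D(t) /
    2). *)
Let pow_small : exists2 K0 : R, 0 < K0 & exists2 t0 : R, 0 < t0 & forall t n, 0 < `|t| <= t0 ->
  D t <= 1 /\ (K0 <= n%:R * D t -> cmod (pow t n).1 (pow t n).2 <= 16^-1).
Proof.
have [K0 K00 HK] : exists2 K0 : R, 0 < K0 & 16 ^+ 2 <= 1 + K0 / 2.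
  have c0 : (0 : R) < 16 ^+ 2 by rewrite exprn_gt0.
  exists (2 * 16 ^+ 2); first by rewrite mulr_gt0.
  by rewrite mulrAC mulfV// mul1r lerDr.
exists K0 => //.
have h0 : (0 : R) < 2^-1 by rewrite invr_gt0.
have [ta ta0 Ha] := char_part_L1 mf nL2 h0.
have [tb tb0 Hb] := charD_le mf nL2 ltr01.
exists (Num.min ta tb); first by rewrite lt_min ta0.
move=> t n /andP[_]; rewrite le_min => /andP[tta ttb].
have D1 := Hb t ttb; rewrite -/(D t) in D1; split => // nD.
have D0 : 0 <= D t := charD_ge0 m mf t.
set c := Ex m (fun x => cos (t * f x)); set sn := Ex m (fun x => sin (t * f x)).
have cE : c = 1 - D t / 2 by rewrite /D /charD -/c; field.
have snE : `|sn| <= 2^-1 * Num.sqrt (D t).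
  apply: le_trans (Ha t _ tta (char_part_sin m mf t)); apply: Ex_norm.
  by apply: integ_sin; exact: measurable_funM.
have sn2 : sn ^+ 2 <= D t / 4.
  have s2 := sqr_sqrtr D0; have s0 := sqrtr_ge0 (D t).
  rewrite -(real_normK (num_real sn)); have := normr_ge0 sn; nra.
have c2 : c ^+ 2 + sn ^+ 2 <= 1 - D t / 2 by rewrite cE; nra.
rewrite /pow cmod_cpow -/c -/sn -(@ler_pXn2r _ 2) ?nnegrE ?exprn_ge0 ?cmod_ge0 ?invr_ge0//.
rewrite -exprM mulnC exprM sqr_cmod.
have b0 : 0 <= c ^+ 2 + sn ^+ 2 by rewrite addr_ge0 ?sqr_ge0.
have b1 : c ^+ 2 + sn ^+ 2 <= expR (- (D t / 2)).
  by apply: (le_trans c2); exact: expR_ge1Dx.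
apply: (@le_trans _ _ (expR (- (D t / 2)) ^+ n)); first by rewrite lerXn2r ?nnegrE ?expR_ge0.
rewrite -expRM_natl mulrN expRN exprVn lef_pV2 ?posrE ?expR_gt0 ?exprn_gt0//.
apply: le_trans (expR_ge1Dx _); apply: (le_trans HK); rewrite lerD2l mulrA ler_wpM2r//.
Qed.

(** For large [n%:R * D t] the accumulated error would be useless. The recursion is stopped after
    [k] steps with [k%:R * D t] between [K0] and [K0 + 1], where the power is already small, and the
    other terms of the Birkhoff sum go into the phase [G]. *)
Let cf_birkhoff_small : exists2 K0 : R, 0 < K0 & exists2 t0 : R, 0 < t0 &
  forall n t p, 0 < `|t| <= t0 -> K0 <= n%:R * D t ->
  `|Ex m (fun x => cos (t * birkhoff_sum T f n x + p))| <= 4^-1 /\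
  cmod (pow t n).1 (pow t n).2 <= 16^-1.
Proof.
have [K0 K00 [tb tb0 Hb]] := pow_small.
have K2 : 0 < K0 + 2 by rewrite addr_gt0.
have [eps e0 eE] : exists2 eps : R, 0 < eps & eps * (K0 + 2) = 16^-1.
  by exists (16^-1 / (K0 + 2)); [rewrite divr_gt0// invr_gt0|rewrite mulfVK// gt_eqF].
have [ta ta0 Ha] := cf_birkhoff e0.
have [tc tc0 Hc] := charD_gt0 mf nL2.
exists (K0 + 1); first by rewrite addr_gt0.
exists (Num.min ta (Num.min tb tc)); first by rewrite !lt_min ta0 tb0.
move=> n t p /andP[tp]; rewrite !le_min => /andP[tta /andP[ttb ttc]] nD.
have Dp : 0 < D t by apply: Hc; rewrite tp.
have tpb : 0 < `|t| <= tb by rewrite tp.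
split; last by apply: (Hb t n tpb).2; apply: le_trans nD; rewrite lerDl.
pose k := (Num.truncn (K0 / D t)).+1.
have k1 : K0 < k%:R * D t by rewrite -ltr_pdivrMr// truncnS_gt.
have [D1 /(_ (ltW k1)) pk] := Hb t k tpb.
have k2 : k%:R * D t <= K0 + 1.
  rewrite /k -natr1 mulrDl mul1r lerD// -ler_pdivlMr// truncn_le// divr_ge0// ltW//.
have kn : (k <= n)%N.
  by rewrite -(ler_nat R) -(ler_pM2r Dp) (le_trans k2).
pose G x := t * birkhoff_sum T f (n - k) x + p.
have mG : measurable_fun setT G by apply: measurable_funD => //; exact: measurable_funM.
have tpa : 0 < `|t| <= ta by rewrite tp.
have := Ha t tpa k G mG.
rewrite (_ : (fun x => cos (t * birkhoff_sum T f k x + _)) = fun x => cos (t * birkhoff_sum T f n x + p)); last first.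
  by apply/funext => x; rewrite /G addrA -mulrDr -birkhoff_sumD (subnKC kn).
set z := Ex m (fun x => cos (t * _ + p)); set x1 := Ex m _; set x2 := Ex m _.
have c1 : `|x1| <= 1 by apply: Ex_bounded; [exact: measurable_cos_comp|move=> x; exact: cos_max].
have c2 : `|x2| <= 1 by apply: Ex_bounded; [exact: measurable_sin_comp|move=> x; exact: sin_max].
have [q1 q2] := norm_le_cmod (pow t k).1 (pow t k).2.
have b1 : `|(pow t k).1 * x1| <= 16^-1.
  by rewrite normrM (le_trans _ (le_trans q1 pk))// ler_piMr.
have b2 : `|(pow t k).2 * x2| <= 16^-1.
  by rewrite normrM (le_trans _ (le_trans q2 pk))// ler_piMr.
have b3 : eps + k%:R * (eps * D t) <= 16^-1.
  by have := ler_wpM2l (ltW e0) k2; rewrite -eE; lra.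
move=> /le_trans/(_ b3) h; rewrite -[z](subrK ((pow t k).1 * x1 - (pow t k).2 * x2)).
apply: (le_trans (ler_normD _ _)).
by have := ler_normB ((pow t k).1 * x1) ((pow t k).2 * x2); lra.
Qed.

Section independent_copies.
Context d' (S' : measurableType d') (P : probability S' R).
Variable Z : nat -> {RV P >-> R}.
Variable F : {RV m >-> R}.
Hypothesis Ff : F = f :> (S -> R).
Hypotheses (indZ : mutually_independent Z) (lawZ : forall k, same_law (Z k) F).

Let sumZ n (x : S') := \sum_(0 <= k < n) Z k x.

Let msumZ n : measurable_fun setT (sumZ n).
Proof. by apply: measurable_sum => k. Qed.

Let cf_iid n t p : Ex P (fun x => cos (t * sumZ n x + p)) =
  (pow t n).1 * cos p - (pow t n).2 * sin p.
Proof.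
have mc : measurable_fun setT (fun x : R => cos (t * x)) by apply: measurable_cos_comp; exact: measurable_funM.
have ms : measurable_fun setT (fun x : R => sin (t * x)) by apply: measurable_sin_comp; exact: measurable_funM.
have Zc k : Ex P (fun x => cos (t * Z k x)) = Ex m (fun x => cos (t * f x)).
  by rewrite (Ex_same_law (lawZ k) mc) ?Ff// => x; exact: cos_max.
have Zs k : Ex P (fun x => sin (t * Z k x)) = Ex m (fun x => sin (t * f x)).
  by rewrite (Ex_same_law (lawZ k) ms) ?Ff// => x; exact: sin_max.
have [<- <-] := independent_sum_cf indZ Zc Zs n.
have mt : measurable_fun setT (fun x => t * sumZ n x) by exact: measurable_funM.
have ic := integ_cos P mt; have i_s := integ_sin P mt.
rewrite ![_ * cos p]mulrC ![_ * sin p]mulrC -(ExZ _ ic) -(ExZ _ i_s) -(ExB (integZ _ ic) (integZ _ i_s)).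
by congr (Ex P _); apply/funext => x; rewrite cosD; ring.
Qed.

Let cf_iid_small n t p : cmod (pow t n).1 (pow t n).2 <= 16^-1 ->
  `|Ex P (fun x => cos (t * sumZ n x + p))| <= 4^-1.
Proof.
move=> pk; rewrite cf_iid; have [q1 q2] := norm_le_cmod (pow t n).1 (pow t n).2.
have b1 : `|(pow t n).1 * cos p| <= 16^-1.
  by rewrite normrM (le_trans _ (le_trans q1 pk))// ler_piMr// cos_max.
have b2 : `|(pow t n).2 * sin p| <= 16^-1.
  by rewrite normrM (le_trans _ (le_trans q2 pk))// ler_piMr// sin_max.
by apply: (le_trans (ler_normB _ _)); lra.
Qed.

Let cf_close (eps : R) : 0 < eps -> exists2 t2 : R, 0 < t2 & forall n t p, 0 < `|t| <= t2 ->
  `|Ex m (fun x => cos (t * birkhoff_sum T f n x + p)) - Ex P (fun x => cos (t * sumZ n x + p))| <=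
  eps + n%:R * (eps * D t).
Proof.
move=> e0; have [t0 t00 H] := cf_birkhoff e0; exists t0 => // n t p tt0.
by have := H t tt0 n (fun=> p) (measurable_cst _); rewrite !Ex_cst cf_iid.
Qed.

Lemma heavy_tail_equivalence (A B : nat -> R) : (forall n, 0 < B n) ->
  forall d'' (S'' : measurableType d'') (Q : probability S'' R) (W : {RV Q >-> R}),
  cvg_in_distribution m (fun n x => (birkhoff_sum T f n x - A n) / B n) Q W <->
  cvg_in_distribution P (fun n x => (sumZ n x - A n) / B n) Q W.
Proof.
move=> B0 d'' S'' Q W.
have [t1 t10 H1] := charD_gt0 mf nL2.
have [K0 K00 [ta ta0 Ha]] := cf_birkhoff_small.
have mW : measurable_fun setT W by [].
split.
- apply: (cvg_in_distribution_compare mS msumZ t10 H1 (charD_double m mf) K00 ta0 _ cf_close B0 mW).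
  by move=> n t p tt0 nD; case: (Ha n t p tt0 nD).
- apply: (cvg_in_distribution_compare msumZ mS t10 H1 (charD_double m mf) K00 ta0 _ _ B0 mW).
    by move=> n t p tt0 nD; apply: cf_iid_small; case: (Ha n t p tt0 nD).
  move=> eps e0; have [t2 t20 H2] := cf_close e0; exists t2 => // n t p tt2.
  by rewrite distrC; exact: H2.
Qed.

End independent_copies.
End heavy_tail_limit.

Lemma Lfun2_sq_integ d (S : measurableType d) (R : realType) (m : probability S R)
    (u : {RV m >-> R}) : (u : S -> R) \in Lfun m 2%:E <-> sq_integ m u.
Proof.
have mu : measurable_fun setT u by [].
split=> [/Lfun2_integrable_sqr iu|[_ iu]]; first by split.
rewrite inE; apply/andP; split; rewrite inE//= /finite_norm unlock poweR_lty//.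
case/integrableP: iu => _; apply: le_lt_trans; apply: ge0_le_integral => //.
- by move=> x _; rewrite poweR_ge0.
- apply/measurable_EFinP; apply: (measurableT_comp (measurable_powR _)).
  exact: measurableT_comp.
- by apply: measurableT_comp => //; apply/measurable_EFinP; exact: measurable_funX.
- by move=> x _ /=; rewrite powR_mulrn// lee_fin normrX.
Qed.

(** * Square integrable observables that are not coboundaries *)

Section gibbs_markov_central_limit.
Context d (S : measurableType d) (R : realType) (m : probability S R).
Variables (T : S -> S) (f : {RV m >-> R}) (K r : R).
Hypotheses (mpT : measure_preserving m T) (L2f : sq_integ m f).
Hypotheses (K0 : 0 <= K) (r0 : 0 < r) (r1 : r < 1).
Let F x := f x - Ex m f.
Hypothesis dec : forall k v, (0 < k)%N -> sq_integ m v ->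
  `|Ex m (fun x => F x * v (iter k T x))| <= K * r ^+ k * norm2 m v.
Hypothesis exactT : forall G : S -> R, integ m G -> forall eps : R, 0 < eps -> exists j0,
  forall j (v : S -> R), (j0 <= j)%N -> measurable_fun setT v -> (forall x, `|v x| <= 1) ->
  `|Ex m (fun x => G x * v (iter j T x)) - Ex m G * Ex m v| <= eps.
Hypothesis ncob : ~ exists (u : {RV m >-> R}) (c : R), coboundary_up_to_constant m T f u c.

Let L2F : sq_integ m F. Proof. by apply: sq_integB => //; exact: sq_integ_cst. Qed.
Let EF0 : Ex m F = 0.
Proof. by rewrite ExB ?Ex_cst ?subrr//; [exact: sq_integ_integ L2f|exact: integ_cst]. Qed.

Let series_corr : correlation_series m T f = fun N => corr_sum m T F N F.
Proof. by apply/funext => N; rewrite corr_sum_series. Qed.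

Let sigma2 := asymptotic_variance m T f.

Lemma cvg_correlation_series : cvgn (correlation_series m T f).
Proof. by rewrite series_corr; exact: (corr_sum_cvg K0 r0 r1 dec L2F). Qed.

Lemma asymptotic_variance_gt0 : 0 < sigma2.
Proof.
have [h L2h hE] := martingale_coboundary mpT L2F K0 r0 r1 dec.
have sE : sigma2 = Ex m (fun x => (F x + h x - h (T x)) ^+ 2).
  rewrite hE /sigma2 /asymptotic_variance series_corr; congr (_ + _).
have L2M : sq_integ m (fun x => F x + h x - h (T x)).
  by apply: sq_integB; [exact: sq_integD|exact: sq_integ_comp].
rewrite lt_neqAle sE Ex_ge0 ?andbT => [|x]; last exact: sqr_ge0.
apply/negP => /eqP/esym/(Ex_eq0_ae L2M.2 (fun x => sqr_ge0 _)) M0; apply: ncob.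
have mu : measurable_fun setT (fun x => - h x) by apply: measurableT_comp => //; exact: sq_integ_measurable L2h.
(* Zero variance means [F x = h (T x) - h x] almost everywhere, whence the sign. *)
pose u : {RV m >-> R} := HB.pack (fun x => - h x) (isMeasurableFun.Build _ _ _ _ _ mu).
exists u, (Ex m f); apply: filterS M0 => x /eqP; rewrite sqrf_eq0 => /eqP E.
by rewrite /u/=; move: E; rewrite /F; lra.
Qed.

Lemma cvg_central_limit : cvg_in_distribution m
  (fun n x => (birkhoff_sum T f n x - n%:R * Ex m f) / Num.sqrt n%:R)
  (normal_prob 0 (Num.sqrt sigma2)) idfun.
Proof.
have s20 := asymptotic_variance_gt0; have s0 : 0 < Num.sqrt sigma2 by rewrite sqrtr_gt0.
have c2 : (fun N => Ex m (fun x => F x * F (iter 0 T x)) +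
    2 * \sum_(1 <= k < N.+1) Ex m (fun x => F x * F (iter k T x))) @ \oo --> sigma2.
  apply: cvgD; first exact: cvg_cst.
  apply: cvgMr; have := cvg_correlation_series; rewrite series_corr; exact.
have clt := central_limit_cf mpT L2F EF0 K0 r0 r1 dec exactT c2 (ltW s20).
have YE t p n x : t * ((birkhoff_sum T f n x - n%:R * Ex m f) / Num.sqrt n%:R) + p =
    t / Num.sqrt n%:R * birkhoff_sum T F n x + p.
  rewrite (_ : birkhoff_sum T F n x = birkhoff_sum T f n x - n%:R * Ex m f); first by ring.
  by rewrite /birkhoff_sum /F sumrB sumr_const_nat subn0 mulr_natl.
have sinE (y : R) : sin y = cos (y + - (pi / 2)) by rewrite cosD cosN sinN cos_pihalf sin_pihalf; ring.
have mf : measurable_fun setT f by [].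
pose Y n x := (birkhoff_sum T f n x - n%:R * Ex m f) / Num.sqrt n%:R.
pose N01 := normal_prob 0 (Num.sqrt sigma2).
have cf t p : (fun n => Ex m (fun x => cos (t * Y n x + p))) @ \oo -->
    Ex N01 (fun x : R => cos (t * x + p)).
  rewrite normal_cf// sqr_sqrtr ?(ltW s20)//.
  rewrite (_ : (fun n => _) = fun n => Ex m (fun x => cos (t / Num.sqrt n%:R * birkhoff_sum T F n x + p))).
    exact: clt.
  by apply/funext => n; congr (Ex m _); apply/funext => x; rewrite YE.
apply: levy_continuity => // [n||t|t].
- apply: measurable_funM => //; apply: measurable_funB => //.
  by apply: measurable_birkhoff_sum => //; exact: mp_measurable mpT.
- exact: measurable_id.
- rewrite (_ : (fun n => _) = fun n => Ex m (fun x => cos (t * Y n x + 0))); last first.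
    by apply/funext => n; congr (Ex m _); apply/funext => x; rewrite addr0.
  rewrite (_ : Ex N01 _ = Ex N01 (fun x : R => cos (t * x + 0))); first exact: cf.
  by congr (Ex N01 _); apply/funext => x; rewrite addr0.
- rewrite (_ : (fun n => _) = fun n => Ex m (fun x => cos (t * Y n x + - (pi / 2)))); last first.
    by apply/funext => n; congr (Ex m _); apply/funext => x; rewrite sinE.
  rewrite (_ : Ex N01 _ = Ex N01 (fun x : R => cos (t * x + - (pi / 2)))); first exact: cf.
  by congr (Ex N01 _); apply/funext => x; rewrite sinE.
Qed.

End gibbs_markov_central_limit.

Theorem theorem1p5 (R : realType) (disp : measure_display)
    (X : metricMeasurableType R disp) (m : probability X R) (T : X -> X)
    (alpha : set (set X)) (f : {RV m >-> R}) (eta : R) :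
  gibbs_markov m T alpha ->
  gm_mixing m T alpha ->
  0 < eta <= 1 ->
  (\esum_(a in alpha) (m a * lipschitz_const f a `^ eta) < +oo)%E ->
  (* (A) *)
  ((f : X -> R) \in Lfun m 2%:E ->
    (forall (u : {RV m >-> R}) (c : R),
      coboundary_up_to_constant m T f u c ->
      ess_bounded m u /\
      forall (d' : measure_display) (S : measurableType d')
        (P : probability S R) (Z Z' : {RV P >-> R}),
        independent2 Z Z' -> same_law Z u -> same_law Z' u ->
        cvg_in_distribution m (fun n x => birkhoff_sum T f n x - n%:R * c)
          P (Z \- Z')) /\
    ((~ exists (u : {RV m >-> R}) (c : R),
         coboundary_up_to_constant m T f u c) ->
      [/\ cvgn (correlation_series m T f),
          0 < asymptotic_variance m T f &
          cvg_in_distribution m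
            (fun n x => (birkhoff_sum T f n x - n%:R * (\int[m]_y f y)%R)
                        / Num.sqrt n%:R)
            (normal_prob 0 (Num.sqrt (asymptotic_variance m T f))) idfun])) /\
  (* (B) *)
  ((f : X -> R) \notin Lfun m 2%:E ->
    forall (d' : measure_display) (S : measurableType d')
      (P : probability S R) (Z : nat -> {RV P >-> R}),
      mutually_independent Z -> (forall k, same_law (Z k) f) ->
    forall (A B : nat -> R), (forall n, 0 < B n) ->
    forall (d'' : measure_display) (S' : measurableType d'')
      (Q : probability S' R) (W : {RV Q >-> R}),
      nondegenerate_rv W ->
      cvg_in_distribution m (fun n x => (birkhoff_sum T f n x - A n) / B n)
        Q W <->
      cvg_in_distribution P
        (fun n w => (\sum_(0 <= k < n) Z k w - A n) / B n)
        Q W).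
Proof.
move=> GM mix eta01 Df.
have [a [b [s [theta [C [M0 [e [idx [M [M00 geo] eP _ ae_]]]]]]]]] := gibbs_markov_model GM mix.
have mpT := gm_preserving GM; have mf : measurable_fun setT f by [].
have alP : forall A, alpha A -> measurable A /\ (0 < m A)%E by case: (gm_partition GM).
have [Dl [Dn O]] := gibbs_markov_observable eta01 Df alP mf M M00 geo (gm_bounded GM) eP ae_.
have dense := measurable_cylinder_approximable M geo (gm_borel GM).
have exactT := Ex_exact M dense.
split => [/Lfun2_sq_integ L2f|nL2f].
- split => [u c cob|ncob].
    have mu : measurable_fun setT u by [].
    split; first exact: (coboundary_bounded M O dense mu cob).
    move=> d' S P Z Z' ZZ' Zu Z'u; apply: (cvg_coboundary mpT exactT _ _ ZZ' Zu Z'u) => n.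
      apply: measurable_funB => //; apply: measurable_birkhoff_sum => //; exact: mp_measurable mpT.
    by apply: filterS (birkhoff_sum_coboundary M cob n) => x ->; ring.
  have [K1 [r [K10 r0 r1 dec]]] := cov_decay M eta01 (ro_Dl O) (ro_Dl_ge0 O) (ro_Dn_ge0 O) (ro_DlE O) (ro_integ O).
  pose F x := f x - Ex m f.
  have L2F : sq_integ m F by apply: sq_integB => //; exact: sq_integ_cst.
  have EF0 : Ex m F = 0.
    by rewrite ExB ?Ex_cst ?subrr//; [exact: sq_integ_integ L2f|exact: integ_cst].
  have K0 : 0 <= K1 * (1 + norm2 m F) by rewrite mulr_ge0// addr_ge0// norm2_ge0.
  (* The decay estimate at scale 1; centering removes the product of the means. *)
  have decF k v : (0 < k)%N -> sq_integ m v ->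
      `|Ex m (fun x => F x * v (iter k T x))| <= K1 * (1 + norm2 m F) * r ^+ k * norm2 m v.
    move=> k0 L2v; have := dec k F v 1 k0 L2F L2v ler01.
    rewrite /cov EF0 mul0r subr0 [K1 * _ * _]mulrAC; apply=> i w.
    apply: filterS (ro_lip O i w) => x; apply: filterS => y Hxy wx wy.
    by rewrite /F opprB addrA subrK mul1r; exact: Hxy.
  split.
  + exact: (cvg_correlation_series L2f K0 r0 r1 decF).
  + exact: (asymptotic_variance_gt0 mpT L2f K0 r0 r1 decF ncob).
  + exact: (cvg_central_limit mpT L2f K0 r0 r1 decF exactT ncob).
- have nL2 : ~ sq_integ m f by move=> L2f; move/negP: nL2f; apply; exact/Lfun2_sq_integ.
  move=> d' S P Z indZ lawZ A B B0 d'' S' Q W _.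
  exact: (heavy_tail_equivalence M O nL2 erefl indZ lawZ A B0).
Qed.
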